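(* Suppose that $\mathcal{O}$ is finitely generated as a module over the ring of $p$-adic integers. Let $G$, $G'$ be finite groups, and suppose that $\mathcal{O}$ contains a primitive $|G|$-th root of unity and a primitive $|G'|$-th root of unity. Let $B$, $B'$ be block algebras of $\mathcal{O}G$, $\mathcal{O}G'$ with nontrivial defect groups $P$, $P'$ and fusion systems $\mathcal{F}$, $\mathcal{F}'$ on $P$, $P'$, respectively. If there is a stable equivalence of Morita type between $B$ and $B'$, then the ranks of the abelian $p$-groups $P/\mathfrak{foc}(\mathcal{F})$ and $P'/\mathfrak{foc}(\mathcal{F}')$ are equal.
   Context: Throughout, $p$ is a prime and $\mathcal{O}$ is a complete discrete valuation ring with maximal ideal $J(\mathcal{O})=\pi\mathcal{O}$, residue field $k=\mathcal{O}/J(\mathcal{O})$ of characteristic $p$, and field of fractions $K$ of characteristic zero. A block (or block algebra) $B$ of $\mathcal{O}G$ is an indecomposable direct factor of $\mathcal{O}G$ as an algebra. For a $p$-subgroup $P$ of $G$, $\mathrm{Br}_P:(\mathcal{O}G)^P\to kC_G(P)$ is the Brauer homomorphism, induced by the map sending $x\in C_G(P)$ to its image in $kC_G(P)$ and $x\in G\setminus C_G(P)$ to $0$; here $(-)^P$ denotes fixed points under conjugation by $P$. A defect group of $B$ is a $p$-subgroup $P$ maximal subject to $\mathrm{Br}_P(1_B)\neq 0$. A source idempotent is a primitive idempotent $i$ in $B^P$ such that $\mathrm{Br}_P(i)\neq 0$; then $A=iBi=i\mathcal{O}Gi$ is called a source algebra of $B$. The choice of $i$ determines a (saturated) fusion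 system $\mathcal{F}$ on $P$: every indecomposable direct summand of $A$ as an $\mathcal{O}P$-$\mathcal{O}P$-bimodule (with $u\in P$ acting by multiplication by $ui$) is isomorphic to $\mathcal{O}P_\varphi\otimes_{\mathcal{O}Q}\mathcal{O}P$ for some $Q\leq P$ and some $\varphi\in\mathrm{Hom}_{\mathcal{F}}(Q,P)$, and the morphisms arising in this way generate $\mathcal{F}$. Here $\mathcal{O}P_\varphi$ is $\mathcal{O}P$ as a left $\mathcal{O}P$-module, with $u\in Q$ acting on the right by multiplication with $\varphi(u)$. A fusion system of $B$ on $P$ means one obtained from some choice of source idempotent. The focal subgroup $\mathfrak{foc}(\mathcal{F})$ is the subgroup of $P$ generated by all elements $\varphi(u)u^{-1}$ with $u\in P$ and $\varphi\in\mathrm{Hom}_{\mathcal{F}}(\langle u\rangle,P)$; it is normal in $P$ and contains the derived subgroup of $P$. The rank of a finite abelian $p$-group is its minimal number of generators. Stable equivalence of Morita type: let $A$, $B$ be $\mathcal{O}$-algebras free of finite rank as $\mathcal{O}$-modules. There is a stable equivalence of Morita type between $A$ and $B$ if there are an $A$-$B$-bimodule $M$ and a $B$-$A$-bimodule $N$, each finitely generated projective as a left module and as a right module, such that $M\otimes_B N\cong A\oplus X$ as $A\otimes_{\mathcal{O}}A^{\mathrm{op}}$-modules and $N\otimes_A M\cong B\oplus Y$ as $B\otimes_{\mathcal{O}}B^{\mathrm{op}}$-modules, with $X$ a projective $A\otimes_{\mathcal{O}}A^{\mathrm{op}}$-module and $Y$ a projective $B\otimes_{\mathcal{O}}B^{\mathrm{op}}$-module.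 *)

(* Defs.v *)
From HB Require Import structures.
From mathcomp Require Import all_boot all_order all_algebra.
From mathcomp Require Import all_fingroup all_solvable.
From mathcomp Require Import generic_quotient.
From mathcomp Require Import boolp.

Set Implicit Arguments.
Unset Strict Implicit.
Unset Printing Implicit Defensive.

Import GRing.Theory.
Local Open Scope ring_scope.
Local Open Scope quotient_scope.

Definition padic_seq (p : nat) : Type := forall n : nat, 'Z_(p ^ n.+1).

Section PadicSeq.
Variable p : nat.
Implicit Types x y z : padic_seq p.

HB.instance Definition _ := Choice.copy (padic_seq p)
  (forall n : nat, ('Z_(p ^ n.+1) : choiceType)).

Definition psZero : padic_seq p := fun=> 0.
Definition psOne : padic_seq p := fun=> 1.
Definition psOpp x : padic_seq p := fun n => - x n.
Definition psAdd x y : padic_seq p := fun n => x n + y n.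
Definition psMul x y : padic_seq p := fun n => x n * y n.

Fact psAddA : associative psAdd.
Proof. by move=> x y z; apply/functional_extensionality_dep => n; apply: addrA. Qed.
Fact psAddC : commutative psAdd.
Proof. by move=> x y; apply/functional_extensionality_dep => n; apply: addrC. Qed.
Fact psAdd0 : left_id psZero psAdd.
Proof. by move=> x; apply/functional_extensionality_dep => n; apply: add0r. Qed.
Fact psAddN : left_inverse psZero psOpp psAdd.
Proof. by move=> x; apply/functional_extensionality_dep => n; apply: addNr. Qed.
Fact psMulA : associative psMul.
Proof. by move=> x y z; apply/functional_extensionality_dep => n; apply: mulrA. Qed.
Fact psMulC : commutative psMul.
Proof. by move=> x y; apply/functional_extensionality_dep => n; apply: mulrC. Qed.
Fact psMul1 : left_id psOne psMul.
Proof. by move=> x; apply/functional_extensionality_dep => n; apply: mul1r. Qed.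
Fact psMulDl : left_distributive psMul psAdd.
Proof. by move=> x y z; apply/functional_extensionality_dep => n; apply: mulrDl. Qed.
Fact psOne_neq0 : psOne != psZero.
Proof. by apply/eqP => /(congr1 (fun x => x 0%N))/eqP; rewrite oner_eq0. Qed.

HB.instance Definition _ := GRing.isZmodule.Build (padic_seq p)
  psAddA psAddC psAdd0 psAddN.
HB.instance Definition _ := GRing.Zmodule_isComNzRing.Build (padic_seq p)
  psMulA psMulC psMul1 psMulDl psOne_neq0.

Definition padic_compat : {pred padic_seq p} :=
  fun x => `[< forall n, inZp (x n.+1) = x n :> 'Z_(p ^ n.+1) >].

Lemma padic_modulus_dvd n :
  ((Zp_trunc (p ^ n.+1)).+2 %| (Zp_trunc (p ^ n.+2)).+2)%N.
Proof.
case: p => [|[|q]]; first by rewrite !exp0n.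
  by rewrite !exp1n.
by rewrite !Zp_cast ?dvdn_exp2l // (@leq_trans (q.+2 ^ 1)) ?leq_exp2l.
Qed.

Lemma padic_compatP x :
  reflect (forall n, inZp (x n.+1) = x n :> 'Z_(p ^ n.+1)) (x \in padic_compat).
Proof. exact: asboolP. Qed.

Fact padic_compat_subring : subring_closed padic_compat.
Proof.
have modK n (m : nat) :
    inZp (m %% (Zp_trunc (p ^ n.+2)).+2) = inZp m :> 'Z_(p ^ n.+1).
  by apply: val_inj; rewrite /= modn_dvdm // padic_modulus_dvd.
have inZpD n (a b : nat) : inZp (a + b) = inZp a + inZp b :> 'Z_(p ^ n.+1).
  by apply: val_inj; rewrite /= modnDm.
have inZpM n (a b : nat) : inZp (a * b) = inZp a * inZp b :> 'Z_(p ^ n.+1).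
  by apply: val_inj; rewrite /= modnMm.
have addP x y : x \in padic_compat -> y \in padic_compat -> x + y \in padic_compat.
  move=> /padic_compatP xP /padic_compatP yP; apply/padic_compatP => n.
  by rewrite -[(x + y) n]/(x n + y n) -xP -yP -inZpD -(modK n (_ + _)%N).
split.
- by apply/padic_compatP => n; apply: val_inj.
- move=> x y xP yP; apply: addP => //; apply/padic_compatP => n.
  move/padic_compatP: yP => yP.
  apply/eqP; rewrite -[(- y) n]/(- (y n)) -addr_eq0 -yP -inZpD -modK.
  rewrite -[X in inZp X]/(val ((- y n.+1) + y n.+1)) addNr; apply/eqP.
  exact: val_inj.
- move=> x y /padic_compatP xP /padic_compatP yP; apply/padic_compatP => n.
  by rewrite -[(x * y) n]/(x n * y n) -xP -yP -inZpM -(modK n (_ * _)%N).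
Qed.

End PadicSeq.

(* The inverse limit of the rings Z / p^(n+1); only meaningful for p prime. *)
Record padic (p : nat) := Padic {
  padic_val :> padic_seq p;
  _ : padic_val \in @padic_compat p }.

HB.instance Definition _ (p : nat) := [isSub for @padic_val p].
HB.instance Definition _ (p : nat) := [Choice of padic p by <:].
HB.instance Definition _ (p : nat) :=
  GRing.SubChoice_isSubComNzRing.Build _ _ (padic p) (@padic_compat_subring p).

(* A ring morphism from the p-adic integers to a complete discrete valuation
   ring of residue characteristic p is automatically continuous, hence unique:
   iota below is the structure map. *)
Definition fg_over_padic (p : nat) (O : comNzRingType) : Prop :=
  exists (iota : {rmorphism padic p -> O}) (n : nat) (e : 'I_n -> O),
  forall x : O, exists c : 'I_n -> padic p, x = \sum_i iota (c i) * e i.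

Section DVR.
Variable O : idomainType.

Definition is_ideal (I : O -> Prop) : Prop :=
  [/\ I 0, forall x y, I x -> I y -> I (x + y) & forall a x, I x -> I (a * x)].

Definition dvd_in (a x : O) : Prop := exists y, x = a * y.

(* A local principal ideal domain that is not a field, with maximal ideal
   pi O, complete in the pi-adic topology; pi-adic separatedness is automatic. *)
Record complete_dvr (pi : O) : Prop := {
  cdvr_pid : forall I, is_ideal I -> exists a, forall x, I x <-> dvd_in a x;
  cdvr_local : forall x y : O,
    x \isn't a GRing.unit -> y \isn't a GRing.unit -> x + y \isn't a GRing.unit;
  cdvr_not_field : exists2 x : O, x != 0 & x \isn't a GRing.unit;
  cdvr_maximal : forall x : O, x \isn't a GRing.unit <-> dvd_in pi x;
  cdvr_complete : forall x : nat -> O,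
    (forall n, dvd_in (pi ^+ n) (x n.+1 - x n)) ->
    exists l, forall n, dvd_in (pi ^+ n) (l - x n) }.

Definition residue_map (pi : O) (k : fieldType) (red : {rmorphism O -> k}) : Prop :=
  (forall y, exists x, red x = y) /\ (forall x, red x = 0 <-> dvd_in pi x).

End DVR.

Definition galg (R : comNzRingType) (gT : finGroupType) : Type := {ffun gT -> R}.

Section GroupAlgebra.
Variables (R : comNzRingType) (gT : finGroupType).
Implicit Types a b c : galg R gT.

HB.instance Definition _ := GRing.Zmodule.copy (galg R gT) {ffun gT -> R}.

Definition gaMul a b : galg R gT := [ffun x => \sum_y a y * b (y^-1 * x)%g].
Definition gdelta (g : gT) : galg R gT := [ffun x => (x == g)%:R].
Definition gaScale (r : R) a : galg R gT := [ffun x => r * a x].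

Fact gaMulA : associative gaMul.
Proof.
move=> a b c; apply/ffunP => x; rewrite !ffunE.
under [RHS]eq_bigr => y _ do rewrite ffunE mulr_suml.
rewrite exchange_big /=; apply: eq_bigr => y _.
rewrite ffunE mulr_sumr [RHS](reindex_inj (mulgI y)) /=.
by apply: eq_bigr => z _; rewrite mulKg mulrA invMg mulgA.
Qed.

Fact gaMul1l : left_id (gdelta 1) gaMul.
Proof.
move=> a; apply/ffunP => x; rewrite ffunE (bigD1 1%g) //= ffunE eqxx mul1r.
rewrite invg1 mul1g big1 ?addr0 // => y /negbTE y1.
by rewrite ffunE y1 mul0r.
Qed.

Fact gaMul1r : right_id (gdelta 1) gaMul.
Proof.
move=> a; apply/ffunP => x; rewrite ffunE (bigD1 x) //= ffunE mulVg eqxx mulr1.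
rewrite big1 ?addr0 // => y /negbTE yx.
by rewrite ffunE -eq_mulVg1 yx mulr0.
Qed.

Fact gaMulDl : left_distributive gaMul +%R.
Proof.
move=> a b c; apply/ffunP => x; rewrite !ffunE -big_split /=.
by apply: eq_bigr => y _; rewrite ffunE mulrDl.
Qed.

Fact gaMulDr : right_distributive gaMul +%R.
Proof.
move=> a b c; apply/ffunP => x; rewrite !ffunE -big_split /=.
by apply: eq_bigr => y _; rewrite ffunE mulrDr.
Qed.

Fact gaOne_neq0 : gdelta 1 != 0.
Proof.
by apply/eqP => /ffunP/(_ 1%g)/eqP; rewrite !ffunE eqxx oner_eq0.
Qed.

HB.instance Definition _ := GRing.Zmodule_isNzRing.Build (galg R gT)
  gaMulA gaMul1l gaMul1r gaMulDl gaMulDr gaOne_neq0.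

Fact gaScaleA r s a : gaScale r (gaScale s a) = gaScale (r * s) a.
Proof. by apply/ffunP => x; rewrite !ffunE mulrA. Qed.
Fact gaScale1 : left_id 1 gaScale.
Proof. by move=> a; apply/ffunP => x; rewrite !ffunE mul1r. Qed.
Fact gaScaleDr : right_distributive gaScale +%R.
Proof. by move=> r a b; apply/ffunP => x; rewrite !ffunE mulrDr. Qed.
Fact gaScaleDl a : {morph gaScale^~ a : r s / r + s}.
Proof. by move=> r s; apply/ffunP => x; rewrite !ffunE mulrDl. Qed.

HB.instance Definition _ := GRing.Zmodule_isLmodule.Build R (galg R gT)
  gaScaleA gaScale1 gaScaleDr gaScaleDl.

Fact gaScaleAl (r : R) (a b : galg R gT) : r *: (a * b) = (r *: a) * b.
Proof.
apply/ffunP => x; rewrite !ffunE mulr_sumr.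
by apply: eq_bigr => y _; rewrite ffunE mulrA.
Qed.
Fact gaScaleAr (r : R) (a b : galg R gT) : r *: (a * b) = a * (r *: b).
Proof.
apply/ffunP => x; rewrite !ffunE mulr_sumr.
by apply: eq_bigr => y _; rewrite ffunE mulrCA.
Qed.

HB.instance Definition _ := GRing.Lmodule_isLalgebra.Build R (galg R gT) gaScaleAl.
HB.instance Definition _ := GRing.Lalgebra_isAlgebra.Build R (galg R gT) gaScaleAr.

End GroupAlgebra.

Section GroupAlgebraMap.
Variables (R : comNzRingType) (gT hT : finGroupType).
Variable phi : {multiplicative gT -> hT}.

Definition galg_map (a : galg R gT) : galg R hT :=
  [ffun y => \sum_(x | phi x == y) a x].

Fact galg_map_is_zmod_morphism : zmod_morphism galg_map.
Proof.
move=> a b; apply/ffunP => y; rewrite !ffunE -sumrB.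
by apply: eq_bigr => x _; rewrite !ffunE.
Qed.

Fact galg_map_is_monoid_morphism : monoid_morphism galg_map.
Proof.
have phi1 : phi 1%g = 1%g by apply: (mulgI (phi 1%g)); rewrite -gmulfM !mulg1.
split=> [|a b]; apply/ffunP => y.
  rewrite ffunE; under eq_bigr => x _ do rewrite ffunE.
  rewrite ffunE; have [->|y1] := eqVneq y 1%g.
    rewrite (bigD1 1%g) ?phi1 //= eqxx big1 ?addr0 // => x.
    by case/andP=> _ /negbTE ->.
  rewrite big1 // => x /eqP xy; case: eqVneq => // x1.
  by rewrite -xy x1 phi1 eqxx in y1.
rewrite !ffunE; under eq_bigr => x _ do rewrite ffunE.
under [RHS]eq_bigr => z _ do rewrite !ffunE mulr_suml.
rewrite exchange_big /=.
rewrite [RHS](exchange_big_dep xpredT) //=.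
apply: eq_bigr => x _.
rewrite (eq_bigl (pred1 (phi x))) => [|z]; last by rewrite eq_sym.
rewrite big_pred1_eq mulr_sumr (reindex_inj (mulgI x)) /=.
apply: eq_big => z; last by rewrite mulKg.
by rewrite gmulfM (canF_eq (mulKg _)).
Qed.

Fact galg_map_is_scalable : scalable galg_map.
Proof.
move=> r a; apply/ffunP => y; rewrite !ffunE mulr_sumr.
by apply: eq_bigr => x _; rewrite ffunE.
Qed.

HB.instance Definition _ := GRing.isZmodMorphism.Build (galg R gT) (galg R hT)
  galg_map galg_map_is_zmod_morphism.
HB.instance Definition _ := GRing.isMonoidMorphism.Build (galg R gT) (galg R hT)
  galg_map galg_map_is_monoid_morphism.
HB.instance Definition _ := GRing.isScalable.Build R (galg R gT) (galg R hT) *:%R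
  galg_map galg_map_is_scalable.

End GroupAlgebraMap.

Section Idempotents.
Variables (O : comNzRingType) (A : algType O).

Definition in_center (a : A) : Prop := forall x, a * x = x * a.

(* e is a primitive idempotent of the (not necessarily unital) subring S. *)
Definition primitive_idempotent (S : A -> Prop) (e : A) : Prop :=
  [/\ S e, e * e = e, e != 0 &
      forall f g, S f -> S g -> f * f = f -> g * g = g ->
        f * g = 0 -> g * f = 0 -> e = f + g -> f = 0 \/ g = 0].

Record idempotent := Idempotent {
  idem_val :> A;
  idemP : idem_val * idem_val = idem_val;
  idem_neq0 : idem_val != 0 }.

Definition corner_pred (e : idempotent) : {pred A} := fun x => (e : A) * x * (e : A) == x.

(* The algebra e A e, with unit element e. *)
Record corner (e : idempotent) := Corner {
  corner_val :> A;
  cornerP : corner_val \in corner_pred e }.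

HB.instance Definition _ (e : idempotent) := [isSub for @corner_val e].
HB.instance Definition _ (e : idempotent) := [Choice of corner e by <:].

Variable e : idempotent.

Fact corner_zmod_closed : zmod_closed (corner_pred e).
Proof.
split=> [|x y]; rewrite !unfold_in ?mulr0 ?mul0r // => /eqP xE /eqP yE.
by rewrite mulrBr mulrBl xE yE.
Qed.

HB.instance Definition _ := GRing.SubChoice_isSubZmodule.Build _ _ (corner e)
  corner_zmod_closed.

Lemma corner_mul1l (x : corner e) : (e : A) * (x : A) = x :> A.
Proof. by case: x => x /= /eqP <-; rewrite !mulrA idemP. Qed.
Lemma corner_mul1r (x : corner e) : (x : A) * (e : A) = x :> A.
Proof. by case: x => x /= /eqP <-; rewrite -!mulrA idemP. Qed.

Fact corner_in1 : (e : A) \in corner_pred e.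
Proof. by rewrite unfold_in !idemP. Qed.
Fact corner_inM (x y : corner e) : (x : A) * (y : A) \in corner_pred e.
Proof.
by apply/eqP; rewrite mulrA corner_mul1l -mulrA corner_mul1r.
Qed.
Fact corner_inZ (r : O) (x : corner e) : r *: (x : A) \in corner_pred e.
Proof.
by apply/eqP; rewrite -scalerAr corner_mul1l -scalerAl corner_mul1r.
Qed.

Definition corner_one : corner e := Corner corner_in1.
Definition corner_mul (x y : corner e) : corner e := Corner (corner_inM x y).
Definition corner_scale (r : O) (x : corner e) : corner e := Corner (corner_inZ r x).

Fact corner_mulA : associative corner_mul.
Proof. by move=> x y z; apply: val_inj; apply: mulrA. Qed.
Fact corner_1mul : left_id corner_one corner_mul.
Proof. by move=> x; apply: val_inj; apply: corner_mul1l. Qed.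
Fact corner_mul1 : right_id corner_one corner_mul.
Proof. by move=> x; apply: val_inj; apply: corner_mul1r. Qed.
Fact corner_mulDl : left_distributive corner_mul +%R.
Proof. by move=> x y z; apply: val_inj; apply: mulrDl. Qed.
Fact corner_mulDr : right_distributive corner_mul +%R.
Proof. by move=> x y z; apply: val_inj; apply: mulrDr. Qed.
Fact corner_one_neq0 : corner_one != 0.
Proof. by rewrite -(inj_eq val_inj) /= idem_neq0. Qed.

HB.instance Definition _ := GRing.Zmodule_isNzRing.Build (corner e)
  corner_mulA corner_1mul corner_mul1 corner_mulDl corner_mulDr corner_one_neq0.

Fact corner_scaleA r s x : corner_scale r (corner_scale s x) = corner_scale (r * s) x.
Proof. by apply: val_inj; apply: scalerA. Qed.
Fact corner_scale1 : left_id 1 corner_scale.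
Proof. by move=> x; apply: val_inj; apply: scale1r. Qed.
Fact corner_scaleDr : right_distributive corner_scale +%R.
Proof. by move=> r x y; apply: val_inj; apply: scalerDr. Qed.
Fact corner_scaleDl x : {morph corner_scale^~ x : r s / r + s}.
Proof. by move=> r s; apply: val_inj; apply: scalerDl. Qed.

HB.instance Definition _ := GRing.Zmodule_isLmodule.Build O (corner e)
  corner_scaleA corner_scale1 corner_scaleDr corner_scaleDl.

Fact corner_scaleAl (r : O) (x y : corner e) : r *: (x * y) = (r *: x) * y.
Proof. by apply: val_inj; apply: scalerAl. Qed.
Fact corner_scaleAr (r : O) (x y : corner e) : r *: (x * y) = x * (r *: y).
Proof. by apply: val_inj; apply: scalerAr. Qed.

HB.instance Definition _ := GRing.Lmodule_isLalgebra.Build O (corner e) corner_scaleAl.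
HB.instance Definition _ := GRing.Lalgebra_isAlgebra.Build O (corner e) corner_scaleAr.

End Idempotents.

Section Projective.
Variables (A : pzRingType) (V : lmodType A).

Definition finitely_generated : Prop :=
  exists (n : nat) (e : 'I_n -> V), forall v, exists c : 'I_n -> A,
    v = \sum_i c i *: e i.

Definition projective : Prop :=
  forall (U W : lmodType A) (f : {linear U -> W}) (g : {linear V -> W}),
    (forall w, exists u, f u = w) ->
    exists h : {linear V -> U}, forall v, f (h v) = g v.

End Projective.

(* A-B-bimodules on which the two induced actions of O coincide, that is,
   modules over the tensor product of A and the opposite of B over O. *)
HB.mixin Record Lmodule_isBimodule (O : comNzRingType) (A B : algType O) M
    of GRing.Lmodule A M := {
  ract : M -> B -> M;
  ractDl : forall b, {morph ract^~ b : m n / m + n};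
  ractDr : forall m, {morph ract m : b c / b + c};
  ract1 : forall m, ract m 1 = m;
  ractM : forall m b c, ract m (b * c) = ract (ract m b) c;
  lractA : forall (a : A) m b, a *: ract m b = ract (a *: m) b;
  bimod_central : forall (r : O) m, (r%:A : A) *: m = ract m r%:A }.

#[short(type="bimodType")]
HB.structure Definition Bimodule (O : comNzRingType) (A B : algType O) :=
  {M of GRing.Lmodule A M & Lmodule_isBimodule O A B M}.

Notation "m *| b" := (ract m b) (at level 40, left associativity) : ring_scope.

Section BimodTheory.
Variables (O : comNzRingType) (A B : algType O) (M : bimodType A B).

Lemma ract0 (b : B) : (0 : M) *| b = 0.
Proof. by apply: (addrI (0 *| b)); rewrite -ractDl !addr0. Qed.

(* M as a right B-module, that is, as a left module over the opposite ring. *)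
Definition rmod : Type := M.
HB.instance Definition _ := GRing.Zmodule.copy rmod M.
Definition rmod_scale (b : B^c) (m : rmod) : rmod := (m : M) *| (b : B).

Fact rmod_scaleA (b c : B^c) m : rmod_scale b (rmod_scale c m) = rmod_scale (b * c) m.
Proof. by rewrite /rmod_scale -ractM. Qed.
Fact rmod_scale1 : left_id 1 rmod_scale.
Proof. exact: ract1. Qed.
Fact rmod_scaleDr : right_distributive rmod_scale +%R.
Proof. by move=> b m n; apply: (ractDl b m n). Qed.
Fact rmod_scaleDl m : {morph rmod_scale^~ m : b c / b + c}.
Proof. exact: (ractDr (m : M)). Qed.

HB.instance Definition _ := GRing.Zmodule_isLmodule.Build B^c rmod
  rmod_scaleA rmod_scale1 rmod_scaleDr rmod_scaleDl.

End BimodTheory.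

Section BimodConstructions.
Variables (O : comNzRingType).

Section Regular.
Variable A : algType O.
Definition reg_ract (x : A^o) (a : A) : A^o := (x : A) * a.
Fact reg_ractDl a : {morph reg_ract^~ a : m n / m + n}.
Proof. by move=> x y; apply: mulrDl. Qed.
Fact reg_ractDr x : {morph reg_ract x : b c / b + c}.
Proof. exact: (mulrDr (x : A)). Qed.
Fact reg_ract1 x : reg_ract x 1 = x.
Proof. exact: mulr1. Qed.
Fact reg_ractM x b c : reg_ract x (b * c) = reg_ract (reg_ract x b) c.
Proof. exact: mulrA. Qed.
Fact reg_lractA (a : A) x b : a *: reg_ract x b = reg_ract (a *: x) b.
Proof. exact: mulrA. Qed.
Fact reg_central (r : O) (x : A^o) : (r%:A : A) *: x = reg_ract x r%:A.
Proof.
by rewrite /reg_ract -[LHS]/((r%:A : A) * (x : A)) mulr_algl mulr_algr.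
Qed.
HB.instance Definition _ := Lmodule_isBimodule.Build O A A A^o
  reg_ractDl reg_ractDr reg_ract1 reg_ractM reg_lractA reg_central.
End Regular.

Section DirectSum.
Variables (A B : algType O) (M N : bimodType A B).
Definition sum_ract (x : M * N) (b : B) : M * N := (x.1 *| b, x.2 *| b).
Fact sum_ractDl b : {morph sum_ract^~ b : m n / m + n}.
Proof. by move=> x y; rewrite /sum_ract !ractDl. Qed.
Fact sum_ractDr x : {morph sum_ract x : b c / b + c}.
Proof. by move=> b c; rewrite /sum_ract !ractDr. Qed.
Fact sum_ract1 x : sum_ract x 1 = x.
Proof. by case: x => m n; rewrite /sum_ract !ract1. Qed.
Fact sum_ractM x b c : sum_ract x (b * c) = sum_ract (sum_ract x b) c.
Proof. by rewrite /sum_ract !ractM. Qed.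
Fact sum_lractA (a : A) x b : a *: sum_ract x b = sum_ract (a *: x) b.
Proof. by congr (_, _); apply: lractA. Qed.
Fact sum_central (r : O) (x : M * N) : (r%:A : A) *: x = sum_ract x r%:A.
Proof. by congr (_, _); apply: bimod_central. Qed.
HB.instance Definition _ := Lmodule_isBimodule.Build O A B (M * N)%type
  sum_ractDl sum_ractDr sum_ract1 sum_ractM sum_lractA sum_central.
End DirectSum.

Section Restriction.
Variables (A B A' B' : algType O).
Variables (f : {lrmorphism A' -> A}) (g : {lrmorphism B' -> B}).
Variable M : bimodType A B.

(* M with a in A' acting on the left as f a, and b in B' on the right as g b. *)
Definition bimod_res (_ : {lrmorphism A' -> A}) (_ : {lrmorphism B' -> B}) : Type := M.
Local Notation resM := (bimod_res f g).
HB.instance Definition _ := GRing.Zmodule.copy resM M.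
Definition res_scale (a : A') (m : resM) : resM := f a *: (m : M).
Definition res_ract (m : resM) (b : B') : resM := (m : M) *| g b.

Fact res_scaleA a b m : res_scale a (res_scale b m) = res_scale (a * b) m.
Proof. by rewrite /res_scale scalerA rmorphM. Qed.
Fact res_scale1 : left_id 1 res_scale.
Proof. by move=> m; rewrite /res_scale rmorph1 scale1r. Qed.
Fact res_scaleDr : right_distributive res_scale +%R.
Proof. by move=> a m n; apply: (scalerDr (f a) (m : M) n). Qed.
Fact res_scaleDl m : {morph res_scale^~ m : a b / a + b}.
Proof. by move=> a b; rewrite /res_scale rmorphD scalerDl. Qed.
HB.instance Definition _ := GRing.Zmodule_isLmodule.Build A' resM
  res_scaleA res_scale1 res_scaleDr res_scaleDl.

Fact res_ractDl b : {morph res_ract^~ b : m n / m + n}.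
Proof. exact: (@ractDl _ _ _ M (g b)). Qed.
Fact res_ractDr m : {morph res_ract m : b c / b + c}.
Proof. by move=> b c; rewrite /res_ract rmorphD ractDr. Qed.
Fact res_ract1 m : res_ract m 1 = m.
Proof. by rewrite /res_ract rmorph1 ract1. Qed.
Fact res_ractM m b c : res_ract m (b * c) = res_ract (res_ract m b) c.
Proof. by rewrite /res_ract rmorphM ractM. Qed.
Fact res_lractA (a : A') (m : resM) b : a *: res_ract m b = res_ract (a *: m) b.
Proof. exact: (lractA (f a) (m : M)). Qed.
Fact res_central (r : O) (m : resM) : (r%:A : A') *: m = res_ract m r%:A.
Proof.
rewrite /res_ract -[LHS]/(f r%:A *: (m : M)).
by rewrite !linearZ_LR /= !rmorph1 bimod_central.
Qed.
HB.instance Definition _ := Lmodule_isBimodule.Build O A' B' resM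
  res_ractDl res_ractDr res_ract1 res_ractM res_lractA res_central.
End Restriction.

End BimodConstructions.

Section BimodMorphisms.
Variables (O : comNzRingType) (A B : algType O).

Definition bimod_hom (M N : bimodType A B) (f : M -> N) : Prop :=
  [/\ {morph f : x y / x + y},
      forall (a : A) x, f (a *: x) = a *: f x &
      forall x (b : B), f (x *| b) = f x *| b].

Definition bimod_iso (M N : bimodType A B) : Prop :=
  exists2 f : M -> N, bimod_hom f & bijective f.

Definition bimod_indecomposable (M : bimodType A B) : Prop :=
  (exists x : M, x != 0) /\
  forall X Y : bimodType A B, bimod_iso M (X * Y)%type ->
    (forall x : X, x = 0) \/ (forall y : Y, y = 0).

Definition bimod_summand (X M : bimodType A B) : Prop :=
  exists Y : bimodType A B, bimod_iso M (X * Y)%type.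

Definition bimod_projective (X : bimodType A B) : Prop :=
  forall (U W : bimodType A B) (f : U -> W) (g : X -> W),
    bimod_hom f -> bimod_hom g -> (forall w, exists u, f u = w) ->
    exists2 h : X -> U, bimod_hom h & forall x, f (h x) = g x.

End BimodMorphisms.

Section Tensor.
Variables (O : comNzRingType) (A B C : algType O).
Variables (M : bimodType A B) (N : bimodType B C).

Definition balanced (Z : zmodType) (f : M -> N -> Z) : Prop :=
  [/\ forall n, {morph f^~ n : m m' / m + m'},
      forall m, {morph f m : n n' / n + n'} &
      forall m b n, f (m *| b) n = f m (b *: n)].

(* Formal sums of pairs, modulo the relation of having the same value under
   every balanced map; [tensor_univ] below is the universal property. *)
Definition teval (Z : zmodType) (f : M -> N -> Z) (s : seq (M * N)) : Z :=
  \sum_(x <- s) f x.1 x.2.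

Definition tensor_rel (s t : seq (M * N)) : bool :=
  `[< forall (Z : zmodType) (f : M -> N -> Z), balanced f -> teval f s = teval f t >].

Fact tensor_rel_refl : reflexive tensor_rel.
Proof. by move=> s; apply/asboolP. Qed.
Fact tensor_rel_sym : symmetric tensor_rel.
Proof.
by move=> s t; apply/asboolP/asboolP => h Z f bf; rewrite h.
Qed.
Fact tensor_rel_trans : transitive tensor_rel.
Proof.
by move=> t s u /asboolP h1 /asboolP h2; apply/asboolP => Z f bf; rewrite h1 // h2.
Qed.

Canonical tensor_equiv := EquivRel tensor_rel
  tensor_rel_refl tensor_rel_sym tensor_rel_trans.

Definition tensor : Type := {eq_quot tensor_equiv}.
HB.instance Definition _ := Choice.copy tensor {eq_quot tensor_equiv}.
HB.instance Definition _ := EqQuotient.copy tensor {eq_quot tensor_equiv}.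

Definition tclass (s : seq (M * N)) : tensor := \pi_tensor s.
Definition tens (m : M) (n : N) : tensor := tclass [:: (m, n)].
Definition tmap (Z : zmodType) (f : M -> N -> Z) (x : tensor) : Z := teval f (repr x).

Lemma tmap_class (Z : zmodType) (f : M -> N -> Z) s : balanced f -> tmap f (tclass s) = teval f s.
Proof.
move=> bf; have : tensor_rel (repr (tclass s)) s.
  by have /eqmodP := reprK (tclass s).
by move/asboolP; apply.
Qed.

Lemma tensor_eq (x y : tensor) :
  (forall (Z : zmodType) (f : M -> N -> Z), balanced f -> tmap f x = tmap f y) -> x = y.
Proof.
move=> h; rewrite -[x]reprK -[y]reprK; apply/eqmodP; exact/asboolP.
Qed.

Definition tensor_add (x y : tensor) : tensor := tclass (repr x ++ repr y).
Definition tensor_zero : tensor := tclass [::].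
Definition tensor_opp (x : tensor) : tensor :=
  tclass [seq (- z.1, z.2) | z <- repr x].
Definition tensor_scale (a : A) (x : tensor) : tensor :=
  tclass [seq (a *: z.1, z.2) | z <- repr x].
Definition tensor_ract (x : tensor) (c : C) : tensor :=
  tclass [seq (z.1, z.2 *| c) | z <- repr x].

Section BalancedMaps.
Variables (Z : zmodType) (f : M -> N -> Z).
Hypothesis bf : balanced f.

Lemma tmap0 : tmap f tensor_zero = 0.
Proof. by rewrite tmap_class // /teval big_nil. Qed.
Lemma tmapD x y : tmap f (tensor_add x y) = tmap f x + tmap f y.
Proof. by rewrite tmap_class // /teval big_cat. Qed.
Lemma balancedN m n : f (- m) n = - f m n.
Proof.
case: bf => fD _ _; apply/eqP; rewrite -addr_eq0 -fD addNr.
by apply/eqP/(addIr (f 0 n)); rewrite -fD !add0r.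
Qed.
Lemma tmapN x : tmap f (tensor_opp x) = - tmap f x.
Proof.
rewrite tmap_class // /teval big_map -sumrN.
by apply: eq_bigr => z _; rewrite balancedN.
Qed.
Lemma balanced_scale a : balanced (fun m n => f (a *: m) n).
Proof.
case: bf => f1 f2 f3; split=> [n m m'|m n n'|m b n] /=.
- by rewrite scalerDr f1.
- by rewrite f2.
- by rewrite lractA f3.
Qed.
Lemma balanced_ract c : balanced (fun m n => f m (n *| c)).
Proof.
case: bf => f1 f2 f3; split=> [n m m'|m n n'|m b n] /=.
- by rewrite f1.
- by rewrite ractDl f2.
- by rewrite f3 lractA.
Qed.
Lemma tmapZ a x : tmap f (tensor_scale a x) = tmap (fun m n => f (a *: m) n) x.
Proof. by rewrite tmap_class // /teval big_map. Qed.
Lemma tmapR x c : tmap f (tensor_ract x c) = tmap (fun m n => f m (n *| c)) x.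
Proof. by rewrite tmap_class // /teval big_map. Qed.
End BalancedMaps.

Fact tensor_addA : associative tensor_add.
Proof. by move=> x y z; apply: tensor_eq => Z f bf; rewrite !tmapD // addrA. Qed.
Fact tensor_addC : commutative tensor_add.
Proof. by move=> x y; apply: tensor_eq => Z f bf; rewrite !tmapD // addrC. Qed.
Fact tensor_add0 : left_id tensor_zero tensor_add.
Proof. by move=> x; apply: tensor_eq => Z f bf; rewrite tmapD // tmap0 // add0r. Qed.
Fact tensor_addN : left_inverse tensor_zero tensor_opp tensor_add.
Proof.
by move=> x; apply: tensor_eq => Z f bf; rewrite tmapD // tmapN // tmap0 // addNr.
Qed.
HB.instance Definition _ := GRing.isZmodule.Build tensor
  tensor_addA tensor_addC tensor_add0 tensor_addN.

Fact tensor_scaleA a b x :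
  tensor_scale a (tensor_scale b x) = tensor_scale (a * b) x.
Proof.
apply: tensor_eq => Z f bf; rewrite !tmapZ //; last exact: balanced_scale.
by apply: eq_bigr => z _; rewrite scalerA.
Qed.
Fact tensor_scale1 : left_id 1 tensor_scale.
Proof.
move=> x; apply: tensor_eq => Z f bf; rewrite tmapZ //.
by apply: eq_bigr => z _; rewrite scale1r.
Qed.
Fact tensor_scaleDr : right_distributive tensor_scale +%R.
Proof.
move=> a x y; apply: tensor_eq => Z f bf.
have bfa := balanced_scale bf a.
by rewrite tmapZ // !tmapD // !tmapZ.
Qed.
Fact tensor_scaleDl x : {morph tensor_scale^~ x : a b / a + b}.
Proof.
move=> a b; apply: tensor_eq => Z f bf; rewrite tmapD // !tmapZ // -big_split.
by apply: eq_bigr => z _; rewrite scalerDl; case: bf => -> .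
Qed.
HB.instance Definition _ := GRing.Zmodule_isLmodule.Build A tensor
  tensor_scaleA tensor_scale1 tensor_scaleDr tensor_scaleDl.

Fact tensor_ractDl c : {morph tensor_ract^~ c : x y / x + y}.
Proof.
move=> x y; apply: tensor_eq => Z f bf.
have bfc := balanced_ract bf c.
by rewrite tmapR // !tmapD // !tmapR.
Qed.
Fact tensor_ractDr x : {morph tensor_ract x : b c / b + c}.
Proof.
move=> b c; apply: tensor_eq => Z f bf; rewrite tmapD // !tmapR // -big_split.
by apply: eq_bigr => z _; rewrite ractDr; case: bf => _ -> .
Qed.
Fact tensor_ract1 x : tensor_ract x 1 = x.
Proof.
apply: tensor_eq => Z f bf; rewrite tmapR //.
by apply: eq_bigr => z _; rewrite ract1.
Qed.
Fact tensor_ractM x b c : tensor_ract x (b * c) = tensor_ract (tensor_ract x b) c.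
Proof.
apply: tensor_eq => Z f bf; rewrite !tmapR //; last exact: balanced_ract.
by apply: eq_bigr => z _; rewrite ractM.
Qed.
Fact tensor_lractA (a : A) x c : a *: tensor_ract x c = tensor_ract (a *: x) c.
Proof.
apply: tensor_eq => Z f bf; rewrite tmapZ // !tmapR //; last exact: balanced_scale.
by rewrite tmapZ //; apply: balanced_ract.
Qed.
Fact tensor_central (r : O) (x : tensor) : (r%:A : A) *: x = tensor_ract x r%:A.
Proof.
apply: tensor_eq => Z f bf; rewrite tmapZ // tmapR //.
by apply: eq_bigr => z _; rewrite bimod_central; case: bf => _ _ ->; rewrite bimod_central.
Qed.
HB.instance Definition _ := Lmodule_isBimodule.Build O A C tensor
  tensor_ractDl tensor_ractDr tensor_ract1 tensor_ractM tensor_lractA tensor_central.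

Lemma tens_balanced : balanced tens.
Proof.
split=> [n m m'|m n n'|m b n]; apply: tensor_eq => Z f bf;
  rewrite ?tmapD // !tmap_class // /teval !big_seq1 /=; by case: bf => f1 f2 f3; rewrite ?f1 ?f2 ?f3.
Qed.

Lemma tensor_span (x : tensor) : x = \sum_(z <- repr x) tens z.1 z.2.
Proof.
rewrite -[LHS]reprK -/(tclass _); elim: (repr x) => [|[m n] s IHs].
  by rewrite big_nil.
rewrite big_cons -IHs; apply: tensor_eq => Z f bf.
by rewrite tmapD // !tmap_class // /teval big_cons big_seq1.
Qed.

Lemma tensor_univ (Z : zmodType) (f : M -> N -> Z) : balanced f ->
  exists2 g : {additive tensor -> Z}, (forall m n, g (tens m n) = f m n) &
    forall g' : {additive tensor -> Z}, (forall m n, g' (tens m n) = f m n) -> g' =1 g.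
Proof.
move=> bf.
have gB : zmod_morphism (tmap f).
  by move=> x y; rewrite -[x - y]/(tensor_add x (tensor_opp y)) tmapD // tmapN.
pose g : {additive tensor -> Z} :=
  HB.pack (tmap f) (GRing.isZmodMorphism.Build tensor Z (tmap f) gB).
have gE m n : g (tens m n) = f m n by rewrite /= tmap_class // /teval big_seq1.
exists g => // g' g'E x; clearbody g.
by rewrite [x]tensor_span !raddf_sum; apply: eq_bigr => z _; rewrite g'E gE.
Qed.

End Tensor.

Definition stably_equivalent_of_Morita_type (O : comNzRingType) (A B : algType O) : Prop :=
  exists (M : bimodType A B) (N : bimodType B A) (X : bimodType A A) (Y : bimodType B B),
    [/\ finitely_generated M /\ projective M,
        finitely_generated (rmod M) /\ projective (rmod M),
        finitely_generated N /\ projective N &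
        finitely_generated (rmod N) /\ projective (rmod N)] /\
    [/\ bimod_iso (tensor M N) (A^o * X)%type, bimod_projective X,
        bimod_iso (tensor N M) (B^o * Y)%type & bimod_projective Y].

Section Blocks.
Variables (O : comNzRingType) (gT : finGroupType).
Local Notation OG := (galg O gT).

(* A block of the group algebra, given by its unit element. *)
Record block := Block {
  block_unit :> OG;
  block_primitive : primitive_idempotent (@in_center O OG) block_unit }.

Variable b : block.

Lemma block_idem : (b : OG) * (b : OG) = b :> OG.
Proof. by case: (block_primitive b). Qed.
Lemma block_neq0 : (b : OG) != 0.
Proof. by case: (block_primitive b). Qed.

Definition block_idempotent : idempotent OG := Idempotent block_idem block_neq0.
Definition block_alg : algType O := corner block_idempotent.

Definition in_block (a : OG) : Prop := a \in corner_pred block_idempotent.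

Definition fixed_by (P : {group gT}) (a : OG) : Prop :=
  forall u, u \in P -> gdelta O u^-1 * a * gdelta O u = a.

Variables (k : fieldType) (red : {rmorphism O -> k}).

(* The Brauer homomorphism, extended by the same formula to all of OG. *)
Definition Br (P : {group gT}) (a : OG) : galg k (subg_of 'C(P)%G) :=
  [ffun x => red (a (sgval x))].

Definition defect_group (p : nat) (P : {group gT}) : Prop :=
  [max P | p.-group P && (Br P b != 0)]%g.

Record source_idempotent (P : {group gT}) := SourceIdempotent {
  source_val :> OG;
  source_primitive :
    primitive_idempotent (fun a => in_block a /\ fixed_by P a) source_val;
  source_Br : Br P source_val != 0 }.

End Blocks.

Section SubgroupMorphisms.
Variables (gT : finGroupType).

Fact sgval_multiplicative (P : {group gT}) : {morph @sgval gT P : x y / (x * y)%g}.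
Proof. by []. Qed.
HB.instance Definition _ (P : {group gT}) :=
  isMultiplicative.Build (subg_of P) gT (@sgval gT P) (@sgval_multiplicative P).

Definition sub_hom (Q R : {group gT}) : Type :=
  {multiplicative subg_of Q -> subg_of R}.

Definition sub_incl (Q P : {group gT}) (sQP : Q \subset P) (x : subg_of Q) : subg_of P :=
  Subg (subsetP sQP _ (subgP x)).

Fact sub_incl_multiplicative (Q P : {group gT}) (sQP : Q \subset P) :
  {morph sub_incl sQP : x y / (x * y)%g}.
Proof. by move=> x y; apply: val_inj. Qed.
HB.instance Definition _ (Q P : {group gT}) (sQP : Q \subset P) :=
  isMultiplicative.Build (subg_of Q) (subg_of P) (sub_incl sQP)
    (sub_incl_multiplicative sQP).

End SubgroupMorphisms.

Section SourceAlgebra.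
Variables (O : comNzRingType) (gT : finGroupType) (b : block O gT).
Variables (k : fieldType) (red : {rmorphism O -> k}) (P : {group gT}).
Variable i : source_idempotent b red P.
Local Notation OG := (galg O gT).
Local Notation OP := (galg O (subg_of P)).

Lemma source_idem : (i : OG) * (i : OG) = i :> OG.
Proof. by case: (source_primitive i). Qed.
Lemma source_neq0 : (i : OG) != 0.
Proof. by case: (source_primitive i). Qed.

Definition source_idem_of : idempotent OG := Idempotent source_idem source_neq0.
Definition source_alg : algType O := corner source_idem_of.

Lemma gdeltaM (g h : gT) : gdelta O g * gdelta O h = gdelta O (g * h)%g.
Proof.
apply/ffunP => x; rewrite !ffunE (bigD1 g) //= !ffunE eqxx mul1r.
rewrite big1 ?addr0 => [|y /negbTE yg]; last by rewrite ffunE yg mul0r.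
by rewrite (can2_eq (mulKVg _) (mulKg _)).
Qed.

Lemma galg_map_sgval (a : OP) :
  galg_map (@sgval gT P) a = \sum_u a u *: gdelta O (sgval u).
Proof.
apply/ffunP => x; rewrite sum_ffunE ffunE big_mkcond.
by apply: eq_bigr => u _; rewrite !ffunE eq_sym; case: eqP; rewrite ?mulr1 ?mulr0.
Qed.

Lemma source_comm (a : OP) :
  (i : OG) * galg_map (@sgval gT P) a = galg_map (@sgval gT P) a * (i : OG).
Proof.
rewrite galg_map_sgval mulr_sumr mulr_suml; apply: eq_bigr => u _.
rewrite -scalerAr -scalerAl; congr (_ *: _).
case: (source_primitive i) => -[_ /(_ _ (subgP u)) iu] _ _ _.
by rewrite -[in RHS]iu !mulrA gdeltaM mulgV mul1r.
Qed.

Fact source_mulP (a : OP) :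
  galg_map (@sgval gT P) a * (i : OG) \in corner_pred source_idem_of.
Proof.
by apply/eqP; rewrite /= mulrA source_comm -!mulrA !source_idem.
Qed.

(* The structure map from OP to iOGi, sending u to u i. *)
Definition source_map (a : OP) : source_alg := Corner (source_mulP a).

Fact source_map_zmod : zmod_morphism source_map.
Proof. by move=> x y; apply: val_inj; rewrite /= raddfB mulrBl. Qed.
Fact source_map_monoid : monoid_morphism source_map.
Proof.
split=> [|x y]; apply: val_inj; rewrite /= ?rmorph1 ?mul1r // rmorphM /=.
by rewrite !mulrA -[X in _ = X * _]mulrA source_comm mulrA -[RHS]mulrA source_idem.
Qed.
Fact source_map_scalable : scalable source_map.
Proof. by move=> r x; apply: val_inj; rewrite /= linearZ /= -scalerAl. Qed.

HB.instance Definition _ := GRing.isZmodMorphism.Build OP source_alg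
  source_map source_map_zmod.
HB.instance Definition _ := GRing.isMonoidMorphism.Build OP source_alg
  source_map source_map_monoid.
HB.instance Definition _ := GRing.isScalable.Build O OP source_alg *:%R
  source_map source_map_scalable.

Definition source_bimod : bimodType OP OP :=
  bimod_res (source_alg^o : bimodType source_alg source_alg) source_map source_map.

(* The tensor product over OQ of OP, with Q acting on the right through phi,
   and OP. *)
Definition twisted_bimod (Q : {group gT}) (sQP : Q \subset P) (phi : sub_hom Q P)
    : bimodType OP OP :=
  tensor (bimod_res (OP^o : bimodType OP OP) idfun (galg_map phi))
         (bimod_res (OP^o : bimodType OP OP) (galg_map (sub_incl sQP)) idfun).

Definition arises (Q : {group gT}) (phi : sub_hom Q P) : Prop :=
  injective phi /\
  exists (sQP : Q \subset P) (X : bimodType OP OP),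
    [/\ bimod_summand X source_bimod, bimod_indecomposable X &
        bimod_iso X (twisted_bimod sQP phi)].

End SourceAlgebra.

(* F Q R f means that f belongs to Hom_F(Q, R). *)
Definition hom_family (gT : finGroupType) : Type :=
  forall Q R : {group gT}, sub_hom Q R -> Prop.

Section Fusion.
Variable gT : finGroupType.

(* A category on the subgroups of P, with injective homomorphisms as morphisms,
   containing those induced by conjugation in P, in which every morphism is the
   composition of an isomorphism and an inclusion. *)
Record fusion_system (P : {group gT}) (F : hom_family gT) : Prop := {
  fus_sub : forall Q R (f : sub_hom Q R), F Q R f -> Q \subset P /\ R \subset P;
  fus_inj : forall Q R (f : sub_hom Q R), F Q R f -> injective f;
  fus_ext : forall Q R (f g : sub_hom Q R), f =1 g -> F Q R f -> F Q R g;
  fus_conj : forall (Q R : {group gT}) (f : sub_hom Q R) u,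
    Q \subset P -> R \subset P -> u \in P ->
    (forall x, sgval (f x) = (sgval x ^ u)%g) -> F Q R f;
  fus_comp : forall Q R S (f : sub_hom Q R) (g : sub_hom R S),
    F Q R f -> F R S g -> F Q S (g \o f);
  fus_iso : forall Q R S (f : sub_hom Q R) (f' : sub_hom Q S) (g : sub_hom S Q),
    F Q R f -> (forall x, sgval (f' x) = sgval (f x)) ->
    cancel f' g -> cancel g f' -> F Q S f' /\ F S Q g }.

Definition generated_fusion (P : {group gT}) (X : forall Q, sub_hom Q P -> Prop)
    : hom_family gT := fun Q R f =>
  forall F, fusion_system P F ->
    (forall Q' (phi : sub_hom Q' P), X Q' phi -> F Q' P phi) -> F Q R f.

Definition block_fusion_system (O : comNzRingType) (k : fieldType)
    (red : {rmorphism O -> k}) (b : block O gT) (P : {group gT})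
    (F : hom_family gT) : Prop :=
  exists i : source_idempotent b red P,
    forall Q R (f : sub_hom Q R), F Q R f <-> generated_fusion (arises i) f.

Definition focal (P : {group gT}) (F : hom_family gT) : {group gT} :=
  <<[set x : gT | `[< exists (u : gT) (phi : sub_hom <[u]>%G P),
      [/\ u \in P, F <[u]>%G P phi &
          x = (sgval (phi (Subg (cycle_id u))) * u^-1)%g] >] ]>>%G.

End Fusion.

(* Main.v *)
(**
  Let zeta be a primitive p-th root of unity in O and lam = 1 - zeta. The proof
  identifies the homomorphisms P / foc(F) -> mu_p with the classes of algebra
  automorphisms of B that are congruent to the identity modulo lam, up to conjugation
  by units congruent to 1 modulo lam, and shows that a stable equivalence of Morita
  type transports the latter. Since there are p ^ r homomorphisms, r the rank of
  P / foc(F), injections in both directions give the theorem.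

  Let i be the source idempotent. A character eta of P that is trivial on foc(F) is
  constant along the bimodule summands of iBi, so rescaling the basis of the double
  cosets PxP on which eta is invariant under conjugation by x gives a map of iBi
  satisfying u a v -> eta(u) eta(v) u a v, the other double cosets contributing nothing
  because O[PxP] would be a summand. Extending it to B and correcting it by a Newton
  iteration with the Casimir element of B over iBi yields an automorphism al with
  al(ui) = eta(u) ui. Conversely an automorphism congruent to 1 modulo lam makes B,
  with P acting by conjugation twisted by al, congruent modulo lam to a permutation
  lattice; by an elementary version of Weiss rigidity its fixed vectors modulo lam come
  from eigenvectors, which produces eta; the bimodule summands of iBi show that eta is
  trivial on the focal subgroup.

  For the transport, let M, N induce the stable equivalence, with N (x)_B M = B' + Y and
  Y projective. An automorphism al twists M; the projectivity of Y lets one deform the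
  identity element of B' inside N (x)_B M to a twisted one, which defines be on B'.
  If two such be are conjugate, the corresponding al are intertwined by an element of
  the form 1 - Tr(d) + lam c', Tr being the trace from the trivial group to G, and this
  element is a unit because P is nontrivial.
*)
From HB Require Import structures.
From mathcomp Require Import all_boot all_order all_algebra.
From mathcomp Require Import all_fingroup all_solvable mxabelem.
From mathcomp Require Import boolp ring.
Require Import Defs.

Set Implicit Arguments.
Unset Strict Implicit.
Unset Printing Implicit Defensive.

Import GRing.Theory.
Local Open Scope ring_scope.

(** * Roots of unity *)

(** The choice of [lam] rests on two facts. Every p-th root of unity is 1 modulo [lam], so a twist
    by a character of order p is invisible modulo [lam] and a twisted object stays close to the
    untwisted one; maps congruent to the identity are bijective, so splittings survive the
    deformation. On the other hand [1 - zeta ^+ l] is exactly [lam] times a unit when p does not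
    divide l, so the first-order term already separates characters. The stable equivalence provides
    maps between M (x) N and B, N (x) M and B' that are not assumed to form an adjunction:
    identities hold up to terms through a projective bimodule. By Higman's criterion such terms are
    written as sums over group conjugates, because in this form the Brauer homomorphism kills them.
    Finiteness of O over the p-adic integers is used through finiteness of the residue ring: powers
    of an element or iterates of a map repeat modulo [pi]. This yields idempotents, locality of
    corners and surjectivity of endomorphisms injective modulo [pi], and stands in for the
    Krull-Schmidt theorem. *)

Section RootOfUnity.
Variables (O : idomainType) (p : nat) (zeta : O).
Hypotheses (p_pr : prime p) (zeta_prim : p.-primitive_root zeta).
Local Notation lam := (1 - zeta).

Lemma lam_neq0 : lam != 0.
Proof.
rewrite subr_eq0 eq_sym -[zeta]expr1 -(prim_order_dvd zeta_prim).
by rewrite gtnNdvd // prime_gt1.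
Qed.

Lemma zetaX_cong l : exists y, zeta ^+ l = 1 + lam * y.
Proof.
exists (- \sum_(i < l) zeta ^+ i); rewrite mulrN -mulNr opprB -subrX1.
by rewrite addrC subrK.
Qed.

(** The quotient is the geometric sum of l powers of [zeta]. With [l * l' = 1] modulo p, the sum of
    l' powers of [zeta ^+ l] is its inverse: after multiplication by [lam] the product telescopes to
    [1 - zeta ^+ (l * l')], which is [lam]. *)
Lemma one_sub_zetaX l : ~~ (p %| l)%N ->
  exists2 u, u \is a GRing.unit & 1 - zeta ^+ l = lam * u.
Proof.
move=> pl; have [p1 p0] := (prime_gt1 p_pr, prime_gt0 p_pr).
have geoE (x : O) k : 1 - x ^+ k = (1 - x) * \sum_(i < k) x ^+ i.
  by rewrite -opprB subrX1 -mulNr opprB.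
exists (\sum_(i < l) zeta ^+ i); last exact: geoE.
have cop : coprime l p by rewrite coprime_sym prime_coprime.
have [l' ll'] : exists l', (l * l' = 1 %[mod p])%N.
  have l_gt0 : (0 < l)%N by case: l pl {cop} => //; rewrite dvdn0.
  case: (egcdnP p l_gt0) => km kn def_kl _; exists km.
  by rewrite mulnC def_kl (eqP cop) modnMDl.
apply/unitrP; exists (\sum_(i < l') (zeta ^+ l) ^+ i).
suff E : (\sum_(i < l) zeta ^+ i) * (\sum_(i < l') (zeta ^+ l) ^+ i) = 1.
  by rewrite [X in X = 1 /\ _]mulrC E.
apply: (mulfI lam_neq0); rewrite mulrA -geoE -geoE mulr1 -exprM.
by rewrite -(prim_expr_mod zeta_prim) ll' modn_small ?expr1.
Qed.

Lemma prod_XsubC_unity_roots :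
  \prod_(a <- [seq zeta ^+ l | l <- iota 0 p]) ('X - a%:P) = 'X^p - 1.
Proof.
pose f : O -> {fraction O} := @tofrac O.
have f_inj : injective f by move=> x y /eqP; rewrite tofrac_eq => /eqP.
have fz : p.-primitive_root (f zeta).
  have [p_gt0 /forallP zE] := andP zeta_prim; apply/andP; split=> //.
  apply/forallP => i; rewrite -(eqP (zE i)) !unity_rootE -tofracXn -tofrac1.
  by rewrite tofrac_eq.
apply: (map_inj_poly f_inj (tofrac0 O)).
have := factor_Xn_sub_1 fz; rewrite /index_iota subn0.
rewrite rmorphB rmorph1 /= map_polyXn => <-.
rewrite big_map rmorph_prod /=; apply: eq_bigr => i _.
by rewrite rmorphB /= map_polyX map_polyC /= /f tofracXn.
Qed.

(** Division of X^p - 1 by X - xi, where [xi = zeta ^+ j]. The inverse of xi is written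
    [xi ^+ p.-1], here and for characters below, so that no division in O is needed. *)
Lemma prod_XsubC_zeta j : (j < p)%N ->
  \prod_(a <- [seq zeta ^+ l | l <- rem j (iota 0 p)]) ('X - a%:P) =
  \poly_(k < p) ((zeta ^+ j) ^+ p.-1 ^+ k.+1).
Proof.
move=> jp; have p_gt0 := prime_gt0 p_pr.
set xi := zeta ^+ j; set w := xi ^+ p.-1.
have xip : xi ^+ p = 1 by rewrite -exprM mulnC exprM (prim_expr_order zeta_prim) expr1n.
have wxi : w * xi = 1 by rewrite /w -exprSr prednK.
have wp : w ^+ p = 1 by rewrite -exprM mulnC exprM xip expr1n.
have := prod_XsubC_unity_roots; rewrite big_map (big_rem j) ?mem_iota //= -/xi.
rewrite -(big_map (fun l => zeta ^+ l) xpredT (fun a => 'X - a%:P)) => E.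
have Xxi : ('X - xi%:P : {poly O}) != 0 by rewrite polyXsubC_eq0.
apply: (mulfI Xxi); rewrite E.
have -> : \poly_(k < p) (w ^+ k.+1) = w%:P * \sum_(k < p) (w%:P * 'X) ^+ k.
  rewrite poly_def mulr_sumr; apply: eq_bigr => k _.
  by rewrite exprMn -mul_polyC mulrA -polyC_exp -polyCM -exprS.
rewrite mulrA [X in X * _](_ : _ = w%:P * 'X - 1); last first.
  by rewrite mulrBl -polyCM [xi * w]mulrC wxi polyC1 mulrC.
by rewrite -subrX1 exprMn -polyC_exp wp mul1r.
Qed.

(** The value at 1 of 1 + X + ... + X^(p-1) is p, and each of its p - 1 linear factors takes there a
    value that is [lam] times a unit. *)
Lemma p_lam : exists2 u, u \is a GRing.unit & p%:R = lam ^+ p.-1 * u.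
Proof.
have p_gt0 := prime_gt0 p_pr.
have := congr1 (horner^~ 1) (prod_XsubC_zeta p_gt0).
rewrite [X in _ = X -> _](_ : _ = p%:R) => [<-|]; last first.
  rewrite horner_poly (eq_bigr (fun=> 1)) => [|i _]; last by rewrite expr0 !expr1n mulr1.
  by rewrite sumr_const card_ord.
have -> : rem 0 (iota 0 p) = iota 1 p.-1.
  by rewrite -[in LHS](prednK p_gt0).
have : all (fun l => ~~ (p %| l)%N) (iota 1 p.-1).
  apply/allP => l; rewrite mem_iota add1n prednK // => /andP[l1 lp].
  by rewrite gtnNdvd.
rewrite -[X in lam ^+ X](size_iota 1 p.-1); elim: (iota 1 p.-1) => [|l s IHs] /=.
  by move=> _; exists 1; rewrite ?unitr1 // big_nil hornerC expr0 mulr1.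
case/andP=> /one_sub_zetaX[u uu uE] /IHs[v uv vE].
exists (u * v); first by rewrite unitrM uu.
rewrite big_cons hornerM hornerXsubC uE vE exprS.
by rewrite mulrACA.
Qed.

Lemma p_neq0 : p%:R != 0 :> O.
Proof.
have [u uu ->] := p_lam; rewrite mulf_neq0 ?expf_neq0 ?lam_neq0 //.
by apply: contraTneq uu => ->; rewrite unitr0.
Qed.

Lemma p_dvd_lam : exists y, p%:R = lam * y.
Proof.
have [u _ ->] := p_lam; have := prime_gt1 p_pr; case: p => [|[|q]] // _.
by exists (lam ^+ q * u); rewrite /= exprS mulrA.
Qed.

Lemma sum_zeta k : ~~ (p %| k)%N -> \sum_(j < p) (zeta ^+ j) ^+ k = 0.
Proof.
move=> pk; have /one_sub_zetaX[u uu uE] := pk.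
have zk : zeta ^+ k - 1 != 0.
  rewrite -oppr_eq0 opprB uE mulf_neq0 ?lam_neq0 //.
  by apply: contraTneq uu => ->; rewrite unitr0.
apply: (mulfI zk); rewrite mulr0.
under eq_bigr => j _ do rewrite -exprM mulnC exprM.
by rewrite -subrX1 -exprM mulnC exprM (prim_expr_order zeta_prim) expr1n subrr.
Qed.

Lemma zeta_exp_eq1 x : x ^+ p = 1 -> exists l, x = zeta ^+ l.
Proof. move=> xp; have := root_prod_XsubC [seq zeta ^+ l | l <- iota 0 p] x.
rewrite prod_XsubC_unity_roots rootE !hornerE xp subrr eqxx.
by move=> /esym/mapP[l _ ->]; exists l. Qed.

End RootOfUnity.

(** * Characters of order p with prescribed kernel and value *)

Section CharacterExtension.
Variables (O : idomainType) (p : nat) (zeta : O).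
Hypotheses (p_pr : prime p) (zeta_prim : p.-primitive_root zeta).
Variables (gT : finGroupType) (P H : {group gT}) (z : gT).
Hypotheses (sHP : H \subset P) (zP : z \in P) (zH : z \notin H).
Hypothesis PpH : forall u, u \in P -> (u ^+ p)%g \in H.
Hypothesis PcH : forall u w, u \in P -> w \in P -> [~ u, w]%g \in H.

(** P / H is elementary abelian, so a subgroup L that contains H and is maximal subject to avoiding
    z has index p. Every coset of L is a power of that of z, and the character reads off the
    exponent. *)
Lemma exists_character : exists chi : gT -> O,
  [/\ forall u w, u \in P -> w \in P -> chi (u * w)%g = chi u * chi w,
      forall u, u \in P -> chi u ^+ p = 1,
      forall u, u \in H -> chi u = 1 & chi z = zeta].
Proof.
pose Q (L : {group gT}) := [&& H \subset L, L \subset P & z \notin L].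
have [|L /maxgroupP[/and3P[sHL sLP zL] maxL] _] := @maxgroup_exists _ Q H.
  by rewrite /Q subxx sHP.
have nLP : P \subset 'N(L)%g.
  apply/subsetP => u uP; rewrite inE; apply/subsetP => _ /imsetP[l lL ->].
  rewrite conjg_mulR groupM //; apply: (subsetP sHL).
  by apply: PcH => //; apply: (subsetP sLP).
have nL u : u \in P -> u \in 'N(L)%g by apply: subsetP.
have quoE u w : u \in P -> w \in P -> coset L u = coset L w -> (u^-1 * w)%g \in L.
  move=> uP wP E; apply: coset_idr; first by rewrite groupM ?groupV ?nL.
  by rewrite morphM ?groupV ?nL // morphV ?nL //= E mulVg.
have lgP u : u \in P -> exists k : 'I_p, ((z ^+ k)^-1 * u)%g \in L.
  move=> uP; have [uL|uL] := boolP (u \in L).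
    by exists (Ordinal (prime_gt0 p_pr)); rewrite expg0 invg1 mul1g.
  (* Maximality of L puts z in the product of [<[u]>] and L; inverting the exponent of u modulo p
     expresses u through z modulo L. *)
  have zLu : z \in (<[u]> <*> L)%g.
    apply: contraR uL => zLu; rewrite -(maxL (<[u]> <*> L)%G) ?joing_subr //=.
      by rewrite (subsetP (joing_subl _ _)) ?cycle_id.
    by rewrite /Q zLu (subset_trans sHL) ?joing_subr //= join_subG sLP cycle_subG uP.
  rewrite norm_joinEl ?cycle_subG ?nL // in zLu.
  case/mulsgP: zLu => _ l /cycleP[k ->] lL zE.
  have pk : ~~ (p %| k)%N.
    apply/dvdnP => -[q kE]; case/negP: zL; rewrite zE groupM //.
    by rewrite kE mulnC expgM groupX // (subsetP sHL) ?PpH.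
  have cop : coprime k p by rewrite coprime_sym prime_coprime.
  have k_gt0 : (0 < k)%N by case: k pk {zE cop} => //; rewrite dvdn0.
  case: (egcdnP p k_gt0) => km kn def_kl _.
  have kmp : (km %% p < p)%N by rewrite ltn_mod prime_gt0.
  exists (Ordinal kmp) => /=.
  have up : (coset L u ^+ p)%g = 1%g.
    by rewrite -morphX ?nL //= coset_id // (subsetP sHL) ?PpH.
  have zp : (coset L z ^+ p)%g = 1%g.
    by rewrite -morphX ?nL //= coset_id // (subsetP sHL) ?PpH.
  apply: quoE; rewrite ?groupX // morphX ?nL // expg_mod //.
  rewrite zE morphM ?nL ?groupX // ?(subsetP sLP) // morphX ?nL //.
  rewrite /= (coset_id lL) mulg1 -expgM mulnC def_kl (eqP cop) expgD expg1 mulnC expgM up.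
  by rewrite expg1n mul1g.
pose lg u : nat := if [pick k : 'I_p | ((z ^+ k)^-1 * u)%g \in L] is Some k then k else 0%N.
have lgE u : u \in P -> ((z ^+ lg u)^-1 * u)%g \in L.
  move=> uP; rewrite /lg; case: pickP => [k //|none].
  by have [k] := lgP u uP; rewrite none.
have cosE u : u \in P -> coset L u = (coset L z ^+ lg u)%g.
  move=> uP; have := lgE u uP; rewrite -[in LHS](mulKVg (z ^+ lg u)%g u).
  move=> l; rewrite morphM ?nL ?groupX //; last by rewrite (subsetP sLP).
  by rewrite /= (coset_id l) mulg1 morphX ?nL.
have ordz : #[coset L z]%g = p.
  apply: nt_prime_order => //.
    by rewrite -morphX ?nL //= coset_id // (subsetP sHL) ?PpH.
  by apply: contra zL => /eqP; apply: coset_idr; apply: nL.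
have zexp m n : (coset L z ^+ m = coset L z ^+ n)%g -> zeta ^+ m = zeta ^+ n.
  by move/eqP; rewrite eq_expg_mod_order ordz => mn; apply/eqP; rewrite (eq_prim_root_expr zeta_prim).
exists (fun u => zeta ^+ lg u); split=> [u w uP wP|u uP|u uH|].
- rewrite -exprD; apply: zexp; rewrite -cosE ?groupM // expgD -!cosE // morphM ?nL //.
- by rewrite -exprM mulnC exprM (prim_expr_order zeta_prim) expr1n.
- rewrite -[RHS](expr0 zeta); apply: zexp; rewrite -cosE ?(subsetP sHP) // expg0.
  by rewrite coset_id // (subsetP sHL).
- by rewrite -[RHS](expr1 zeta); apply: zexp; rewrite -cosE // expg1.
Qed.
End CharacterExtension.

(** * Bijectivity of maps congruent to the identity *)

Section Nakayama.
Variables (O : comUnitRingType) (lam : O).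
Hypothesis lam_jac : forall y, 1 + lam * y \is a GRing.unit.

(** A permutation other than the identity moves some index and so picks up an off-diagonal entry,
    which is divisible by [lam]. *)
Lemma det_cong1_unit n (A : 'M[O]_n) : \det (1%:M + lam *: A) \is a GRing.unit.
Proof.
suff [y ->] : exists y, \det (1%:M + lam *: A) = 1 + lam * y by [].
have prodE (I : finType) (F : I -> O) : (forall i, exists y, F i = 1 + lam * y) ->
    exists y, \prod_i F i = 1 + lam * y.
  move=> FE; elim/big_ind: _ => [|_ _ [y ->] [z ->]|i _ //].
    by exists 0; rewrite mulr0 addr0.
  by exists (y + z + lam * y * z); ring.
rewrite /determinant (bigD1 1%g) //= odd_perm1 expr0 mul1r.
have [|y ->] := prodE 'I_n (fun i => (1%:M + lam *: A) i ((1 : 'S_n)%g i)).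
  by move=> i; exists (A i i); rewrite perm1 !mxE eqxx.
have [z ->] : exists z, \sum_(s : 'S_n | s != 1%g)
   (-1) ^+ s * \prod_i (1%:M + lam *: A) i (s i) = lam * z.
  elim/big_ind: _ => [|_ _ [u ->] [v ->]|s s1].
  - by exists 0; rewrite mulr0.
  - by exists (u + v); rewrite mulrDr.
  have [i si] : exists i, i != s i.
    apply/existsP; apply: contraR s1; rewrite negb_exists => /forallP si.
    by apply/eqP/permP => i; rewrite perm1; have:= si i; rewrite negbK => /eqP <-.
  rewrite (bigD1 i) //= !mxE (negbTE si) add0r.
  by eexists; rewrite mulrCA -mulrA; reflexivity.
by exists (y + z); rewrite mulrDr addrA.
Qed.

Variables (B : algType O) (V : lmodType B) (n : nat) (e : 'I_n -> V).
Hypothesis span_e : forall v, exists c : 'I_n -> O, v = \sum_j (c j)%:A *: e j.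
Variable phi : V -> V.
Hypothesis phiD : {morph phi : x y / x + y}.
Hypothesis phiZ : forall r v, phi (r%:A *: v) = r%:A *: phi v.
Hypothesis phi1 : forall v, exists w, phi v = v + lam%:A *: w.

(** Generators need not be independent, so [phi] is only covered by a matrix F, chosen congruent to
    the identity. Inverting F gives surjectivity. For injectivity, Cayley-Hamilton makes the
    characteristic polynomial of F annihilate [phi]; its constant term is a unit, so a vector killed
    by [phi] is zero. *)
Lemma cong1_bij : bijective phi.
Proof.
have phi0 : phi 0 = 0 by apply: (addrI (phi 0)); rewrite -phiD !addr0.
have phiS (I : finType) (F : I -> V) : phi (\sum_i F i) = \sum_i phi (F i).
  exact: (big_morph phi phiD phi0).
have algAct (r s : O) (v : V) : r%:A *: (s%:A *: v) = (r * s)%:A *: v.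
  by rewrite scalerA mulr_algl scalerA.
have [n0|n0] := posnP n.
  have V0 (v : V) : v = 0.
    have [c ->] := span_e v; rewrite big1 // => j _.
    by have := ltn_ord j; rewrite [X in (_ < X)%N]n0 ltn0.
  by exists id => v; rewrite [LHS]V0 [RHS]V0.
case: n n0 e span_e => // m _ f span_f.
have [Psi PsiE] : exists Psi : 'I_m.+1 -> 'I_m.+1 -> O,
    forall j, phi (f j) = f j + lam%:A *: \sum_i (Psi j i)%:A *: f i.
  have /choice[Psi PsiE] : forall j, exists c : 'I_m.+1 -> O,
      phi (f j) = f j + lam%:A *: \sum_i (c i)%:A *: f i.
    by move=> j; have [w ->] := phi1 (f j); have [c ->] := span_f w; exists c.
  by exists Psi.
pose F : 'M[O]_m.+1 := 1%:M + lam *: \matrix_(i, j) Psi j i.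
have FE j : phi (f j) = \sum_i (F i j)%:A *: f i.
  rewrite PsiE scaler_sumr; under [RHS]eq_bigr => i _ do rewrite !mxE !scalerDl -algAct.
  rewrite big_split /=; congr (_ + _); rewrite (bigD1 j) //= eqxx mulr1n !scale1r.
  by rewrite big1 ?addr0 // => i /negbTE ->; rewrite !scale0r.
have Fu : \det F \is a GRing.unit by apply: det_cong1_unit.
have phiM (G : 'M[O]_m.+1) j : phi (\sum_i (G i j)%:A *: f i) =
    \sum_i ((F *m G) i j)%:A *: f i.
  rewrite phiS; under eq_bigr => i _ do rewrite phiZ FE scaler_sumr.
  rewrite exchange_big /=; apply: eq_bigr => i _; rewrite mxE scaler_suml scaler_suml.
  by apply: eq_bigr => l _; rewrite algAct mulrC.
have phi_inj v : phi v = 0 -> v = 0.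
  move=> phiv; pose q : {poly O} := char_poly F.
  have CH : horner_mx F q = 0 := Cayley_Hamilton F.
  have iterE k j : iter k phi (f j) = \sum_i ((F ^+ k) i j)%:A *: f i.
    elim: k => [|k IHk]; last by rewrite iterS IHk phiM exprS.
    rewrite /= (bigD1 j) //= expr0 mxE eqxx !scale1r big1 ?addr0 // => i /negbTE ij.
    by rewrite mxE ij !scale0r.
  have iterD k : {morph iter k phi : x y / x + y}.
    by move=> x y; elim: k => //= k ->; rewrite phiD.
  have iter0 k : iter k phi 0 = 0 by elim: k => //= k ->.
  have iterZ k r x : iter k phi (r%:A *: x) = r%:A *: iter k phi x.
    by elim: k => //= k ->; rewrite phiZ.
  have qf j : \sum_(k < size q) (q`_k)%:A *: iter k phi (f j) = 0.
    under eq_bigr => k _ do rewrite iterE scaler_sumr.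
    rewrite exchange_big /= big1 // => i _.
    have qF : \sum_(k < size q) q`_k *: F ^+ k = 0.
      rewrite -[RHS]CH -[in RHS](coefK q) poly_def linear_sum /=.
      by apply: eq_bigr => k _; rewrite linearZ rmorphXn /= horner_mx_X.
    have /matrixP/(_ i j) := qF; rewrite summxE mxE => E.
    transitivity ((\sum_(k < size q) (q`_k *: F ^+ k) i j)%:A *: f i).
      by rewrite !scaler_suml; apply: eq_bigr => k _; rewrite algAct mxE.
    by rewrite E !scale0r.
  have qv : \sum_(k < size q) (q`_k)%:A *: iter k phi v = 0.
    have [c ->] := span_f v.
    under eq_bigr => k _.
      rewrite (big_morph (iter k phi) (iterD k) (iter0 k)) scaler_sumr.
      under eq_bigr => j _ do rewrite iterZ algAct mulrC -algAct.
      over.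
    rewrite exchange_big /= big1 // => j _.
    by rewrite -scaler_sumr qf scaler0.
  have q_gt0 : (0 < size q)%N by rewrite size_char_poly.
  have qv0 : (q`_0)%:A *: v = 0.
    rewrite -[RHS]qv (bigD1 (Ordinal q_gt0)) //= big1 ?addr0 // => -[[|k] ltk] // _.
    by rewrite [val _]/= iterSr phiv iter0 scaler0.
  have q0 : q`_0 \is a GRing.unit.
    by rewrite char_poly_det unitrM Fu andbT unitrX // unitrN1.
  by rewrite -[v]scale1r -[1](scale1r (1 : B)) -(mulVr q0) -algAct qv0 scaler0.
have phi_surj v : exists w, phi w = v.
  have [c ->] := span_f v.
  exists (\sum_j ((invmx F *m \col_j c j) j 0)%:A *: f j).
  rewrite phiS; under eq_bigr => i _ do rewrite phiZ FE scaler_sumr.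
  rewrite exchange_big /=; apply: eq_bigr => i _.
  transitivity (((F *m (invmx F *m \col_j c j)) i 0)%:A *: f i).
    rewrite [in RHS]mxE scaler_suml scaler_suml.
    by apply: eq_bigr => l _; rewrite algAct mulrC.
  by rewrite mulKVmx ?unitmxE // mxE.
have /choice[psi psiK] := phi_surj.
exists psi => // v; apply/eqP; rewrite -subr_eq0; apply/eqP/phi_inj.
have phiN x : phi (- x) = - phi x by apply: (addrI (phi x)); rewrite -phiD !subrr.
by rewrite phiD phiN psiK subrr.
Qed.
End Nakayama.

(** * Complete discrete valuation rings *)

Section CompleteDVR.
Variables (O : idomainType) (pi : O) (k : fieldType) (red : {rmorphism O -> k}).
Hypotheses (O_cdvr : complete_dvr pi) (k_residue : residue_map pi red).

Lemma red0P x : red x = 0 <-> dvd_in pi x.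
Proof. by case: k_residue. Qed.

Lemma unit_red x : (x \is a GRing.unit) = (red x != 0).
Proof.
have h := cdvr_maximal O_cdvr x.
apply/idP/idP => [xu|rx]; first by apply/eqP => /red0P/h /negP.
by apply/negPn/negP => /h /red0P rx0; rewrite rx0 eqxx in rx.
Qed.

Lemma one_pi_unit y : 1 + pi * y \is a GRing.unit.
Proof.
rewrite unit_red rmorphD rmorph1 (_ : red (pi * y) = 0) ?addr0 ?oner_eq0 //.
by apply/red0P; exists y.
Qed.

Lemma pi_neq0 : pi != 0.
Proof.
have [x x0 xN] := cdvr_not_field O_cdvr.
have [y xE] := (cdvr_maximal O_cdvr x).1 xN.
by apply: contra_neq x0 => pi0; rewrite xE pi0 mul0r.
Qed.

(** The intersection of the ideals generated by the [pi ^+ n] is principal, generated by some a.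
    Cancelling [pi] gives a = pi b with b again in the intersection, so a = a (pi c), and a vanishes
    because 1 - pi c is a unit. *)
Lemma pi_sep x : (forall n, dvd_in (pi ^+ n) x) -> x = 0.
Proof.
pose I x := forall n, dvd_in (pi ^+ n) x.
have idI : is_ideal I.
  split=> [n|y z Iy Iz n|a y Iy n]; first by exists 0; rewrite mulr0.
    have [u ->] := Iy n; have [v ->] := Iz n; by exists (u + v); rewrite mulrDr.
  by have [u ->] := Iy n; exists (a * u); rewrite mulrCA.
have [a aE] := cdvr_pid O_cdvr idI.
have Ia : I a by apply/aE; exists 1; rewrite mulr1.
have [b ab] := Ia 1%N; rewrite expr1 in ab.
have Ib : I b.
  move=> n; have [c aC] := Ia n.+1; exists c; apply: (mulfI pi_neq0).
  by rewrite -ab aC exprS mulrA.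
have [c bE] := (aE b).1 Ib.
have a0 : a = 0.
  have : a * (1 + pi * - c) = 0 by rewrite mulrDr mulr1 {1}ab bE; ring.
  by move/(canRL (mulrK (one_pi_unit _))); rewrite mul0r.
by move=> /aE [y ->]; rewrite a0 mul0r.
Qed.

(** Applied to [lam]: a congruence modulo a high power of [pi] then implies one modulo [lam]. *)
Lemma dvd_pi_pow x : x != 0 -> exists n, dvd_in x (pi ^+ n).
Proof.
move=> x0; have [n nx] : exists n, ~ dvd_in (pi ^+ n) x.
  by apply/existsNP => h; case/eqP: x0; apply: pi_sep.
elim: n => [|n IHn] in x x0 nx *; first by case: nx; exists x; rewrite mul1r.
have [xu|xN] := boolP (x \is a GRing.unit).
  by exists 0%N; exists x^-1; rewrite expr0 divrr.
have [y xE] := (cdvr_maximal O_cdvr x).1 xN.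
have y0 : y != 0 by apply: contra_neq x0 => y0; rewrite xE y0 mulr0.
have [m [z zE]] : exists m, dvd_in y (pi ^+ m).
  apply: IHn => // -[z yE]; apply: nx; exists z.
  by rewrite xE yE exprS mulrA.
by exists m.+1; exists z; rewrite xE exprS zE mulrA.
Qed.

Section ResidueChar.
Variable p : nat.
Hypotheses (p_prime : prime p) (k_char : p \in [pchar k]).

Lemma p_in_pi : dvd_in pi p%:R.
Proof. by apply/red0P; rewrite rmorph_nat (pcharf0 k_char). Qed.

Lemma lam_in_pi zeta : p.-primitive_root zeta -> dvd_in pi (1 - zeta).
Proof.
move=> zP; have [u u_unit pE] := p_lam p_prime zP; apply/red0P.
have : red p%:R = 0 by apply/red0P; apply: p_in_pi.
rewrite pE rmorphM rmorphXn => /eqP; rewrite mulf_eq0 expf_eq0.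
case/orP => [/andP[_ /eqP//]|/eqP u0].
by move: u_unit; rewrite unit_red u0 eqxx.
Qed.

Lemma lam_jac zeta : p.-primitive_root zeta -> forall y : O, 1 + (1 - zeta) * y \is a GRing.unit.
Proof. by move=> /lam_in_pi[z ->] y; rewrite -mulrA one_pi_unit. Qed.

Hypothesis O_fg : fg_over_padic p O.

Lemma padic_div_p (d : padic p) : padic_val d 0%N = 0 -> exists y : padic p, d = p%:R * y.
Proof.
move=> d0; have p_gt0 := prime_gt0 p_prime.
have pn n : ((Zp_trunc (p ^ n.+1)).+2 = p ^ n.+1)%N.
  by rewrite Zp_cast // (@leq_trans p) ?prime_gt1 // -{1}[p]expn1 leq_pexp2l.
have vZ n m : nat_of_ord (inZp m : 'Z_(p ^ n.+1)) = (m %% p ^ n.+1)%N.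
  exact: (congr1 (fun q => m %% q)%N (pn n)).
pose D n : nat := padic_val d n.
have DE n : (D n.+1 %% p ^ n.+1 = D n)%N.
  have /padic_compatP/(_ n) : padic_val d \in @padic_compat p by apply: valP.
  by move/(congr1 (fun z => nat_of_ord z)); rewrite vZ.
have Dp n : (p %| D n)%N.
  elim: n => [|n IHn]; first by rewrite /D d0.
  rewrite (divn_eq (D n.+1) (p ^ n.+1)) DE dvdn_add // expnS dvdn_mull // dvdn_mulr //.
(* Division by p costs one level: the component of the quotient modulo [p ^ n.+1] is read from the
   component of [d] modulo [p ^ n.+2]. *)
have yP : (fun n => inZp (D n.+1 %/ p) : 'Z_(p ^ n.+1)) \in @padic_compat p.
  apply/padic_compatP => n; apply: val_inj; rewrite [LHS]vZ [RHS]vZ vZ.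
  rewrite modn_dvdm ?dvdn_exp2l // -(DE n.+1) {1}(divn_eq (D n.+2) (p ^ n.+2)).
  rewrite divnDr; last by rewrite DE.
  by rewrite (expnS p n.+1) mulnCA mulKn // modnMDl.
exists (Padic yP); apply: val_inj; apply: functional_extensionality_dep => n.
have E m (z : padic p) : padic_val (m%:R * z) n = m%:R * padic_val z n.
  elim: m => [|m IHm]; first by rewrite !mul0r.
  rewrite !mulrSr !mulrDl !mul1r -IHm.
  by [].
apply/esym/(etrans (E _ _)).
rewrite mulr_natl Zp_mulrn; apply: val_inj; apply: (etrans (vZ _ _)).
by rewrite [padic_val _ n]/(inZp (D n.+1 %/ p)) vZ modnMml divnK // DE.
Qed.

(** Every p-adic integer is a digit below p plus a multiple of p, and [pi] divides p in O. Hence the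
    combinations of the generators of O with digits as coefficients meet every class modulo [pi]. *)
Lemma finite_residue : exists (T : finType) (rep : T -> O),
  forall x, exists t, dvd_in pi (x - rep t).
Proof.
have [iota [n [e span_e]]] := O_fg.
exists {ffun 'I_n -> 'I_p}, (fun t : {ffun 'I_n -> 'I_p} => \sum_i (t i : nat)%:R * e i) => x.
have [c ->] := span_e x.
have p_gt0 := prime_gt0 p_prime.
have p1 : ((Zp_trunc (p ^ 1)).+2 = p)%N by rewrite expn1 Zp_cast ?prime_gt1.
exists [ffun i => Ordinal (ltn_pmod (padic_val (c i) 0%N) p_gt0)].
rewrite -sumrB; suff h i : dvd_in pi (iota (c i) * e i -
    ([ffun i => Ordinal (ltn_pmod (padic_val (c i) 0%N) p_gt0)] i : nat)%:R * e i).
  elim/big_ind: _ => [|_ _ [u ->] [v ->]|i _]; last exact: h.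
    by exists 0; rewrite mulr0.
  by exists (u + v); rewrite mulrDr.
rewrite ffunE /= -mulrBl.
set a := (padic_val (c i) 0%N : nat).
have [y yE] : exists y : padic p, c i - (a %% p)%:R = p%:R * y.
  apply: padic_div_p; have E0 m : padic_val (m%:R : padic p) 0%N = m%:R :> 'Z_(p ^ 1).
    by elim: m => [|m IHm] //; rewrite !mulrSr -IHm.
  rewrite -[LHS]/(padic_val (c i) 0%N - padic_val ((a %% p)%:R : padic p) 0%N) E0.
  apply/eqP; rewrite subr_eq0; apply/eqP/val_inj.
  by rewrite Zp_nat /= -/a p1 modn_mod modn_small // -[X in (_ < X)%N]p1 ltn_ord.
have [u uE] := p_in_pi; exists (u * iota y * e i); rewrite !mulrA -uE; congr (_ * _).
by rewrite -(rmorph_nat iota (a %% p)) -rmorphB yE rmorphM rmorph_nat.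
Qed.

End ResidueChar.
End CompleteDVR.

Section PiDiv.
Variables (O : idomainType) (pi : O) (R : algType O).
Implicit Types a b : R.

Definition pdv n a := exists w, a = pi ^+ n *: w.

Lemma pdv0 n : pdv n 0. Proof. by exists 0; rewrite scaler0. Qed.
Lemma pdvD n a b : pdv n a -> pdv n b -> pdv n (a + b).
Proof. by move=> [u ->] [v ->]; exists (u + v); rewrite scalerDr. Qed.
Lemma pdvN n a : pdv n a -> pdv n (- a).
Proof. by move=> [u ->]; exists (- u); rewrite scalerN. Qed.
Lemma pdvB n a b : pdv n a -> pdv n b -> pdv n (a - b).
Proof. by move=> ha /pdvN; apply: pdvD. Qed.
Lemma pdv_trans n b a c : pdv n (a - b) -> pdv n (b - c) -> pdv n (a - c).
Proof. by move=> h1 h2; rewrite -[a](subrK b) -addrA; apply: pdvD. Qed.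
Lemma pdvC n a b : pdv n (a - b) -> pdv n (b - a).
Proof. by move/pdvN; rewrite opprB. Qed.
Lemma pdvMl n a b : pdv n a -> pdv n (b * a).
Proof. by move=> [u ->]; exists (b * u); rewrite scalerAr. Qed.
Lemma pdvMr n a b : pdv n a -> pdv n (a * b).
Proof. by move=> [u ->]; exists (u * b); rewrite scalerAl. Qed.
Lemma pdvMM m n a b : pdv m a -> pdv n b -> pdv (m + n) (a * b).
Proof.
by move=> [u ->] [v ->]; exists (u * v); rewrite -scalerAl -scalerAr scalerA exprD.
Qed.
Lemma pdvZ n r a : pdv n a -> pdv n (r *: a).
Proof. by move=> [u ->]; exists (r *: u); rewrite !scalerA mulrC. Qed.
Lemma pdv_le m n a : (m <= n)%N -> pdv n a -> pdv m a.
Proof. by move=> mn [u ->]; exists (pi ^+ (n - m) *: u); rewrite scalerA -exprD subnKC. Qed.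
Lemma pdv_sum n (I : finType) (F : I -> R) : (forall i, pdv n (F i)) -> pdv n (\sum_i F i).
Proof. by move=> h; elim/big_ind: _ => [|x y|i _]; [exact: pdv0 | exact: pdvD | exact: h]. Qed.
Lemma pdvM2 n a b c d : pdv n (a - b) -> pdv n (c - d) -> pdv n (a * c - b * d).
Proof.
move=> h1 h2; apply: (@pdv_trans _ (b * c)).
  by rewrite -mulrBl; apply: pdvMr.
by rewrite -mulrBr; apply: pdvMl.
Qed.
Lemma pdvX n m a b : pdv n (a - b) -> pdv n (a ^+ m - b ^+ m).
Proof.
move=> h; elim: m => [|m IHm]; first by rewrite subrr; apply: pdv0.
by rewrite !exprS; apply: pdvM2.
Qed.
End PiDiv.

(** * Adic limits and idempotents in group algebras *)

Section GroupAlgebraLimits.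
Variables (O : idomainType) (pi : O) (k : fieldType) (red : {rmorphism O -> k}).
Hypotheses (O_cdvr : complete_dvr pi) (k_residue : residue_map pi red).
Variable gT : finGroupType.
Local Notation OG := (galg O gT).
Implicit Types a b x y : OG.
Local Notation pdv := (pdv pi).

Lemma pdv_coef n a : pdv n a <-> forall x : gT, dvd_in (pi ^+ n) (a x).
Proof.
split=> [[w ->] x|h]; first by exists (w x); rewrite ffunE.
have [w wE] := choice h; exists [ffun x => w x : O]; apply/ffunP => x.
by rewrite !ffunE -wE.
Qed.

Lemma pdv_sep a : (forall n, pdv n a) -> a = 0.
Proof.
move=> h; apply/ffunP => x; rewrite ffunE; apply: (pi_sep O_cdvr k_residue) => n.
by have /pdv_coef := h n; apply.
Qed.

Lemma gal_lim (s : nat -> OG) : (forall n, pdv n (s n.+1 - s n)) ->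
  exists l, forall n, pdv n (l - s n).
Proof.
move=> h; have /choice[l lE] : forall x : gT, exists l, forall n, dvd_in (pi ^+ n) (l - s n x).
  move=> x; apply: (cdvr_complete O_cdvr) => n.
  by have /pdv_coef/(_ x) := h n; rewrite !ffunE.
by exists [ffun x => l x] => n; apply/pdv_coef => x; rewrite !ffunE.
Qed.

Lemma gal_lim_uniq a b (s : nat -> OG) : (forall n, pdv n (a - s n)) ->
  (forall n, pdv n (b - s n)) -> a = b.
Proof.
move=> ha hb; apply/eqP; rewrite -subr_eq0; apply/eqP/pdv_sep => n.
by apply: (pdv_trans (ha n)); apply: pdvC.
Qed.

Lemma gal_tf r a : r != 0 -> r *: a = 0 -> a = 0.
Proof.
move=> r0 /ffunP ra; apply/ffunP => x; have := ra x; rewrite !ffunE => /eqP.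
by rewrite mulf_eq0 (negbTE r0) => /eqP.
Qed.

Variable p : nat.
Hypotheses (p_prime : prime p) (k_char : p \in [pchar k]) (O_fg : fg_over_padic p O).

Lemma gal_pigeon (s : nat -> OG) : exists m d, pdv 1 (s m - s (m + d.+1)%N).
Proof.
have [T [rep repP]] := finite_residue k_residue p_prime k_char O_fg.
have /choice[c cE] : forall n, exists c : {ffun gT -> T}, forall x : gT, dvd_in pi (s n x - rep (c x)).
  move=> n; have [c cE] := choice (fun x : gT => repP (s n x)).
  by exists [ffun x => c x] => x; rewrite ffunE.
have [m [n [mn cmn]]] : exists m n, (m < n)%N /\ c m = c n.
  pose N := #|{ffun gT -> T}|.
  have /injectivePn[i [j ij cij]] : ~~ injectiveb (fun i : 'I_N.+1 => c i).
    by apply/negP => /injectiveP/leq_card; rewrite card_ord ltnn.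
  have [ltij|ltji|/val_inj eij] := ltngtP (i : nat) j.
  - by exists i, j.
  - by exists j, i.
  - by rewrite eij eqxx in ij.
exists m, (n - m).-1; rewrite prednK ?subn_gt0 // subnKC ?(ltnW mn) //.
apply/pdv_coef => x; rewrite expr1 !ffunE.
have [u uE] := cE m x; have [v vE] := cE n x; exists (u - v).
by rewrite mulrBr -uE -vE cmn opprB addrA subrK.
Qed.

Lemma gal_pow_idem x : exists n, pdv 1 (x ^+ n.+1 * x ^+ n.+1 - x ^+ n.+1).
Proof.
have [m [d md]] := gal_pigeon (fun n => x ^+ n).
have step j i : (m <= j)%N -> pdv 1 (x ^+ j - x ^+ (j + i * d.+1)).
  move=> mj; elim: i => [|i IHi]; first by rewrite mul0n addn0 subrr; apply: pdv0.
  apply: (pdv_trans IHi); set a := (j + i * d.+1)%N.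
  have -> : (j + i.+1 * d.+1 = (m + d.+1) + (a - m))%N.
    have ma : (m <= a)%N by rewrite (leq_trans mj) ?leq_addr.
    by rewrite addnAC subnKC // mulSn addnCA addnC.
  have {1}-> : (a = m + (a - m))%N by rewrite subnKC // (leq_trans mj) ?leq_addr.
  by rewrite !exprD -mulrBl -exprD; apply: pdvMr.
(* The exponent is [m.+1 * d.+1]: a multiple of the period, beyond the point m where periodicity
   starts, so that doubling it changes nothing modulo [pi]. *)
exists (m * d.+1 + d)%N; apply: pdvC; rewrite -exprD.
have -> : ((m * d.+1 + d).+1 = m.+1 * d.+1)%N by rewrite mulSn addSn addnC.
by apply: step; apply: leq_trans (leq_pmulr m.+1 (ltn0Sn d)).
Qed.

(** The cofactor of x - y in x^p - y^p is congruent modulo [pi] to p y^(p-1), which supplies the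
    additional factor [pi]. *)
Lemma gal_pth_power n x y : GRing.comm x y -> pdv n.+1 (x - y) -> pdv n.+2 (x ^+ p - y ^+ p).
Proof.
move=> cxy h; rewrite (subrXX_comm _ cxy) -[n.+2]addn1; apply: pdvMM => //.
have [z pE] := p_in_pi k_residue k_char.
have hp : pdv 1 (\sum_(i < p) y ^+ p.-1).
  rewrite sumr_const card_ord -mulr_natl -scaler_nat pE mulr_algl; exists (z *: y ^+ p.-1).
  by rewrite expr1 scalerA.
rewrite -[X in pdv 1 X](subrK (\sum_(i < p) y ^+ p.-1)); apply: pdvD => //.
rewrite -sumrB; apply: pdv_sum => i.
have -> : y ^+ p.-1 = y ^+ (p.-1 - i) * y ^+ i.
  by rewrite -exprD subnK // -ltnS prednK ?prime_gt0.
by rewrite -mulrBl; apply: pdvMr; apply: pdvX; apply: (@pdv_le _ _ _ _ n.+1).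
Qed.

(* The p^n-th powers of an idempotent modulo pi converge to an idempotent. *)
Lemma gal_idem_lift f : pdv 1 (f * f - f) -> exists e : OG,
  [/\ e * e = e, pdv 1 (e - f) & forall n, exists m, pdv n (e - f ^+ m.+1)].
Proof.
move=> ff; have pX m : (0 < p ^ m)%N by rewrite expn_gt0 prime_gt0.
have fX m : pdv 1 (f ^+ m.+1 - f).
  elim: m => [|m IHm]; first by rewrite expr1 subrr; apply: pdv0.
  by apply: pdv_trans ff; rewrite exprS -mulrBr; apply: pdvMl.
have pow (a b : nat) n : pdv 1 (f ^+ a - f ^+ b) -> pdv n.+1 (f ^+ (a * p ^ n) - f ^+ (b * p ^ n)).
  move=> ab; elim: n => [|n IHn]; first by rewrite expn0 !muln1.
  by rewrite expnSr !mulnA !(exprM _ (_ * _)); apply: gal_pth_power => //; apply/commrX/commr_sym/commrX.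
have s1 n : pdv n (f ^+ (p ^ n.+1) - f ^+ (p ^ n)).
  rewrite expnS -[X in _ - f ^+ X]mul1n; apply: (@pdv_le _ _ _ _ n.+1) => //; apply: pow.
  by rewrite -(prednK (prime_gt0 p_prime)) expr1; apply: fX.
have [e eE] := gal_lim s1; exists e; split.
- apply: (@gal_lim_uniq _ _ (fun n => f ^+ (p ^ n))) => // n.
  apply: (@pdv_trans _ _ _ _ (f ^+ (p ^ n) * f ^+ (p ^ n))); first exact: pdvM2.
  rewrite -exprD addnn -mul2n -[X in _ - f ^+ X]mul1n.
  by apply: (@pdv_le _ _ _ _ n.+1) => //; apply: pow; rewrite expr1; apply: fX.
- by apply: (pdv_trans (eE 1%N)); rewrite -(prednK (pX 1%N)); apply: fX.
- by move=> n; exists (p ^ n).-1; rewrite prednK.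
Qed.

(** * Local corners of primitive idempotents *)

Section Local.
Variable S : OG -> Prop.
Hypothesis SB : forall a b, S a -> S b -> S (a - b).
Hypothesis SM : forall a b, S a -> S b -> S (a * b).
Hypothesis Slim : forall a, (forall n, exists2 y, S y & pdv n (a - y)) -> S a.
Variable e : OG.
Hypothesis e_prim : primitive_idempotent S e.

Let Se : S e. Proof. by case: e_prim. Qed.
Let ee : e * e = e. Proof. by case: e_prim. Qed.
Let S0 : S 0. Proof. by rewrite -(subrr e); apply: SB. Qed.
Let SD a b : S a -> S b -> S (a + b).
Proof. by move=> Sa Sb; rewrite -[b]opprK -[- b]sub0r; apply: (SB) => //; apply: SB. Qed.

(** The corner e S e, followed by invertibility in it. S will be the centre of the group algebra or
    the P-fixed points of a block; it is a predicate closed under differences, products and limits,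
    which serves both cases without building subalgebras. *)
Definition in_e x := S x /\ e * x * e = x.
Definition unit_e x := exists2 y, in_e y & x * y = e.

Lemma in_e_l x : in_e x -> e * x = x.
Proof. by case=> _ <-; rewrite !mulrA ee. Qed.
Lemma in_e_r x : in_e x -> x * e = x.
Proof. by case=> _ <-; rewrite -!mulrA ee. Qed.
Lemma in_eP x : S x -> e * x = x -> x * e = x -> in_e x.
Proof. by move=> Sx h1 h2; split; rewrite ?h1 ?h2. Qed.
Lemma in_e_e : in_e e. Proof. by split; rewrite ?ee. Qed.
Lemma in_eM x y : in_e x -> in_e y -> in_e (x * y).
Proof.
move=> hx hy; apply: in_eP; first by apply: SM; [case: hx|case: hy].
  by rewrite mulrA in_e_l.
by rewrite -mulrA in_e_r.
Qed.
Lemma in_eB x y : in_e x -> in_e y -> in_e (x - y).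
Proof.
move=> hx hy; apply: in_eP; first by apply: SB; [case: hx|case: hy].
  by rewrite mulrBr !in_e_l.
by rewrite mulrBl !in_e_r.
Qed.
Lemma in_eD x y : in_e x -> in_e y -> in_e (x + y).
Proof.
move=> hx hy; apply: in_eP; first by apply: SD; [case: hx|case: hy].
  by rewrite mulrDr !in_e_l.
by rewrite mulrDl !in_e_r.
Qed.
Lemma in_eX x n : in_e x -> in_e (x ^+ n.+1).
Proof. by move=> hx; elim: n => [|n IHn]; rewrite ?expr1 // exprS; apply: in_eM. Qed.
Lemma in_e_lim x : (forall n, exists2 y, in_e y & pdv n (x - y)) -> in_e x.
Proof.
move=> h; apply: in_eP.
- by apply: Slim => n; have [y [Sy _] xy] := h n; exists y.
- apply/eqP; rewrite -subr_eq0; apply/eqP/pdv_sep => n; have [y hy xy] := h n.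
  apply: (@pdv_trans _ _ _ _ y); last exact: pdvC.
  by rewrite -(in_e_l hy) -mulrBr; apply: pdvMl.
- apply/eqP; rewrite -subr_eq0; apply/eqP/pdv_sep => n; have [y hy xy] := h n.
  apply: (@pdv_trans _ _ _ _ y); last exact: pdvC.
  by rewrite -(in_e_r hy) -mulrBl; apply: pdvMr.
Qed.

Lemma prim_idem f : in_e f -> f * f = f -> f = 0 \/ f = e.
Proof.
move=> hf ff; case: e_prim => _ _ _ /(_ f (e - f)); case.
- by case: hf.
- by apply: SB => //; case: hf.
- by [].
- by rewrite mulrBl mulrBr ee (in_e_l hf) mulrBr (in_e_r hf) ff subrr subr0.
- by rewrite mulrBr (in_e_r hf) ff subrr.
- by rewrite mulrBl (in_e_l hf) ff subrr.
- by rewrite addrC subrK.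
- by left.
- by move/eqP; rewrite subr_eq0 => /eqP <-; right.
Qed.

(** The product in the other order is an idempotent of the corner, hence 0 or e, and 0 would force e
    to vanish. *)
Lemma unit_eC x y : in_e x -> in_e y -> x * y = e -> y * x = e.
Proof.
move=> hx hy xy; case: (@prim_idem (y * x)) => //; first exact: in_eM.
  by rewrite mulrA -[y * x * y]mulrA xy (in_e_r hy).
move=> yx0; case: e_prim => _ _ /eqP[]; rewrite -ee -{1}xy -{1}xy.
by rewrite mulrA -[x * y * x]mulrA yx0 mulr0 mul0r.
Qed.

Lemma unit_e_e : unit_e e. Proof. by exists e; [exact: in_e_e|]. Qed.

Lemma unit_eM x y : in_e x -> in_e y -> unit_e (x * y) -> unit_e x.
Proof. by move=> hx hy [z hz xyz]; exists (y * z); [exact: in_eM|rewrite mulrA]. Qed.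
Lemma unit_e_pi x : in_e x -> pdv 1 (e - x) -> unit_e x.
Proof.
move=> hx ex; pose y := e - x; have hy : in_e y by apply: in_eB => //; exact: in_e_e.
pose s n := e + \sum_(j < n) y ^+ j.+1.
have sh n : in_e (s n).
  rewrite /s; elim: n => [|n IHn]; first by rewrite big_ord0 addr0; apply: in_e_e.
  by rewrite big_ord_recr /= addrA; apply: in_eD => //; apply: in_eX.
have yX n : pdv n.+1 (y ^+ n.+1).
  by elim: n => [|n IHn] //; rewrite exprS -[n.+2]add1n; apply: pdvMM.
have s1 n : pdv n (s n.+1 - s n).
  have -> : s n.+1 - s n = y ^+ n.+1 by rewrite /s big_ord_recr /= addrA [_ + _ - _]addrC addKr.
  by apply: (@pdv_le _ _ _ _ n.+1).
have xs n : x * s n = e - y ^+ n.+1.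
  have -> : x = e - y by rewrite /y opprB addrC subrK.
  elim: n => [|n IHn]; first by rewrite /s big_ord0 addr0 expr1 mulrBl ee (in_e_r hy).
  rewrite /s big_ord_recr /= addrA mulrDr -/(s n) IHn mulrBl -exprS (in_e_l (in_eX n hy)).
  by rewrite addrA subrK.
have [l lE] := gal_lim s1; exists l; first by apply: in_e_lim => n; exists (s n).
apply: (@gal_lim_uniq _ _ (fun n => x * s n)) => n.
  by rewrite -mulrBr; apply: pdvMl.
by rewrite xs opprB addrC subrK; apply: (@pdv_le _ _ _ _ n.+1).
Qed.

(** A power of x is idempotent modulo [pi] and lifts to an idempotent f, a limit of powers of x and
    therefore in the corner. If f = e then x is a unit; if f = 0 then x is nilpotent modulo [pi] and
    a geometric sum shows that e - x is a unit. *)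
Lemma unit_e_or x : in_e x -> unit_e x \/ unit_e (e - x).
Proof.
move=> hx; have [n xn] := gal_pow_idem x.
have [f [ff fx flim]] := gal_idem_lift xn.
have hf : in_e f.
  apply: in_e_lim => m; have [j fj] := flim m; exists (x ^+ n.+1 ^+ j.+1) => //.
  by apply: in_eX; apply: in_eX.
have hxn := in_eX n hx.
have [f0|fe] := prim_idem hf ff; [right|left].
  have h : unit_e (e - x ^+ n.+1).
    apply: unit_e_pi; first by apply: in_eB => //; exact: in_e_e.
    by rewrite opprB addrC subrK -[X in pdv 1 X]opprK; apply: pdvN; rewrite -sub0r -f0.
  have hs : in_e (e + \sum_(j < n) x ^+ j.+1).
    elim: (n) => [|m IHm]; first by rewrite big_ord0 addr0; apply: in_e_e.
    by rewrite big_ord_recr /= addrA; apply: in_eD => //; apply: in_eX.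
  have E : (e - x) * (e + \sum_(j < n) x ^+ j.+1) = e - x ^+ n.+1.
    elim: (n) => [|m IHm]; first by rewrite big_ord0 addr0 expr1 mulrBl ee (in_e_r hx).
    rewrite big_ord_recr /= addrA mulrDr IHm mulrBl -exprS (in_e_l (in_eX m hx)).
    by rewrite addrA subrK.
  rewrite -E in h; apply: unit_eM h => //.
  by apply: in_eB => //; exact: in_e_e.
have h : unit_e (x ^+ n.+1) by apply: unit_e_pi => //; rewrite -fe.
case: n h {xn fx flim hxn} => [|n]; first by rewrite expr1.
by rewrite exprS => h; apply: unit_eM h => //; apply: in_eX.
Qed.

Lemma unit_eD x y : in_e x -> in_e y -> unit_e (x + y) -> unit_e x \/ unit_e y.
Proof.
move=> hx hy [v hv xyv]; have hxv := in_eM hx hv; have hyv := in_eM hy hv.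
case: (unit_e_or hxv) => h; [left|right]; first exact: unit_eM h.
have E : e - x * v = y * v by rewrite -xyv mulrDl addrC addKr.
by rewrite E in h; apply: unit_eM h.
Qed.

Lemma unit_e_sum (I : finType) (Q : pred I) (F : I -> OG) : (forall i, Q i -> in_e (F i)) ->
  unit_e (\sum_(i | Q i) F i) -> exists2 i, Q i & unit_e (F i).
Proof.
move=> hF; rewrite -big_filter.
have : all Q [seq i <- index_enum I | Q i] by apply: filter_all.
elim: [seq i <- _ | _] => [_|i s IHs /= /andP[Qi Qs]].
  rewrite big_nil => -[z _]; rewrite mul0r => e0.
  by case: e_prim => _ _; rewrite -e0 eqxx.
rewrite big_cons => h; case: (unit_eD _ _ h); first exact: hF.
- elim: s Qs {IHs h} => [|j s IHs] /=; first by rewrite big_nil -(subrr e) => _; apply: in_eB; apply: in_e_e.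
  by case/andP=> Qj Qs; rewrite big_cons; apply: in_eD; [exact: hF|exact: IHs].
- by exists i.
- exact: IHs.
Qed.

End Local.
End GroupAlgebraLimits.

(** * Rigidity of permutation lattices modulo 1 - zeta *)

Lemma chief_step (gT : finGroupType) (p : nat) (P K : {group gT}) :
  prime p -> (p.-group P)%g -> (K <| P)%g -> (K :!=: P)%g ->
  exists z, [/\ z \in P, z \notin K, (z ^+ p)%g \in K &
    forall u, u \in P -> [~ z, u]%g \in K].
Proof.
move=> p_pr pP nKP KP; have [sKP nPK] := andP nKP.
have PK1 : (P / K != 1)%g.
  apply: contra KP => /eqP PK1; rewrite eqEsubset sKP.
  by rewrite -quotient_sub1 // PK1 subxx.
have pPK : (p.-group (P / K))%g by apply: quotient_pgroup.
have ntZ : ('Z(P / K) != 1)%g by rewrite center_nil_eq1 // (pgroup_nil pPK).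
have pZ : (p.-group 'Z(P / K))%g by apply: pgroupS pPK; apply: center_sub.
have [_ pdvd _] := pgroup_pdiv pZ ntZ.
have [zK zKZ ozK] := Cauchy p_pr pdvd.
have /(subsetP (center_sub _)) zKPK := zKZ.
case/morphimP: (zKPK) => z nz zP zE; exists z; split=> //.
- apply: contraTN (prime_gt1 p_pr) => zK1; rewrite -ozK zE /= coset_id //.
  by rewrite order1.
- apply: coset_idr; first by rewrite groupX.
  by rewrite morphX //= -zE -ozK expg_order.
- move=> u uP; have nu : u \in 'N(K)%g by apply: subsetP uP.
  apply: coset_idr; first by rewrite groupR.
  rewrite morphR //= -zE; apply/eqP/commgP; have /centerP[_] := zKZ; apply.
  exact: mem_quotient.
Qed.

(** * Spectral projections of an operator at the powers of zeta *)

Section OperatorTrace.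
Variables (O : idomainType) (p : nat) (zeta : O).
Hypotheses (p_pr : prime p) (zeta_prim : p.-primitive_root zeta).
Local Notation lam := (1 - zeta).
Variables (M : lmodType O) (T : {linear M -> M}).

Let pr (s : seq O) (m : M) := foldr (fun a w => T w - a *: w) m s.

Lemma foldr_horner (s : seq O) m : pr s m =
  \sum_(k < (size s).+1) (\prod_(a <- s) ('X - a%:P))`_k *: iter k T m.
Proof.
elim: s => [|a s IHs] /=.
  by rewrite big_ord_recl big_ord0 big_nil addr0 /= coefC eqxx scale1r.
rewrite IHs big_cons; set q := \prod_(_ <- s) _.
have q_s : q`_(size s).+1 = 0.
  by rewrite nth_default // size_prod_XsubC.
under [RHS]eq_bigr => k _ do rewrite mulrBl coefB coefXM coefCM scalerBl.
rewrite sumrB; congr (_ - _).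
  rewrite [RHS]big_ord_recl /= scale0r add0r linear_sum.
  by apply: eq_bigr => k _; rewrite linearZ.
rewrite [RHS]big_ord_recr /= q_s mulr0 scale0r addr0 scaler_sumr.
by apply: eq_bigr => k _; rewrite scalerA.
Qed.

(** If T^p = 1, the right side is a unit times p times the projection to the eigenspace of
    [zeta ^+ j]. The product form on the left is the one in which divisibility can be gained factor
    by factor. *)
Lemma foldr_zeta (j : nat) m : (j < p)%N ->
  pr [seq zeta ^+ l | l <- rem j (iota 0 p)] m =
  \sum_(k < p) ((zeta ^+ j) ^+ p.-1 ^+ k.+1) *: iter k T m.
Proof.
move=> jp; have p_gt0 := prime_gt0 p_pr.
rewrite foldr_horner prod_XsubC_zeta // size_map size_rem ?mem_iota //.
rewrite size_iota prednK //; apply: eq_bigr => k _.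
by rewrite coef_poly ltn_ord.
Qed.

Lemma sum_zeta_trace m :
  \sum_(j < p) \sum_(k < p) ((zeta ^+ j) ^+ p.-1 ^+ k) *: iter k T m = p%:R *: m.
Proof.
have [p_gt0 p_gt1] := (prime_gt0 p_pr, prime_gt1 p_pr).
rewrite exchange_big (bigD1 (Ordinal p_gt0)) //= [X in _ + X]big1 ?addr0 => [|k k0].
  by rewrite -scaler_suml; under eq_bigr => j _ do rewrite expr0;
     rewrite sumr_const card_ord.
rewrite -scaler_suml; under eq_bigr => j _ do rewrite -exprM.
rewrite sum_zeta ?scale0r // Euclid_dvdM // negb_or !gtnNdvd ?prednK //.
- by rewrite lt0n.
- by rewrite -ltnS prednK.
Qed.

End OperatorTrace.

(** * Orbits of a normal subgroup and their representatives *)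

Section Orbits.
Variables (gT : finGroupType) (X : finType) (to : gT -> X -> X).
Hypothesis to1 : forall x, to 1%g x = x.
Variable P : {group gT}.
Hypothesis toM : forall u w x, u \in P -> w \in P -> to (u * w)%g x = to u (to w x).

Definition orb (K : {group gT}) x := [set to k x | k in K].
Definition orep (K : {group gT}) x := odflt x [pick y in orb K x].

Variables K : {group gT}.
Hypothesis sKP : K \subset P.
Let KP k : k \in K -> k \in P. Proof. exact: subsetP. Qed.

Lemma orb_refl x : x \in orb K x.
Proof. by apply/imsetP; exists 1%g; rewrite ?group1 ?to1. Qed.

Lemma orb_sub x y : y \in orb K x -> orb K y \subset orb K x.
Proof.
case/imsetP=> k kK ->; apply/subsetP => _ /imsetP[l lK ->].
by rewrite -toM ?KP //; apply/imsetP; exists (l * k)%g; rewrite ?groupM.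
Qed.

Lemma orb_sym x y : y \in orb K x -> x \in orb K y.
Proof.
case/imsetP=> k kK ->; apply/imsetP; exists k^-1%g; rewrite ?groupV //.
by rewrite -toM ?KP ?groupV // mulVg to1.
Qed.

Lemma orb_eq x y : y \in orb K x -> orb K y = orb K x.
Proof.
move=> yx; apply/eqP; rewrite eqEsubset orb_sub //.
by rewrite orb_sub // orb_sym.
Qed.

Lemma orep_mem x : orep K x \in orb K x.
Proof. by rewrite /orep; case: pickP => [y //|/(_ x)]; rewrite orb_refl. Qed.

Lemma orep_eq x y : (orep K y == orep K x) = (y \in orb K x).
Proof.
apply/eqP/idP => [E|/orb_eq E].
  by rewrite -(orb_eq (orep_mem x)) -E orb_sym ?orep_mem.
by rewrite /orep E; case: pickP => // /(_ x); rewrite orb_refl.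
Qed.

Lemma orep_id x : orep K (orep K x) = orep K x.
Proof. by apply/eqP; rewrite orep_eq orep_mem. Qed.

Hypothesis nKP : P \subset 'N(K)%g.

Lemma orb_to u x y : u \in P -> (to u y \in orb K (to u x)) = (y \in orb K x).
Proof.
have H v a c : v \in P -> c \in orb K a -> to v c \in orb K (to v a).
  move=> vP /imsetP[k kK ->]; have kv : (k ^ v^-1)%g \in K.
    by rewrite memJ_norm // (subsetP nKP) ?groupV.
  apply/imsetP; exists (k ^ v^-1)%g => //.
  rewrite -(toM _ vP (KP kK)) -(toM _ (KP kv) vP) conjgE invgK.
  by rewrite -!mulgA mulVg mulg1.
move=> uP; apply/idP/idP => [/(H u^-1%g)|]; last exact: H.
by rewrite groupV -!toM ?groupV // mulVg !to1 => ->.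
Qed.

(** P normalises K, so u permutes the K-orbits; composing with [orep K] turns this into a
    permutation of the chosen representatives. *)
Lemma reindex_orep (M : nmodType) (F : X -> M) (Q : pred X) u : u \in P ->
    (forall x, Q (to u x) = Q x) -> (forall k x, k \in K -> Q (to k x) = Q x) ->
  \sum_(x | (orep K x == x) && Q x) F x =
  \sum_(x | (orep K x == x) && Q x) F (orep K (to u x)).
Proof.
move=> uP Qu QK.
have Qo x : Q (orep K x) = Q x by have /imsetP[k kK ->] := orep_mem x; apply: QK.
have QV x : Q (to u^-1%g x) = Q x by rewrite -Qu -toM ?groupV // mulgV to1.
have inv v w x : v \in P -> w \in P -> (v * w = 1)%g -> orep K x == x ->
    orep K (to v (orep K (to w x))) = x.
  move=> vP wP vw /eqP xE; rewrite -[RHS]xE; apply/eqP; rewrite orep_eq.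
  rewrite [X in orb K X](_ : x = to v (to w x)); last by rewrite -toM // vw to1.
  by rewrite orb_to // orep_mem.
rewrite (reindex_onto (fun x => orep K (to u x)) (fun x => orep K (to u^-1%g x))) /=.
  apply: eq_bigl => x; rewrite orep_id eqxx Qo Qu /=.
  have [/eqP xE|xE] := boolP (orep K x == x).
    by rewrite inv ?groupV ?mulVg ?xE ?eqxx ?andbT.
  rewrite andbC; case: eqP => // E; case/eqP: xE; rewrite -[in LHS]E orep_id //.
by move=> x /andP[/inv -> //]; rewrite ?groupV ?mulgV.
Qed.

(** The exponents n for which z^n preserves the K-orbit of x are multiples of p, since z^p preserves
    it and z does not. *)
Lemma orep_exp (p : nat) z x : prime p -> z \in P -> (z ^+ p)%g \in K ->
  to z x \notin orb K x ->
  injective (fun k : 'I_p => orep K (to (z ^+ k)%g x)).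
Proof.
move=> p_pr zP zpK zx.
have xpow n m : to (z ^+ n)%g x \in orb K x -> to (z ^+ (n * m))%g x \in orb K x.
  move=> nx; elim: m => [|m IHm]; first by rewrite muln0 expg0 to1 orb_refl.
  rewrite mulnS expgD toM ?groupX //; rewrite -(orb_to _ _ (groupX n zP)) in IHm.
  by rewrite -(orb_eq nx).
have zK m : to (z ^+ (p * m))%g x \in orb K x.
  by apply: xpow; apply/imsetP; exists (z ^+ p)%g.
have no k : to (z ^+ k)%g x \in orb K x -> (p %| k)%N.
  apply: contraLR => pk; apply: contra zx => kx.
  have k_gt0 : (0 < k)%N by case: k pk {kx} => //; rewrite dvdn0.
  have cop : coprime k p by rewrite coprime_sym prime_coprime.
  case: (egcdnP p k_gt0) => km kn def_kl _.
  have := xpow k km kx; rewrite mulnC def_kl (eqP cop) addnC expgD expg1 mulnC.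
  rewrite toM ?groupX //; set y := to _ x => E.
  have yz : to z y \in orb K (to z x) by rewrite orb_to // zK.
  by rewrite -(orb_eq E) (orb_eq yz) orb_refl.
suff le (k l : 'I_p) : (l <= k)%N -> orep K (to (z ^+ k)%g x) = orep K (to (z ^+ l)%g x) -> k = l.
  move=> k l E; case: (leqP l k) => [lk|/ltnW kl]; first exact: le.
  by apply/esym/le.
move=> lk /eqP; rewrite orep_eq -{1}(subnK lk) addnC expgD toM ?groupX //.
rewrite orb_to ?groupX // => /no kl; apply/val_inj/eqP; rewrite eqn_leq lk andbT.
rewrite -subn_eq0; case: posnP kl => // kl0 /(dvdn_leq kl0).
by rewrite leqNgt (leq_ltn_trans (leq_subr _ _) (ltn_ord k)).
Qed.
End Orbits.

Section Congruence.
Variables (O : comNzRingType) (lam : O) (M : lmodType O).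

Definition cg (m n : M) := exists w, m - n = lam *: w.

Lemma cg_refl m : cg m m. Proof. by exists 0; rewrite subrr scaler0. Qed.
Lemma cg_sym m n : cg m n -> cg n m.
Proof. by case=> w E; exists (- w); rewrite scalerN -E opprB. Qed.
Lemma cg_trans n m k : cg m n -> cg n k -> cg m k.
Proof. by move=> [w E] [w' E']; exists (w + w'); rewrite scalerDr -E -E' addrA subrK. Qed.
Lemma cgD m n m' n' : cg m n -> cg m' n' -> cg (m + m') (n + n').
Proof. by move=> [w E] [w' E']; exists (w + w'); rewrite scalerDr -E -E' opprD addrACA. Qed.
Lemma cgN m n : cg m n -> cg (- m) (- n).
Proof. by move=> [w E]; exists (- w); rewrite scalerN -E opprB opprK addrC. Qed.
Lemma cgB m n m' n' : cg m n -> cg m' n' -> cg (m - m') (n - n').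
Proof. by move=> h /cgN; apply: cgD. Qed.
Lemma cg_sum (I : finType) (Q : pred I) (F G : I -> M) :
  (forall i, Q i -> cg (F i) (G i)) -> cg (\sum_(i | Q i) F i) (\sum_(i | Q i) G i).
Proof.
move=> FG; apply: (big_ind2 cg) => //; first exact: cg_refl.
by move=> *; apply: cgD.
Qed.
Lemma cgZ r m n : cg m n -> cg (r *: m) (r *: n).
Proof. by move=> [w E]; exists (r *: w); rewrite -scalerBr E !scalerA mulrC. Qed.
Lemma cgZl r s m : (exists y, r - s = lam * y) -> cg (r *: m) (s *: m).
Proof. by move=> [y E]; exists (y *: m); rewrite -scalerBl E scalerA. Qed.
Lemma cg_lam m : cg (lam *: m) 0. Proof. by exists m; rewrite subr0. Qed.
Lemma cg_sub0 m n : cg m n -> cg (m - n) 0. Proof. by case=> w E; exists w; rewrite subr0. Qed.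
End Congruence.
Arguments cg {O} lam {M}.

Lemma cg_lin (O : comNzRingType) (lam : O) (M N : lmodType O) (T : {linear M -> N}) m n :
  cg lam m n -> cg lam (T m) (T n).
Proof. by case=> w E; exists (T w); rewrite -linearB E linearZ. Qed.

(** * The inductive step of rigidity: adjoining one central element *)

Section Rigidity.
Variables (O : idomainType) (p : nat) (zeta : O).
Hypotheses (p_pr : prime p) (zeta_prim : p.-primitive_root zeta).
Local Notation lam := (1 - zeta).
Variables (M : lmodType O).
Hypothesis tf : forall (r : O) (m : M), r != 0 -> r *: m = 0 -> m = 0.
Variables (gT : finGroupType) (P : {group gT}).
Hypothesis pP : (p.-group P)%g.
Variables (X : finType) (to : gT -> X -> X).
Hypothesis to1 : forall x, to 1%g x = x.
Hypothesis toM : forall u w x, u \in P -> w \in P -> to (u * w)%g x = to u (to w x).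
Variable FF : (M -> O^o) -> Prop.
Local Notation "m == n %cg" := (cg lam m n) (at level 70).

(* [S] is a pure sublattice on which K acts trivially, and [v], [f] present it modulo
   lam as a summand of a permutation module. *)
Record rdata (K : {group gT}) (act : gT -> {linear M -> M}) (S : M -> Prop)
    (v : X -> M) (f : X -> {linear M -> O^o}) : Prop := RData {
  rd_sub : (K <| P)%g;
  rd_M : forall u w m, u \in P -> w \in P -> act (u * w)%g m = act u (act w m);
  rd_1 : forall m, act 1%g m = m;
  rd_FF : forall g, FF g -> linear g /\ forall u m, u \in P -> cg lam (g (act u m)) (g m);
  rd_S0 : S 0;
  rd_SD : forall r x y, S x -> S y -> S (r *: x + y);
  rd_Sp : forall r x, r != 0 -> S (r *: x) -> S x;
  rd_Sact : forall u x, u \in P -> S x -> S (act u x);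
  rd_K : forall k m, k \in K -> S m -> act k m = m;
  rd_v : forall x, S (v x);
  rd_vP : forall u x, u \in P -> cg lam (act u (v x)) (v (to u x));
  rd_fP : forall u x m, u \in P -> S m -> cg lam (f (to u x) (act u m)) (f x m);
  rd_id : forall m, S m -> cg lam m (\sum_(x | orep to K x == x) f x m *: v x) }.

Section Step.
Variables (K : {group gT}) (act : gT -> {linear M -> M}) (S : M -> Prop).
Variables (v : X -> M) (f : X -> {linear M -> O^o}).
Hypothesis rd : rdata K act S v f.
Variable z : gT.
Hypotheses (zP : z \in P) (zK : z \notin K) (zpK : (z ^+ p)%g \in K).
Hypothesis zC : forall u, u \in P -> [~ z, u]%g \in K.

Let sKP : K \subset P. Proof. by case/andP: (rd_sub rd). Qed.
Let nKP : P \subset 'N(K)%g. Proof. by case/andP: (rd_sub rd). Qed.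
Let KP k : k \in K -> k \in P. Proof. exact: subsetP. Qed.
Let p_gt0 : (0 < p)%N := prime_gt0 p_pr.
Let SZ r x : S x -> S (r *: x).
Proof. by move=> Sx; rewrite -[_ *: _]addr0; apply: (rd_SD rd) => //; apply: (rd_S0 rd). Qed.
Let SD x y : S x -> S y -> S (x + y).
Proof. by move=> Sx Sy; rewrite -[x]scale1r; apply: (rd_SD rd). Qed.
Let SB x y : S x -> S y -> S (x - y).
Proof. by move=> Sx Sy; apply: SD => //; rewrite -scaleN1r; apply: SZ. Qed.
Let Ssum (I : finType) (Q : pred I) (F : I -> M) :
  (forall i, Q i -> S (F i)) -> S (\sum_(i | Q i) F i).
Proof. by move=> SF; elim/big_ind: _ => [|x y|i] //; [apply: (rd_S0 rd) | apply: SD | exact: SF]. Qed.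
Let lam0 : lam != 0 := lam_neq0 p_pr zeta_prim.
Let tf_inj (r : O) (m n : M) : r != 0 -> r *: m = r *: n -> m = n.
Proof.
move=> r0 E; apply/eqP; rewrite -subr_eq0; apply/eqP; apply: (tf r0).
by rewrite scalerBr E subrr.
Qed.
Let Slam m n : S m -> S n -> cg lam m n -> exists2 w, S w & m = n + lam *: w.
Proof.
move=> Sm Sn [w E]; exists w; last by rewrite -E addrC subrK.
by apply: (rd_Sp rd lam0); rewrite -E; apply: SB.
Qed.

Let actP u w m : u \in P -> w \in P -> act (u * w)%g m = act u (act w m).
Proof. exact: (rd_M rd). Qed.

Let iter_act k m : iter k (act z) m = act (z ^+ k)%g m.
Proof.
elim: k => [|k IHk]; first by rewrite expg0 (rd_1 rd).
by rewrite iterS IHk expgS actP ?groupX.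
Qed.

Let zuC u : u \in P -> exists2 c, c \in K & (z * u = u * (z * c))%g.
Proof.
move=> uP; exists [~ z, u]%g; first exact: zC.
by rewrite commgEr conjgE !mulgA mulgK mulgV mul1g.
Qed.

Let act_zC u m : u \in P -> S m -> act z (act u m) = act u (act z m).
Proof.
move=> uP Sm; have [c cK E] := zuC uP; have cP := KP cK.
transitivity (act (z * u)%g m); first by rewrite actP.
by rewrite E actP ?groupM // actP // (rd_K rd cK Sm).
Qed.

Let act_zp m : S m -> act (z ^+ p)%g m = m.
Proof. by move=> Sm; apply: (rd_K rd). Qed.

(** The points whose K-orbit is moved by z. These orbits form regular cycles of length p under z,
    which is why they can be handled by traces. *)
Definition fr x := to z x \notin orb to K x.

Let K1 := (<[z]> <*> K)%G.

Let nzK : z \in 'N(K)%g. Proof. exact: (subsetP nKP). Qed.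
Let K1E : K1 = (<[z]> * K)%g :> {set gT}.
Proof. by rewrite /= norm_joinEl // cycle_subG. Qed.

Let sKK1 : K \subset K1. Proof. exact: joing_subr. Qed.
Let zK1 : z \in K1. Proof. by rewrite (subsetP (joing_subl _ _)) ?cycle_id. Qed.
Let sK1P : K1 \subset P. Proof. by rewrite join_subG cycle_subG zP. Qed.

Lemma step_normal : (K1 <| P)%g.
Proof.
rewrite /normal sK1P /=; apply/subsetP => u uP; rewrite inE.
rewrite -genJ gen_subG conjUg subUset; apply/andP; split; last first.
  by rewrite (normP (subsetP nKP _ uP)) sub_gen ?subsetUr.
rewrite -cycleJ cycle_subG conjg_mulR groupM //.
by rewrite (subsetP sKK1) // zC.
Qed.

Let oT u x y : u \in P -> (to u y \in orb to K (to u x)) = (y \in orb to K x).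
Proof. exact: (orb_to to1 toM sKP nKP). Qed.
Let oE x y : y \in orb to K x -> orb to K y = orb to K x.
Proof. exact: (orb_eq to1 toM sKP). Qed.

Let fr_to u x : u \in P -> fr (to u x) = fr x.
Proof.
move=> uP; congr (~~ _); have [c cK E] := zuC uP; have cP := KP cK.
rewrite -toM // E toM ?groupM // oT // toM //.
have {}E : to z (to c x) \in orb to K (to z x).
  by rewrite oT //; apply/imsetP; exists c.
apply/idP/idP => h.
  by rewrite -(oE h) (oE E) orb_refl.
by rewrite -(oE h).
Qed.

Let orepP x : exists2 k, k \in K & orep to K x = to k x.
Proof. by have /imsetP[k kK ->] := orep_mem to1 K x; exists k. Qed.

Let fr_orep x : fr (orep to K x) = fr x.
Proof. by have [k kK ->] := orepP x; apply: fr_to; apply: KP. Qed.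

Let orb_K1 x : ~~ fr x -> orb to K1 x = orb to K x.
Proof.
rewrite negbK => zx; apply/setP => y; apply/imsetP/imsetP => -[k].
  rewrite K1E => /mulsgP[_ l /cycleP[n ->] lK ->] ->.
  suff /imsetP[k0 k0K ->] : to (z ^+ n * l)%g x \in orb to K x by exists k0.
  rewrite toM ?groupX ?(KP lK) //.
  have lx : to l x \in orb to K x by apply/imsetP; exists l.
  elim: n => [|n IHn]; first by rewrite expg0 to1.
  by rewrite expgS toM ?groupX // -(oE zx) oT.
by move=> kK ->; exists k; rewrite ?(subsetP sKK1 k).
Qed.

Let orep_K1 x : ~~ fr x -> orep to K1 x = orep to K x.
Proof.
move=> /orb_K1 E; rewrite /orep E; case: pickP => // /(_ x).
Qed.

Section OrbitSums.
Variable F : X -> M.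
Hypothesis FK : forall k x, k \in K -> cg lam (F (to k x)) (F x).

Let F_orep x : cg lam (F (orep to K x)) (F x).
Proof. by have [k kK ->] := orepP x; apply: FK. Qed.

Lemma orbit_sum_to u : u \in P ->
  cg lam (\sum_(x | (orep to K x == x) && fr x) F x)
     (\sum_(x | (orep to K x == x) && fr x) F (to u x)).
Proof.
move=> uP; rewrite (reindex_orep to1 toM sKP nKP F (Q := fr) uP) => [|x|k x /KP kP].
- by apply: cg_sum => x _; apply: F_orep.
- exact: fr_to.
- exact: fr_to.
Qed.

(** A K1-orbit of moved points is the union of p distinct K-orbits, translates of one another by the
    powers of z. *)
Lemma orbit_sum_K1 :
  cg lam (\sum_(x | (orep to K x == x) && fr x) F x)
     (\sum_(k < p) \sum_(x | (orep to K1 x == x) && fr x) F (to (z ^+ k)%g x)).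
Proof.
rewrite exchange_big /= (partition_big (orep to K1) (fun x => (orep to K1 x == x) && fr x)) /=.
  apply: cg_sum => x /andP[/eqP xE frx].
  have inj := orep_exp to1 toM sKP nKP p_pr zP zpK frx.
  rewrite (_ : \sum_(i | _) _ = \sum_(k < p) F (orep to K (to (z ^+ k)%g x))).
    by apply: cg_sum => k _; apply: F_orep.
  pose h k := orep to K (to (z ^+ (k : 'I_p))%g x).
  rewrite -(big_imset F (h := h) (A := predT)) => [|k l _ _ /inj //].
  apply: eq_bigl => y; apply/idP/imsetP => [/andP[/andP[/eqP yE fry] /eqP yx]|].
    have : y \in orb to K1 x by rewrite -(orep_eq to1 toM sK1P) xE yx.
    case/imsetP=> g; rewrite K1E => /mulsgP[_ l /cycleP[n ->] lK ->] yg.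
    exists (Ordinal (ltn_pmod n p_gt0)) => //; rewrite /h /= -[LHS]yE.
    apply/eqP; rewrite (orep_eq to1 toM sKP).
    have -> : y = to (z ^+ n)%g (to l x) by rewrite -toM ?groupX ?(KP lK).
    rewrite (_ : to (z ^+ n)%g _ = to (z ^+ (n %% p))%g (to ((z ^+ p) ^+ (n %/ p) * l)%g x)).
      rewrite oT ?groupX //; apply/imsetP.
      by exists ((z ^+ p) ^+ (n %/ p) * l)%g => //; rewrite groupM // groupX.
    rewrite -!toM ?groupX ?groupM ?groupX ?(KP lK) //; congr (to _ x).
    by rewrite mulgA -expgM -expgD addnC mulnC -divn_eq.
  case=> k _ ->; rewrite /h (orep_id to1 toM sKP) eqxx fr_orep fr_to ?groupX // frx /=.
  rewrite -[X in _ == X]xE (orep_eq to1 toM sK1P); apply: (subsetP (orb_sub toM sK1P _)).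
    by apply: (_ : to (z ^+ k)%g x \in orb to K1 x); apply/imsetP; exists (z ^+ k)%g; rewrite ?groupX.
  by have [l lK ->] := orepP (to (z ^+ k)%g x); apply/imsetP; exists l; rewrite ?(subsetP sKK1 l).
move=> x /andP[/eqP xE frx]; rewrite (orep_id to1 toM sK1P) eqxx /=.
have /imsetP[k kK ->] := orep_mem to1 K1 x.
by rewrite fr_to // (subsetP sK1P).
Qed.
End OrbitSums.

(** [delta] keeps one K-orbit from each cycle of moved orbits, and [Rop] is its trace over the
    powers of z. Modulo [lam], [Rop m] is the part of the expansion of m over the moved orbits and
    [Qop m] the part over the orbits fixed by z, so z fixes [Qop m] modulo [lam]. The point of this
    form is that [Rop] and [Qop] commute with z exactly on S, not only modulo [lam]. *)
Definition delta m := \sum_(x | (orep to K1 x == x) && fr x) (f x m : O) *: v x.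
Definition Rop m := \sum_(k < p) act (z ^+ k)%g (delta (act (z^-1 ^+ k)%g m)).
Definition Qop m := m - Rop m.

Let delta_lin : linear delta.
Proof.
move=> r a b; rewrite /delta scaler_sumr -big_split; apply: eq_bigr => x _.
by rewrite linearP scalerDl scalerA.
Qed.
Let deltaL : {linear M -> M} := HB.pack delta (GRing.isLinear.Build O M M *:%R delta delta_lin).
Let R_lin : linear Rop.
Proof.
move=> r a b; rewrite /Rop scaler_sumr -big_split; apply: eq_bigr => k _.
by rewrite linearP delta_lin linearP.
Qed.
Let Q_lin : linear Qop.
Proof. by move=> r a b; rewrite /Qop R_lin scalerBr opprD addrACA. Qed.
Let QL : {linear M -> M} := HB.pack Qop (GRing.isLinear.Build O M M *:%R Qop Q_lin).
Let QB a b : Qop (a - b) = Qop a - Qop b. Proof. exact: (linearB QL). Qed.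
Let QZ r a : Qop (r *: a) = r *: Qop a. Proof. exact: (linearZ_LR QL). Qed.
Let iterQ_lin n : linear (iter n Qop).
Proof. by move=> r a b; elim: n => //= n ->; apply: Q_lin. Qed.

Let iterQ0 n : iter n Qop 0 = 0.
Proof. by elim: n => //= n ->; apply: (linear0 QL). Qed.
Let iterQZ n r a : iter n Qop (r *: a) = r *: iter n Qop a.
Proof. by have := iterQ_lin n r a 0; rewrite iterQ0 !addr0. Qed.
Let iterQB n a b : iter n Qop (a - b) = iter n Qop a - iter n Qop b.
Proof. by have := iterQ_lin n (-1) b a; rewrite !scaleN1r ![- _ + _]addrC. Qed.
Let iterQ_sum n (I : finType) (F : I -> M) : iter n Qop (\sum_i F i) = \sum_i iter n Qop (F i).
Proof.
apply: (big_morph _ _ (iterQ0 n)) => a b.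
by have := iterQ_lin n 1 a b; rewrite !scale1r.
Qed.

Let S_delta m : S (delta m).
Proof. by apply: Ssum => x _; apply: SZ; apply: (rd_v rd). Qed.
Let Sact u m : u \in P -> S m -> S (act u m). Proof. exact: (rd_Sact rd). Qed.
Let S_R m : S (Rop m).
Proof. by apply: Ssum => k _; apply: Sact => //; rewrite groupX. Qed.
Let S_Q m : S m -> S (Qop m). Proof. by move=> Sm; apply: SB. Qed.
Let S_iterQ n m : S m -> S (iter n Qop m).
Proof. by move=> Sm; elim: n => //= n; apply: S_Q. Qed.

Let FU u x m : u \in P -> S m ->
  cg lam (act u ((f x m : O) *: v x)) ((f (to u x) (act u m) : O) *: v (to u x)).
Proof.
move=> uP Sm; rewrite linearZ; apply: (cg_trans (n := (f x m : O) *: v (to u x))).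
  by apply: cgZ; apply: (rd_vP rd).
by apply: cgZl; have [w E] := cg_sym (rd_fP rd x uP Sm); exists w.
Qed.

Let FK m k x : S m -> k \in K ->
  cg lam ((f (to k x) m : O) *: v (to k x)) ((f x m : O) *: v x).
Proof.
move=> Sm kK; have kP := KP kK; rewrite -[in X in cg _ X _](rd_K rd kK Sm).
apply: cg_sym; rewrite -[X in cg _ X _](rd_K rd kK); first exact: FU.
by apply: SZ; apply: (rd_v rd).
Qed.

Let Hop m := \sum_(x | (orep to K x == x) && fr x) (f x m : O) *: v x.
Let Gop m := \sum_(x | (orep to K x == x) && ~~ fr x) (f x m : O) *: v x.

Let zexpV k : (z ^+ k * z^-1 ^+ k)%g = 1%g.
Proof. by rewrite expgVn mulgV. Qed.

Let R_H m : S m -> cg lam (Rop m) (Hop m).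
Proof.
move=> Sm; apply: cg_sym; apply: cg_trans (orbit_sum_K1 _) _.
  by move=> k x kK; apply: FK.
apply: cg_sum => k _; rewrite linear_sum; apply: cg_sum => x _.
have zkP : (z ^+ k)%g \in P by rewrite groupX.
apply: cg_sym; apply: cg_trans (FU _ zkP _) _; first by apply: Sact => //; rewrite groupX ?groupV.
by rewrite -actP ?groupX ?groupV // zexpV (rd_1 rd); apply: cg_refl.
Qed.

Let Q_G m : S m -> cg lam (Qop m) (Gop m).
Proof.
move=> Sm; have := cgB (rd_id rd Sm) (R_H Sm).
by rewrite (bigID fr) /= -/(Hop m) -/(Gop m) addrAC subrr add0r.
Qed.

Let z_Q m : S m -> cg lam (act z (Qop m)) (Qop m).
Proof.
move=> Sm; apply: cg_trans (cg_lin _ (Q_G Sm)) _; apply: cg_trans (cg_sym (Q_G Sm)).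
rewrite linear_sum; apply: cg_sum => x /andP[_]; rewrite negbK => /imsetP[k kK zx].
rewrite linearZ; apply: cgZ; apply: cg_trans (rd_vP rd x zP) _.
rewrite zx; apply: cg_sym; rewrite -[X in cg _ X _](rd_K rd kK) //.
  by apply: (rd_vP rd); apply: KP.
exact: (rd_v rd).
Qed.

Let u_R u m : u \in P -> S m -> cg lam (act u (Rop m)) (Rop (act u m)).
Proof.
move=> uP Sm; have Sum : S (act u m) by apply: Sact.
apply: cg_trans (cg_lin _ (R_H Sm)) _; apply: cg_trans (cg_sym (R_H Sum)).
apply: cg_sym; apply: cg_trans (orbit_sum_to _ uP) _.
  by move=> k x kK; apply: FK.
by rewrite linear_sum; apply: cg_sum => x _; apply: cg_sym; apply: FU.
Qed.

Let z_R m : S m -> act z (Rop m) = Rop (act z m).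
Proof.
move=> Sm; rewrite linear_sum /Rop.
have pE : p = p.-1.+1 by rewrite prednK.
rewrite [in LHS]pE [in RHS]pE big_ord_recr big_ord_recl [LHS]addrC /=; congr (_ + _).
  rewrite -actP ?groupX // -expgS -pE act_zp // !expg0 !(rd_1 rd).
  congr delta; rewrite -[in LHS](act_zp Sm) -actP ?groupX ?groupV //; congr (act _ m).
  by rewrite [X in (_ * z ^+ X)%g]pE expgSr mulgA expgVn mulVg mul1g.
apply: eq_bigr => k _; rewrite -actP ?groupX // -expgS; congr (act _ (delta _)).
rewrite -actP ?groupX ?groupV //; congr (act _ m).
by rewrite /bump /= add1n expgSr mulgKV.
Qed.

Let z_iterQ n m : S m -> act z (iter n Qop m) = iter n Qop (act z m).
Proof.
move=> Sm; elim: n => //= n <-; rewrite /Qop linearB z_R //; exact: S_iterQ.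
Qed.

Let u_iterQ n u m : u \in P -> S m -> cg lam (act u (iter n Qop m)) (iter n Qop (act u m)).
Proof.
move=> uP Sm; elim: n => [|n IHn] /=; first exact: cg_refl.
apply: cg_trans (_ : cg lam _ (Qop (act u (iter n Qop m)))) _.
  by rewrite /Qop linearB; apply: cgB; [exact: cg_refl | apply: u_R; last exact: S_iterQ].
exact: (cg_lin QL IHn).
Qed.

Let cg_linf (g : M -> O^o) a b : linear g -> cg lam a b -> cg lam (g a) (g b).
Proof.
move=> gl [w E]; exists (g w); have -> : a = lam *: w + b by rewrite -E subrK.
by rewrite gl addrK.
Qed.

(** Functionals in FF do not see the action of P modulo [lam]. On a vector that z fixes modulo [lam]
    the p terms of [Rop] therefore have congruent values, and their sum is a multiple of p, hence of
    [lam]. *)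
Lemma Rop_FF g w : FF g -> S w -> cg lam (act z w) w -> cg lam (g (Rop w)) 0.
Proof.
move=> Fg Sw zw; have [gl gP] := rd_FF rd Fg.
have zVw k : cg lam (act (z^-1 ^+ k)%g w) w.
  elim: k => [|k IHk]; first by rewrite expg0 (rd_1 rd); apply: cg_refl.
  rewrite expgS actP ?groupX ?groupV //; apply: cg_trans (cg_lin _ IHk) _.
  apply: cg_sym; rewrite -{1}[w](rd_1 rd) -(mulVg z) actP ?groupV //.
  exact: cg_lin.
have g0 : g 0 = 0 by have := gl (-1) 0 0; rewrite scaler0 addr0 scaleN1r addNr.
have gsum (F : 'I_p -> M) : g (\sum_k F k) = \sum_k g (F k).
  apply: (big_morph g _ g0) => a b; have := gl 1 a b; by rewrite !scale1r.
rewrite gsum; apply: cg_trans (_ : cg lam _ (\sum_(k < p) g (delta w))) _.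
  apply: cg_sum => k _; apply: cg_trans (gP _ _ (groupX _ zP)) _.
  by apply: cg_linf => //; apply: (cg_lin deltaL).
rewrite sumr_const card_ord -scaler_nat; have [y ->] := p_dvd_lam p_pr zeta_prim.
by rewrite -scalerA; apply: cg_lam.
Qed.

Let zpr (s : seq O) m := foldr (fun a w => act z w - a *: w) m s.
Let S_zpr s m : S m -> S (zpr s m).
Proof. by move=> Sm; elim: s => //= a s IHs; apply: SB; [apply: Sact | apply: SZ]. Qed.
Let zpr_Q s m : S m -> zpr s (Qop m) = Qop (zpr s m).
Proof.
move=> Sm; elim: s => //= a s ->; have := z_iterQ 1 (S_zpr s Sm) => /= ->.
by rewrite QB QZ.
Qed.

(** z is the identity modulo [lam] on the image of [Qop], so a factor [act z - a] with a congruent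
    to 1 gains one [lam] for each application of [Qop]. Exact commutation with z allows the
    applications to be spent one at a time. *)
Lemma zpr_div s m : (forall a, a \in s -> exists y, a = 1 + lam * y) -> S m ->
  exists2 w, S w & zpr s (iter (size s) Qop m) = lam ^+ size s *: w.
Proof.
move=> s1 Sm; elim: s s1 => [|a s IHs] s1 /=; first by exists m; rewrite ?scale1r.
have [b bs|w Sw E] := IHs; first by apply: s1; rewrite inE bs orbT.
have {}E : zpr s (Qop (iter (size s) Qop m)) = lam ^+ size s *: Qop w.
  by rewrite zpr_Q ?E ?QZ //; apply: S_iterQ.
rewrite -/(zpr s (Qop (iter (size s) Qop m))) E linearZ_LR.
have [y ->] := s1 a (mem_head _ _).
have [w' Sw' zw] := Slam (Sact zP (S_Q Sw)) (S_Q Sw) (z_Q Sw).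
exists (w' - y *: Qop w); first by apply: SB => //; apply/SZ/S_Q.
rewrite zw [(1 + lam * y) *: _]scalerDl scale1r scalerDr opprD addrACA subrr add0r.
rewrite exprSr -[RHS]scalerA [in RHS]scalerBr [in RHS]scalerBr; congr (_ - _).
by rewrite !scalerA; congr (_ *: _); ring.
Qed.

Let ztr j m := \sum_(k < p) ((zeta ^+ j) ^+ p.-1 ^+ k) *: iter k (act z) m.

Let ztr_lin j : linear (ztr j).
Proof.
move=> r a b; rewrite /ztr scaler_sumr -big_split; apply: eq_bigr => k _ /=.
by rewrite !iter_act linearP scalerDr !scalerA mulrC.
Qed.

Let xiV j : zeta ^+ j * (zeta ^+ j) ^+ p.-1 = 1.
Proof.
by rewrite -exprS prednK // -exprM mulnC exprM (prim_expr_order zeta_prim) expr1n.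
Qed.

Let wV j : ((zeta ^+ j) ^+ p.-1) ^+ p.-1 = zeta ^+ j.
Proof.
rewrite -[LHS]mulr1 -(xiV j) [zeta ^+ j * _]mulrC mulrA -exprSr prednK //.
by rewrite exprAC [zeta ^+ j ^+ p]exprAC (prim_expr_order zeta_prim) !expr1n mul1r.
Qed.

Let z_ztr j m : S m -> act z (ztr j m) = zeta ^+ j *: ztr j m.
Proof.
move=> Sm; rewrite /ztr linear_sum scaler_sumr.
have pE : p = p.-1.+1 by rewrite prednK.
rewrite [in LHS]pE [in RHS]pE big_ord_recr big_ord_recl [LHS]addrC /=; congr (_ + _).
  by rewrite linearZ_LR -iterS -pE iter_act act_zp // expr0 scale1r wV.
apply: eq_bigr => k _; rewrite linearZ_LR scalerA /bump /= add1n; congr (_ *: _).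
by rewrite exprS mulrA xiV mul1r.
Qed.

(** Up to a unit, [ztr j] is a product of p - 1 factors as in [zpr_div]. They gain [lam ^+ p.-1], a
    unit multiple of p, which cancels the denominator of the spectral projection. *)
Lemma ztr_div j m : (j < p)%N -> S m ->
  exists2 w, S w & ztr j (iter p.-1 Qop m) = p%:R *: w.
Proof.
move=> jp Sm; set s := [seq zeta ^+ l | l <- rem j (iota 0 p)].
have sz : size s = p.-1 by rewrite size_map size_rem ?mem_iota // size_iota.
have [a /mapP[l _ ->]|w Sw] := @zpr_div s m _ Sm; first exact: zetaX_cong.
rewrite /zpr sz foldr_zeta // => E; have [u uu pE] := p_lam p_pr zeta_prim.
exists ((zeta ^+ j * u^-1) *: w); first exact: SZ.
rewrite scalerA (_ : p%:R * (zeta ^+ j * u^-1) = zeta ^+ j * lam ^+ p.-1); last first.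
  by rewrite pE mulrACA divrr // mulr1 mulrC.
rewrite -scalerA -E scaler_sumr; apply: eq_bigr => k _.
by rewrite scalerA exprS mulrA xiV mul1r.
Qed.

(** [Eh j] is the spectral projection of z preceded by [iter p.-1 Qop], which makes it integral, and
    followed by [iter p.-1 Qop], which makes it commute with P modulo [lam]. The sum of the [Eh j]
    is therefore a power of [Qop] and not the identity. *)
Lemma step_operators : exists Eh : nat -> M -> M, forall j, (j < p)%N ->
  [/\ forall m, S m -> S (Eh j m) /\ act z (Eh j m) = zeta ^+ j *: Eh j m,
     forall u m, u \in P -> S m -> cg lam (act u (Eh j m)) (Eh j (act u m)),
     forall r a b, S a -> S b -> Eh j (r *: a + b) = r *: Eh j a + Eh j b,
     forall m, S m -> act z m = zeta ^+ j *: m -> Eh j m = iter (p.-1 + p.-1) Qop m &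
     forall m, S m -> \sum_(i < p) Eh i m = iter (p.-1 + p.-1) Qop m].
Proof.
have p0 : p%:R != 0 :> O by apply: p_neq0 zeta_prim.
have /choice[E EP] : forall jm : nat * M, exists w, (jm.1 < p)%N -> S jm.2 ->
    S w /\ p%:R *: w = ztr jm.1 (iter p.-1 Qop jm.2).
  move=> [j m] /=; have [jp|jp] := boolP (j < p)%N; last by exists 0.
  have [Sm|nS] := pselect (S m); last by exists 0.
  by have [w Sw ->] := ztr_div jp Sm; exists w.
have ES j m : (j < p)%N -> S m -> S (E (j, m)) by move=> jp Sm; have [] := EP (j, m) jp Sm.
have EE j m : (j < p)%N -> S m -> p%:R *: E (j, m) = ztr j (iter p.-1 Qop m).
  by move=> jp Sm; have [] := EP (j, m) jp Sm.
have S_comb r a b : S a -> S b -> S (r *: a + b) by move=> Sa Sb; apply: (rd_SD rd).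
have E_lin j r a b : (j < p)%N -> S a -> S b ->
    E (j, r *: a + b) = r *: E (j, a) + E (j, b).
  move=> jp Sa Sb; apply: (tf_inj p0); rewrite (EE _ _ jp (S_comb r _ _ Sa Sb)).
  by rewrite iterQ_lin ztr_lin scalerDr scalerA mulrC -scalerA !EE.
have E0 j : (j < p)%N -> E (j, 0) = 0.
  move=> jp; have := E_lin j (-1) 0 0 jp (rd_S0 rd) (rd_S0 rd).
  by rewrite scaler0 addr0 scaleN1r addNr.
have E_bigsum j (F : 'I_p -> M) : (j < p)%N -> (forall i, S (F i)) ->
    E (j, \sum_i F i) = \sum_i E (j, F i).
  move=> jp SF; suff [] : S (\sum_i F i) /\ E (j, \sum_i F i) = \sum_i E (j, F i) by [].
  apply: (big_rec2 (fun a b => S a /\ E (j, a) = b)) => [|i b a _ [Sa Eab]].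
    by split; [apply: (rd_S0 rd) | apply: E0].
  split; first exact: SD.
  by have := E_lin j 1 _ _ jp (SF i) Sa; rewrite !scale1r Eab.
have E_z j m : (j < p)%N -> S m -> act z (E (j, m)) = zeta ^+ j *: E (j, m).
  move=> jp Sm; apply: (tf_inj p0); rewrite -linearZ_LR EE // scalerA mulrC -scalerA EE //.
  by rewrite z_ztr //; apply: S_iterQ.
have E_sum m : S m -> \sum_(j < p) E ((j : nat), m) = iter p.-1 Qop m.
  move=> Sm; apply: (tf_inj p0); rewrite scaler_sumr -(sum_zeta_trace p_pr zeta_prim (act z)).
  by apply: eq_bigr => j _; rewrite EE.
have z_iter_eig m l k : act z m = zeta ^+ l *: m -> iter k (act z) m = zeta ^+ l ^+ k *: m.
  move=> zm; elim: k => [|k IHk]; first by rewrite scale1r.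
  by rewrite iterS IHk linearZ_LR zm scalerA exprSr.
have Qeig m l n : S m -> act z m = zeta ^+ l *: m ->
    act z (iter n Qop m) = zeta ^+ l *: iter n Qop m.
  by move=> Sm zm; rewrite z_iterQ // zm iterQZ.
have ztr_eig i j m : act z m = zeta ^+ j *: m ->
    ztr i m = (\sum_(k < p) ((zeta ^+ i) ^+ p.-1 * zeta ^+ j) ^+ k) *: m.
  move=> zm; rewrite scaler_suml; apply: eq_bigr => k _.
  by rewrite (z_iter_eig _ j) // scalerA exprMn.
have E_eig j m : (j < p)%N -> S m -> act z m = zeta ^+ j *: m -> E (j, m) = iter p.-1 Qop m.
  move=> jp Sm zm; apply: (tf_inj p0); rewrite EE // (ztr_eig j j); last exact: Qeig.
  rewrite mulrC xiV; congr (_ *: _); rewrite (eq_bigr (fun=> 1)) => [|k _]; last exact: expr1n.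
  by rewrite sumr_const card_ord.
have E_neq i j m : (i < p)%N -> (j < p)%N -> i != j -> S m -> act z m = zeta ^+ j *: m -> E (i, m) = 0.
  move=> ip jp ij Sm zm; apply: (tf p0); rewrite EE // (ztr_eig i j); last exact: Qeig.
  set x := _ * _; rewrite [X in X *: _](_ : _ = 0) ?scale0r //.
  have x1 : x - 1 != 0.
    rewrite subr_eq0; apply: contra ij => /eqP xE.
    have : zeta ^+ j = zeta ^+ i by rewrite -[LHS]mul1r -(xiV i) -mulrA -/x xE mulr1.
    by move/eqP; rewrite (eq_prim_root_expr zeta_prim) !modn_small // eq_sym.
  apply: (mulfI x1); rewrite mulr0 -subrX1 /x exprMn -!exprM.
  rewrite -mulnA [(p.-1 * p)%N]mulnC mulnA [(i * p)%N]mulnC [(j * p)%N]mulnC -mulnA !exprM (prim_expr_order zeta_prim).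
  by rewrite !expr1n mulr1 subrr.
exists (fun j m => iter p.-1 Qop (E (j, m))) => j jp; split.
- move=> m Sm; split; first by apply/S_iterQ/ES.
  by apply: Qeig; rewrite ?E_z //; apply: ES.
- move=> u m uP Sm; have Sum : S (act u m) by apply: Sact.
  (* The defects [w i] lie in distinct eigenspaces of z. Their sum is divisible by [lam], because
     the sum of the [E i] is [iter p.-1 Qop], which commutes with P modulo [lam]. Applying [E j] to
     the sum isolates [iter p.-1 Qop] of the j-th defect. *)
  pose w (i : 'I_p) := act u (E ((i : nat), m)) - E ((i : nat), act u m).
  have Sw i : S (w i) by apply: SB; [apply: Sact => //|]; apply: ES.
  have zw i : act z (w i) = zeta ^+ i *: w i.
    rewrite linearB E_z // (act_zC uP) ?E_z //; last exact: ES.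
    by rewrite linearZ_LR scalerBr.
  have [y Sy wE] : exists2 y, S y & \sum_(i < p) w i = lam *: y.
    have Sl : S (act u (iter p.-1 Qop m)) by apply/Sact/S_iterQ.
    have [y Sy yE] := Slam Sl (S_iterQ _ Sum) (u_iterQ p.-1 uP Sm).
    exists y => //; rewrite sumrB E_sum // -linear_sum E_sum // yE.
    by rewrite addrAC subrr add0r.
  have Qw : iter p.-1 Qop (w (Ordinal jp)) = lam *: E (j, y).
    have -> : iter p.-1 Qop (w (Ordinal jp)) = E (j, \sum_(i < p) w i).
      rewrite E_bigsum // (bigD1 (Ordinal jp)) //= big1 ?addr0 => [|i ij].
        by rewrite E_eig // zw.
      apply: (E_neq _ i) => //; rewrite ?zw //.
      by apply: contra ij => /eqP ij; apply/eqP/val_inj.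
    by rewrite wE; have := E_lin j lam y 0 jp Sy (rd_S0 rd); rewrite E0 // !addr0.
  apply: cg_trans (u_iterQ _ uP (ES _ _ jp Sm)) _.
  by exists (E (j, y)); rewrite -Qw /w iterQB.
- by move=> r a b Sa Sb; rewrite E_lin // iterQ_lin.
- by move=> m Sm zm; rewrite E_eig // iterD.
- by move=> m Sm; rewrite iterD -[iter p.-1 Qop m]E_sum // iterQ_sum.
Qed.

(** On such a vector [Rop w] is congruent to the sum of the translates of [delta w] by the powers of
    z. [Qop] sends these to congruent vectors, so the sum becomes a multiple of p. *)
Lemma Qop_idem w : S w -> cg lam (act z w) w -> cg lam (Qop (Qop w)) (Qop w).
Proof.
move=> Sw zw.
have zk k : cg lam (act (z ^+ k)%g w) w.
  elim: k => [|k IHk]; first by rewrite expg0 (rd_1 rd); apply: cg_refl.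
  by rewrite expgS actP ?groupX //; apply: cg_trans (cg_lin _ IHk) _.
have zVw k : cg lam (act (z^-1 ^+ k)%g w) w.
  apply: cg_sym; rewrite -[w in cg _ w _](rd_1 rd) -(mulVg (z ^+ k)%g) -expgVn actP ?groupX ?groupV //.
  exact: cg_lin.
suff : cg lam (Qop (Rop w)) 0.
  move=> QR; rewrite -{2}[Qop w]subr0 {2}/Qop QB; apply: cgB QR; exact: cg_refl.
have Sd := S_delta w.
apply: cg_trans (_ : cg lam _ (Qop (\sum_(k < p) act (z ^+ k)%g (delta w)))) _.
  apply: (cg_lin QL); apply: cg_sum => k _; apply: cg_lin; exact: (cg_lin deltaL).
rewrite -/(iter 1 Qop _) iterQ_sum /=.
apply: cg_trans (_ : cg lam _ (\sum_(k < p) Qop (delta w))) _.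
  apply: cg_sum => k _; rewrite -iter_act; elim: (k : nat) => [|n IHn]; first exact: cg_refl.
  rewrite iterS; have := z_iterQ 1 (_ : S (iter n (act z) (delta w))) => /= <-; last first.
    by rewrite iter_act; apply: Sact; rewrite ?groupX.
  by apply: cg_trans (cg_lin _ IHn) _; apply: z_Q.
rewrite sumr_const card_ord -scaler_nat; have [y ->] := p_dvd_lam p_pr zeta_prim.
by rewrite -scalerA; apply: cg_lam.
Qed.

(** The difference telescopes into terms [Rop] of an iterate of [Qop], each killed modulo [lam] by
    FF. *)
Lemma sub_iterQ (D : M -> Prop) n m : (forall a b, D a -> D b -> D (a + b)) ->
  (forall a, (forall g, FF g -> cg lam (g a) 0) -> D a) ->
  S m -> cg lam (act z m) m -> D (m - iter n Qop m).
Proof.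
move=> DD DN Sm zm; elim: n => [|n IHn].
  apply: DN => g Fg; have [gl _] := rd_FF rd Fg; rewrite subrr.
  by have := gl (-1) 0 0; rewrite scaler0 addr0 scaleN1r addNr => ->; apply: cg_refl.
rewrite iterS {2}/Qop opprB addrA addrAC; apply: (DD) => //.
apply: DN => g Fg; apply: Rop_FF => //; first exact: S_iterQ.
rewrite z_iterQ //; elim: n {IHn} => [|n IHn] //=.
exact: (cg_lin QL IHn).
Qed.

Section Data.
Variables (j : nat) (Eh : M -> M) (theta : gT -> O).
Hypothesis EhS : forall m, S m -> S (Eh m) /\ act z (Eh m) = zeta ^+ j *: Eh m.
Hypothesis EhP : forall u m, u \in P -> S m -> cg lam (act u (Eh m)) (Eh (act u m)).
Hypothesis EhL : forall r a b, S a -> S b -> Eh (r *: a + b) = r *: Eh a + Eh b.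
Hypothesis EhE : forall m, S m -> act z m = zeta ^+ j *: m -> Eh m = iter (p.-1 + p.-1) Qop m.
Hypothesis thM : forall u w, u \in P -> w \in P -> theta (u * w)%g = theta u * theta w.
Hypothesis thp : forall u, u \in P -> theta u ^+ p = 1.
Hypothesis thK : forall u, u \in K -> theta u = 1.
Hypothesis thz : theta z = zeta ^+ j.

Let c u := theta u ^+ p.-1.
Let c1 u : u \in P -> exists y, c u = 1 + lam * y.
Proof.
move=> uP; have [l ->] : exists l, c u = zeta ^+ l.
  by apply: (zeta_exp_eq1 zeta_prim); rewrite /c exprAC thp // expr1n.
exact: zetaX_cong.
Qed.
Let cg_c u (m : M) : u \in P -> cg lam (c u *: m) m.
Proof.
move=> /c1[y ->]; exists (y *: m).
by rewrite scalerDl scale1r addrC addKr scalerA.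
Qed.
Let act'_lin u : linear (fun m => c u *: act u m).
Proof. by move=> r a b; rewrite linearP scalerDr !scalerA mulrC. Qed.
Let act' u : {linear M -> M} :=
  HB.pack (fun m => c u *: act u m) (GRing.isLinear.Build O M M *:%R _ (act'_lin u)).
Let Sj m := S m /\ act z m = zeta ^+ j *: m.
Let v' x := if fr x then ztr j (v x) else Eh (v x).

Let S_ztr m : S m -> S (ztr j m).
Proof.
by move=> Sm; apply: Ssum => k _; apply: SZ; rewrite iter_act; apply: Sact; rewrite ?groupX.
Qed.
Let Sv x : S (v x). Proof. exact: (rd_v rd). Qed.

Lemma Eh_cg a b : S a -> S b -> cg lam a b -> cg lam (Eh a) (Eh b).
Proof.
move=> Sa Sb ab; have [w Sw ->] := Slam Sa Sb ab.
by exists (Eh w); rewrite [b + _]addrC EhL // addrK.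
Qed.

Let Eh_sum (I : finType) (Q : pred I) (r : I -> O) (F : I -> M) : (forall i, S (F i)) ->
  Eh (\sum_(i | Q i) r i *: F i) = \sum_(i | Q i) r i *: Eh (F i).
Proof.
move=> SF; have S0 := rd_S0 rd.
have E0 : Eh 0 = 0.
  by have := EhL (-1) S0 S0; rewrite scaler0 addr0 scaleN1r addNr.
suff [] : S (\sum_(i | Q i) r i *: F i) /\
  Eh (\sum_(i | Q i) r i *: F i) = \sum_(i | Q i) r i *: Eh (F i) by [].
apply: (big_rec2 (fun a b => S a /\ Eh a = b)) => [//|i b a _ [Sa Eab]].
by split; [apply/SD => //; apply: SZ | rewrite EhL // Eab].
Qed.

Let Sj_cg m : Sj m -> cg lam (act z m) m.
Proof.
case=> _ ->; have [y ->] := zetaX_cong zeta j; exists (y *: m).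
by rewrite scalerDl scale1r addrC addKr scalerA.
Qed.

Let R_fr m : Sj m ->
  \sum_(x | (orep to K1 x == x) && fr x) (f x m : O) *: ztr j (v x) = Rop m.
Proof.
case=> Sm zm.
have zV k : act (z^-1 ^+ k)%g m = (zeta ^+ j) ^+ p.-1 ^+ k *: m.
  elim: k => [|k IHk]; first by rewrite expg0 (rd_1 rd) scale1r.
  rewrite expgS actP ?groupX ?groupV // IHk linearZ_LR exprSr -scalerA; congr (_ *: _).
  rewrite -[m in LHS]scale1r -[1](xiV j) mulrC -scalerA -zm linearZ_LR.
  by rewrite -actP ?groupV // mulVg (rd_1 rd).
have dZ r a : delta (r *: a) = r *: delta a := linearZ_LR deltaL r a.
rewrite /Rop; under [RHS]eq_bigr => k _ do rewrite zV dZ linearZ_LR linear_sum.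
under [RHS]eq_bigr => k _ do rewrite scaler_sumr.
rewrite exchange_big /=; apply: eq_bigr => x _; rewrite /ztr scaler_sumr.
by apply: eq_bigr => k _; rewrite iter_act [in RHS]linearZ_LR !scalerA; congr (_ *: _); rewrite mulrC.
Qed.

(** Dividing the action by theta makes z, hence K1, act trivially on the eigenspace of [zeta ^+ j],
    and changes nothing modulo [lam]. The new generators are [ztr j (v x)], a trace over z, on moved
    orbits and [Eh (v x)] on fixed ones; the coordinates f are kept. *)
Lemma step_data : exists (act2 : gT -> {linear M -> M}) (v2 : X -> M),
  (forall u m, act2 u m = theta u ^+ p.-1 *: act u m) /\
  rdata K1 act2 (fun m => S m /\ act z m = zeta ^+ j *: m) v2 f.
Proof.
exists act', v'; split=> //.
have act'E u m : act' u m = c u *: act u m by [].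
have act'_cg u m : u \in P -> cg lam (act' u m) (act u m) by move=> uP; apply: cg_c.
split.
- exact: step_normal.
- move=> u w m uP wP; rewrite !act'E linearZ_LR actP // scalerA /c thM // exprMn.
  by [].
- by move=> m; rewrite act'E (rd_1 rd) /c thK ?group1 // expr1n scale1r.
- move=> g Fg; have [gl gP] := rd_FF rd Fg; split=> // u m uP.
  by apply: cg_trans (gP u m uP); apply: cg_linf => //; apply: act'_cg.
- by split; rewrite ?linear0 ?scaler0 //; apply: (rd_S0 rd).
- move=> r x y [Sx zx] [Sy zy]; split; first exact: (rd_SD rd).
  by rewrite linearP zx zy scalerDr !scalerA mulrC.
- move=> r x r0 [Srx zrx]; split; first exact: (rd_Sp rd r0).
  by apply: (tf_inj r0); rewrite -linearZ_LR zrx !scalerA mulrC.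
- move=> u x uP [Sx zx]; split; rewrite act'E; first by apply/SZ/Sact.
  by rewrite linearZ_LR (act_zC uP) // zx linearZ_LR !scalerA mulrC.
- move=> k m kK1 [Sm zm]; move: kK1; rewrite K1E => /mulsgP[_ l /cycleP[n ->] lK ->].
  have lP := KP lK; have znP : (z ^+ n)%g \in P by rewrite groupX.
  rewrite act'E actP // (rd_K rd lK) // /c thM // (thK lK) mulr1.
  have -> : theta (z ^+ n)%g = theta z ^+ n.
    elim: n {znP} => [|n IHn]; first by rewrite expg0 thK ?group1.
    by rewrite expgS thM ?groupX // IHn exprS.
  have -> : act (z ^+ n)%g m = (zeta ^+ j) ^+ n *: m.
    elim: n {znP} => [|n IHn]; first by rewrite expg0 (rd_1 rd) scale1r.
    by rewrite expgS actP ?groupX // IHn linearZ_LR zm scalerA exprSr.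
  by rewrite thz scalerA exprAC -exprMn mulrC xiV expr1n scale1r.
- move=> x; rewrite /v'; case: ifP => _; last exact: EhS.
  by split; [apply: S_ztr | apply: z_ztr].
- move=> u x uP; apply: cg_trans (act'_cg _ _ uP) _; rewrite /v' fr_to //; case: ifP => _.
    rewrite (_ : act u (ztr j (v x)) = ztr j (act u (v x))).
      by have := cg_lin (HB.pack (ztr j) (GRing.isLinear.Build O M M *:%R _ (ztr_lin j)) : {linear M -> M}) (rd_vP rd x uP).
    rewrite /ztr linear_sum; apply: eq_bigr => k _; rewrite linearZ_LR; congr (_ *: _).
    elim: (k : nat) => //= n <-; rewrite act_zC //.
    by rewrite iter_act; apply: Sact; rewrite ?groupX.
  apply: cg_trans (EhP uP (Sv x)) _; apply: Eh_cg => //; first exact: Sact.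
  exact: (rd_vP rd).
- move=> u x m uP [Sm _]; rewrite act'E linearZ_LR.
  apply: cg_trans (rd_fP rd x uP Sm); have [y ->] := c1 uP.
  exists (y * f (to u x) (act u m)); rewrite /= -[_ *: _]/((1 + lam * y) * _) mulrDl mul1r.
  by rewrite addrC addKr -mulrA.
- move=> m Sjm; have [Sm zm] := Sjm; rewrite (bigID fr) /=.
  rewrite (eq_bigr (fun x => (f x m : O) *: ztr j (v x))) => [|x /andP[_ frx]]; last by rewrite /v' frx.
  rewrite R_fr // (eq_bigr (fun x => (f x m : O) *: Eh (v x))) => [|x /andP[_ frx]]; last first.
    by rewrite /v' (negbTE frx).
  rewrite (eq_bigl (fun x => (orep to K x == x) && ~~ fr x)) => [|x]; last first.
    by case frx: (fr x); rewrite ?andbF // (orep_K1 (negbT frx)).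
  rewrite -Eh_sum // -/(Gop m).
  (* The moved orbits give [Rop m] exactly. The fixed ones give [Eh (Gop m)], congruent to
     [Eh (Qop m)]; on this eigenvector [Eh] is a power of [Qop], so [Qop_idem] returns [Qop m]. *)
  apply: (cg_trans (n := Rop m + Qop m)).
    by rewrite /Qop [Rop m + _]addrC subrK; apply: cg_refl.
  apply: cgD; first exact: cg_refl.
  have SG : S (Gop m) by apply: Ssum => x _; apply: SZ.
  apply: cg_sym; apply: cg_trans (Eh_cg SG (S_Q Sm) (cg_sym (Q_G Sm))) _.
  rewrite EhE; [|exact: S_Q|]; last by have := z_iterQ 1 Sm; rewrite /= zm QZ.
  elim: (p.-1 + p.-1)%N => [|n IHn]; first exact: cg_refl.
  rewrite iterS; apply: cg_trans (_ : cg lam _ (Qop (Qop m))) _; first exact: (cg_lin QL IHn).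
  by apply: Qop_idem => //; apply: Sj_cg.
Qed.
End Data.
End Step.

Definition pchar_on (chi : gT -> O) :=
  (forall u w, u \in P -> w \in P -> chi (u * w)%g = chi u * chi w) /\
  (forall u, u \in P -> chi u ^+ p = 1).

Section HomModLam.
Variable a : gT -> O^o.
Hypothesis aM : forall u w, u \in P -> w \in P -> cg lam (a (u * w)%g) (a u + a w).

Let a1 : cg lam (a 1%g) 0.
Proof.
have /cg_sym[w E] := aM (group1 P) (group1 P); exists w.
by rewrite -E mulg1 addrK subr0.
Qed.

Let aV u : u \in P -> cg lam (a u^-1%g) (- a u).
Proof.
move=> uP; have uV : u^-1%g \in P by rewrite groupV.
rewrite -[X in cg _ X _](addrK (a u)) -[X in cg _ _ X]add0r; apply: cgB (cg_refl _ _).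
by apply: cg_trans a1; rewrite -(mulVg u); apply/cg_sym/aM.
Qed.

(** a is a homomorphism from P to O / [lam]. Its kernel contains all p-th powers, because [lam]
    divides p, and all commutators, so [exists_character] applies to it. *)
Lemma exists_char_sep z : z \in P -> ~ cg lam (a z) 0 ->
  exists chi, [/\ pchar_on chi, forall u, u \in P -> cg lam (a u) 0 -> chi u = 1 & chi z = zeta].
Proof.
move=> zP az; pose H := [set u in P | `[< cg lam (a u) 0 >]].
have HE u : u \in P -> cg lam (a u) 0 -> u \in H.
  by move=> uP au; rewrite inE uP; apply/asboolP.
have gH : group_set H.
  apply/group_setP; split=> [|u w]; first by apply: HE.
  rewrite !inE => /andP[uP /asboolP au] /andP[wP /asboolP aw].
  apply/andP; split; rewrite ?groupM //; apply/asboolP.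
  by apply: cg_trans (aM uP wP) _; rewrite -[0](addr0 0); apply: cgD.
have [|||||chi [chM chp ch1 chz]] := exists_character p_pr zeta_prim (H := Group gH) (P := P) (z := z).
- by apply/subsetP => u; rewrite inE => /andP[].
- exact: zP.
- by rewrite inE zP; apply/asboolP.
- move=> u uP; apply: HE; rewrite ?groupX //.
  have aX n : cg lam (a (u ^+ n)%g) (n%:R *: a u).
    elim: n => [|n IHn]; first by rewrite expg0 scale0r.
    rewrite expgS -natr1 [n%:R + 1]addrC scalerDl scale1r; apply: cg_trans (aM uP (groupX n uP)) _.
    by apply: cgD => //; apply: cg_refl.
  apply: cg_trans (aX p) _; have [y ->] := p_dvd_lam p_pr zeta_prim.
  by rewrite -scalerA; apply: cg_lam.
- move=> u w uP wP; have [uV wV] : u^-1%g \in P /\ w^-1%g \in P by rewrite !groupV.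
  apply: HE; rewrite ?groupR //; rewrite commgEl conjgE.
  apply: cg_trans (aM uV _) _; first by rewrite !groupM.
  rewrite (_ : 0 = - a u + (- a w + (a u + a w))); last first.
    by rewrite [a u + a w]addrC addKr addNr.
  apply: cgD; first exact: aV.
  apply: cg_trans (aM wV (groupM uP wP)) _; apply: cgD; first exact: aV.
  exact: aM.
by exists chi; split=> // u uP au; apply: ch1; apply: HE.
Qed.
End HomModLam.

(* Induction on P/K. An element z of order p in the centre of P/K splits S into
   approximate eigenspaces; twisting by a character sending z to the eigenvalue makes
   z act trivially, and when there is no such character every fixed vector of the
   eigenspace is killed modulo lam by the functionals in FF. *)
Lemma rigidity_rec (D : M -> Prop) : (forall a b, D a -> D b -> D (a + b)) ->
  (forall a, (forall g, FF g -> cg lam (g a) 0) -> D a) ->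
  forall n (K : {group gT}) act S v f, (#|P| - #|K| <= n)%N -> rdata K act S v f ->
  (forall chi m, pchar_on chi -> S m -> (forall u, u \in P -> act u m = chi u *: m) -> D m) ->
  forall m, S m -> (forall u, u \in P -> cg lam (act u m) m) -> D m.
Proof.
move=> DD DN; elim=> [|n IHn] K act S v f PK rd Deig m Sm mP.
  have nKP := rd_sub rd; have sKP := normal_sub nKP.
  have KE : K = P.
    by apply/eqP; rewrite -val_eqE eqEcard sKP /= -subn_eq0 -leqn0.
  apply: (Deig (fun=> 1)) => //; first by split=> *; rewrite ?mulr1 ?expr1n.
  by move=> u uP; rewrite scale1r (rd_K rd) // KE.
have nKP := rd_sub rd; have sKP := normal_sub nKP.
have [KE|KP] := eqVneq (K : {set gT}) P.
  apply: (Deig (fun=> 1)) => //; first by split=> *; rewrite ?mulr1 ?expr1n.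
  by move=> u uP; rewrite scale1r (rd_K rd) // KE.
have [z [zP zK zpK zC]] := chief_step p_pr pP nKP KP.
have [Eh EhP] := step_operators rd zP zpK zC.
have p_gt0 := prime_gt0 p_pr.
have D0 : D 0.
  apply: DN => g Fg; have [gl _] := rd_FF rd Fg.
  by have := gl (-1) 0 0; rewrite scaler0 addr0 scaleN1r addNr => ->; apply: cg_refl.
have [_ _ _ _ /(_ m Sm) Esum] := EhP 0%N p_gt0.
(* The difference between m and the sum of the [Eh j m] lies in D by [sub_iterQ]. Each component
   [Eh j m] is again fixed by P modulo [lam] and is treated separately. *)
rewrite -[m](subrK (iter (p.-1 + p.-1) (Qop K act v f z) m)); apply: (DD).
  by apply: (sub_iterQ rd) => //; apply: mP.
rewrite -Esum; elim/big_ind: _ => // j _.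
have jp := ltn_ord j; have [ES EP EL EE _] := EhP j jp.
set w := Eh j m; have [Sw zw] := ES m Sm.
have wP u : u \in P -> cg lam (act u w) w.
  move=> uP; apply: cg_trans (EP u m uP Sm) _.
  by apply: (Eh_cg rd EL) => //; [apply: (rd_Sact rd) | apply: mP].
have [[theta [[thM thp] thK thz]]|noth] :=
  pselect (exists theta, [/\ pchar_on theta, forall u, u \in K -> theta u = 1 & theta z = zeta ^+ j]).
  have [act2 [v2 [act2E rd2]]] := step_data rd zP zpK zC ES EP EL EE thM thp thK thz.
  have thc u : u \in P -> theta u ^+ p.-1 * theta u = 1.
    by move=> uP; rewrite -exprSr prednK // thp.
  apply: (IHn _ act2 _ v2 f _ rd2) => //.
  - rewrite -ltnS (leq_trans _ PK) // ltn_sub2l //.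
      by rewrite proper_card // properEneq KP.
    rewrite proper_card // properE joing_subr; apply: contra zK => /subsetP; apply.
    by rewrite (subsetP (joing_subl _ _)) ?cycle_id.
  - move=> chi m2 [chM chp] [Sm2 _] m2E; apply: (Deig (fun u => theta u * chi u)) => //.
      split=> [u1 u2 u1P u2P|u uP]; first by rewrite thM // chM // mulrACA.
      by rewrite exprMn thp // chp // mulr1.
    move=> u uP; rewrite -scalerA -m2E // act2E scalerA mulrC thc // scale1r //.
  - move=> u uP; rewrite act2E; apply: cg_trans (_ : cg lam _ (act u w)) (wP u uP).
    have [l ->] : exists l, theta u ^+ p.-1 = zeta ^+ l.
      by apply: (zeta_exp_eq1 zeta_prim); rewrite exprAC thp // expr1n.
    have [y ->] := zetaX_cong zeta l; exists (y *: act u w).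
    by rewrite scalerDl scale1r addrC addKr scalerA.
(* Without a suitable character: [g (act u w) - g w] divided by [lam] defines a homomorphism a from
   P to O / [lam], trivial on K. If [a z] were nonzero, a power of the character given by
   [exists_char_sep] would contradict the assumption. So [a z] vanishes; but it is a unit times
   [g w], because [1 - zeta ^+ j] is [lam] times a unit, the case j = 0 being excluded by the
   trivial character. *)
apply: DN => g Fg; have [gl gP] := rd_FF rd Fg.
have gcg b c : cg lam b c -> exists2 y, b = lam *: y + c & g b = lam *: g y + g c.
  by case=> y E; have bE : b = lam *: y + c by [rewrite -E subrK]; exists y; rewrite // bE gl.
have /choice[a aE] : forall u, exists t : O^o, u \in P -> g (act u w) = lam *: t + g w.
  move=> u; have [uP|uP] := boolP (u \in P); last by exists 0.
  by have [y _ E] := gcg _ _ (wP u uP); exists (g y).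
have lam0 := lam_neq0 p_pr zeta_prim.
have lamI (x y : O^o) : lam *: x = lam *: y -> x = y by apply: (mulfI lam0).
have aM u1 u2 : u1 \in P -> u2 \in P -> cg lam (a (u1 * u2)%g) (a u1 + a u2).
  move=> u1P u2P; have [y yE yg] := gcg _ _ (wP u2 u2P).
  have -> : a u2 = g y by apply/lamI/(addIr (g w)); rewrite -aE // yg.
  have -> : a (u1 * u2)%g = g (act u1 y) + a u1.
    apply: lamI; apply: (addIr (g w)).
    by rewrite -aE ?groupM // (rd_M rd) // yE linearP gl aE // scalerDr addrA.
  have [t tE] := gP u1 y u1P; exists t; rewrite -tE.
  by rewrite opprD addrA addrK.
have [az|az] := pselect (cg lam (a z) 0); last first.
  have [chi [[chM chp] chK chz]] := exists_char_sep aM zP az; case: noth.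
  exists (fun u => chi u ^+ j); split.
  - split=> [u1 u2 u1P u2P|u uP]; first by rewrite chM // exprMn.
    by rewrite exprAC chp // expr1n.
  - move=> u uK; have uP := subsetP sKP u uK; rewrite chK ?expr1n //.
    have -> : a u = 0; last exact: cg_refl.
    by apply/lamI/(addIr (g w)); rewrite -aE // scaler0 add0r (rd_K rd).
  - by rewrite chz.
have [j0|j0] := posnP j.
  case: noth; exists (fun=> 1); split=> //; last by rewrite j0.
  by split=> *; rewrite ?mulr1 ?expr1n.
have [u uu uE] : exists2 u, u \is a GRing.unit & 1 - zeta ^+ j = lam * u.
  by apply: one_sub_zetaX zeta_prim _ _; rewrite ?gtnNdvd.
have [y /= yE] := az; rewrite subr0 in yE.
pose gw : O := g w; pose az' : O := a z.
have g0 : g 0 = 0 by have := gl (-1) 0 0; rewrite scaler0 addr0 scaleN1r addNr.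
have E1 : zeta ^+ j * gw = lam * az' + gw.
  by have := aE z zP; rewrite zw -[_ *: w]addr0 gl g0 addr0.
have E : gw * - u = az'.
  apply: (mulfI lam0); rewrite mulrCA mulrN -uE.
  by rewrite -[RHS](addrK gw) -E1; ring.
exists (- u^-1 * y); rewrite subr0.
have -> : g w = az' * - u^-1 by rewrite -E !mulrN mulNr opprK mulrK.
rewrite /az' yE -[_ *: y]/(lam * (y : O)) -[RHS]/(lam * (- u^-1 * (y : O))).
by ring.
Qed.
End Rigidity.

(** * Transfer of automorphisms through a stable equivalence *)

Section TensorTools.
Variables (O : comNzRingType) (A B C : algType O).
Variables (M : bimodType A B) (N : bimodType B C).

Lemma tens_ind (Q : tensor M N -> Prop) : Q 0 ->
  (forall x y, Q x -> Q y -> Q (x + y)) -> (forall m n, Q (tens m n)) -> forall x, Q x.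
Proof. by move=> Q0 QD Qt x; rewrite [x]tensor_span; elim/big_ind: _. Qed.

Lemma morphD0 (V Z : zmodType) (f : V -> Z) : {morph f : x y / x + y} -> f 0 = 0.
Proof. by move=> fD; apply: (addrI (f 0)); rewrite -fD !addr0. Qed.

Lemma tens_ext (Z : zmodType) (f g : tensor M N -> Z) :
  {morph f : x y / x + y} -> {morph g : x y / x + y} ->
  (forall m n, f (tens m n) = g (tens m n)) -> f =1 g.
Proof.
move=> fD gD fg; apply: tens_ind => [|x y|//]; first by rewrite !morphD0.
by rewrite fD gD => -> ->.
Qed.

Lemma tmapDE (Z : zmodType) (f : M -> N -> Z) : balanced f ->
  {morph tmap f : x y / x + y}.
Proof. by move=> bf x y; apply: tmapD. Qed.

Lemma tmap_tens (Z : zmodType) (f : M -> N -> Z) m n : balanced f ->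
  tmap f (tens m n) = f m n.
Proof. by move=> bf; rewrite /tens tmap_class // /teval big_seq1. Qed.

Lemma tensDl (n : N) : {morph (fun m : M => tens m n) : m m' / m + m'}.
Proof. by case: (tens_balanced M N) => h _ _; apply: h. Qed.
Lemma tensDr (m : M) : {morph (fun n : N => tens m n) : n n' / n + n'}.
Proof. by case: (tens_balanced M N) => _ h _; apply: h. Qed.
Lemma tens_bal (m : M) b (n : N) : tens (m *| b) n = tens m (b *: n).
Proof. by case: (tens_balanced M N) => _ _; apply. Qed.

Lemma tensZ a (m : M) (n : N) : a *: tens m n = tens (a *: m) n.
Proof.
apply: tensor_eq => Z f bf; rewrite -[_ *: _]/(tensor_scale a (tens m n)).
by rewrite tmapZ // !tmap_tens //; apply: balanced_scale.
Qed.
Lemma tensR (m : M) (n : N) c : tens m n *| c = tens m (n *| c).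
Proof.
apply: tensor_eq => Z f bf; rewrite -[_ *| _]/(tensor_ract (tens m n) c).
by rewrite tmapR // !tmap_tens //; apply: balanced_ract.
Qed.
Lemma tmapZE (Z : zmodType) (f : M -> N -> Z) a x : balanced f ->
  tmap f (a *: x) = tmap (fun m n => f (a *: m) n) x.
Proof. by move=> bf; rewrite -[_ *: _]/(tensor_scale a x) tmapZ. Qed.
Lemma tmapRE (Z : zmodType) (f : M -> N -> Z) x c : balanced f ->
  tmap f (x *| c) = tmap (fun m n => f m (n *| c)) x.
Proof. by move=> bf; rewrite -[_ *| _]/(tensor_ract x c) tmapR. Qed.

Lemma tmap_comp (Z Z' : zmodType) (g : Z -> Z') (f : M -> N -> Z) x :
  {morph g : x y / x + y} -> g (tmap f x) = tmap (fun m n => g (f m n)) x.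
Proof. by move=> gD; rewrite /tmap /teval (big_morph g gD (morphD0 gD)). Qed.

Lemma eq_tmap (Z : zmodType) (f g : M -> N -> Z) x :
  (forall m n, f m n = g m n) -> tmap f x = tmap g x.
Proof. by move=> fg; apply: eq_bigr => z _; apply: fg. Qed.

End TensorTools.

Section Scalars.
Variables (O : comNzRingType) (B : algType O).

(** Makes O itself an algebra over O, so that [bimod_res] can reduce one of the two actions on a
    bimodule to the action of O. *)
Definition in_scal (r : O^o) : B := (r : O)%:A.
Fact in_scal_zmod : zmod_morphism in_scal.
Proof. by move=> r s; apply: scalerBl. Qed.
Fact in_scal_monoid : monoid_morphism in_scal.
Proof. by split=> [|r s]; rewrite /in_scal ?scale1r // mulr_algl scalerA. Qed.
Fact in_scal_scalable : scalable in_scal.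
Proof. by move=> r s; rewrite /in_scal scalerA. Qed.
HB.instance Definition _ := GRing.isZmodMorphism.Build O^o B in_scal in_scal_zmod.
HB.instance Definition _ := GRing.isMonoidMorphism.Build O^o B in_scal in_scal_monoid.
HB.instance Definition _ := GRing.isScalable.Build O O^o B *:%R in_scal in_scal_scalable.

Lemma algAct (V : lmodType B) (r s : O) (v : V) : r%:A *: (s%:A *: v) = (r * s)%:A *: v.
Proof. by rewrite scalerA mulr_algl scalerA. Qed.

Lemma algZA (V : lmodType B) (r : O) (b : B) (v : V) : r%:A *: (b *: v) = (r *: b) *: v.
Proof. by rewrite scalerA mulr_algl. Qed.

Lemma algZC (V : lmodType B) (r : O) (b : B) (v : V) : r%:A *: (b *: v) = b *: (r%:A *: v).
Proof. by rewrite !scalerA mulr_algl mulr_algr. Qed.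

End Scalars.

(* For a block b of a group algebra, gam g = b g and t is the coefficient at 1. *)
Record group_spanned (O : comNzRingType) (B : algType O) (gT : finGroupType)
    (gam : gT -> B) (t : B -> O) : Prop := GroupSpanned {
  gs_1 : gam 1%g = 1;
  gs_M : forall x y, gam (x * y)%g = gam x * gam y;
  gs_t : forall r a b, t (r *: a + b) = r * t a + t b;
  gs_span : forall a, a = \sum_g t (gam g^-1%g * a) *: gam g;
  gs_spanr : forall a, a = \sum_g t (a * gam g^-1%g) *: gam g }.

(** * Higman's criterion for projective bimodules *)

Section Higman.
Variables (O : comNzRingType) (B : algType O) (gT : finGroupType).
Variables (gam : gT -> B) (t : B -> O).
Hypothesis gs : group_spanned gam t.

Lemma gs_tD : {morph t : a b / a + b}.
Proof. by move=> a b; rewrite -[a]scale1r (gs_t gs) mul1r scale1r. Qed.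
Lemma gs_t0 : t 0 = 0. Proof. exact: (morphD0 gs_tD). Qed.
Lemma gs_tZ r a : t (r *: a) = r * t a.
Proof. by rewrite -[r *: a]addr0 (gs_t gs) gs_t0 addr0. Qed.
Lemma gs_linear (V W : lmodType B) (f : V -> W) : {morph f : x y / x + y} ->
  (forall r v, f (r%:A *: v) = r%:A *: f v) ->
  (forall g v, f (gam g *: v) = gam g *: f v) -> forall b v, f (b *: v) = b *: f v.
Proof.
move=> fD fZ fg b v; rewrite (gs_span gs b) !scaler_suml.
rewrite (big_morph f fD (morphD0 fD)); apply: eq_bigr => g _.
by rewrite -(algZA _ (gam g) v) fZ fg algZA.
Qed.

(** The multiplication B (x)_O V -> V is a surjective bimodule map and therefore splits. [tau] is a
    splitting followed by t on the factor B, and the formula is the expansion [gs_span] read through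
    the splitting. *)
Lemma left_trace (C : algType O) (V : bimodType B C) : bimod_projective V ->
  exists tau : V -> V, [/\ {morph tau : x y / x + y}, forall v c, tau (v *| c) = tau v *| c &
    forall v, v = \sum_g gam g *: tau (gam g^-1%g *: v)].
Proof.
move=> projV.
pose M1 : bimodType B O^o := bimod_res (B^o : bimodType B B) idfun (@in_scal O B).
pose V1 : bimodType O^o C := bimod_res V (@in_scal O B) idfun.
pose F (a : M1) (v : V1) : V := (a : B) *: (v : V).
have bF : balanced F.
  split=> [v a a'|a v v'|a r v]; rewrite /F.
  - exact: scalerDl.
  - exact: scalerDr.
  - by rewrite -[a *| r]/((a : B) * in_scal B r) -scalerA.
pose f := tmap F.
pose q := tmap (fun (a : M1) (v : V1) => (t (a : B))%:A *: (v : V)).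
have bq : balanced (fun (a : M1) (v : V1) => (t (a : B))%:A *: (v : V)).
  split=> [v a a'|a v v'|a r v].
  - by rewrite gs_tD !scalerDl.
  - exact: scalerDr.
  - rewrite -[a *| r]/((a : B) * in_scal B r) -[r *: v]/(in_scal B r *: (v : V)).
    by rewrite algAct /in_scal mulr_algr gs_tZ mulrC.
have fhom : @bimod_hom O B C (tensor M1 V1) V f.
  split=> [x y|a x|x c].
  - exact: tmapDE.
  - rewrite /f tmapZE // (@tmap_comp _ _ _ _ _ _ _ _ (fun v => a *: v)) => [|u w]; last exact: scalerDr.
    by apply: eq_tmap => m n; rewrite /F scalerA.
  - rewrite /f tmapRE // (@tmap_comp _ _ _ _ _ _ _ _ (fun v => v *| c)) => [|u w]; last exact: ractDl.
    apply: eq_tmap => m n; exact: (lractA (m : B) (n : V) c).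
have idhom : @bimod_hom O B C V V id by [].
have fsurj (v : V) : exists u, f u = v.
  by exists (tens (1 : M1) (v : V1)); rewrite /f tmap_tens // /F scale1r.
have [h [hD hZ hR] fh] := projV _ _ _ _ fhom idhom fsurj.
exists (fun v => q (h v)); split=> [x y|v c|v].
- by rewrite hD /q tmapDE.
- rewrite hR /q tmapRE // (@tmap_comp _ _ _ _ _ _ _ _ (fun v => v *| c)) => [|u w]; last exact: ractDl.
  apply: eq_tmap => m n; exact: (lractA ((t (m : B))%:A : B) (n : V) c).
- rewrite -[LHS]fh; under eq_bigr => g _ do rewrite hZ.
  move: (h v); apply: tens_ext => [x y|x y|a w]; first exact: tmapDE.
    rewrite -big_split; apply: eq_bigr => g _ /=.
    by rewrite scalerDr /q tmapDE // scalerDr.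
  rewrite /f tmap_tens // /F {1}(gs_span gs (a : B)) scaler_suml; apply: eq_bigr => g _.
  rewrite tensZ /q tmap_tens // -[gam g^-1%g *: a]/(gam g^-1%g * (a : B)).
  by rewrite -algZA algZC.
Qed.

Lemma right_trace (C : algType O) (V : bimodType C B) : bimod_projective V ->
  exists tau : V -> V, [/\ {morph tau : x y / x + y}, forall v c, tau (c *: v) = c *: tau v &
    forall v, v = \sum_g tau (v *| gam g^-1%g) *| gam g].
Proof.
move=> projV.
pose M1 : bimodType O^o B := bimod_res (B^o : bimodType B B) (@in_scal O B) idfun.
pose V1 : bimodType C O^o := bimod_res V idfun (@in_scal O B).
pose F (v : V1) (a : M1) : V := (v : V) *| (a : B).
have bF : balanced F.
  split=> [v a a'|a v v'|v r a]; rewrite /F.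
  - exact: ractDl.
  - exact: (ractDr (a : V)).
  - by rewrite -[v *| r]/((v : V) *| in_scal B r) -ractM.
pose f := tmap F.
pose q := tmap (fun (v : V1) (a : M1) => (v : V) *| (t (a : B))%:A).
have bq : balanced (fun (v : V1) (a : M1) => (v : V) *| (t (a : B))%:A).
  split=> [v a a'|a v v'|v r a].
  - exact: ractDl.
  - by rewrite gs_tD scalerDl ractDr.
  - rewrite -[v *| r]/((v : V) *| in_scal B r) -[r *: a]/(in_scal B r * (a : B)).
    by rewrite -ractM /in_scal mulr_algl scalerA mulr_algl gs_tZ.
have fhom : @bimod_hom O C B (tensor V1 M1) V f.
  split=> [x y|c x|x a].
  - exact: tmapDE.
  - rewrite /f tmapZE // (@tmap_comp _ _ _ _ _ _ _ _ (fun v => c *: v)) => [|u w]; last exact: scalerDr.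
    by apply: eq_tmap => m n; rewrite /F; apply/esym; apply: (lractA c (m : V) (n : B)).
  - rewrite /f tmapRE // (@tmap_comp _ _ _ _ _ _ _ _ (fun v => v *| a)) => [|u w]; last exact: ractDl.
    by apply: eq_tmap => m n; rewrite /F -ractM.
have idhom : @bimod_hom O C B V V id by [].
have fsurj (v : V) : exists u, f u = v.
  by exists (tens (v : V1) (1 : M1)); rewrite /f tmap_tens // /F ract1.
have [h [hD hZ hR] fh] := projV _ _ _ _ fhom idhom fsurj.
exists (fun v => q (h v)); split=> [x y|v c|v].
- by rewrite hD /q tmapDE.
- rewrite hZ /q tmapZE // (@tmap_comp _ _ _ _ _ _ _ _ (fun v => c *: v)) => [|u w]; last exact: scalerDr.
  apply: eq_tmap => m n; apply/esym; exact: (lractA c (m : V) ((t (n : B))%:A : B)).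
- rewrite -[LHS]fh; under eq_bigr => g _ do rewrite hR.
  move: (h v); apply: tens_ext => [x y|x y|w a]; first exact: tmapDE.
    rewrite -big_split; apply: eq_bigr => g _ /=.
    by rewrite ractDl /q tmapDE // ractDl.
  rewrite /f tmap_tens // /F {1}(gs_spanr gs (a : B)).
  rewrite (big_morph _ (ractDr (w : V)) (morphD0 (ractDr (w : V)))); apply: eq_bigr => g _.
  rewrite tensR /q tmap_tens // -[a *| gam g^-1%g]/((a : B) * gam g^-1%g).
  by rewrite -ractM mulr_algl.
Qed.
End Higman.

Section ModLam.
Variables (O : comNzRingType) (lam : O).

Section One.
Variables (B : algType O) (V : lmodType B).
Definition cb (m n : V) := exists w, m - n = lam%:A *: w.
Lemma cb_refl m : cb m m. Proof. by exists 0; rewrite subrr scaler0. Qed.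
Lemma cb_sym m n : cb m n -> cb n m.
Proof. by case=> w E; exists (- w); rewrite scalerN -E opprB. Qed.
Lemma cb_trans n m k : cb m n -> cb n k -> cb m k.
Proof. by move=> [w E] [w' E']; exists (w + w'); rewrite scalerDr -E -E' addrA subrK. Qed.
Lemma cbD m n m' n' : cb m n -> cb m' n' -> cb (m + m') (n + n').
Proof. by move=> [w E] [w' E']; exists (w + w'); rewrite scalerDr -E -E' opprD addrACA. Qed.
Lemma cbN m n : cb m n -> cb (- m) (- n).
Proof. by move=> [w E]; exists (- w); rewrite scalerN -E opprD. Qed.
Lemma cbB m n m' n' : cb m n -> cb m' n' -> cb (m - m') (n - n').
Proof. by move=> h /cbN; apply: cbD. Qed.
Lemma cb_sum (I : finType) (F G : I -> V) :
  (forall i, cb (F i) (G i)) -> cb (\sum_i F i) (\sum_i G i).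
Proof.
move=> h; elim/big_rec2: _ => [|i x y _ xy]; first exact: cb_refl.
by apply: cbD.
Qed.
End One.

(** Linearity over O for modules over possibly different algebras; O acts through the scalars of
    each, and semilinear maps are still covered. *)
Definition olin (B C : algType O) (V : lmodType B) (W : lmodType C) (f : V -> W) :=
  {morph f : x y / x + y} /\ forall r v, f (r%:A *: v) = r%:A *: f v.

Section Two.
Variables (B C : algType O) (V : lmodType B) (W : lmodType C).
Implicit Types f : V -> W.

Lemma cb_map f m n : olin f -> cb m n -> cb (f m) (f n).
Proof.
move=> [fD fZ] [w E]; exists (f w); rewrite -fZ -E.
by apply: (addIr (f n)); rewrite subrK -fD subrK.
Qed.

Lemma olin0 f : olin f -> f 0 = 0. Proof. by case=> /morphD0. Qed.
Lemma olinB f x y : olin f -> f (x - y) = f x - f y.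
Proof. by case=> fD _; apply: (addIr (f y)); rewrite -fD !subrK. Qed.
Lemma olin_sum f (I : finType) (F : I -> V) : olin f -> f (\sum_i F i) = \sum_i f (F i).
Proof. by move=> h; case: (h) => fD _; rewrite (big_morph f fD (olin0 h)). Qed.

Lemma olin_sumf (I : finType) (F : I -> V -> W) : (forall i, olin (F i)) ->
  olin (fun v => \sum_i F i v).
Proof.
move=> h; split=> [x y|r v].
  by rewrite -big_split; apply: eq_bigr => i _; case: (h i) => /= ->.
by rewrite scaler_sumr; apply: eq_bigr => i _; case: (h i) => _ ->.
Qed.
Lemma olin_subf f g : olin f -> olin g -> olin (fun v => f v - g v).
Proof.
move=> [fD fZ] [gD gZ]; split=> [x y|r v]; first by rewrite fD gD opprD addrACA.
by rewrite fZ gZ scalerBr.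
Qed.
Lemma olin_inv f g : olin f -> cancel f g -> cancel g f -> olin g.
Proof.
move=> [fD fZ] fK gK; split=> [x y|r v]; apply: (can_inj fK).
  by rewrite fD !gK.
by rewrite fZ !gK.
Qed.
End Two.

Lemma olin_comp (B C D : algType O) (U : lmodType B) (V : lmodType C) (W : lmodType D)
  (g : V -> W) (f : U -> V) : olin g -> olin f -> olin (fun u => g (f u)).
Proof.
move=> [gD gZ] [fD fZ]; split=> [x y|r x]; first by rewrite fD gD.
by rewrite fZ gZ.
Qed.

Lemma olin_id (B : algType O) (V : lmodType B) : olin (@id V). Proof. by []. Qed.

Lemma olin_scale (B : algType O) (V : lmodType B) b : olin (fun v : V => b *: v).
Proof. by split=> [x y|r v]; rewrite ?scalerDr // algZC. Qed.

Lemma olin_ract (B C : algType O) (V : bimodType B C) c : olin (fun v : V => v *| c).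
Proof. by split=> [x y|r v]; rewrite ?ractDl // lractA. Qed.

Lemma olin_tensl (A B C : algType O) (M : bimodType A B) (N : bimodType B C) (n : N) :
  olin (fun m : M => tens m n).
Proof. by split=> [x y|r m]; rewrite ?tensDl // tensZ. Qed.

Lemma olin_tensr (A B C : algType O) (M : bimodType A B) (N : bimodType B C) (m : M) :
  olin (fun n : N => tens m n).
Proof.
split=> [x y|r n]; first by rewrite tensDr.
by rewrite tensZ -tens_bal bimod_central.
Qed.

Section Tmap.
Variables (A B C D : algType O) (M : bimodType A B) (N : bimodType B C) (W : lmodType D).
Lemma olin_tmap (f : M -> N -> W) : balanced f -> (forall n, olin (f^~ n)) -> olin (tmap f).
Proof.
move=> bf fl; split=> [x y|r x]; first exact: tmapDE.
rewrite tmapZE // (@tmap_comp _ _ _ _ _ _ _ _ (fun v => r%:A *: v)) => [|u w]; last exact: scalerDr.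
by apply: eq_tmap => m n; case: (fl n) => _ ->.
Qed.
Lemma cb_tmap (f g : M -> N -> W) x : (forall m n, cb (f m n) (g m n)) -> cb (tmap f x) (tmap g x).
Proof.
move=> fg; rewrite /tmap /teval; elim/big_rec2: _ => [|i u v _ uv]; first exact: cb_refl.
by apply: cbD.
Qed.
End Tmap.

End ModLam.

Record aut_lam (O : comNzRingType) (lam : O) (B : algType O) (al : B -> B) : Prop := AutLam {
  al_D : {morph al : x y / x + y};
  al_M : forall x y, al (x * y) = al x * al y;
  al_1 : al 1 = 1;
  al_Z : forall r x, al (r *: x) = r *: al x;
  al_cg : forall x, exists w, al x = x + lam *: w }.

Section DualBasis.
Variables (O : comNzRingType) (B : algType O) (V : lmodType B).

Lemma dual_basis : finitely_generated V -> projective V ->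
  exists (n : nat) (e : 'I_n -> V) (f : 'I_n -> V -> B),
  [/\ forall j, {morph f j : x y / x + y}, forall j b v, f j (b *: v) = b * f j v &
    forall v, v = \sum_j f j v *: e j].
Proof.
move=> [n [e span_e]] projV.
pose g (c : {ffun 'I_n -> B^o}) : V := \sum_j (c j : B) *: e j.
have gl : linear g.
  move=> a x y; rewrite /g scaler_sumr -big_split /=; apply: eq_bigr => j _.
  by rewrite !ffunE scalerDl scalerA.
pose gL : {linear {ffun 'I_n -> B^o} -> V} :=
  HB.pack g (GRing.isLinear.Build B {ffun 'I_n -> B^o} V *:%R g gl).
pose idL : {linear V -> V} := idfun.
have gs w : exists u, gL u = w.
  have [c ->] := span_e w; exists [ffun j => c j : B^o] => /=.
  by apply: eq_bigr => j _; rewrite ffunE.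
have [h hE] := projV _ _ gL idL gs.
exists n, e, (fun j v => h v j); split=> [j x y|j b v|v].
- by rewrite raddfD ffunE.
- by rewrite linearZ_LR /= ffunE.
- by rewrite -[LHS]hE.
Qed.
End DualBasis.

Section SpanO.
Variables (O : comNzRingType) (B : algType O) (gT : finGroupType) (gam : gT -> B) (t : B -> O).
Hypothesis gs : group_spanned gam t.

Lemma fg_span (V : lmodType B) : finitely_generated V ->
  exists (n : nat) (e : 'I_n -> V), forall v, exists c : 'I_n -> O, v = \sum_j (c j)%:A *: e j.
Proof.
move=> [n [e span_e]].
exists #|{: gT * 'I_n}|, (fun j => gam (enum_val j).1 *: e (enum_val j).2) => v.
have [c ->] := span_e v.
exists (fun j => t (gam (enum_val j).1^-1%g * c (enum_val j).2)).
rewrite (reindex (@enum_rank {: gT * 'I_n})) /=; last first.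
  by exists enum_val => [x _|x _]; rewrite ?enum_rankK ?enum_valK.
under [RHS]eq_bigr => z _ do rewrite enum_rankK.
rewrite -(pair_bigA _ (fun g j => (t (gam g^-1%g * c j))%:A *: (gam g *: e j))) exchange_big /=.
apply: eq_bigr => j _; rewrite {1}(gs_span gs (c j)) scaler_suml.
by apply: eq_bigr => g _; rewrite algZA.
Qed.

Lemma fg_map (V W : lmodType B) (f : V -> W) : {morph f : x y / x + y} ->
  (forall b v, f (b *: v) = b *: f v) -> (forall w, exists v, f v = w) ->
  finitely_generated V -> finitely_generated W.
Proof.
move=> fD fZ fs [n [e span_e]]; exists n, (fun j => f (e j)) => w.
have [v <-] := fs w; have [c ->] := span_e v; exists c.
by rewrite (big_morph f fD (morphD0 fD)); apply: eq_bigr => j _; rewrite fZ.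
Qed.

Lemma fg_tensor (C D : algType O) (M : bimodType C B) (N : bimodType B D) :
  finitely_generated M -> finitely_generated N -> finitely_generated (tensor M N).
Proof.
move=> [n [e span_e]] [n' [e' span_e']].
exists #|{: 'I_n * 'I_n'}|, (fun j => tens (e (enum_val j).1) (e' (enum_val j).2)).
apply: tens_ind => [|x y [c ->] [c' ->]|m m'].
- by exists (fun=> 0); rewrite big1 // => j _; rewrite scale0r.
- by exists (fun j => c j + c' j); rewrite -big_split; apply: eq_bigr => j _; rewrite scalerDl.
have [c' ->] := span_e' m'.
have /choice[c cE] : forall j, exists c : 'I_n -> C, m *| c' j = \sum_i c i *: e i by [].
exists (fun j => c (enum_val j).2 (enum_val j).1).
rewrite (big_morph (tens m) (tensDr m) (morphD0 (tensDr m))).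
rewrite [RHS](reindex (@enum_rank {: 'I_n * 'I_n'})) /=; last first.
  by exists enum_val => [x _|x _]; rewrite ?enum_rankK ?enum_valK.
under [RHS]eq_bigr => z _ do rewrite enum_rankK.
rewrite -(pair_bigA _ (fun i j => c j i *: tens (e i) (e' j))) exchange_big /=.
apply: eq_bigr => j _; rewrite -tens_bal cE.
rewrite (big_morph (fun x => tens x (e' j)) (tensDl (e' j)) (morphD0 (tensDl (e' j)))).
by apply: eq_bigr => i _; rewrite tensZ.
Qed.
End SpanO.

(** * Transport of automorphisms along the stable equivalence *)

Section Transfer.
Variables (O : comUnitRingType) (lam : O).
Hypothesis lam_jac : forall y, 1 + lam * y \is a GRing.unit.
Variables (B B' : algType O) (gT gT' : finGroupType).
Variables (gam : gT -> B) (t : B -> O) (gam' : gT' -> B') (t' : B' -> O).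
Hypotheses (gs : group_spanned gam t) (gs' : group_spanned gam' t').
Variables (M : bimodType B B') (N : bimodType B' B).
Hypotheses (M_fg : finitely_generated M) (M_proj : projective M).
Hypothesis N_fg : finitely_generated N.
Variable eps : tensor M N -> B.
Hypothesis epsD : {morph eps : x y / x + y}.
Hypothesis epsZ : forall b x, eps (b *: x) = b * eps x.
Hypothesis epsR : forall x b, eps (x *| b) = eps x * b.
Variable kap : tensor M N.
Hypothesis kapC : forall b : B, b *: kap = kap *| b.
Hypothesis eps_kap : eps kap = 1.
Variable eps' : tensor N M -> B'.
Hypothesis eps'D : {morph eps' : x y / x + y}.
Hypothesis eps'Z : forall b x, eps' (b *: x) = b * eps' x.
Hypothesis eps'R : forall x b, eps' (x *| b) = eps' x * b.
Variable kap' : tensor N M.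
Hypothesis eps'_kap : eps' kap' = 1.
Variable Y : bimodType B' B'.
Hypothesis Y_proj : bimod_projective Y.
Variables (pY : tensor N M -> Y) (jY : Y -> tensor N M).
Hypothesis pYhom : bimod_hom pY.
Hypothesis jYhom : bimod_hom jY.
Hypothesis pYjY : forall y, pY (jY y) = y.
Hypothesis pYkap : pY kap' = 0.
Hypothesis eps'jY : forall y, eps' (jY y) = 0.
Hypothesis L_split : forall x, x = eps' x *: kap' + jY (pY x).

Local Notation L := (tensor N M).
Local Notation cb := (cb lam).

Let evf (m : M) (n : N) (m' : M) : M := eps (tens m n) *: m'.
Let evf_bal m : balanced (evf m).
Proof.
split=> [x n n'|n x y|n b x]; rewrite /evf.
- by rewrite tensDr epsD scalerDl.
- exact: scalerDr.
- by rewrite -tensR epsR scalerA.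
Qed.
(** The map M (x) L -> M that contracts the first two factors of M (x) N (x) M with [eps]. *)
Definition ev (m : M) : L -> M := tmap (evf m).

Lemma ev_tens m n m' : ev m (tens n m') = eps (tens m n) *: m'.
Proof. by rewrite /ev tmap_tens //; apply: evf_bal. Qed.
Lemma evD m : {morph ev m : x y / x + y}.
Proof. by move=> x y; apply: tmapDE. Qed.
Lemma ev_olin m : olin (ev m).
Proof.
apply: olin_tmap => // x; split=> [n n'|r n]; rewrite /evf.
  by rewrite tensDr epsD scalerDl.
by rewrite algZA bimod_central -tensR epsR mulr_algr.
Qed.
Lemma ev_Z b m x : ev (b *: m) x = b *: ev m x.
Proof.
rewrite /ev (@tmap_comp _ _ _ _ _ _ _ _ (fun v => b *: v)) => [|u w]; last exact: scalerDr.
by apply: eq_tmap => n m'; rewrite /evf -tensZ epsZ scalerA.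
Qed.
Lemma ev_R m b x : ev (m *| b) x = ev m (b *: x).
Proof.
rewrite /ev tmapZE //; apply: eq_tmap => n m'.
by rewrite /evf tens_bal.
Qed.
Lemma ev_Dm x : {morph ev^~ x : m m' / m + m'}.
Proof.
move=> m m'; rewrite -[LHS]/(tmap (evf (m + m')) x) /tmap /teval -big_split /=.
by apply: eq_bigr => i _; rewrite /evf tensDl epsD scalerDl.
Qed.

(** For the unit and counit of an adjunction, composites such as [s0] and [T0] would be the
    identities in the triangle laws. Here [eps], [kap] and [eps'], [kap'] are chosen independently,
    so only a relation between the two composites, up to a trace, remains. *)
Definition s0 (m : M) : M := ev m kap'.
Let T0f (m : M) (mi : M) (ni : N) : M := mi *| eps' (tens ni m).
Let T0f_bal m : balanced (T0f m).
Proof.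
split=> [n x y|x n n'|x b n]; rewrite /T0f.
- exact: ractDl.
- by rewrite tensDl eps'D ractDr.
- by rewrite -tensZ eps'Z ractM.
Qed.
Definition T0 (m : M) : M := tmap (T0f m) kap.

Lemma eps'_olin : olin (eps' : L -> B'^o).
Proof. by split=> // r v; rewrite eps'Z. Qed.

Lemma tau_left : exists tau : M -> M, olin tau /\
  forall m, m = \sum_g gam g *: tau (gam g^-1%g *: m).
Proof.
have [n [e [f [fD fZ fE]]]] := dual_basis M_fg M_proj.
exists (fun m => \sum_j (t (f j m))%:A *: e j); split.
  apply: olin_sumf => j; split=> [x y|r m]; first by rewrite fD (gs_tD gs) !scalerDl.
  by rewrite fZ mulr_algl (gs_tZ gs) algAct.
move=> m; rewrite {1}(fE m).
under [RHS]eq_bigr => g _ do rewrite scaler_sumr.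
rewrite exchange_big /=; apply: eq_bigr => j _.
rewrite {1}(gs_span gs (f j m)) scaler_suml; apply: eq_bigr => g _.
by rewrite -algZA algZC fZ.
Qed.

(** Higman's criterion on both sides at once. Composing an O-linear map with group elements and
    [tau0], and summing, yields a bimodule map; since [tau0] is linear this respects congruences
    modulo [lam]. *)
Lemma tau_two : exists tau0 : Y -> Y, olin tau0 /\
  forall v, v = \sum_y (\sum_x gam' x *: tau0 (gam' x^-1%g *: (v *| gam' y^-1%g))) *| gam' y.
Proof.
have [t1 [t1D t1R t1E]] := left_trace gs' Y_proj.
have [t2 [t2D t2Z t2E]] := right_trace gs' Y_proj.
exists (fun v => t1 (t2 v)); split.
  split=> [x y|r v]; first by rewrite t2D t1D.
  by rewrite t2Z bimod_central t1R bimod_central.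
move=> v; rewrite {1}(t2E v); apply: eq_bigr => y _; congr (_ *| _).
by rewrite {1}(t1E (t2 _)); apply: eq_bigr => x _; rewrite t2Z.
Qed.

Section OneAut.
Variable al : B -> B.
Hypothesis alP : aut_lam lam al.

(** M is a retract of a free module: apply [al] to the coordinates and project back. The result need
    not be visibly bijective, but it is congruent to the identity. *)
Lemma twist_exists : exists sg : M -> M, [/\ olin sg,
  forall b m, sg (b *: m) = al b *: sg m & forall m, cb (sg m) m].
Proof.
have [n [e [f [fD fZ fE]]]] := dual_basis M_fg M_proj.
exists (fun m => \sum_j al (f j m) *: e j); split=> [|b m|m].
- apply: olin_sumf => j; split=> [x y|r m]; first by rewrite fD (al_D alP) !scalerDl.
  by rewrite fZ mulr_algl (al_Z alP) algZA.
- rewrite scaler_sumr; apply: eq_bigr => j _.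
  by rewrite fZ (al_M alP) scalerA.
- rewrite {2}(fE m); apply: cb_sum => j.
  have [w ->] := al_cg alP (f j m); exists (w *: e j).
  by rewrite scalerDl addrC addrA addNr add0r algZA.
Qed.

Lemma cb_add (A : algType O) (V : lmodType A) (x y : V) : cb x y -> exists w, x = y + lam%:A *: w.
Proof. by case=> w E; exists w; rewrite -E addrC subrK. Qed.

(** [S] and [T] are deformations of [s0] and [T0] that intertwine M with its twist by [al] on the
    left and [be] on the right. They are recorded because the comparison of two transports in
    [conjugator] composes an [S] with a [T]. *)
Lemma transfer : exists (be : B' -> B') (S T : M -> M), [/\ aut_lam lam be,
  [/\ olin S, forall b m, S (b *: m) = al b *: S m, forall m y, S (m *| be y) = S m *| y
    & forall m, cb (S m) (s0 m)] &
  [/\ olin T, forall b m, T (al b *: m) = b *: T m, forall m y, T (m *| y) = T m *| be y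
    & forall m, cb (T m) (T0 m)]].
Proof.
have [sg [sg_olin sgZ sg1]] := twist_exists.
have [nM [eM span_M]] := fg_span gs M_fg.
have [si sgK siK] : bijective sg.
  apply: (cong1_bij lam_jac span_M) => [x y|r v|v]; [by case: sg_olin | by case: sg_olin|].
  exact: cb_add.
have si_olin := olin_inv sg_olin sgK siK.
have siZ b m : si (al b *: m) = b *: si m by apply: (can_inj sgK); rewrite sgZ !siK.
have si1 m : cb (si m) m.
  by rewrite -{2}(siK m); apply: cb_sym; apply: sg1.
(* Transporting the right action along [sg] gives a second right action of B' on M, which commutes
   with B because [sg] is semilinear, and is congruent to the first. [star] is the action induced on
   L. *)
pose rho y m := si (sg m *| y).
have rho_olin y : olin (rho y).
  apply: (olin_comp si_olin); exact: (olin_comp (olin_ract _ y) sg_olin).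
have rhoZ y b m : rho y (b *: m) = b *: rho y m by rewrite /rho sgZ -lractA siZ.
have rho1 y m : cb (rho y m) (m *| y).
  apply: cb_trans (si1 _) _; exact: (cb_map (olin_ract _ y)) (sg1 m).
have starb y : balanced (fun n m => tens n (rho y m) : L).
  split=> [m n n'|n m m'|n b m].
  - exact: tensDl.
  - by rewrite (proj1 (rho_olin y)) tensDr.
  - by rewrite tens_bal rhoZ.
pose star (x : L) y : L := tmap (fun n m => tens n (rho y m)) x.
have star_tens n m y : star (tens n m) y = tens n (rho y m) by rewrite /star tmap_tens.
have star_olin y : olin (star^~ y).
  by apply: olin_tmap => // m; apply: olin_tensl.
have starZ (b : B') x y : star (b *: x) y = b *: star x y.
  rewrite /star tmapZE // (@tmap_comp _ _ _ _ _ _ _ _ (fun v => b *: v)) => [|u w]; last exact: scalerDr.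
  by apply: eq_tmap => n m; rewrite tensZ.
have star1 x y : cb (star x y) (x *| y).
  move: x; apply: tens_ind => [|x x' h h'|n m].
  - by rewrite (olin0 (star_olin y)) ract0; apply: cb_refl.
  - by rewrite (proj1 (star_olin y)) ractDl; apply: cbD.
  - rewrite star_tens tensR; exact: (cb_map (olin_tensr _ n) (rho1 y m)).
have starDr x : {morph star x : y y' / y + y'}.
  move=> y y'; move: x; apply: tens_ext => [u v|u v|n m].
  - exact: (proj1 (star_olin _)).
  - by rewrite !(proj1 (star_olin _)) addrACA.
  - by rewrite !star_tens -tensDr /rho ractDr (proj1 si_olin).
have starO x r : star x r%:A = r%:A *: x.
  move: x; apply: tens_ext => [u v|u v|n m].
  - exact: (proj1 (star_olin _)).
  - exact: scalerDr.
  - rewrite star_tens /rho -bimod_central -(proj2 sg_olin) sgK.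
    by rewrite (proj2 (olin_tensr _ n)).
have star_1 x : star x 1 = x by rewrite -[1]scale1r starO scale1r scale1r.
have starM x y y' : star x (y * y') = star (star x y) y'.
  move: x; apply: tens_ext => [u v|u v|n m].
  - exact: (proj1 (star_olin _)).
  - by rewrite !(proj1 (star_olin _)).
  - by rewrite !star_tens /rho ractM siK.
have [pYD pYZ pYR] := pYhom; have [jYD jYZ jYR] := jYhom.
have pY_olin : olin pY by [].
have jY_olin : olin jY by [].
have [tau0 [tau0_olin tau0E]] := tau_two.
(* Y is projective, so the bimodule structure on L twisted by [al] still maps onto it. *)
pose r1 (x : L) : Y := \sum_y (\sum_z gam' z *:
   tau0 (pY (star (gam' z^-1%g *: x) (gam' y^-1%g)))) *| gam' y.
have r1_olin : olin r1.
  apply: olin_sumf => y; apply: (olin_comp (olin_ract _ _)); apply: olin_sumf => z.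
  apply: (olin_comp (olin_scale _ _)); apply: (olin_comp tau0_olin).
  apply: (olin_comp pY_olin); apply: (olin_comp (star_olin _)); exact: olin_scale.
have r1Z b x : r1 (b *: x) = b *: r1 x.
  apply: (gs_linear gs') => [||g v]; [exact: (proj1 r1_olin)|exact: (proj2 r1_olin)|].
  rewrite /r1 scaler_sumr; apply: eq_bigr => y _; rewrite lractA; congr (_ *| _).
  rewrite scaler_sumr (reindex_inj (mulgI g)) /=; apply: eq_bigr => z _.
  have -> : gam' (g * z)^-1%g *: (gam' g *: v) = gam' z^-1%g *: v.
    by rewrite scalerA -(gs_M gs') invMg mulgKV.
  by rewrite (gs_M gs') scalerA.
have star_lin (V : bimodType B' B') (f : L -> V) (fo : olin f) :
    (forall x g, f (star x (gam' g)) = f x *| gam' g) ->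
    forall x y, f (star x y) = f x *| y.
  move=> fg x y; rewrite (gs_span gs' y).
  rewrite (big_morph (star x) (starDr x) (morphD0 (starDr x))) (olin_sum _ fo).
  rewrite (big_morph _ (ractDr (f x)) (morphD0 (ractDr (f x)))).
  apply: eq_bigr => g _; set r := t' _.
  by rewrite -mulr_algl starM starO fg (proj2 fo) ractM bimod_central.
have r1R x y : r1 (star x y) = r1 x *| y.
  apply: star_lin => // {}x g.
  rewrite /r1 (big_morph _ (ractDl (gam' g)) (ract0 _ _)).
  rewrite (reindex_inj (mulIg g)) /=; apply: eq_bigr => z _.
  rewrite -ractM -(gs_M gs'); congr (_ *| _); apply: eq_bigr => y' _.
  by rewrite starZ -starM -(gs_M gs') invMg mulKVg -starZ.
have r1_1 x : cb (r1 x) (pY x).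
  rewrite (tau0E (pY x)); apply: cb_sum => y.
  apply: (cb_map (olin_ract _ _)); apply: cb_sum => z; apply: (cb_map (olin_scale _ _)).
  apply: (cb_map tau0_olin); rewrite lractA -pYZ -pYR; apply: (cb_map pY_olin); exact: star1.
have Y_fg : finitely_generated Y.
  apply: (@fg_map _ _ L Y pY) => // [w|]; first by exists (jY w).
  exact: fg_tensor.
have [nY [eY span_Y]] := fg_span gs' Y_fg.
have rj_olin : olin (fun v => r1 (jY v)) by apply: (olin_comp r1_olin).
have [h0 rjK h0K] : bijective (fun v => r1 (jY v)).
  apply: (cong1_bij lam_jac span_Y) => [x y|r v|v]; [exact: (proj1 rj_olin) | exact: (proj2 rj_olin)|].
  by apply: cb_add; rewrite -{2}(pYjY v); apply: r1_1.
have h0_olin := olin_inv rj_olin rjK h0K.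
have h0Z b v : h0 (b *: v) = b *: h0 v.
  by apply: (can_inj rjK); rewrite h0K jYZ r1Z h0K.
have h01 v : cb (h0 v) v.
  by rewrite -{2}(h0K v); apply: cb_sym; rewrite -{2}(pYjY (h0 v)); apply: r1_1.
(* The kernel of [r1] is a free left B'-module on [Th]. It is stable under [star], and the effect of
   y on the generator [Th] defines [be y]. *)
pose Th := kap' - jY (h0 (r1 kap')).
have r1Th : r1 Th = 0 by rewrite (olinB _ _ r1_olin) h0K subrr.
have epsTh b : eps' (b *: Th) = b.
  by rewrite eps'Z (olinB _ _ eps'_olin) eps'_kap eps'jY subr0 mulr1.
have Th1 : cb Th kap'.
  have h : cb (r1 kap') 0 by rewrite -pYkap.
  have h2 : cb (jY (h0 (r1 kap'))) 0.
    by rewrite -(olin0 (olin_comp jY_olin h0_olin)); apply: (cb_map (olin_comp jY_olin h0_olin)).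
  by rewrite -[X in cb _ X]subr0; apply: cbB => //; apply: cb_refl.
have kerr x : r1 x = 0 -> x = eps' x *: Th.
  move=> rx; have E : x - eps' x *: Th = jY (pY x + h0 (r1 (eps' x *: kap'))).
    rewrite {1}(L_split x) /Th scalerBr opprB jYD r1Z h0Z jYZ.
    by rewrite addrC addrA subrK addrC.
  apply/eqP; rewrite -subr_eq0 E.
  have : r1 (jY (pY x + h0 (r1 (eps' x *: kap')))) = 0.
    by rewrite -E (olinB _ _ r1_olin) rx r1Z r1Th scaler0 subr0.
  move/(congr1 h0); rewrite rjK => ->.
  by rewrite (olin0 h0_olin) (olin0 jY_olin).
pose be y := eps' (star Th y).
have beTh y : star Th y = be y *: Th.
  by apply: kerr; rewrite r1R r1Th ract0.
have be_aut : aut_lam lam be.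
  split=> [x y|x y||r x|x]; rewrite /be.
  - by rewrite starDr eps'D.
  - by rewrite starM !beTh starZ beTh scalerA !epsTh.
  - by rewrite star_1 -[Th]scale1r epsTh.
  - by rewrite -mulr_algl starM starO starZ eps'Z mulr_algl.
  - have h : cb (eps' (star Th x) : B'^o) (eps' (kap' *| x)).
      apply: (cb_map eps'_olin); apply: cb_trans (star1 _ _) _.
      exact: (cb_map (olin_ract _ x)).
    have [w E] := cb_add h; exists (w : B').
    by rewrite -[lam *: w]mulr_algl E eps'R eps'_kap mul1r.
(* The section of [r1] given by [jY] after [h0] respects only the left action. Averaging it makes it
   compatible with [star] as well, so that [pr] below splits off the kernel of [r1] as a
   bimodule. *)
pose hs (v : Y) : L := \sum_y star (\sum_z gam' z *:
   jY (h0 (tau0 (gam' z^-1%g *: (v *| gam' y^-1%g))))) (gam' y).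
have hs_olin : olin hs.
  apply: olin_sumf => y; apply: (olin_comp (star_olin _)); apply: olin_sumf => z.
  apply: (olin_comp (olin_scale _ _)); apply: (olin_comp jY_olin); apply: (olin_comp h0_olin).
  apply: (olin_comp tau0_olin); apply: (olin_comp (olin_scale _ _)); exact: olin_ract.
have r1hs v : r1 (hs v) = v.
  rewrite (olin_sum _ r1_olin) [RHS]tau0E; apply: eq_bigr => y _.
  rewrite r1R; congr (_ *| _); rewrite (olin_sum _ r1_olin); apply: eq_bigr => z _.
  by rewrite r1Z h0K.
have hsZ b v : hs (b *: v) = b *: hs v.
  apply: (gs_linear gs') => [||g {}v]; [exact: (proj1 hs_olin)|exact: (proj2 hs_olin)|].
  rewrite /hs scaler_sumr; apply: eq_bigr => y _; rewrite -starZ; congr (star _ _).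
  rewrite scaler_sumr (reindex_inj (mulgI g)) /=; apply: eq_bigr => z _.
  have -> : gam' (g * z)^-1%g *: ((gam' g *: v) *| gam' y^-1%g) =
      gam' z^-1%g *: (v *| gam' y^-1%g).
    by rewrite -lractA scalerA -(gs_M gs') invMg mulgKV.
  by rewrite (gs_M gs') scalerA.
have hsR v y : hs (v *| y) = star (hs v) y.
  have hsg g u : hs (u *| gam' g) = star (hs u) (gam' g).
    rewrite /hs (olin_sum _ (star_olin _)) (reindex_inj (mulIg g)) /=.
    apply: eq_bigr => z _; rewrite -starM -(gs_M gs'); congr (star _ _).
    by apply: eq_bigr => y' _; rewrite -ractM -(gs_M gs') invMg mulKVg.
  rewrite (gs_span gs' y) (big_morph _ (ractDr v) (morphD0 (ractDr v))) (olin_sum _ hs_olin).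
  rewrite (big_morph (star _) (starDr _) (morphD0 (starDr _))).
  apply: eq_bigr => g _; set r := t' _.
  by rewrite -mulr_algl starM starO -(proj2 hs_olin) -hsg ractM bimod_central.
have hs1 v : cb (hs v) (jY v).
  rewrite {2}(tau0E v) (olin_sum _ jY_olin); apply: cb_sum => y.
  apply: cb_trans (star1 _ _) _; rewrite jYR; apply: (cb_map (olin_ract _ _)).
  rewrite (olin_sum _ jY_olin); apply: cb_sum => z; rewrite jYZ; apply: (cb_map (olin_scale _ _)).
  apply: (cb_map jY_olin); exact: h01.
pose pr (x : L) := eps' (x - hs (r1 x)).
have prTh x : x - hs (r1 x) = pr x *: Th.
  by apply: kerr; rewrite (olinB _ _ r1_olin) r1hs subrr.
have pr_olin : olin (pr : L -> B'^o).
  apply: (olin_comp eps'_olin); apply: (olin_subf (@olin_id _ _ L)).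
  exact: (olin_comp hs_olin).
have prZ b x : pr (b *: x) = b * pr x by rewrite /pr r1Z hsZ -scalerBr eps'Z.
have prR x y : pr (star x y) = pr x * be y.
  by rewrite /pr r1R hsR -(olinB _ _ (star_olin y)) prTh starZ beTh scalerA !epsTh.

have pr1 x : cb (pr x : B'^o) (eps' x).
  have -> : eps' x = eps' (x - jY (pY x)).
    by rewrite (olinB _ _ eps'_olin) eps'jY subr0.
  apply: (cb_map eps'_olin); apply: cbB; first exact: cb_refl.
  apply: cb_trans (hs1 _) _; apply: (cb_map jY_olin); exact: r1_1.
have ev_star m x y : ev m (star x y) = rho y (ev m x).
  move: x; apply: tens_ext => [u v|u v|n m'].
  - by rewrite (proj1 (star_olin y)) evD.
  - by rewrite evD (proj1 (rho_olin y)).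
  - by rewrite star_tens !ev_tens rhoZ.
have evm_olin x : olin (ev^~ x).
  by split=> [m m'|r m]; rewrite ?ev_Dm // ev_Z.
have trf_bal m : balanced (fun mi ni => mi *| pr (tens ni (si m)) : M).
  split=> [n x y|x n n'|x b n].
  - exact: ractDl.
  - by rewrite tensDl (proj1 pr_olin) ractDr.
  - by rewrite -tensZ prZ ractM.
(* [T] is [T0] with [eps'] replaced by its deformation [pr], just as [S] is [s0] with [kap']
   replaced by [Th]; [sg] and its inverse absorb the twist by [al]. *)
pose T m := tmap (fun mi ni => mi *| pr (tens ni (si m)) : M) kap.
exists be, (fun m => sg (ev m Th)), T; split=> //.
- split=> [|b m|m y|m].
  + exact: (olin_comp sg_olin).
  + by rewrite ev_Z sgZ.
  + by rewrite ev_R -beTh ev_star siK.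
  + apply: cb_trans (sg1 _) _; exact: (cb_map (ev_olin m)).
- split=> [|b m|m y|m].
  + split=> [x y|r x]; rewrite /T.
      rewrite /tmap /teval -big_split; apply: eq_bigr => i _ /=.
      by rewrite (proj1 si_olin) tensDr (proj1 pr_olin) ractDr.
    rewrite (@tmap_comp _ _ _ _ _ _ _ _ (fun v => r%:A *: v)) => [|u w]; last exact: scalerDr.
    apply: eq_tmap => m n; rewrite (proj2 si_olin) (proj2 (olin_tensr _ n)) prZ.
    by rewrite ractM -bimod_central lractA.
  + rewrite /T siZ (@tmap_comp _ _ _ _ _ _ _ _ (fun v => b *: v)) => [|u w]; last exact: scalerDr.
    transitivity (tmap (fun mi ni => mi *| pr (tens ni (si m)) : M) (kap *| b)).
      by rewrite tmapRE //; apply: eq_tmap => mi ni; rewrite tens_bal.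
    rewrite -kapC tmapZE //; apply: eq_tmap => mi ni; by rewrite lractA.
  + rewrite /T (@tmap_comp _ _ _ _ _ _ _ _ (fun v => v *| be y)) => [|u w]; last exact: ractDl.
    apply: eq_tmap => mi ni; rewrite -ractM -prR star_tens /rho siK.
    by [].
  + apply: cb_tmap => mi ni; rewrite /T0f.
    have h : cb (pr (tens ni (si m)) : B'^o) (eps' (tens ni m)).
      apply: cb_trans (pr1 _) _; apply: (cb_map eps'_olin); apply: (cb_map (olin_tensr _ ni)); exact: si1.
    have [w E] := h; exists (mi *| w).
    have rN (x y : B') : mi *| x - mi *| y = mi *| (x - y).
      by apply: (addIr (mi *| y)); rewrite subrK -ractDr subrK.
    have lw : lam%:A *: w = (lam%:A : B') * (w : B') by [].
    by rewrite rN E lw ractM -bimod_central lractA.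
Qed.
End OneAut.

Definition conj_sum (d : B) : B := \sum_g gam g * d * gam g^-1%g.

(* The two maps [s0] and [T0] are mutually inverse up to maps factoring through
   a projective bimodule, hence up to a relative trace. *)
Lemma s0T0 : exists Z : M -> M, [/\ olin Z,
  forall m y, Z (m *| y) = Z m *| y &
  forall m, s0 (T0 m) = m - \sum_g gam g *: Z (gam g^-1%g *: m)].
Proof.
have [tau [tau_olin tauE]] := tau_left.
have [t2 [t2D t2Z t2E]] := right_trace gs' Y_proj.
have t2_olin : olin t2 by [].
have [pYD pYZ pYR] := pYhom; have [jYD jYZ jYR] := jYhom.
have pY_olin : olin pY by [].
have jY_olin : olin jY by [].
(* By [L_split] the defect of the composite is the part that passes through Y. Inserting [t2] writes
   it as a trace on the right, and [tau], which comes from projectivity of M over B, as a trace on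
   the left. *)
pose Z1f m mi ni : M := ev mi (jY (t2 (pY (tens ni m)))).
have Z1f_bal m : balanced (Z1f m).
  split=> [n x y|x n n'|x b n]; rewrite /Z1f.
  - exact: ev_Dm.
  - by rewrite tensDl pYD t2D jYD evD.
  - by rewrite -tensZ pYZ t2Z jYZ ev_R.
pose Z1 m := tmap (Z1f m) kap.
have Z1D : {morph Z1 : x y / x + y}.
  move=> x y; rewrite /Z1 /tmap /teval -big_split; apply: eq_bigr => i _ /=.
  by rewrite /Z1f tensDr pYD t2D jYD evD.
have Z1Z b m : Z1 (b *: m) = b *: Z1 m.
  rewrite /Z1 (@tmap_comp _ _ _ _ _ _ _ _ (fun v => b *: v)) => [|u w]; last exact: scalerDr.
  transitivity (tmap (Z1f m) (kap *| b)).
    by rewrite tmapRE //; apply: eq_tmap => mi ni; rewrite /Z1f tens_bal.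
  by rewrite -kapC tmapZE //; apply: eq_tmap => mi ni; rewrite /Z1f ev_Z.
have Z1_olin : olin Z1 by [].
exists (fun m => \sum_y tau (Z1 (m *| gam' y^-1%g)) *| gam' y); split=> [|m b|m].
- apply: olin_sumf => y; apply: (olin_comp (olin_ract _ _)); apply: (olin_comp tau_olin).
  apply: (olin_comp Z1_olin); exact: olin_ract.
- pose f m := \sum_y tau (Z1 (m *| gam' y^-1%g)) *| gam' y.
  have f_olin : olin f.
    apply: olin_sumf => y; apply: (olin_comp (olin_ract _ _)); apply: (olin_comp tau_olin).
    apply: (olin_comp Z1_olin); exact: olin_ract.
  have fg u g : f (u *| gam' g) = f u *| gam' g.
    rewrite /f (big_morph _ (ractDl (gam' g)) (ract0 _ _)).
    rewrite (reindex_inj (mulIg g)) /=; apply: eq_bigr => z _.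
    by rewrite -!ractM -!(gs_M gs') invMg mulKVg.
  rewrite -/(f _) -/(f m) (gs_span gs' b).
  rewrite (big_morph _ (ractDr m) (morphD0 (ractDr m))) (olin_sum _ f_olin).
  rewrite (big_morph _ (ractDr (f m)) (morphD0 (ractDr (f m)))).
  apply: eq_bigr => g _; set r := t' _.
  by rewrite -mulr_algl !ractM -!bimod_central fg (proj2 f_olin).
- have -> : \sum_g gam g *: (\sum_y tau (Z1 ((gam g^-1%g *: m) *| gam' y^-1%g)) *| gam' y) =
      \sum_y Z1 (m *| gam' y^-1%g) *| gam' y.
    under eq_bigr => g _ do rewrite scaler_sumr.
    rewrite exchange_big /=; apply: eq_bigr => y _.
    rewrite [X in _ = X *| _]tauE (big_morph _ (ractDl (gam' y)) (ract0 _ _)).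
    by apply: eq_bigr => g _; rewrite lractA -Z1Z lractA.
  have evT x : ev (T0 m) x = tmap (fun mi ni => ev mi (eps' (tens ni m) *: x)) kap.
    rewrite /T0 (@tmap_comp _ _ _ _ _ _ _ _ (ev^~ x)) => [|u w]; last exact: ev_Dm.
    by apply: eq_tmap => mi ni; rewrite /T0f ev_R.
  rewrite /s0 evT.
  have -> : \sum_y Z1 (m *| gam' y^-1%g) *| gam' y =
      tmap (fun mi ni => ev mi (jY (pY (tens ni m)))) kap.
    rewrite /Z1 /tmap /teval.
    under eq_bigr => y _ do rewrite (big_morph _ (ractDl (gam' y)) (ract0 _ _)).
    rewrite exchange_big /=; apply: eq_bigr => i _.
    have evR x c : ev i.1 x *| c = ev i.1 (x *| c).
      move: x; apply: tens_ext => [u v|u v|n m'].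
      - by rewrite evD ractDl.
      - by rewrite ractDl evD.
      - by rewrite tensR !ev_tens lractA.
    rewrite [X in _ = ev _ (jY X)]t2E (olin_sum _ jY_olin) (olin_sum _ (ev_olin _)).
    by apply: eq_bigr => y _; rewrite /Z1f evR -jYR -tensR pYR.
  rewrite -[X in X - _](scale1r m) -eps_kap.
  have -> : eps kap *: m = tmap (fun mi ni => ev mi (tens ni m)) kap.
    rewrite [kap in LHS]tensor_span (big_morph eps epsD (morphD0 epsD)) scaler_suml /tmap /teval.
    by apply: eq_bigr => i _; rewrite ev_tens.
  rewrite /tmap /teval -sumrB; apply: eq_bigr => i _.
  by rewrite -(olinB _ _ (ev_olin _)) [X in X - _]L_split addrK.
Qed.

(** The composite of [T2], right multiplication by w and [S1] is right B'-linear, and semilinear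
    from [al2] to [al1]. Tensored with N it acts on M (x) N, and c is the image of [kap] contracted
    by [eps]. Modulo [lam] the composite is [s0] after [T0], whence the trace of d. *)
Lemma conjugator (al1 al2 : B -> B) (be1 be2 : B' -> B') (S1 T2 : M -> M) (w : B') :
  aut_lam lam al1 -> aut_lam lam al2 ->
  [/\ olin S1, forall b m, S1 (b *: m) = al1 b *: S1 m,
     forall m y, S1 (m *| be1 y) = S1 m *| y & forall m, cb (S1 m) (s0 m)] ->
  [/\ olin T2, forall b m, T2 (al2 b *: m) = b *: T2 m,
     forall m y, T2 (m *| y) = T2 m *| be2 y & forall m, cb (T2 m) (T0 m)] ->
  (forall y, be2 y * w = w * be1 y) -> (exists w', w = 1 + lam *: w') ->
  exists c d : B, (forall b, al1 b * c = c * al2 b) /\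
    exists c', c = 1 - conj_sum d + lam *: c'.
Proof.
move=> al1P al2P [S_olin SZ SR S_s0] [T_olin TZ TR T_T0] wE [w' w'E].
pose C m := S1 (T2 m *| w).
have C_olin : olin C.
  by apply: (olin_comp S_olin); apply: (olin_comp (olin_ract _ w)).
have CR m y : C (m *| y) = C m *| y by rewrite /C TR -ractM wE ractM SR.
have CZ b m : C (al2 b *: m) = al1 b *: C m by rewrite /C TZ -lractA SZ.
have [Z [Z_olin ZR ZE]] := s0T0.
have epsf_bal (f : M -> M) : olin f -> (forall m y, f (m *| y) = f m *| y) ->
    balanced (fun m n => eps (tens (f m) n)).
  move=> fo fR; split=> [n x y|m n n'|m b n].
  - by rewrite (proj1 fo) tensDl epsD.
  - by rewrite tensDr epsD.
  - by rewrite fR tens_bal.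
have C_bal := epsf_bal C C_olin CR; have Z_bal := epsf_bal Z Z_olin ZR.
pose c : B := tmap (fun m n => eps (tens (C m) n)) kap.
pose d : B := tmap (fun m n => eps (tens (Z m) n)) kap.
exists c, d; split=> [b|].
  rewrite /c (@tmap_comp _ _ _ _ _ _ _ _ (fun v => al1 b * v)) => [|u v]; last exact: mulrDr.
  rewrite (@tmap_comp _ _ _ _ _ _ _ _ (fun v => v * al2 b)) => [|u v]; last exact: mulrDl.
  transitivity (tmap (fun m n => eps (tens (C m) n)) (al2 b *: kap)).
    by rewrite tmapZE //; apply: eq_tmap => m n; rewrite CZ -tensZ epsZ.
  by rewrite kapC tmapRE //; apply: eq_tmap => m n; rewrite -tensR epsR.
have Ts0 m : cb (C m) (s0 (T0 m)).
  apply: cb_trans (S_s0 _) _; rewrite /s0.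
  have h : cb (T2 m *| w) (T0 m).
    apply: cb_trans (T_T0 m); rewrite w'E; exists (T2 m *| w').
    by rewrite ractDr ract1 addrC addKr -mulr_algl ractM -bimod_central lractA.
  case: h => u E; exists (ev u kap'); rewrite -ev_Z -E.
  by apply: (addIr (ev (T0 m) kap')); rewrite subrK -ev_Dm subrK.
have h : cb (c : B^o) (1 - conj_sum d).
  have -> : 1 - conj_sum d = tmap (fun m n => eps (tens (s0 (T0 m)) n)) kap.
    have -> : 1 = tmap (fun m n => eps (tens m n)) kap.
      rewrite -eps_kap {1}[kap]tensor_span (big_morph eps epsD (morphD0 epsD)).
      by rewrite /tmap /teval.
    have gZ g : gam g * d * gam g^-1%g =
        tmap (fun m n => eps (tens (gam g *: Z (gam g^-1%g *: m)) n)) kap.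
      rewrite -mulrA /d (@tmap_comp _ _ _ _ _ _ _ _ (fun v => v * gam g^-1%g)) => [|u v]; last exact: mulrDl.
      transitivity (gam g * tmap (fun m n => eps (tens (Z m) n)) (gam g^-1%g *: kap)).
        congr (_ * _); rewrite kapC tmapRE //.
        by apply: eq_tmap => m n; rewrite -tensR epsR.
      rewrite tmapZE // (@tmap_comp _ _ _ _ _ _ _ _ (fun v => gam g * v)) => [|u v]; last exact: mulrDr.
      by apply: eq_tmap => m n; rewrite -tensZ epsZ.
    rewrite /conj_sum (eq_bigr _ (fun g _ => gZ g)) /tmap /teval exchange_big /= -sumrB.
    apply: eq_bigr => i _; rewrite ZE.
    have e_olin : olin (fun m : M => eps (tens m i.2) : B^o).
      by split=> [x y|r x]; rewrite ?tensDl ?epsD // -tensZ epsZ.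
    by rewrite (olinB _ _ e_olin) (olin_sum _ e_olin).
  apply: cb_tmap => m n; have [u E] := Ts0 m; exists (eps (tens u n)).
  have -> : lam%:A *: (eps (tens u n) : B^o) = eps (tens (lam%:A *: u) n) by rewrite -tensZ epsZ.
  rewrite -E; apply: (addIr (eps (tens (s0 (T0 m)) n))).
  by rewrite subrK -epsD -tensDl subrK.
have [v E] := cb_add h; exists (v : B).
by rewrite -[lam *: v]mulr_algl.
Qed.
End Transfer.

(** * The Brauer homomorphism and relative traces *)

Section FixedPointSum.
Variables (k : fieldType) (p : nat).
Hypothesis k_char : p \in [pchar k].

Lemma sum_fixed_points (aT : finGroupType) (T : finType) (to : {action aT &-> T})
    (P : {group aT}) (S : {set T}) (F : T -> k) :
  (p.-group P)%g -> [acts P, on S | to]%g ->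
  (forall x u, x \in S -> u \in P -> F (to x u) = F x) ->
  \sum_(x in S) F x = \sum_(x in 'Fix_(S | to)(P)%g) F x.
Proof.
move=> pP actsS FP.
pose F' x := if x \in 'Fix_to(P)%g then F x else 0.
have -> : \sum_(x in 'Fix_(S | to)(P)%g) F x = \sum_(x in S) F' x.
  rewrite -big_mkcondr; apply: eq_bigl => x; by rewrite inE.
have partS := orbit_partition actsS.
have [/eqP covS trS _] := and3P partS.
rewrite -covS !big_trivIset //; apply: eq_bigr => _ /imsetP[x xS ->].
have cstF y : y \in orbit to P x -> F y = F x by case/imsetP=> u uP ->; apply: FP.
have [xF|xF] := boolP (x \in 'Fix_to(P)%g).
  have /orbit1P xo := xF; rewrite (eq_bigl (mem [set x])) => [|y]; last by rewrite -xo.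
  rewrite [RHS](eq_bigl (mem [set x])) => [|y]; last by rewrite -xo.
  by rewrite !big_set1 /F' xF.
rewrite [RHS]big1 => [|y yo]; last first.
  rewrite /F'; case: ifP => // yF; case/negP: xF.
  have /afixP yfix := yF; case/imsetP: yo => u uP yE; have := yfix _ (groupVr uP).
  by rewrite yE actK => ->; rewrite -yE.
rewrite (eq_bigr (fun=> F x)) // sumr_const card_orbit -mulr_natr.
have /p_natP[[|e] oE] : p.-nat #|orbit to P x| by apply: pnat_dvd pP; apply: dvdn_orbit.
  by case/negP: xF; apply/orbit1P/eqP; rewrite eq_sym eqEcard sub1set orbit_refl oE cards1.
by rewrite -(card_orbit to) oE expnS natrM (pcharf0 k_char) mul0r mulr0.
Qed.
End FixedPointSum.

Section GroupAlgebraBasics.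
Variables (O : comNzRingType) (gT : finGroupType).
Local Notation OG := (galg O gT).
Local Notation "''d' g" := (gdelta O (g : gT)) (at level 8, g at level 2, format "''d' g").
Implicit Types a c d : OG.

Lemma gdelta_mull g a x : ('d g * a) x = a (g^-1 * x)%g.
Proof.
rewrite ffunE (bigD1 g) //= ffunE eqxx mul1r big1 ?addr0 // => y /negbTE yg.
by rewrite ffunE yg mul0r.
Qed.
Lemma gdelta_mulr g a x : (a * 'd g) x = a (x * g^-1)%g.
Proof.
rewrite ffunE (bigD1 (x * g^-1)%g) //= ffunE invMg invgK mulgKV eqxx mulr1.
rewrite big1 ?addr0 // => y yg; rewrite ffunE; case: eqP => [E|_]; last by rewrite mulr0.
by case/eqP: yg; rewrite -E invMg invgK mulKVg.
Qed.
Lemma gdelta1 : 'd 1 = 1 :> OG. Proof. by []. Qed.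
Lemma gdelta_VK g : 'd (g^-1)%g * 'd g = 1. Proof. by rewrite gdeltaM mulVg. Qed.
Lemma gdelta_KV g : 'd g * 'd (g^-1)%g = 1. Proof. by rewrite gdeltaM mulgV. Qed.
Lemma galg_sum a : a = \sum_g a g *: 'd g.
Proof.
apply/ffunP => x; rewrite sum_ffunE (bigD1 x) //= !ffunE eqxx mulr1.
by rewrite big1 ?addr0 // => y /negbTE yx; rewrite !ffunE eq_sym yx mulr0.
Qed.

Definition conjd a g : OG := 'd (g^-1)%g * a * 'd g.
Lemma conjdE a g x : conjd a g x = a (x ^ g^-1)%g.
Proof. by rewrite gdelta_mulr gdelta_mull !invgK conjgE invgK mulgA. Qed.
Lemma conjdM a g h : conjd a (g * h)%g = conjd (conjd a g) h.
Proof. by rewrite /conjd invMg -!gdeltaM !mulrA. Qed.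
Lemma conjd1 a : conjd a 1%g = a.
Proof. by rewrite /conjd invg1 gdelta1 mul1r mulr1. Qed.
Lemma conjdMM a c g : conjd (a * c) g = conjd a g * conjd c g.
Proof. by rewrite /conjd -!mulrA (mulrA ('d g)) gdelta_KV mul1r. Qed.
Lemma conjdD a c g : conjd (a + c) g = conjd a g + conjd c g.
Proof. by rewrite /conjd mulrDr mulrDl. Qed.
Lemma conjdK a g : conjd (conjd a g) g^-1%g = a.
Proof. by rewrite -conjdM mulgV conjd1. Qed.
Lemma conjdKV a g : conjd (conjd a g^-1%g) g = a.
Proof. by rewrite -conjdM mulVg conjd1. Qed.

Lemma center_conj a : in_center a <-> forall g, conjd a g = a.
Proof.
split=> [ca g|h c]; first by rewrite /conjd -mulrA ca mulrA gdelta_VK mul1r.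
have com g : a * 'd g = 'd g * a by rewrite -[in RHS](h g) /conjd !mulrA gdelta_KV mul1r.
rewrite (galg_sum c) mulr_sumr mulr_suml; apply: eq_bigr => g _.
by rewrite -scalerAr -scalerAl com.
Qed.

Lemma conj_center z g : in_center z -> conjd z g = z.
Proof. by move=> /center_conj. Qed.

Definition trc (H : {group gT}) d := \sum_(C in rcosets H [set: gT]) conjd d (repr C).

Lemma fixed_conjd (H : {group gT}) a u : fixed_by H a -> u \in H -> conjd a u = a.
Proof. by move=> h; apply: h. Qed.

Lemma conjd_repr (H : {group gT}) d t : fixed_by H d -> conjd d (repr (H :* t)%g) = conjd d t.
Proof.
move=> dH; have /rcosetP[u uH ->] := mem_repr_rcoset H t.
by rewrite conjdM (fixed_conjd dH uH).
Qed.

(** In characteristic zero an identity between relative traces may be checked after multiplication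
    by [#|H|], where the choice of coset representatives disappears. *)
Lemma trc_card (H : {group gT}) d : fixed_by H d -> #|H|%:R *: trc H d = \sum_g conjd d g.
Proof.
move=> dH; rewrite /trc scaler_sumr.
have [/eqP covR trR _] := and3P (rcosets_partition (subsetT H)).
rewrite (eq_bigl (mem (cover (rcosets H [set: gT])))) => [|g]; last by rewrite covR !inE.
rewrite big_trivIset //; apply: eq_bigr => _ /rcosetsP[t _ ->].
rewrite (eq_bigr (fun=> conjd d (repr (H :* t)%g))) => [|g /rcosetP[u uH ->]]; last first.
  by rewrite conjdM (fixed_conjd dH uH) conjd_repr.
by rewrite sumr_const card_rcoset scaler_nat.
Qed.

Lemma trc_center (H : {group gT}) d : fixed_by H d -> in_center (trc H d).
Proof.
move=> dH; apply/center_conj => g; rewrite {1}/conjd /trc mulr_sumr mulr_suml.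
rewrite [RHS](reindex_acts 'Rs _ (in_setT g)) ?actsRs_rcosets //=.
apply: eq_bigr => _ /rcosetsP[t _ ->]; rewrite -/(conjd _ _) rcosetE -rcosetM !conjd_repr // -conjdM.
by [].
Qed.

Lemma trcD (H : {group gT}) c d : trc H (c + d) = trc H c + trc H d.
Proof. by rewrite /trc -big_split; apply: eq_bigr => C _; apply: conjdD. Qed.
Lemma trcMz (H : {group gT}) d z : in_center z -> trc H (d * z) = trc H d * z.
Proof.
move=> zC; rewrite /trc mulr_suml; apply: eq_bigr => C _.
by rewrite conjdMM (conj_center _ zC).
Qed.
Lemma fixedM (H : {group gT}) c d : fixed_by H c -> fixed_by H d -> fixed_by H (c * d).
Proof. by move=> hc hd u uH; rewrite -/(conjd _ _) conjdMM [conjd c u]hc // [conjd d u]hd. Qed.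
Lemma fixedB (H : {group gT}) c d : fixed_by H c -> fixed_by H d -> fixed_by H (c - d).
Proof. by move=> hc hd u uH; rewrite mulrBr mulrBl hc // hd. Qed.
Lemma fixed_center (H : {group gT}) (z : OG) : in_center z -> fixed_by H z.
Proof. by move=> zC u uH; apply: conj_center. Qed.
Lemma fixed_norm (H : {group gT}) d t : t \in 'N(H)%g -> fixed_by H d -> fixed_by H (conjd d t).
Proof.
move=> tN dH u uH; rewrite -/(conjd _ u) -conjdM (conjgCV t u) conjdM [conjd d (u ^ _)]dH //.
by rewrite memJ_norm // groupV.
Qed.

End GroupAlgebraBasics.

Section Brauer.
Variables (O : idomainType) (pi : O) (k : fieldType) (red : {rmorphism O -> k}).
Hypotheses (O_cdvr : complete_dvr pi) (k_residue : residue_map pi red).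
Variables (p : nat) (gT : finGroupType) (P : {group gT}).
Hypotheses (k_char : p \in [pchar k]) (pP : (p.-group P)%g).
Local Notation OG := (galg O gT).
Implicit Types a c d : OG.

Definition brz a := forall x, x \in 'C(P)%g -> red (a x) = 0.
(** Invariance under P modulo [pi] only. This suffices for the Brauer map to be multiplicative, and
    it also holds for elements that commute with P modulo [lam]. *)
Definition pfix a := forall u x, u \in P -> red (a (x ^ u)%g) = red (a x).

Lemma brzP a : brz a <-> Br red P a = 0.
Proof.
split=> [h|/ffunP h x xC]; last by have := h (Subg xC); rewrite !ffunE.
by apply/ffunP => x; rewrite !ffunE h // subgP.
Qed.
Lemma fixed_pfix a : fixed_by P a -> pfix a.
Proof.
move=> h u x uP; have := conjdE a u^-1%g x.
by rewrite (fixed_conjd h) ?groupV // invgK => ->.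
Qed.
Lemma brzD a c : brz a -> brz c -> brz (a + c).
Proof. by move=> h1 h2 x xC; rewrite ffunE rmorphD h1 // h2 // addr0. Qed.
Lemma brz_pi a : pdv pi 1 a -> brz a.
Proof. by move=> [w ->] x _; rewrite ffunE; apply/(red0P k_residue); exists (w x). Qed.
Lemma br_mul a c : pfix a -> pfix c -> forall x, x \in 'C(P)%g ->
  red ((a * c) x) = \sum_(y in 'C(P)%g) red (a y) * red (c (y^-1 * x)%g).
Proof.
move=> ha hc x xC; rewrite ffunE rmorph_sum /=.
under eq_bigr => y _ do rewrite rmorphM.
have := @sum_fixed_points k p k_char _ _ ('J)%act P [set: gT] (fun y => red (a y) * red (c (y^-1 * x)%g)) pP.
rewrite setTI afixJ => <-.
- by apply: eq_bigl => y; rewrite inE.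
- by apply/actsP => u uP y; rewrite !inE.
- move=> y u _ uP /=; rewrite ha //; congr (_ * _).
  have xu : (x ^ u)%g = x by rewrite conjgE (centP xC u uP) mulKg.
  by rewrite -{1}xu -conjVg -conjMg hc.
Qed.

Lemma brzMl a c : pfix a -> pfix c -> brz a -> brz (a * c).
Proof. by move=> ha hc h x xC; rewrite br_mul // big1 // => y yC; rewrite h // mul0r. Qed.
Lemma brzMr a c : pfix a -> pfix c -> brz c -> brz (a * c).
Proof.
move=> ha hc h x xC; rewrite br_mul // big1 // => y yC; rewrite [red (c _)]h ?mulr0 //.
by rewrite groupM ?groupV.
Qed.

(** Translating a coset by P does not change the coefficients on the centraliser of P, so the cosets
    not fixed by P cancel in orbits of length divisible by p. *)
Lemma brz_trc (H : {group gT}) d : fixed_by H d ->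
  brz (trc H d - \sum_(C in 'Fix_(rcosets H [set: gT] | 'Rs)(P)%g) conjd d (repr C)).
Proof.
move=> dH x xC; rewrite !ffunE /trc !sum_ffunE rmorphB !rmorph_sum /=.
apply/eqP; rewrite subr_eq0; apply/eqP.
apply: (@sum_fixed_points k p k_char _ _ ('Rs)%act P _ (fun C => red (conjd d (repr C) x)) pP).
  by apply: subset_trans (actsRs_rcosets H [set: gT]); apply: subsetT.
move=> _ u /rcosetsP[t _ ->] uP; rewrite /= rcosetE -rcosetM !conjd_repr // conjdM conjdE.
have xu : (x ^ u)%g = x by rewrite conjgE (centP xC u uP) mulKg.
by rewrite -{1}xu conjgK.
Qed.
End Brauer.

Lemma natr_neq0_fraction (O : idomainType) : [pchar {fraction O}] =i pred0 ->
  forall n, (0 < n)%N -> n%:R != 0 :> O.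
Proof.
move=> K_char n n_gt0; apply/eqP => n0.
have /pcharf0P/(_ n) := K_char; rewrite -(rmorph_nat (@tofrac O)) n0 rmorph0 eqxx.
by rewrite -[RHS]negbK -lt0n n_gt0.
Qed.

(** * Defect groups and source idempotents *)

Section BlockTheory.
Variables (O : idomainType) (pi : O) (k : fieldType) (red : {rmorphism O -> k}).
Hypotheses (O_cdvr : complete_dvr pi) (k_residue : residue_map pi red).
Variable p : nat.
Hypotheses (p_prime : prime p) (k_char : p \in [pchar k]) (O_fg : fg_over_padic p O).
Hypothesis K_char : [pchar {fraction O}] =i pred0.
Variables (gT : finGroupType) (b : block O gT) (P : {group gT}).
Hypothesis P_defect : defect_group b red p P.
Local Notation OG := (galg O gT).
Local Notation "''d' g" := (gdelta O (g : gT)) (at level 8, g at level 2, format "''d' g").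
Local Notation eb := (block_unit b).
Implicit Types a c d : OG.
Local Notation pdv := (pdv pi).

Lemma defect_pgroup : (p.-group P)%g.
Proof. by have /maxgroupp/andP[] := P_defect. Qed.
Lemma defect_Br : ~ brz red P eb.
Proof. by have /maxgroupp/andP[_ /eqP h] := P_defect => /brzP. Qed.

Let bb : eb * eb = eb :> OG. Proof. by case: (block_primitive b). Qed.
Let bC : in_center eb. Proof. by case: (block_primitive b). Qed.
Let b0 : eb != 0. Proof. by case: (block_primitive b). Qed.

Lemma limit_kernel (T : OG -> OG) a : {morph T : x y / x - y} ->
  (forall n x, pdv n x -> pdv n (T x)) ->
  (forall n, exists2 y, T y = 0 & pdv n (a - y)) -> T a = 0.
Proof.
move=> TB Tn h; apply: (pdv_sep O_cdvr k_residue) => n; have [y Ty ay] := h n.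
by have := Tn n _ ay; rewrite TB Ty subr0.
Qed.

Lemma limit_conj a g : (forall n, exists2 y, conjd y g = y & pdv n (a - y)) -> conjd a g = a.
Proof.
move=> h; apply/eqP; rewrite -subr_eq0; apply/eqP.
apply: (@limit_kernel (fun a => conjd a g - a)) => [x y|n x hx|n].
- by rewrite /conjd mulrBr mulrBl !opprB addrACA [RHS]addrACA; congr (_ + _); rewrite addrC.
- by apply: pdvB => //; apply: pdvMr; apply: pdvMl.
- by have [y yg ay] := h n; exists y; rewrite ?yg ?subrr.
Qed.

Lemma centerB a c : in_center a -> in_center c -> in_center (a - c).
Proof. by move=> ha hc x; rewrite mulrBl mulrBr ha hc. Qed.
Lemma centerM a c : in_center a -> in_center c -> in_center (a * c).
Proof. by move=> ha hc x; rewrite -mulrA hc mulrA ha mulrA. Qed.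
Lemma center_lim a : (forall n, exists2 y, in_center y & pdv n (a - y)) -> in_center a.
Proof.
move=> h; apply/center_conj => g; apply: limit_conj => n; have [y yC ay] := h n.
by exists y => //; apply: conj_center.
Qed.

Definition inZ a := in_e (@in_center O OG) eb a.
Definition unitZ a := unit_e (@in_center O OG) eb a.

Definition inP a := in_block b a /\ fixed_by P a.
Lemma in_blockE a : in_block b a <-> eb * a * eb = a.
Proof. by split=> [/eqP|h]; last apply/eqP. Qed.
Lemma in_block_l a : in_block b a -> eb * a = a.
Proof. by move/in_blockE <-; rewrite !mulrA bb. Qed.
Lemma in_block_mulb a : in_block b (eb * a).
Proof. by apply/in_blockE; rewrite mulrA bb -mulrA -bC mulrA bb. Qed.
Lemma in_block_iff a : in_block b a <-> eb * a = a.
Proof. by split=> [/in_block_l|<-]; last exact: in_block_mulb. Qed.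
Lemma in_blockM a c : in_block b a -> in_block b (a * c).
Proof. by move=> /in_block_l ha; apply/in_block_iff; rewrite mulrA ha. Qed.
Lemma in_blockMr a c : in_block b c -> in_block b (a * c).
Proof. by move=> /in_block_l hc; apply/in_block_iff; rewrite mulrA bC -mulrA hc. Qed.
Lemma in_block_conj a g : in_block b a -> in_block b (conjd a g).
Proof. by move=> ha; apply: in_blockM; apply: in_blockMr. Qed.

Lemma inPB a c : inP a -> inP c -> inP (a - c).
Proof.
move=> [ha fa] [hc fc]; split; last exact: fixedB.
by apply/in_block_iff; rewrite mulrBr !in_block_l.
Qed.
Lemma inPM a c : inP a -> inP c -> inP (a * c).
Proof. by move=> [ha fa] [hc fc]; split; [exact: in_blockM|exact: fixedM]. Qed.
Lemma inP_lim a : (forall n, exists2 y, inP y & pdv n (a - y)) -> inP a.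
Proof.
move=> h; split.
  apply/in_block_iff/eqP; rewrite -subr_eq0; apply/eqP.
  apply: (@limit_kernel (fun a => eb * a - a)) => [x y|n x hx|n].
  - by rewrite mulrBr !opprB addrACA [RHS]addrACA; congr (_ + _); rewrite addrC.
  - by apply: pdvB => //; apply: pdvMl.
  - by have [y [yb _] ay] := h n; exists y; rewrite ?in_block_l ?subrr.
move=> u uP; apply: limit_conj => n; have [y [_ yP] ay] := h n.
by exists y => //; apply: yP.
Qed.
Lemma inP_b : inP eb.
Proof. by split; [apply/in_block_iff | exact: fixed_center]. Qed.
Lemma inP_bM a : fixed_by P a -> inP (eb * a).
Proof. by move=> fa; split; [exact: in_block_mulb|apply: fixedM => //; exact: fixed_center]. Qed.
Lemma inP_conj a t : t \in 'N(P)%g -> inP a -> inP (conjd a t).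
Proof. by move=> tN [ha fa]; split; [exact: in_block_conj|exact: fixed_norm]. Qed.

Lemma inZ_trc (H : {group gT}) d : in_block b d -> fixed_by H d -> inZ (trc H d).
Proof.
move=> db dH; split; first exact: trc_center.
by rewrite bC -mulrA bb -trcMz // -bC in_block_l.
Qed.

Lemma unitZ_not_pi a : unitZ a -> ~ pdv 1 a.
Proof.
move=> [y _ ay] pa; case/eqP: b0; apply: (pdv_sep O_cdvr k_residue) => n.
have b1 : pdv 1 eb by rewrite -ay; apply: pdvMr.
elim: n => [|n IHn]; first by exists eb; rewrite scale1r.
by rewrite -bb -[n.+1]add1n; apply: pdvMM.
Qed.

Definition class_sum (C : {set gT}) : OG := \sum_(y in C) 'd y.

Lemma trc_class (D : {group gT}) x : D \subset 'C[x]%g ->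
  trc D ('d x) = #|'C[x]%g : D|%g%:R *: class_sum (x ^: [set: gT])%g.
Proof.
move=> DC; have fD : fixed_by D ('d x).
  by move=> u uD; rewrite !gdeltaM -mulgA -(cent1P (subsetP DC u uD)) mulKg.
have nD := natr_neq0_fraction K_char (cardG_gt0 D).
apply/eqP; rewrite -subr_eq0; apply/eqP/(@gal_tf _ _ #|D|%:R) => //.
apply/eqP; rewrite scalerBr subr_eq0 trc_card // scalerA -natrM Lagrange //.
apply/eqP; rewrite /class_sum scaler_sumr.
rewrite (partition_big (fun g => x ^ g)%g (mem (x ^: [set: gT])%g)) => [|g _]; last first.
  by apply: memJ_class; rewrite inE.
apply: eq_bigr => _ /imsetP[t _ ->].
rewrite (eq_bigr (fun=> 'd (x ^ t)%g)) => [|g /andP[_ /eqP <-]]; last first.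
  by rewrite /conjd !gdeltaM conjgE mulgA.
rewrite sumr_const -scaler_nat; congr (_%:R *: _).
rewrite -[RHS](card_rcoset _ t); apply: eq_card => g.
rewrite [LHS]unfold_in /= mem_rcoset; apply/eqP/cent1P => [E|E].
  by apply/esym/commgP/conjg_fixP; rewrite conjgM E conjgK.
have /commgP/conjg_fixP h : commute x (g * t^-1)%g by exact: esym.
by rewrite -{2}h conjgM conjgKV.
Qed.

(** eb is a combination of class sums, each multiplied by eb. The centre of the block is local, so
    one of the terms is a unit there; its coefficient cannot vanish in k, and its inverse provides
    v. *)
Lemma block_classes : exists x, exists2 v, in_center v &
  red (eb x) != 0 /\ eb = class_sum (x ^: [set: gT])%g * v.
Proof.
have bcl x g : eb (x ^ g)%g = eb x.
  have /center_conj/(_ g^-1%g) bg := bC.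
  by rewrite -{2}bg conjdE invgK.
have csC x : in_center (class_sum (x ^: [set: gT])%g).
  have nD := natr_neq0_fraction K_char (cardG_gt0 'C[x]%G).
  have := @trc_class ('C[x])%G x (subxx _); rewrite indexgg scale1r => <-.
  apply: trc_center => u uD; rewrite !gdeltaM -mulgA -(cent1P uD) mulKg //.
have bE : eb = \sum_(C in classes [set: gT]) (eb (repr C) *: class_sum C) * eb.
  rewrite -mulr_suml; rewrite -[LHS]bb; congr (_ * _); rewrite {1}[LHS]galg_sum.
  have [/eqP cov tr _] := and3P (classes_partition [set: gT]).
  rewrite (eq_bigl (mem (cover (classes [set: gT]%G)))) => [|g]; last by rewrite cov !inE.
  rewrite big_trivIset //; apply: eq_bigr => _ /imsetP[x _ ->].
  rewrite /class_sum scaler_sumr; apply: eq_bigr => _ /imsetP[t _ ->].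
  have /imsetP[s _ ->] := mem_repr x (class_refl [set: gT] x).
  by rewrite !bcl.
have inF C : C \in classes [set: gT]%g -> inZ ((eb (repr C) *: class_sum C) * eb).
  case/imsetP=> x _ ->; have hZ : in_center ((eb (repr (x ^: [set: gT])%g) *: class_sum (x ^: [set: gT])%g) * eb).
    by apply: centerM => // y; rewrite -scalerAl -scalerAr csC.
  by split=> //; rewrite -2!mulrA bb bC -mulrA bb.
have bprim := block_primitive b.
have := unit_e_e bprim; rewrite {2}bE.
case/(unit_e_sum O_cdvr k_residue p_prime k_char O_fg centerB centerM center_lim bprim inF) => C /imsetP[x _ CE] hu.
have hnp := unitZ_not_pi hu; case: hu => v [vC _] vE.
exists x, (eb (repr C) *: (eb * v)).
  by move=> y; rewrite -scalerAl -scalerAr (centerM bC vC).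
split; last by rewrite -CE -[LHS]vE -!scalerAl -scalerAr mulrA.
apply/eqP => rx; apply: hnp.
have [s _ rE] : exists2 s, s \in [set: gT] & repr C = (x ^ s)%g.
  by apply/imsetP; rewrite CE; apply: (mem_repr x (class_refl _ x)).
have [z bz] : dvd_in pi (eb (repr C)) by rewrite rE bcl; apply/(red0P k_residue).
by exists (z *: class_sum C * eb); rewrite bz -!scalerAl scalerA expr1.
Qed.

Lemma fixed_scale (H : {group gT}) r a : fixed_by H a -> fixed_by H (r *: a).
Proof. by move=> h u uH; rewrite -scalerAr -scalerAl h. Qed.

(** By [brz_trc] some coset of D must be fixed by P, and a fixed coset of t means that P lies in the
    conjugate of D by t. *)
Lemma defect_fixed (D : {group gT}) d : fixed_by D d -> ~ brz red P (trc D d) ->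
  exists t, (P \subset D :^ t)%g.
Proof.
move=> dD nb; have h := brz_trc red k_char defect_pgroup dD.
have [E0|[C]] := set_0Vmem 'Fix_(rcosets D [set: gT] | 'Rs)(P)%g.
  by case: nb; move: h; rewrite E0 big_set0 subr0.
case/setIP=> /rcosetsP[t _ ->] /afixP fx; exists t.
apply/subsetP => u uP; have := fx u uP; rewrite /= rcosetE -rcosetM => E.
have : (t * u)%g \in (D :* t)%g by rewrite -E rcoset_refl.
by rewrite mem_rcoset mem_conjg conjgE invgK mulgA.
Qed.

Lemma trc_conj (H : {group gT}) d t : fixed_by H d -> fixed_by (H :^ t)%G (conjd d t) /\
  trc (H :^ t)%G (conjd d t) = trc H d.
Proof.
move=> dH; have dHt : fixed_by (H :^ t)%G (conjd d t).
  move=> u; rewrite mem_conjg => uH.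
  rewrite -/(conjd _ u) -conjdM (conjgCV t u) conjdM (fixed_conjd dH) //.
split=> //; apply/eqP; rewrite -subr_eq0; apply/eqP/(@gal_tf _ _ #|H|%:R).
  exact: (natr_neq0_fraction K_char (cardG_gt0 H)).
apply/eqP; rewrite scalerBr subr_eq0 trc_card // -(cardJg H t) -/(#|(H :^ t)%G|) trc_card //.
rewrite [X in _ == X](reindex_inj (mulgI t)) /=; apply/eqP; apply: eq_bigr => g _.
by rewrite conjdM.
Qed.

(** Take x from [block_classes] and D a Sylow p-subgroup of its centraliser. The trace of x from D
    is the class sum times an index prime to p, so eb is a trace from D and P lies in a conjugate of
    D. Conversely the conjugate of x is centralised by that conjugate of D and has a nonzero
    coefficient in eb, so maximality of P gives equality. *)
Lemma defect_trace : exists c, inP c /\ trc P c = eb.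
Proof.
have [x [v vC [bx bE]]] := block_classes.
have [D sylD] := Sylow_exists p 'C[x]%G.
have [DC pD cD] := and3P sylD.
have fx : fixed_by D ('d x).
  by move=> u uD; rewrite !gdeltaM -mulgA -(cent1P (subsetP DC u uD)) mulKg.
have rm : red (#|'C[x]%g : D|%g%:R) != 0.
  rewrite rmorph_nat -(dvdn_pcharf k_char) -prime_coprime // coprime_sym.
  by move: cD; rewrite p'natE // => h; rewrite coprime_sym prime_coprime.
have mU : (#|'C[x]%g : D|%g%:R : O) \is a GRing.unit by rewrite (unit_red O_cdvr k_residue).
pose d := #|'C[x]%g : D|%g%:R^-1 *: ('d x * v).
have dD : fixed_by D d by apply: fixed_scale; apply: fixedM => //; apply: fixed_center.
have trd : trc D d = eb.
  have wC : in_center (#|'C[x]%g : D|%g%:R^-1 *: v) by move=> y; rewrite -scalerAl -scalerAr vC.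
  by rewrite /d scalerAr trcMz // trc_class // -scalerAr -scalerAl scalerA mulVr // scale1r -bE.
have [t PD] : exists t, (P \subset D :^ t)%g by apply: (defect_fixed dD); rewrite trd; apply: defect_Br.
have PE : P = (D :^ t)%G.
  apply/esym/group_inj; apply: (maxgroupP P_defect).2 => //.
  rewrite pgroupJ pD /=; apply/eqP => /brzP h.
  have xC : (x ^ t)%g \in 'C((D :^ t)%G)%g.
    by rewrite /= centJ memJ_conjg -sub_cent1.
  have := h _ xC; have /center_conj/(_ t) bg := bC.
  rewrite -{1}bg conjdE conjgK => E; by rewrite E eqxx in bx.
have [fc trc'] := trc_conj t dD.
exists (eb * conjd d t); split; first by apply: inP_bM; rewrite PE.
rewrite PE.
by rewrite bC trcMz // trc' trd bb.
Qed.

(** The matrix of left multiplication by a over k. Its rank drops when an idempotent is split, which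
    provides a minimal choice in [source_trace]. *)
Definition redmx a : 'M[k]_#|gT| :=
  \matrix_(i, j) red (a (enum_val i * (enum_val j)^-1)%g).

Lemma redmxM a c : redmx (a * c) = redmx a *m redmx c.
Proof.
apply/matrixP => i j; rewrite !mxE ffunE rmorph_sum /=.
under [RHS]eq_bigr => l _ do rewrite !mxE.
rewrite [RHS](reindex (@enum_rank gT)) /=; last first.
  by exists enum_val => [x _|x _]; rewrite ?enum_rankK ?enum_valK.
rewrite (reindex_inj (mulgI (enum_val i))) /= (reindex_inj invg_inj) /=.
apply: eq_bigr => y _; rewrite rmorphM !enum_rankK invMg invgK.
by rewrite mulgA mulgKV.
Qed.

Lemma idem_pi_zero (f : OG) : f * f = f -> pdv 1 f -> f = 0.
Proof.
move=> ff f1; apply: (pdv_sep O_cdvr k_residue) => n.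
elim: n => [|n IHn]; first by exists f; rewrite scale1r.
by rewrite -ff -[n.+1]add1n; apply: pdvMM.
Qed.

Lemma redmx0 a : redmx a = 0 -> pdv 1 a.
Proof.
move=> a0; apply/pdv_coef => x; rewrite expr1; apply/(red0P k_residue).
have /matrixP/(_ (enum_rank x) (enum_rank 1%g)) := a0.
by rewrite !mxE !enum_rankK invg1 mulg1.
Qed.

Lemma idem_rank (f1 f2 : OG) : f1 * f1 = f1 -> f2 * f2 = f2 -> f1 * f2 = 0 -> f2 * f1 = 0 ->
  (\rank (redmx (f1 + f2)%R) <= \rank (redmx f1))%N -> f2 = 0.
Proof.
move=> h1 h2 h12 h21 hr; apply: idem_pi_zero => //; apply: redmx0.
have sub1 : (redmx f1 <= redmx (f1 + f2)%R)%MS.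
  by have {1}-> : f1 = f1 * (f1 + f2); [rewrite mulrDr h1 h12 addr0|rewrite redmxM submxMl].
have /submxP[X XE] : (redmx (f1 + f2)%R <= redmx f1)%MS.
  by rewrite -(mxrank_leqif_sup sub1) eqn_leq hr mxrankS.
have -> : f2 = (f1 + f2) * f2 by rewrite mulrDl h12 h2 add0r.
rewrite redmxM XE -mulmxA -redmxM h12.
have -> : redmx 0 = 0 by apply/matrixP => x y; rewrite !mxE ffunE rmorph0.
by rewrite mulmx0.
Qed.

Lemma inPD a c : inP a -> inP c -> inP (a + c).
Proof.
move=> ha hc; rewrite -[c]opprK -[- c]sub0r; apply: inPB => //; apply: inPB => //.
by rewrite -(subrr a); apply: inPB.
Qed.

Section Source.
Variable i : OG.
Hypotheses (i_prim : primitive_idempotent inP i) (i_Br : ~ brz red P i).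

Let ii : i * i = i. Proof. by case: i_prim. Qed.
Let iP : inP i. Proof. by case: i_prim. Qed.

Definition unitI a := unit_e inP i a.
Definition inI a := in_e inP i a.

Lemma inIE a : inP a -> inI (i * a * i).
Proof.
by move=> ha; split; [apply: inPM => //; apply: inPM|rewrite -!mulrA ii !mulrA ii].
Qed.
Lemma unitI_Br a : inI a -> unitI a -> ~ brz red P a.
Proof.
move=> [[_ fa] _] [y [[_ fy] _] ay] h; apply: i_Br; rewrite -ay.
by apply: (brzMl k_char defect_pgroup) => //; apply: fixed_pfix.
Qed.

Lemma unitI_D a c : inI a -> inI c -> unitI (a + c) -> unitI a \/ unitI c.
Proof.
apply: (unit_eD O_cdvr k_residue p_prime k_char O_fg inPB inPM inP_lim i_prim).
Qed.

(** The trace from P given by [defect_trace] is unrelated to i. An idempotent f0 of minimal rank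
    through which such a trace passes is primitive, and comparison of Brauer images shows that it is
    associate to an N(P)-conjugate of i, which carries the trace over to i. *)
Lemma source_trace : exists d e, [/\ inP d, inP e & trc P (d * i * e) = eb].
Proof.
pose good f := [/\ inP f, f * f = f & exists2 c, inP c & unitZ (trc P (c * f))].
have bprim := block_primitive b.
have [f0 gf0 fmin] : exists2 f, good f & forall f', good f' -> (\rank (redmx f) <= \rank (redmx f'))%N.
  have [c [cP tc]] := defect_trace.
  have gb : good eb.
    split=> //; first exact: inP_b.
    by exists c => //; rewrite trcMz // tc bb; apply: (unit_e_e bprim).
  have ex : exists n, `[< exists2 f, good f & \rank (redmx f) = n >].
    by exists (\rank (redmx eb)); apply/asboolP; exists eb.
  case: (ex_minnP ex) => n /asboolP[f gf fn] nmin; exists f => // f' gf'.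
  by rewrite fn; apply: nmin; apply/asboolP; exists f'.
have [f0P ff [c1 c1P c1u]] := gf0.
have inZt c f : inP c -> inP f -> inZ (trc P (c * f)).
  by move=> hc hf; apply: inZ_trc; have [] := inPM hc hf.
have f0_prim : primitive_idempotent inP f0.
  split=> //.
    apply/eqP => f00; apply: (unitZ_not_pi c1u); rewrite f00 mulr0.
    rewrite /trc big1 => [|C _]; first exact: pdv0.
    by rewrite /conjd mulr0 mul0r.
  move=> f g fP gP ff' gg' fg gf E.
  have : unitZ (trc P (c1 * f) + trc P (c1 * g)) by rewrite -trcD -mulrDr -E.
  case/(unit_eD O_cdvr k_residue p_prime k_char O_fg centerB centerM center_lim bprim); try exact: inZt.
    move=> hu; right; apply: (@idem_rank f g) => //; rewrite -E; apply: fmin.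
    by split=> //; exists c1.
  move=> hu; left; apply: (@idem_rank g f) => //; rewrite addrC -E; apply: fmin.
  by split=> //; exists c1.
have [v hv bv] := c1u; have [vC _] := hv.
pose c2 := c1 * v; pose h := c2 * f0.
have c2P : inP c2.
  by split; [apply: in_blockM; case: c1P|apply: fixedM; [case: c1P|exact: fixed_center]].
have hP : inP h by apply: inPM.
have tr2 : trc P h = eb.
  by rewrite /h /c2 -mulrA vC mulrA trcMz.
pose Fx := 'Fix_(rcosets P [set: gT] | 'Rs)(P)%g.
have FxN C : C \in Fx -> repr C \in 'N(P)%g.
  rewrite /Fx afixRs_rcosets => /rcosetsP[t /setIP[_ tN] ->].
  have /rcosetP[u uP ->] := mem_repr_rcoset P t.
  by apply: groupM => //; apply: (subsetP (normG P)).
have conjP C : C \in Fx -> inP (conjd h (repr C)) by move/FxN => tN; apply: inP_conj.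
have FP : inP (\sum_(C in Fx) conjd h (repr C)).
  elim/big_ind: _ => [|x y|C]; [|exact: inPD|exact: conjP].
  by rewrite -(subrr i); apply: inPB.
pose X0 := trc P h - \sum_(C in Fx) conjd h (repr C).
have X0P : inP X0 by apply: inPB => //; rewrite tr2; apply: inP_b.
have X0z : brz red P (i * X0 * i).
  have pf a : inP a -> pfix red P a by case=> _ fa; apply: fixed_pfix.
  apply: (brzMl k_char defect_pgroup); [by apply: pf; apply: inPM | exact: pf|].
  apply: (brzMr k_char defect_pgroup); [exact: pf|exact: pf|].
  by apply: (brz_trc red k_char defect_pgroup); case: hP.
(* Modulo the Brauer kernel the trace of h reduces to the conjugates of h by elements of N(P). The
   corner of i is local and no unit of it lies in the Brauer kernel, so one of these conjugates is
   invertible in the corner. *)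
have iE : i = i * X0 * i + i * (\sum_(C in Fx) conjd h (repr C)) * i.
  rewrite -mulrDl -mulrDr /X0 subrK tr2.
  by have [ib _] := iP; rewrite -mulrA in_block_l.
have : unitI i by apply: (unit_e_e i_prim).
rewrite {1}iE => u1.
have [hu|] := unitI_D (inIE X0P) (inIE FP) u1; first by case: (unitI_Br (inIE X0P) hu).
rewrite mulr_sumr mulr_suml.
have iI C : C \in Fx -> inI (i * conjd h (repr C) * i) by move=> /conjP; apply: inIE.
case/(unit_e_sum O_cdvr k_residue p_prime k_char O_fg inPB inPM inP_lim i_prim iI) => C CF.
have tN := FxN C CF; set t := repr C in tN * => -[y yI iy].
have tN' : t^-1%g \in 'N(P)%g by rewrite groupV.
pose i' := conjd i t^-1%g; pose y' := conjd y t^-1%g.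
have i'P : inP i' by apply: inP_conj.
have y'P : inP y' by apply: inP_conj => //; case: yI.
have i'E : i' * i' = i' by rewrite -conjdMM ii.
pose X := i' * c2; pose Y := i' * y'.
have XP : inP X by apply: inPM.
have YP : inP Y by apply: inPM.
(* A and B factor i' through f0. The product in the other order is a nonzero idempotent in the
   corner of the primitive f0, hence equal to f0, and i' and f0 are associate. *)
pose A := X * f0; pose B := f0 * Y.
have AP : inP A by apply: inPM.
have BP : inP B by apply: inPM.
have AB : A * B = i'.
  rewrite /A /B mulrA -(mulrA X) ff /X /Y /i' /y' -(mulrA _ c2) -/h -[h](conjdK _ t) -!conjdMM.
  by congr (conjd _ _); rewrite mulrA.
have iA : i' * A = A by rewrite /A mulrA /X (mulrA i' i') i'E.
have qI : in_e inP f0 (B * A).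
  by split; [apply: inPM|rewrite /A /B !mulrA ff -!mulrA ff].
have qq : B * A * (B * A) = B * A by rewrite mulrA -(mulrA B) AB -mulrA iA.
have [q0|qE] := prim_idem inPB f0_prim qI qq.
  have i'0 : i' = 0 by rewrite -i'E -{1}AB -AB -mulrA (mulrA B) q0 mul0r mulr0.
  by case: i_prim => _ _ /eqP[]; rewrite -[i](conjdKV _ t) -/i' i'0 /conjd mulr0 mul0r.
exists (conjd (c2 * B) t), (conjd A t); split; [by apply: inP_conj => //; apply: inPM|exact: inP_conj|].
have -> : conjd (c2 * B) t * i * conjd A t = conjd h t.
  by rewrite -[i in LHS](conjdKV _ t) -!conjdMM -/i' /h -(mulrA _ i') iA -mulrA qE.
have [_ tr] := trc_conj t (proj2 hP).
have PE : (P :^ t)%G = P by apply: group_inj; apply/normP.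
by rewrite -tr2 -tr PE.
Qed.
End Source.
End BlockTheory.

(** * Equivariant endomorphisms of the group algebra *)

Section FixedVector.
Variables (gT : finGroupType) (p : nat) (V : zmodType) (N W : V -> Prop) (act : gT -> V -> V).
Variable P : {group gT}.
Hypotheses (p_pr : prime p) (pP : (p.-group P)%g).
Hypothesis N0 : N 0.
Hypothesis NB : forall x y, N x -> N y -> N (x - y).
Hypothesis Np : forall v, N (v *+ p).
Hypothesis actD : forall u, {morph act u : x y / x + y}.
Hypothesis actN : forall u v, u \in P -> N v -> N (act u v).
Hypothesis act1 : forall v, act 1%g v = v.
Hypothesis actM : forall u w v, u \in P -> w \in P -> act (u * w)%g v = act u (act w v).
Hypothesis W0 : W 0.
Hypothesis WD : forall x y, W x -> W y -> W (x + y).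
Hypothesis Wact : forall u v, u \in P -> W v -> W (act u v).

Let eqN x y := N (x - y).
Let ND x y : N x -> N y -> N (x + y).
Proof. by move=> hx hy; rewrite -[y]opprK -[- y]sub0r; apply: NB => //; apply: NB. Qed.
Let eqN_trans y x z : eqN x y -> eqN y z -> eqN x z.
Proof. by move=> h1 h2; rewrite /eqN -[x](subrK y) -addrA; apply: ND. Qed.
Let eqN_sym x y : eqN x y -> eqN y x.
Proof. by move=> h; rewrite /eqN -opprB -sub0r; apply: NB. Qed.
Let act0 u : act u 0 = 0.
Proof. by apply: (addrI (act u 0)); rewrite -actD !addr0. Qed.
Let actB u x y : act u (x - y) = act u x - act u y.
Proof. by apply: (addIr (act u y)); rewrite subrK -actD subrK. Qed.
Let actMn u x n : act u (x *+ n) = act u x *+ n.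
Proof. by elim: n => [|n IHn]; rewrite ?act0 // !mulrSr actD IHn. Qed.
Let act_sum u n (F : 'I_n -> V) : act u (\sum_l F l) = \sum_l act u (F l).
Proof. exact: (big_morph _ (actD u) (act0 u)). Qed.
Let act_eqN u x y : u \in P -> eqN x y -> eqN (act u x) (act u y).
Proof. by move=> uP h; rewrite /eqN -actB; apply: actN. Qed.
Let NMn x n : N x -> N (x *+ n).
Proof. by move=> h; elim: n => // n IHn; rewrite mulrSr; apply: ND. Qed.
Let N_sum n (F : 'I_n -> V) : (forall l, N (F l)) -> N (\sum_l F l).
Proof. by move=> h; elim/big_ind: _. Qed.

(** V modulo N need not be finite, so orbits are not counted; the group fixing the vector modulo N
    is enlarged one central element at a time. W is closed under sums but not under differences,
    which limits the combinations allowed. *)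
Lemma pgroup_fixed_vector v : W v -> ~ N v ->
  exists v', [/\ W v', ~ N v' & forall u, u \in P -> N (act u v' - v')].
Proof.
move=> Wv Nv.
suff main n (K : {group gT}) : (#|P| - #|K| <= n)%N -> (K <| P)%g ->
    forall v, W v -> ~ N v -> (forall u, u \in K -> eqN (act u v) v) ->
    exists v', [/\ W v', ~ N v' & forall u, u \in P -> N (act u v' - v')].
  apply: (main #|P| 1%G _ (normal1 P) v) => //; first exact: leq_subr.
  by move=> u /set1P->; rewrite act1 /eqN subrr.
elim: n K => [|n IHn] K PK nKP {Wv Nv}v Wv Nv Kv.
  have KE : K = P.
    by apply/eqP; rewrite -val_eqE eqEcard (normal_sub nKP) /= -subn_eq0 -leqn0.
  by exists v; split=> // u uP; apply: Kv; rewrite KE.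
have [KE|KP] := eqVneq (K : {set gT}) P.
  by exists v; split=> // u uP; apply: Kv; rewrite KE.
have [z [zP zK zpK zC]] := chief_step p_pr pP nKP KP.
have sKP := normal_sub nKP.
(* Pascal's rule shows that [act z^-1] moves [w j.+1] by [w j] minus a multiple of 'C(p, j.+1),
   which p divides. Hence the first [w j] outside N is fixed by z modulo N; one exists since
   [w p.-1] is a translate of v. The coefficients are natural numbers, so the [w j] stay in W. *)
pose w j := \sum_(l < p) act (z ^+ l)%g v *+ 'C(l, j).
have zX l : (z ^+ l)%g \in P by apply: groupX.
have Ww j : W (w j).
  rewrite /w; elim/big_ind: _ => // l _; elim: 'C(l, j) => // c IHc.
  by rewrite mulrSr; apply: WD => //; apply: Wact.
have wK j u : u \in K -> eqN (act u (w j)) (w j).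
  move=> uK; rewrite /eqN /w act_sum -sumrB; apply: N_sum => l.
  rewrite actMn -mulrnBl; apply: NMn.
  have uP := subsetP sKP u uK.
  have uzK : (u ^ (z ^+ l))%g \in K by rewrite memJ_norm // (subsetP (normal_norm nKP)).
  rewrite -actM // conjgC actM //; last exact: (subsetP sKP).
  by apply: act_eqN => //; apply: Kv.
have p_gt0 := prime_gt0 p_pr.
have p1 : (p.-1 < p)%N by rewrite prednK.
have wp : ~ N (w p.-1).
  rewrite /w (bigD1 (Ordinal p1)) //= binn mulr1n big1 ?addr0 => [h|l lp]; last first.
    rewrite bin_small // ltn_neqAle -ltnS prednK // ltn_ord andbT.
    by apply: contra lp => /eqP lp; apply/eqP/val_inj.
  by apply: Nv; rewrite -[v]act1 -(mulVg (z ^+ p.-1)%g) actM ?groupV //; apply: actN; rewrite ?groupV.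
have [j jN jmin] : exists2 j, ~ N (w j) & forall i, (i < j)%N -> N (w i).
  have ex : exists j, `[< ~ N (w j) >] by exists p.-1; apply/asboolP.
  case: (ex_minnP ex) => j /asboolP jN jmin; exists j => // i ij.
  by apply: contrapT => h; have := jmin i (asboolT h); rewrite leqNgt ij.
have zVP : z^-1%g \in P by rewrite groupV.
have zw : eqN (act z^-1%g (w j)) (w j).
  have E : act z^-1%g (w j) = act z^-1%g v *+ 'C(0, j) +
      \sum_(l < p.-1) act (z ^+ l)%g v *+ 'C(l.+1, j).
    rewrite act_sum -(big_mkord xpredT (fun l => act z^-1%g (act (z ^+ l)%g v *+ 'C(l, j)))).
    rewrite -{1}(prednK p_gt0) big_nat_recl // actMn expg0 act1 big_mkord; congr (_ + _).
    by apply: eq_bigr => l _; rewrite actMn -actM // expgS mulKg.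
  have E2 m : w m = \sum_(l < p.-1) act (z ^+ l)%g v *+ 'C(l, m) + act (z ^+ p.-1)%g v *+ 'C(p.-1, m).
    rewrite /w -(big_mkord xpredT (fun l => act (z ^+ l)%g v *+ 'C(l, m))).
    by rewrite -{1}(prednK p_gt0) big_nat_recr //= big_mkord.
  case: j jN jmin E => [|j] jN jmin E.
    rewrite /eqN; have -> : act z^-1%g (w 0%N) - w 0%N = act z^-1%g v - act (z ^+ p.-1)%g v.
      rewrite E E2 !bin0 !mulr1n opprD addrACA.
      have -> : \sum_(l < p.-1) act (z ^+ l)%g v *+ 'C(l.+1, 0) =
         \sum_(l < p.-1) act (z ^+ l)%g v *+ 'C(l, 0) by apply: eq_bigr => l _; rewrite !bin0.
      by rewrite addrA subrK.
    have -> : act (z ^+ p.-1)%g v = act z^-1%g (act (z ^+ p)%g v).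
      by rewrite -actM // -{2}(prednK p_gt0) expgS mulKg.
    by apply: eqN_sym; apply: act_eqN => //; apply: Kv.
  have jp : (j.+1 < p)%N.
    by rewrite ltnNge; apply/negP => pj; apply: wp; apply: jmin; rewrite prednK.
  rewrite /eqN; have -> : act z^-1%g (w j.+1) - w j.+1 = w j - act (z ^+ p.-1)%g v *+ 'C(p, j.+1).
    rewrite E bin0n mulr0n add0r (E2 j) (E2 j.+1).
    have -> : 'C(p, j.+1) = ('C(p.-1, j.+1) + 'C(p.-1, j))%N by rewrite -[in LHS](prednK p_gt0) binS.
    under eq_bigr => l _ do rewrite binS mulrnDr.
    rewrite big_split /= mulrnDr !opprD [LHS]addrACA subrr add0r.
    by rewrite [RHS]addrACA subrr addr0.
  apply: NB; first exact: jmin.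
  have /dvdnP[m ->] : (p %| 'C(p, j.+1))%N by apply: prime_dvd_bin.
  by rewrite mulrnA; apply: Np.
pose St := [set u in P | `[< eqN (act u (w j)) (w j) >]].
have gSt : group_set St.
  apply/group_setP; split=> [|u u']; first by rewrite inE group1 /=; apply/asboolP; rewrite act1 /eqN subrr.
  rewrite !inE => /andP[uP /asboolP h] /andP[u'P /asboolP h']; rewrite groupM //=.
  apply/asboolP; rewrite actM //; apply: eqN_trans h; exact: act_eqN.
pose K1 := (<[z]> <*> K)%G.
have K1St : K1 \subset Group gSt.
  rewrite join_subG cycle_subG; apply/andP; split.
    by rewrite -groupV /= inE zVP; apply/asboolP.
  by apply/subsetP => u uK; rewrite /= inE (subsetP sKP u uK); apply/asboolP/wK.
have sKK1 : K \subset K1 by apply: joing_subr.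
have zK1 : z \in K1 by rewrite (subsetP (joing_subl _ _)) ?cycle_id.
have nK1P : (K1 <| P)%g.
  rewrite /normal join_subG cycle_subG zP sKP /=; apply/subsetP => u uP; rewrite inE.
  rewrite -genJ gen_subG conjUg subUset; apply/andP; split; last first.
    by rewrite (normP (subsetP (normal_norm nKP) _ uP)) sub_gen ?subsetUr.
  by rewrite -cycleJ cycle_subG conjg_mulR groupM // (subsetP sKK1) // zC.
apply: (IHn K1) nK1P _ (Ww j) jN _; last first.
  by move=> u /(subsetP K1St); rewrite inE => /andP[_ /asboolP].
have cK : (#|K| < #|K1|)%N.
  by apply: proper_card; rewrite properE sKK1; apply/subsetPn; exists z.
by move: PK; rewrite !leq_subLR addnS => /leq_trans; apply; rewrite -addSn leq_add2r.
Qed.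
End FixedVector.

Section Equivariant.
Variables (O : idomainType) (pi : O) (k : fieldType) (red : {rmorphism O -> k}).
Hypotheses (O_cdvr : complete_dvr pi) (k_residue : residue_map pi red).
Variable p : nat.
Hypotheses (p_prime : prime p) (k_char : p \in [pchar k]) (O_fg : fg_over_padic p O).
Variables (gT : finGroupType) (P : {group gT}).
Hypothesis pP : (p.-group P)%g.
Local Notation OG := (galg O gT).
Local Notation "''d' g" := (gdelta O (g : gT)) (at level 8, g at level 2, format "''d' g").
Implicit Types a c d : OG.
Local Notation pdv := (pdv pi).

Definition lin_map (T : OG -> OG) :=
  {morph T : x y / x + y} /\ forall r a, T (r *: a) = r *: T a.

Lemma lin_map0 T : lin_map T -> T 0 = 0.
Proof. by case=> TD _; apply: (addrI (T 0)); rewrite -TD !addr0. Qed.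
Lemma lin_mapB T x y : lin_map T -> T (x - y) = T x - T y.
Proof. by case=> TD _; apply: (addIr (T y)); rewrite subrK -TD subrK. Qed.
Lemma lin_map_pdv T n a : lin_map T -> pdv n a -> pdv n (T a).
Proof. by move=> [_ TZ] [w ->]; exists (T w); rewrite TZ. Qed.

(** The iterates of T on a vector repeat modulo [pi]; cancelling T, which is injective modulo [pi],
    shows that T is surjective modulo [pi], and successive approximation gives surjectivity. *)
Lemma inj_pi_bij T : lin_map T -> (forall a, pdv 1 (T a) -> pdv 1 a) ->
  exists W, [/\ lin_map W, cancel T W & cancel W T].
Proof.
move=> Tl Ti; have [TD TZ] := Tl.
have Tinj0 a : T a = 0 -> a = 0.
  move=> Ta; apply: (pdv_sep O_cdvr k_residue) => n; elim: n => [|n [w wE]].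
    by exists a; rewrite scale1r.
  have Tw : T w = 0.
    apply: (@gal_tf _ _ (pi ^+ n)); first by rewrite expf_neq0 // (pi_neq0 O_cdvr).
    by rewrite -TZ -wE.
  have [v vE] : pdv 1 w by apply: Ti; rewrite Tw; apply: pdv0.
  by exists v; rewrite wE vE scalerA expr1 -exprSr.
have /choice[B BE] : forall a, exists c, pdv 1 (a - T c).
  move=> a; have [m [d md]] := gal_pigeon k_residue p_prime k_char O_fg (fun n => iter n T a).
  exists (iter d T a); elim: m md => [|m IHm] md; first by rewrite add0n iterS in md.
  apply: IHm; apply: Ti; rewrite (lin_mapB _ _ Tl); exact: md.
have /choice[C CE] : forall a, exists c, a - T (B a) = pi *: c by move=> a; have [c] := BE a; rewrite expr1; exists c.
have Tsurj a : exists c, T c = a.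
  pose s n := \sum_(j < n) pi ^+ j *: B (iter j C a).
  have sE n : a - T (s n) = pi ^+ n *: iter n C a.
    elim: n => [|n IHn]; first by rewrite /s big_ord0 (lin_map0 Tl) subr0 scale1r.
    rewrite /s big_ord_recr /= TD opprD addrA -/(s n) IHn TZ -scalerBr CE scalerA.
    by rewrite exprS mulrC.
  have s1 n : pdv n (s n.+1 - s n).
    have -> : s n.+1 - s n = pi ^+ n *: B (iter n C a).
      by rewrite /s big_ord_recr /= [_ + _ - _]addrC addKr.
    by exists (B (iter n C a)).
  have [l lE] := gal_lim O_cdvr s1; exists l.
  apply: (@gal_lim_uniq _ _ _ _ O_cdvr k_residue _ _ _ (fun n => T (s n))) => n.
    by rewrite -(lin_mapB _ _ Tl); apply: lin_map_pdv.
  by rewrite sE; exists (iter n C a).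
have /choice[W WE] := Tsurj.
have TW : cancel T W.
  move=> a; apply/eqP; rewrite -subr_eq0; apply/eqP/Tinj0.
  by rewrite (lin_mapB _ _ Tl) WE subrr.
exists W; split=> //; split=> [x y|r x]; apply: (can_inj TW).
  by rewrite TD !WE.
by rewrite TZ !WE.
Qed.

Definition bi_equi (T : OG -> OG) :=
  lin_map T /\ forall u v a, u \in P -> v \in P -> T ('d u * a * 'd v) = 'd u * T a * 'd v.

Lemma bi_equi_id : bi_equi id. Proof. by []. Qed.
Lemma bi_equi_comp T T' : bi_equi T -> bi_equi T' -> bi_equi (fun a => T (T' a)).
Proof.
move=> [[TD TZ] TP] [[TD' TZ'] TP']; split; first split=> [x y|r x].
- by rewrite TD' TD.
- by rewrite TZ' TZ.
- by move=> u v a uP vP; rewrite TP' // TP.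
Qed.
Lemma bi_equiD T T' : bi_equi T -> bi_equi T' -> bi_equi (fun a => T a + T' a).
Proof.
move=> [[TD TZ] TP] [[TD' TZ'] TP']; split; first split=> [x y|r x].
- by rewrite TD' TD addrACA.
- by rewrite TZ' TZ scalerDr.
- by move=> u v a uP vP; rewrite TP' // TP // mulrDr mulrDl.
Qed.
Lemma bi_equiB T T' : bi_equi T -> bi_equi T' -> bi_equi (fun a => T a - T' a).
Proof.
move=> [[TD TZ] TP] [[TD' TZ'] TP']; split; first split=> [x y|r x].
- by rewrite TD' TD opprD addrACA.
- by rewrite TZ' TZ scalerBr.
- by move=> u v a uP vP; rewrite TP' // TP // mulrBr mulrBl.
Qed.
Lemma bi_equi_inv T W : bi_equi T -> lin_map W -> cancel T W -> cancel W T -> bi_equi W.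
Proof.
move=> [_ TP] Wl TW WT; split=> // u v a uP vP; apply: (can_inj TW).
by rewrite TP // !WT.
Qed.

Definition bi_fixed a := forall u v, u \in P -> v \in P -> pdv 1 ('d u * a * 'd v - a).

(** The kernel of T modulo [pi] is stable under both actions of P. If it is nonzero it contains a
    vector fixed by both: [pgroup_fixed_vector] is used for the left action and then for the right
    action on left-fixed vectors. *)
Lemma bi_equi_bij T : bi_equi T -> (forall a, bi_fixed a -> pdv 1 (T a) -> pdv 1 a) ->
  exists W, [/\ bi_equi W, cancel T W & cancel W T].
Proof.
move=> TE Tf; have [Tl TP] := TE.
suff Ti a : pdv 1 (T a) -> pdv 1 a.
  have [W [Wl TW WT]] := inj_pi_bij Tl Ti.
  by exists W; split=> //; apply: bi_equi_inv TE Wl TW WT.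
move=> Ta; apply: contrapT => Na.
have Np (v : OG) : pdv 1 (v *+ p).
  have [z zE] := p_in_pi k_residue k_char; rewrite -scaler_nat zE; exists (z *: v).
  by rewrite scalerA expr1.
have pB (x y : OG) : pdv 1 x -> pdv 1 y -> pdv 1 (x - y) by apply: pdvB.
have [a1 [Ta1 Na1 a1P]] := @pgroup_fixed_vector gT p OG (fun a => pdv 1 a) (fun a => pdv 1 (T a))
    (fun u a => 'd u * a) P p_prime pP (pdv0 _ _ _) pB Np
    (fun u x y => mulrDr _ x y) (fun u v _ => @pdvMl _ _ _ _ _ _)
    (fun v => mul1r v) (fun u w v _ _ => etrans (congr1 (fun g => g * v) (esym (gdeltaM O u w))) (esym (mulrA _ _ _)))
    (eq_ind_r _ (pdv0 _ _ _) (lin_map0 Tl))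
    (fun x y hx hy => eq_ind_r _ (pdvD hx hy) (proj1 Tl x y))
    (fun u v uP h => ltac:(by have := TP u 1%g v uP (group1 P); rewrite !mulr1 => ->; apply: pdvMl)) a Ta Na.
pose W a := pdv 1 (T a) /\ forall u, u \in P -> pdv 1 ('d u * a - a).
have r1 v : v * 'd (1^-1)%g = v :> OG by rewrite invg1 mulr1.
have rM u w v : u \in P -> w \in P -> v * 'd ((u * w)^-1)%g = v * 'd (w^-1)%g * 'd (u^-1)%g :> OG.
  by move=> _ _; rewrite invMg -gdeltaM mulrA.
have W0 : W 0 by split=> [|u _]; rewrite ?(lin_map0 Tl) ?mulr0 ?subr0; apply: pdv0.
have WD x y : W x -> W y -> W (x + y).
  move=> [h1 h2] [h3 h4]; split=> [|u uP]; first by rewrite (proj1 Tl); exact: pdvD.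
  by rewrite mulrDr opprD addrACA; apply: pdvD; [exact: h2|exact: h4].
have Wact u v : u \in P -> W v -> W (v * 'd (u^-1)%g).
  move=> uP [h1 h2]; split=> [|w wP]; last by rewrite mulrA -mulrBl; apply: pdvMr; apply: h2.
  by have := TP 1%g u^-1%g v (group1 P) (groupVr uP); rewrite !mul1r => ->; exact: pdvMr.
have [a2 [[Ta2 a2P] Na2 a2Q]] := @pgroup_fixed_vector gT p OG (fun a => pdv 1 a)
    W (fun u a => a * 'd (u^-1)%g) P p_prime pP (pdv0 _ _ _) pB Np
    (fun u x y => mulrDl x y _) (fun u v _ => @pdvMr _ _ _ _ _ _) r1 rM W0 WD Wact
    a1 (conj Ta1 a1P) Na1.
apply: Na2; apply: Tf => // u v uP vP.
apply: (@pdv_trans _ _ _ _ ('d u * a2)); last exact: a2P.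
rewrite -mulrA -mulrBr; apply: pdvMl.
by have := a2Q _ (groupVr vP); rewrite invgK.
Qed.

(** A nontrivial P has no fixed points on the group under right translation, so every orbit of terms
    cancels. *)
Lemma full_trace_brz d : (P :!=: 1)%g -> brz red P (\sum_g conjd d g).
Proof.
move=> P1 x xC; rewrite sum_ffunE rmorph_sum /=.
have h := @sum_fixed_points k p k_char _ _ ('R)%act P [set: gT] (fun g => red (conjd d g x)) pP.
transitivity (\sum_(g in [set: gT]) red (conjd d g x)); first by apply: eq_bigl => g; rewrite inE.
rewrite h.
- rewrite big_pred0 // => g; rewrite inE in_setT /=; apply/negbTE/afixP => fx.
  case/trivgPn: P1 => u uP; apply/negP; rewrite negbK.
  by have /= := fx u uP; rewrite -{2}[g]mulg1 => /mulgI ->.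
- by apply/actsP => u uP y; rewrite !inE.
move=> g u _ uP /=; rewrite conjdM !conjdE.
have xu : (x ^ u)%g = x by rewrite conjgE (centP xC u uP) mulKg.
by rewrite -{1}xu conjgK.
Qed.
End Equivariant.

(** * Automorphisms of a block and characters of the defect group *)

Section BlockAlgebra.
Variables (O : idomainType) (pi : O) (k : fieldType) (red : {rmorphism O -> k}).
Hypotheses (O_cdvr : complete_dvr pi) (k_residue : residue_map pi red).
Variable p : nat.
Hypotheses (p_prime : prime p) (k_char : p \in [pchar k]) (O_fg : fg_over_padic p O).
Hypothesis K_char : [pchar {fraction O}] =i pred0.
Variable zeta : O.
Hypothesis zeta_prim : p.-primitive_root zeta.
Variables (gT : finGroupType) (b : block O gT) (P : {group gT}).
Hypothesis P_defect : defect_group b red p P.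
Hypothesis P_nontrivial : (P :!=: 1)%g.
Local Notation lam := (1 - zeta).
Local Notation OG := (galg O gT).
Local Notation "''d' g" := (gdelta O (g : gT)) (at level 8, g at level 2, format "''d' g").
Local Notation eb := (block_unit b).
Local Notation B := (block_alg b).
Local Notation valB := (@corner_val O (galg O gT) (block_idempotent b)).

Let eb_C : in_center eb. Proof. by case: (block_primitive b). Qed.

Definition toB (a : OG) : B := Corner (in_block_mulb b a).
Definition gam (g : gT) : B := toB ('d g).
Definition tB (x : B) : O := (valB x) 1%g.

Lemma B_in (x : B) : in_block b (valB x). Proof. by case: x. Qed.
Lemma ebl (x : B) : eb * (valB x) = valB x. Proof. exact/in_block_l/B_in. Qed.
Lemma ebr (x : B) : (valB x) * eb = valB x. Proof. by rewrite -eb_C ebl. Qed.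
Lemma valB_inj : injective valB. Proof. exact: val_inj. Qed.
Lemma valB_M (x y : B) : valB (x * y) = valB x * valB y. Proof. by []. Qed.
Lemma galgB (a c : OG) x : (a - c) x = a x - c x. Proof. by rewrite !ffunE. Qed.
Lemma galgD (a c : OG) x : (a + c) x = a x + c x. Proof. by rewrite ffunE. Qed.
Lemma galgZ r (a : OG) x : (r *: a) x = r * a x. Proof. by rewrite ffunE. Qed.
Lemma toB_val (x : B) : toB (valB x) = x.
Proof. by apply: val_inj; rewrite /= ebl. Qed.
Lemma toBM a c : toB (a * c) = toB a * toB c.
Proof.
by apply: val_inj; rewrite /= eb_C -mulrA -eb_C mulrA [RHS]mulrA -(mulrA eb a) -eb_C mulrA -!mulrA (mulrA eb eb) block_idem !mulrA.
Qed.
Lemma toB_D : {morph toB : x y / x + y}.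
Proof. by move=> x y; apply: val_inj; rewrite /= mulrDr. Qed.
Lemma toB_Z r x : toB (r *: x) = r *: toB x.
Proof. by apply: val_inj; rewrite /= -scalerAr. Qed.
Lemma toB1 : toB 1 = 1. Proof. by apply: val_inj; rewrite /= mulr1. Qed.

Lemma val_gaml g (x : B) : valB (gam g * x) = 'd g * (valB x).
Proof. by rewrite /= eb_C -mulrA ebl. Qed.
Lemma val_gamr g (x : B) : valB (x * gam g) = (valB x) * 'd g.
Proof. by rewrite /= mulrA ebr. Qed.
Lemma gam1 : gam 1%g = 1. Proof. exact: toB1. Qed.
Lemma gamM x y : gam (x * y)%g = gam x * gam y.
Proof. by rewrite /gam -gdeltaM toBM. Qed.
Lemma gam_VK g : gam g^-1%g * gam g = 1. Proof. by rewrite -gamM mulVg gam1. Qed.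
Lemma B_sum (x : B) : x = \sum_g (valB x) g *: gam g.
Proof.
rewrite -[LHS]toB_val {1}(galg_sum (valB x)) (big_morph toB toB_D (morphD0 toB_D)).
by apply: eq_bigr => g _; rewrite toB_Z.
Qed.

Lemma B_group_spanned : group_spanned gam tB.
Proof.
split=> [||r x y|x|x]; [exact: gam1|exact: gamM| | |].
- by rewrite /tB /= !ffunE.
- by rewrite {1}[x]B_sum; apply: eq_bigr => g _; rewrite /tB val_gaml gdelta_mull invgK mulg1.
- by rewrite {1}[x]B_sum; apply: eq_bigr => g _; rewrite /tB val_gamr gdelta_mulr invgK mul1g.
Qed.

Let lamJ : forall y, 1 + lam * y \is a GRing.unit.
Proof. exact: (lam_jac O_cdvr k_residue p_prime k_char zeta_prim). Qed.

Lemma unit_cong1 (w : B) : exists y, (1 + lam *: w) * y = 1 /\ y * (1 + lam *: w) = 1.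
Proof.
have [n [e span_e]] : exists (n : nat) (e : 'I_n -> B^o), forall v, exists c : 'I_n -> O, v = \sum_j (c j)%:A *: e j.
  apply: (fg_span B_group_spanned); exists 1%N, (fun=> 1 : B^o) => v; exists (fun=> v).
  by rewrite big_ord1; rewrite -[v *: _]/((v : B) * 1) mulr1.
pose phi (v : B^o) : B^o := (1 + lam *: w) * (v : B).
have [g phiK gK] : bijective phi.
  apply: (cong1_bij lamJ span_e) => [x y|r v|v]; rewrite /phi.
  - exact: mulrDr.
  - by rewrite -![_ *: _ in RHS]/(_ * _) -[X in _ * X]/(r%:A * (v : B)) mulr_algl mulr_algl scalerAr.
  - exists (w * (v : B) : B^o); rewrite mulrDl mul1r; congr (_ + _).
    by rewrite -[RHS]/((lam%:A : B) * (w * v)) mulr_algl scalerAl.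
exists (g 1); have h : (1 + lam *: w) * g 1 = 1 := gK 1.
split=> //; apply: (can_inj phiK); rewrite /phi.
by rewrite mulrA h mul1r mulr1.
Qed.

Variable i : source_idempotent b red P.
Local Notation si := (source_val i).

Let iP : inP b P si. Proof. by case: (source_primitive i). Qed.
Let i_prim : primitive_idempotent (inP b P) si. Proof. exact: source_primitive. Qed.
Let i_Br : ~ brz red P si.
Proof. by move/brzP => h; have := source_Br i; rewrite h eqxx. Qed.
Let pP : (p.-group P)%g. Proof. exact: (defect_pgroup P_defect). Qed.

Definition iB : B := toB si.
Lemma val_iB : valB iB = si. Proof. by rewrite /= in_block_l //; case: iP. Qed.
Lemma iBiB : iB * iB = iB.
Proof.
have ii : si * si = si by case: i_prim.
by apply: valB_inj; rewrite valB_M val_iB ii.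
Qed.

Definition fixB (x : B) := forall u, u \in P -> gam u * x = x * gam u.
Lemma fixB_inP x : fixB x <-> inP b P (valB x).
Proof.
split=> [h|[_ h] u uP].
  split=> [|u uP]; first exact: B_in.
  have /(congr1 valB) := h _ uP; rewrite val_gaml val_gamr => E.
  by rewrite -mulrA -E mulrA gdelta_VK mul1r.
by apply: valB_inj; rewrite val_gaml val_gamr -[valB x in LHS](h u uP) !mulrA gdelta_KV mul1r.
Qed.
Lemma fixB_i : fixB iB. Proof. by apply/fixB_inP; rewrite val_iB. Qed.
Lemma fixB_D x y : fixB x -> fixB y -> fixB (x + y).
Proof. by move=> hx hy u uP; rewrite mulrDr mulrDl hx // hy. Qed.
Lemma fixB_N x : fixB x -> fixB (- x).
Proof. by move=> hx u uP; rewrite mulrN mulNr hx. Qed.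
Lemma fixB_M x y : fixB x -> fixB y -> fixB (x * y).
Proof. by move=> hx hy u uP; rewrite mulrA hx // -mulrA hy // mulrA. Qed.
(* Invertibility in the corner [iB * B * iB]. *)
Definition isu (a : B) := exists y, [/\ iB * y * iB = y, a * y = iB & y * a = iB].

(** The inverse of a P-fixed element in the corner is automatically P-fixed, so invertibility can be
    tested in the local ring of P-fixed points. *)
Lemma isu_unitI a : fixB a -> iB * a * iB = a -> isu a <-> unitI b P si (valB a).
Proof.
move=> fa ia; have inIv (y : B) : fixB y -> iB * y * iB = y -> inI b P si (valB y).
  by move=> /fixB_inP hy /(congr1 valB) /= E; split=> //; rewrite -val_iB.
split=> [[y [yi ay ya]]|[y [[yb yP] yi] ay]].
  have fy : fixB y.
    have yr : y * iB = y by rewrite -yi -!mulrA iBiB.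
    have yl : iB * y = y by rewrite -yi !mulrA iBiB.
    move=> u uP; have : y * gam u * (a * y) = (y * a) * gam u * y.
      by rewrite -!mulrA (mulrA (gam u) a) fa // -!mulrA.
    by rewrite ay ya -mulrA fixB_i // mulrA yr -fixB_i // -mulrA yl.
  exists (valB y); first exact: inIv.
  by rewrite -val_iB -ay.
have yiC : si * y = y * si.
  by rewrite -yi -!mulrA source_idem !mulrA source_idem.
exists (toB y); have yE : valB (toB y) = y by rewrite /= in_block_l.
have ya : y * (valB a) = si.
    have hy : inI b P si y by split.
  exact: (unit_eC (inPB (b := b) (P := P)) (inPM (b := b) (P := P)) i_prim (inIv _ fa ia) hy ay).
by split; apply: valB_inj; rewrite !valB_M ?val_iB yE.
Qed.

Lemma isu_D a c : fixB a -> iB * a * iB = a -> fixB c -> iB * c * iB = c ->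
  isu (a + c) -> isu a \/ isu c.
Proof.
move=> fa ia fc ic.
have inIv (y : B) : fixB y -> iB * y * iB = y -> inI b P si (valB y).
  by move=> /fixB_inP hy /(congr1 valB) /= E; split=> //; rewrite -val_iB.
rewrite isu_unitI; [|exact: fixB_D|by rewrite mulrDr mulrDl ia ic].
rewrite !isu_unitI //.
apply: (unitI_D O_cdvr k_residue p_prime k_char O_fg i_prim); exact: inIv.
Qed.

Lemma isu_i : isu iB. Proof. by exists iB; rewrite !iBiB. Qed.

Lemma isu_cong a c : iB * a * iB = a -> isu c -> iB * c * iB = c -> cg lam a c -> isu a.
Proof.
move=> ia [y [yi cy yc]] ic [w wE].
pose w' := iB * w * iB; have aw : a = c + lam *: w'.
  by rewrite /w' scalerAl scalerAr -wE mulrBr mulrBl ia ic addrC subrK.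
have w'l : iB * w' = w' by rewrite /w' !mulrA iBiB.
have w'r : w' * iB = w' by rewrite /w' -!mulrA iBiB.
have yr : y * iB = y by rewrite -yi -!mulrA iBiB.
have yl : iB * y = y by rewrite -yi !mulrA iBiB.
have cr : c * iB = c by rewrite -ic -!mulrA iBiB.
have [v [v1 v2]] := unit_cong1 (y * w'); set m := 1 + _ in v1 v2.
have aE : a = c * m by rewrite /m mulrDr mulr1 -scalerAr mulrA cy w'l.
have im : iB * m = m * iB.
  by rewrite /m mulrDr mulrDl mulr1 mul1r -scalerAr -scalerAl mulrA yl -mulrA w'r.
have iv : iB * v = v * iB.
  have : v * (iB * m) * v = v * (m * iB) * v by rewrite im.
  by rewrite -!mulrA v1 mulr1 mulrA v2 mul1r => ->.
exists (iB * v * y); split.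
- by rewrite !mulrA iBiB -mulrA yr.
- by rewrite aE -!mulrA (mulrA m iB) -im -!mulrA (mulrA m) v1 mul1r mulrA cr cy.
- by rewrite aE -!mulrA (mulrA y) yc im (mulrA v) v2 mul1r iBiB.
Qed.

Definition brB (x : B) := brz red P (valB x).
Lemma brB_i : ~ brB iB. Proof. by rewrite /brB val_iB. Qed.
Lemma brB_D x y : brB x -> brB y -> brB (x + y). Proof. exact: brzD. Qed.
Lemma brB_lam x : cg lam x 0 -> brB x.
Proof.
move=> [w]; rewrite subr0 => ->; have [z zE] := lam_in_pi O_cdvr k_residue p_prime k_char zeta_prim.
apply: (brz_pi k_residue); exists (valB (z *: w)).
by rewrite zE expr1 /= scalerA.
Qed.

Definition mfix (x : B) := forall u, u \in P -> cg lam (gam u * x) (x * gam u).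

Lemma cg_mull c x y : cg lam x y -> cg lam (c * x : B) (c * y).
Proof. by move=> [w E]; exists (c * w); rewrite -mulrBr E scalerAr. Qed.
Lemma cg_mulr c x y : cg lam x y -> cg lam (x * c : B) (y * c).
Proof. by move=> [w E]; exists (w * c); rewrite -mulrBl E scalerAl. Qed.
Lemma cg_mul x y x' y' : cg lam x y -> cg lam x' y' -> cg lam (x * x' : B) (y * y').
Proof. by move=> h h'; apply: cg_trans (cg_mulr _ h) (cg_mull _ h'). Qed.

Lemma lamE : exists z, lam = pi * z.
Proof. exact: (lam_in_pi O_cdvr k_residue p_prime k_char zeta_prim). Qed.

Lemma mfix_coef x u y : mfix x -> u \in P ->
  exists w, valB x (y ^ u)%g - valB x y = lam * w.
Proof.
move=> h uP; have [w /(congr1 (fun c : B => valB c (u * y ^ u)%g))] := h u uP.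
rewrite -[valB (_ - _)]/(valB (gam u * x) - valB (x * gam u)) val_gaml val_gamr.
rewrite galgB galgZ gdelta_mull gdelta_mulr mulKg => E.
exists (valB w (u * y ^ u)%g).
have uyu : (u * y ^ u * u^-1 = y)%g by rewrite conjgE mulKVg mulgK.
by rewrite -E uyu.
Qed.

Lemma mfix_pfix x : mfix x -> pfix red P (valB x).
Proof.
move=> h u y uP; have [w wE] := mfix_coef y h uP; have [z zE] := lamE.
apply/eqP; rewrite -subr_eq0 -rmorphB wE; apply/eqP/(red0P k_residue).
by exists (z * w); rewrite zE mulrA.
Qed.

Lemma brB_mul x y : mfix x -> mfix y -> brB x -> brB (x * y).
Proof. by move=> hx hy; apply: (brzMl k_char pP); apply: mfix_pfix. Qed.

Lemma isu_brB a a' : mfix a -> mfix a' -> a * a' = iB -> ~ brB a.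
Proof. by move=> ha ha' aa h; apply: brB_i; rewrite -aa; apply: brB_mul. Qed.

(** P permutes the group basis, so an invariant modulo [lam] lifts to an invariant: on each P-class
    all coefficients are replaced by that of one representative. *)
Lemma lift_fixed x : mfix x -> exists2 h, fixB h & cg lam h x.
Proof.
move=> xm; pose h0 : OG := [ffun y => valB x (repr (y ^: P)%g)].
have /choice[w wE] : forall y, exists w, h0 y - valB x y = lam * w.
  move=> y; rewrite ffunE; have /imsetP[u uP ->] := mem_repr y (class_refl P y).
  exact: mfix_coef.
exists (toB h0).
  apply/fixB_inP; apply: inP_bM => u uP; apply/ffunP => y.
  by rewrite -/(conjd h0 u) conjdE !ffunE classGidl ?groupV.
exists (toB [ffun y => w y]); rewrite -toB_Z -[X in _ - X]toB_val.
have -> : h0 = valB x + lam *: ([ffun y => w y] : OG).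
  by apply/ffunP => y; rewrite galgD galgZ [X in _ * X]ffunE -wE addrC subrK.
by rewrite toB_D addrC addKr.
Qed.

Definition linB (f : B -> B) := {morph f : x y / x + y} /\ forall r x, f (r *: x) = r *: f x.

(** Writing eb as the trace of d i e, put [X C] = g^-1 d i and [Y C] = i e g for g representing the
    coset C. The sum of the [X C] (x) [Y C] in Bi (x) iB over OP is then central with product 1.
    Balanced pairs f, h take the place of maps out of that tensor product. *)
Lemma casimir : exists X Y : {set gT} -> B,
  [/\ forall C, X C * iB = X C, forall C, iB * Y C = Y C,
    \sum_(C in rcosets P [set: gT]) X C * Y C = 1 &
    forall f h, linB f -> linB h ->
      (forall u x y, u \in P -> x * iB = x -> iB * y = y ->
         f (x * (gam u * iB)) * h y = f x * h (gam u * iB * y)) ->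
      forall a, \sum_(C in rcosets P [set: gT]) f (a * X C) * h (Y C) =
                \sum_(C in rcosets P [set: gT]) f (X C) * h (Y C * a)].
Proof.
have [d [e [dP eP de]]] := source_trace O_cdvr k_residue p_prime k_char O_fg K_char P_defect i_prim i_Br.
have fixd : fixB (toB d) by apply/fixB_inP; rewrite /= in_block_l //; case: dP.
have fixe : fixB (toB e) by apply/fixB_inP; rewrite /= in_block_l //; case: eP.
pose X (C : {set gT}) := gam (repr C)^-1%g * toB d * iB.
pose Y (C : {set gT}) := iB * toB e * gam (repr C).
exists X, Y; split=> [C|C||f h [fD fZ] [hD hZ] bal a].
- by rewrite /X -mulrA iBiB.
- by rewrite /Y !mulrA iBiB.
- apply: valB_inj; rewrite -[RHS]de /trc.
  rewrite (big_morph valB (id1 := 0) (op1 := +%R)) //.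
  have ii : si * si = si by case: i_prim.
  have dE : valB (toB d) = d by rewrite /= in_block_l //; case: dP.
  have eE : valB (toB e) = e by rewrite /= in_block_l //; case: eP.
  apply: eq_bigr => C _.
  have -> : X C * Y C = gam (repr C)^-1%g * (toB d * iB * toB e * gam (repr C)).
    by rewrite /X /Y !mulrA -(mulrA _ iB iB) iBiB.
  by rewrite val_gaml val_gamr !valB_M val_iB dE eE /conjd !mulrA.
have XE t : exists2 u, u \in P & X (P :* t)%g = gam t^-1%g * toB d * iB * gam u^-1%g /\ Y (P :* t)%g = gam u * (iB * toB e * gam t).
  have /rcosetP[u uP E] := mem_repr_rcoset P t; exists u => //; have uV := groupVr uP.
  rewrite /X /Y E invMg !gamM; split.
    by rewrite -!mulrA -(fixB_i uV) (mulrA (toB d)) -(fixd _ uV) -!mulrA.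
  by rewrite !mulrA fixB_i // -[iB * gam u * _]mulrA fixe // !mulrA.
have Xi C : X C * iB = X C by rewrite /X -mulrA iBiB.
have Yi C : iB * Y C = Y C by rewrite /Y !mulrA iBiB.
have main g : \sum_(C in rcosets P [set: gT]) f (gam g * X C) * h (Y C) =
    \sum_(C in rcosets P [set: gT]) f (X C) * h (Y C * gam g).
  rewrite [RHS](reindex_acts 'Rs _ (in_setT g^-1%g)) ?actsRs_rcosets //=.
  apply: eq_bigr => _ /rcosetsP[t _ ->]; rewrite rcosetE -rcosetM.
  have [u uP [Xt Yt]] := XE t; have [w wP [Xg Yg]] := XE (t * g^-1)%g.
  have uV := groupVr uP; have wV := groupVr wP.
  pose x0 := gam t^-1%g * toB d * iB; pose y0 := iB * toB e * gam t.
  have x0i : x0 * iB = x0 by rewrite /x0 -mulrA iBiB.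
  have y0i : iB * y0 = y0 by rewrite /y0 !mulrA iBiB.
  have can x y v : v \in P -> x * iB = x -> iB * y = y ->
      f (x * gam v^-1%g) * h (gam v * y) = f x * h y.
    move=> vP xi yi; have vV := groupVr vP.
    have -> : x * gam v^-1%g = x * (gam v^-1%g * iB) by rewrite fixB_i // mulrA xi.
    have gi : iB * (gam v * y) = gam v * y by rewrite mulrA -fixB_i // -mulrA yi.
    by rewrite bal // -mulrA gi mulrA gam_VK mul1r.
  rewrite Xt Yt -/x0 -/y0 mulrA can //; last by rewrite -mulrA x0i.
  rewrite Xg Yg invMg invgK !gamM.
  have -> : gam g * gam t^-1%g * toB d * iB = gam g * x0 by rewrite /x0 !mulrA.
  have -> : gam w * (iB * toB e * (gam t * gam g^-1%g)) * gam g = gam w * y0.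
    by rewrite /y0 -!mulrA gam_VK mulr1.
  by rewrite can // -mulrA x0i.
have f0 : f 0 = 0 := morphD0 fD; have h0 : h 0 = 0 := morphD0 hD.
rewrite [a]B_sum; transitivity (\sum_g valB a g *: \sum_(C in rcosets P [set: gT]) f (gam g * X C) * h (Y C)).
  under [RHS]eq_bigr => g _ do rewrite scaler_sumr.
  rewrite exchange_big /=; apply: eq_bigr => C _.
  rewrite mulr_suml (big_morph f fD f0) mulr_suml; apply: eq_bigr => g _.
  by rewrite -scalerAl fZ scalerAl.
under eq_bigr => g _ do rewrite main scaler_sumr.
rewrite exchange_big /=; apply: eq_bigr => C _.
rewrite mulr_sumr (big_morph h hD h0) mulr_sumr; apply: eq_bigr => g _.
by rewrite -scalerAr hZ scalerAr.
Qed.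

End BlockAlgebra.

(** * The character attached to an automorphism *)

Section Correspondence.
Variables (O : idomainType) (pi : O) (k : fieldType) (red : {rmorphism O -> k}).
Hypotheses (O_cdvr : complete_dvr pi) (k_residue : residue_map pi red).
Variable p : nat.
Hypotheses (p_prime : prime p) (k_char : p \in [pchar k]) (O_fg : fg_over_padic p O).
Hypothesis K_char : [pchar {fraction O}] =i pred0.
Variable zeta : O.
Hypothesis zeta_prim : p.-primitive_root zeta.
Variables (gT : finGroupType) (b : block O gT) (P : {group gT}).
Hypothesis P_defect : defect_group b red p P.
Variable i : source_idempotent b red P.
Local Notation lam := (1 - zeta).
Local Notation OG := (galg O gT).
Local Notation "''d' g" := (gdelta O (g : gT)) (at level 8, g at level 2, format "''d' g").
Local Notation eb := (block_unit b).
Local Notation B := (block_alg b).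
Local Notation valB := (@corner_val O (galg O gT) (block_idempotent b)).
Local Notation si := (source_val i).
Local Notation iB := (iB i).
Local Notation gam := (gam b).
Local Notation toB := (toB b).
Local Notation fixB := (fixB P).
Local Notation mfix := (@mfix O zeta gT b P).
Local Notation isu := (isu i).
Local Notation brB := (brB red P).
Local Notation cgB := (@cg O lam B).
Let pP : (p.-group P)%g := defect_pgroup P_defect.

(** [al] need not fix iB. The elements a and a' make iB and its image associate idempotents, and
    through them the two actions of P on the corner can be compared. *)
Record rel_wit (al : B -> B) (eta : gT -> O) (a a' : B) : Prop := RelWit {
  rw_l : iB * a = a;
  rw_r : a * al iB = a;
  rw_l' : al iB * a' = a';
  rw_r' : a' * iB = a';
  rw_aa' : a * a' = iB;
  rw_a'a : a' * a = al iB;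
  rw_eta : forall u, u \in P -> a * al (gam u * iB) = eta u *: (gam u * a) }.

(* The automorphism [al] twists the action of P on the source algebra by the
   linear character [eta], up to conjugation. *)
Definition twists (al : B -> B) (eta : gT -> O) := exists a a', rel_wit al eta a a'.

Local Notation pcharP := (pchar_on p P).
Implicit Types (eta chi : gT -> O) (al be : B -> B).

Lemma pchar_1 eta : pcharP eta -> eta 1%g = 1.
Proof.
move=> [eM ep]; have e1 : eta 1%g * eta 1%g = eta 1%g by rewrite -eM ?mulg1.
have /eqP := ep _ (group1 P); case: (p) (prime_gt0 p_prime) => // n _ /eqP E.
suff <- : eta 1%g ^+ n.+1 = eta 1%g by [].
by elim: n {E} => [|n IHn]; rewrite ?expr1 // exprS IHn.
Qed.
Lemma pchar_V eta u : pcharP eta -> u \in P -> eta u * eta u^-1%g = 1.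
Proof. by move=> h uP; rewrite -(proj1 h) ?groupV // mulgV (pchar_1 h). Qed.
Lemma pchar_inv eta : pcharP eta -> pcharP (fun u => eta u^-1%g).
Proof.
move=> [eM ep]; split=> [u w uP wP|u uP]; last by rewrite ep ?groupV.
by rewrite invMg eM ?groupV // mulrC.
Qed.
Lemma pchar_cong eta u : pcharP eta -> u \in P -> exists y, eta u = 1 + lam * y.
Proof.
by move=> [_ ep] /ep /(zeta_exp_eq1 zeta_prim)[l ->]; apply: zetaX_cong.
Qed.
Lemma pchar_neq0 eta u : pcharP eta -> u \in P -> eta u != 0.
Proof.
move=> h uP; apply/eqP => e0; have /eqP := pchar_V h uP.
by rewrite e0 mul0r eq_sym oner_eq0.
Qed.
Lemma pchar_cgZ eta u (x : B) : pcharP eta -> u \in P -> cgB (eta u *: x) x.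
Proof.
move=> h uP; rewrite -[X in cg _ _ X]scale1r; apply: cgZl.
by have [y ->] := pchar_cong h uP; exists y; rewrite addrC addKr.
Qed.

Lemma al_cgB (al : B -> B) x : aut_lam lam al -> cgB (al x) x.
Proof. by move=> h; have [w ->] := al_cg h x; exists w; rewrite addrC addKr. Qed.

Section Witness.
Variables (al : B -> B) (eta : gT -> O) (a a' : B).
Hypotheses (alP : aut_lam lam al) (etaP : pcharP eta) (aP : rel_wit al eta a a').

Lemma rel_wit' u : u \in P -> al (gam u * iB) * a' = eta u *: (a' * gam u).
Proof.
move=> uP; have E : a' * (a * al (gam u * iB)) * a' = a' * (eta u *: (gam u * a)) * a'.
  by rewrite (rw_eta aP uP).
move: E; rewrite mulrA (rw_a'a aP) -(al_M alP) mulrA -(fixB_i i uP) -(mulrA (gam u)) iBiB.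
move=> ->; rewrite -scalerAr -scalerAl -!mulrA (rw_aa' aP) (fixB_i i uP) mulrA.
by rewrite (rw_r' aP).
Qed.

Lemma rel_mfix : mfix a.
Proof.
move=> u uP; apply: cg_sym; apply: cg_trans (pchar_cgZ (gam u * a) etaP uP).
rewrite -(rw_eta aP uP) -{1}(rw_r aP) -mulrA; apply: cg_mull.
rewrite (fixB_i i uP); apply: cg_trans (cg_sym (al_cgB _ alP)).
by apply: cg_mulr; apply: al_cgB.
Qed.

Lemma rel_mfix' : mfix a'.
Proof.
move=> u uP; apply: cg_trans (pchar_cgZ (a' * gam u) etaP uP).
rewrite -(rel_wit' uP) -{1}(rw_l' aP) mulrA; apply: cg_mulr.
apply: cg_trans (cg_sym (al_cgB _ alP)).
by apply: cg_mull; apply: al_cgB.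
Qed.
End Witness.

(** [v] is invertible in the corner and commutes with u up to the ratio of the two characters at u.
    If that ratio is not 1, all coefficients of [v] on the centraliser of P vanish, which is
    impossible for a unit of the corner. *)
Lemma twists_unique al1 al2 eta1 eta2 (w w' : B) :
  aut_lam lam al1 -> aut_lam lam al2 -> pcharP eta1 -> pcharP eta2 ->
  twists al1 eta1 -> twists al2 eta2 -> w * w' = 1 -> w' * w = 1 ->
  (forall x, w * al1 x = al2 x * w) -> forall u, u \in P -> eta1 u = eta2 u.
Proof.
move=> al1P al2P e1P e2P [a1 [a1' r1]] [a2 [a2' r2]] ww' w'w wal u uP.
have w'al x : al1 x * w' = w' * al2 x by rewrite -[LHS]mul1r -w'w -!mulrA (mulrA w) wal -!mulrA ww' mulr1.
pose v := a2 * w * a1'; pose v' := a1 * w' * a2'.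
have vv' : v * v' = iB.
  rewrite /v /v' -!mulrA (mulrA a1') (rw_a'a r1) (mulrA w) wal -!mulrA (mulrA w) ww' mul1r.
  by rewrite (rw_l' r2) (rw_aa' r2).
have v'v : v' * v = iB.
  rewrite /v /v' -!mulrA (mulrA a2') (rw_a'a r2) (mulrA w') -w'al -!mulrA (mulrA w') w'w mul1r.
  by rewrite (rw_l' r1) (rw_aa' r1).
have key t : t \in P -> v * gam t = (eta2 t * eta1 t^-1%g) *: (gam t * v).
  move=> tP; have E := rel_wit' al1P r1 tP.
  have -> : v * gam t = eta1 t^-1%g *: (a2 * w * (al1 (gam t * iB) * a1')).
    by rewrite E -!scalerAr scalerA mulrC (pchar_V e1P) // scale1r mulrA.
  have -> : a2 * w * (al1 (gam t * iB) * a1') = eta2 t *: (gam t * v).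
    rewrite -!mulrA (mulrA w) wal -!mulrA mulrA (rw_eta r2) // -scalerAl.
    by rewrite /v -!mulrA.
  by rewrite scalerA mulrC.
have cP t : t \in P -> exists y, eta2 t * eta1 t^-1%g = 1 + lam * y.
  move=> tP; have [y ->] := pchar_cong e2P tP; have [z ->] := pchar_cong e1P (groupVr tP).
  by exists (y + z + lam * y * z); ring.
have vm : mfix v.
  move=> t tP; rewrite key //; apply: cg_sym; rewrite -[X in cg _ _ X]scale1r; apply: cgZl.
  by have [y ->] := cP t tP; exists y; rewrite addrC addKr.
have v'm : mfix v'.
  move=> t tP; have v'r : v' * iB = v' by rewrite /v' -!mulrA (rw_r' r2).
  have v'l : iB * v' = v' by rewrite /v' !mulrA (rw_l r1).
  have : v' * (v * gam t) * v' = (eta2 t * eta1 t^-1%g) *: (v' * gam t).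
    by rewrite key // -scalerAr -scalerAl -(mulrA v') -(mulrA (gam t)) vv' (fixB_i i tP) (mulrA v') v'r.
  rewrite (mulrA v') v'v -(fixB_i i tP) -mulrA v'l => ->.
  rewrite -[X in cg _ _ X]scale1r; apply: cgZl.
  by have [y ->] := cP t tP; exists y; rewrite addrC addKr.
have nb := isu_brB O_cdvr k_residue p_prime k_char zeta_prim P_defect vm v'm vv'.
have [c1|cn1] := eqVneq (eta2 u * eta1 u^-1%g) 1.
  by apply: (mulIf (pchar_neq0 e1P (groupVr uP))); rewrite c1 (pchar_V e1P).
case: nb => x xC; suff -> : valB v x = 0 by rewrite rmorph0.
have /(congr1 (fun c : B => valB c (x * u)%g)) := key u uP.
rewrite val_gamr gdelta_mulr mulgK -[valB (_ *: _)]/(_ *: valB (gam u * v)) galgZ val_gaml gdelta_mull.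
have -> : (u^-1 * (x * u))%g = x by rewrite (centP xC u uP) mulKg.
move=> E; have /eqP : (1 - eta2 u * eta1 u^-1%g) * valB v x = 0 by rewrite mulrBl mul1r {1}E subrr.
by rewrite mulf_eq0 subr_eq0 eq_sym (negbTE cn1) => /eqP.
Qed.

(** Lifting a2 a1' to a P-fixed element yields h', congruent to iB, that intertwines [be1] and [be2]
    exactly on the image of P. Averaging h' with the Casimir element extends the intertwining to the
    whole of B, and the average is congruent to 1. *)
Lemma twists_conj be1 be2 eta : aut_lam lam be1 -> aut_lam lam be2 -> pcharP eta ->
  twists be1 eta -> twists be2 eta ->
  exists2 w : B, (exists w', w = 1 + lam *: w') & forall x, be2 x * w = w * be1 x.
Proof.
move=> b1P b2P eP [a1 [a1' r1]] [a2 [a2' r2]].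
have [X [Y [Xi Yi XY bal]]] := casimir O_cdvr k_residue p_prime k_char O_fg K_char P_defect i.
have m1 := rel_mfix b1P eP r1; have m2 := rel_mfix b2P eP r2.
have a0m : mfix (a2 * a1').
  move=> u uP; rewrite mulrA; apply: cg_trans (cg_mulr a1' (m2 u uP)) _.
  by rewrite -!mulrA; apply: cg_mull; apply: (rel_mfix' b1P eP r1).
have [h hfix hcg] := lift_fixed a0m.
have [z zfix zE] : exists2 z, fixB z & z = iB * h * iB.
  by exists (iB * h * iB) => //; apply: fixB_M; [apply: fixB_M => //|]; exact: fixB_i.
pose h' := a2' * z * a1.
have h'1 : cgB h' iB.
  have h1 : cgB h' (a2' * (iB * (a2 * a1') * iB) * a1).
    by rewrite /h' zE; apply: cg_mulr; apply: cg_mull; apply: cg_mulr; apply: cg_mull.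
  apply: cg_trans h1 _; rewrite !mulrA -(mulrA a2') (rw_l r2) (rw_a'a r2) -!mulrA (rw_l r1) (rw_a'a r1).
  by rewrite -{3}(iBiB i); apply: cg_mul; apply: al_cgB.
have h'e u : u \in P -> h' * be1 (gam u * iB) = be2 (gam u * iB) * h'.
  move=> uP; rewrite /h' -mulrA (rw_eta r1) // !mulrA (rel_wit' b2P r2) //.
  rewrite -scalerAr -!scalerAl; congr (_ *: _).
  by rewrite !mulrA -(mulrA a2' z) -zfix // mulrA.
exists (\sum_(C in rcosets P [set: gT]) be2 (X C) * h' * be1 (Y C)).
  suff : cgB (\sum_(C in rcosets P [set: gT]) be2 (X C) * h' * be1 (Y C)) 1.
    by case=> w E; exists w; rewrite -E addrC subrK.
  rewrite -XY; apply: cg_sum => C _; rewrite -{2}(Xi C).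
  apply: cg_mul; last exact: al_cgB.
  by apply: cg_mul => //; apply: al_cgB.
move=> x; rewrite mulr_sumr mulr_suml.
have lin1 : linB be1 by split; [exact: al_D b1P|exact: al_Z b1P].
have lin2 : linB (fun x => be2 x * h').
  split=> [y y'|r y]; first by rewrite (al_D b2P) mulrDl.
  by rewrite (al_Z b2P) scalerAl.
transitivity (\sum_(C in rcosets P [set: gT]) be2 (x * X C) * h' * be1 (Y C)).
  by apply: eq_bigr => C _; rewrite (al_M b2P) !mulrA.
rewrite (bal _ _ lin2 lin1); first by apply: eq_bigr => C _; rewrite (al_M b1P) !mulrA.
move=> u y y' uP yi y'i; rewrite (al_M b2P) (al_M b1P).
by rewrite -(mulrA (be2 y) (be2 _)) -h'e // -!mulrA.
Qed.

(** * Automorphisms fixing the source idempotent *)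

Section Normalised.
Variable al : B -> B.
Hypotheses (alP : aut_lam lam al) (al_i : al iB = iB).

Definition cornB (w : OG) : B := toB (si * w * si).
Lemma si_si : si * si = si. Proof. exact: source_idem. Qed.
Lemma si_block : in_block b si. Proof. by case: (source_primitive i) => -[]. Qed.
Lemma val_cornB w : valB (cornB w) = si * w * si.
Proof. by rewrite /= in_block_l //; apply: in_blockM; apply: in_blockM; exact: si_block. Qed.
Lemma cornBl w : iB * cornB w = cornB w.
Proof. by apply: valB_inj; rewrite valB_M val_cornB val_iB !mulrA si_si. Qed.
Lemma cornBr w : cornB w * iB = cornB w.
Proof. by apply: valB_inj; rewrite valB_M val_cornB val_iB -!mulrA si_si. Qed.

(* A P-action that is congruent to conjugation modulo lam; an eigenvector of it in
   the corner that is invertible there identifies the twist made by [al]. *)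
Definition tact (u : gT) (w : OG) : OG :=
  valB (gam u * cornB w * al (gam u^-1%g * iB)) + 'd u * (w - si * w * si) * 'd (u^-1)%g.

Lemma cornB_D : {morph cornB : x y / x + y}.
Proof. by move=> x y; rewrite /cornB mulrDr mulrDl toB_D. Qed.
Lemma cornB_Z r x : cornB (r *: x) = r *: cornB x.
Proof. by rewrite /cornB -scalerAr -scalerAl toB_Z. Qed.

Lemma si_d u : u \in P -> si * 'd u = 'd u * si.
Proof.
move=> uP; case: (source_primitive i) => -[_ fi] _ _ _.
by rewrite -{1}(fi _ (groupVr uP)) invgK -!mulrA gdelta_VK mulr1.
Qed.

Lemma tact_linear u : linear (tact u).
Proof.
move=> r x y; rewrite /tact cornB_D cornB_Z; set z := al _.
rewrite mulrDr mulrDl -scalerAr -scalerAl -[valB (_ + _)]/(_ *: valB _ + valB _).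
have -> : r *: x + y - si * (r *: x + y) * si = r *: (x - si * x * si) + (y - si * y * si).
  by rewrite mulrDr mulrDl -scalerAr -scalerAl scalerBr opprD addrACA.
by rewrite mulrDr mulrDl -scalerAr -scalerAl scalerDr addrACA.
Qed.
Definition tactL u : {linear OG -> OG} :=
  HB.pack (tact u) (GRing.isLinear.Build O OG OG *:%R (tact u) (@tact_linear u)).

Lemma corn_tact u w : u \in P -> si * tact u w * si = valB (gam u * cornB w * al (gam u^-1%g * iB)).
Proof.
move=> uP; have uV := groupVr uP; rewrite /tact mulrDr mulrDl.
have -> : si * ('d u * (w - si * w * si) * 'd (u^-1)%g) * si = 0.
  rewrite !mulrA (si_d uP) -!mulrA -(si_d uV) !mulrA -(mulrA ('d u)) mulrBr -(mulrA _ _ si) mulrBl.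
  by rewrite !mulrA si_si -(mulrA _ si si) si_si subrr mulr0 mul0r.
rewrite addr0 -[si in X in X * _](val_iB i) -[X in _ * X](val_iB i) -!valB_M; congr valB.
rewrite !mulrA -(fixB_i i uP) -(mulrA (gam u)) cornBl -mulrA; congr (_ * _).
by rewrite -{2}al_i -(al_M alP) -mulrA iBiB.
Qed.

Lemma cornB_tact u w : u \in P -> cornB (tact u w) = gam u * cornB w * al (gam u^-1%g * iB).
Proof. by move=> uP; apply: valB_inj; rewrite val_cornB corn_tact. Qed.

Lemma al_gam u w : u \in P -> w \in P ->
  al (gam u * iB) * al (gam w * iB) = al (gam (u * w)%g * iB).
Proof.
move=> uP wP; rewrite -(al_M alP) gamM; congr al.
by rewrite -(mulrA (gam u)) (mulrA iB) -(fixB_i i wP) -!mulrA iBiB.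
Qed.

Lemma tactM u v w : u \in P -> v \in P -> tact (u * v)%g w = tact u (tact v w).
Proof.
move=> uP vP; have uV := groupVr uP; have vV := groupVr vP.
rewrite [in RHS]/tact corn_tact // cornB_tact //; congr (_ + _).
  by congr valB; rewrite -!mulrA al_gam // -invMg gamM -!mulrA.
by rewrite (addrC (valB _)) addrK invMg -!gdeltaM !mulrA.
Qed.
Lemma tact1 w : tact 1%g w = w.
Proof.
rewrite /tact invg1 gam1 gdelta1.
rewrite (mul1r (cornB w)). rewrite (mul1r iB) al_i cornBr val_cornB mul1r mulr1.
by rewrite addrC subrK.
Qed.

Lemma tact_cg u w : u \in P -> cg lam (tact u w) ('d u * w * 'd (u^-1)%g).
Proof.
move=> uP; have uV := groupVr uP.
have [z zE] : cgB (gam u * cornB w * al (gam u^-1%g * iB)) (gam u * cornB w * (gam u^-1%g * iB)).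
  by apply: cg_mull; apply: al_cgB.
exists (valB z); rewrite -[_ *: valB z]/(valB (lam *: z)) -zE /tact.
have -> : 'd u * w * 'd (u^-1)%g = 'd u * (si * w * si) * 'd (u^-1)%g + 'd u * (w - si * w * si) * 'd (u^-1)%g.
  by rewrite -mulrDl -mulrDr addrC subrK.
rewrite opprD addrACA subrr addr0; congr (_ - _).
transitivity (valB (gam u * (cornB w * gam u^-1%g))).
  by rewrite val_gaml val_gamr val_cornB !mulrA.
rewrite -[\val _]/(valB _); congr valB.
by rewrite (fixB_i i uV) (mulrA _ iB) -(mulrA (gam u)) cornBr mulrA.
Qed.

Definition coefL (x : gT) : {linear OG -> O^o} :=
  HB.pack (fun w : OG => (w x : O^o)) (GRing.isLinear.Build O OG O^o *:%R (fun w : OG => (w x : O^o))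
    (fun r u v => etrans (galgD (r *: u) v x) (congr1 (fun t => t + v x) (galgZ r u x)))).

Lemma cg_coef x (w w' : OG) : cg lam w w' -> @cg O lam O^o (w x) (w' x).
Proof. by move=> [z E]; exists (z x); rewrite -galgB E galgZ. Qed.

Lemma isu0 : ~ isu 0.
Proof.
by move=> [y [_ E _]]; apply: (@brB_i _ _ red _ _ _ i) => x _; rewrite -E mul0r ffunE rmorph0.
Qed.

(** The group basis makes OG a permutation lattice, [tact] is congruent to conjugation and fixes
    [si] modulo [lam], so [rigidity_rec] applies. If no eigenvector had an invertible corner, it
    would place [si] in D, making iB a P-fixed non-unit up to the Brauer kernel, against locality of
    the corner. *)
Lemma unit_eigenvector : exists (chi : gT -> O) (c : B), [/\ pcharP chi, isu c, iB * c * iB = c &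
  forall u, u \in P -> gam u * c * al (gam u^-1%g * iB) = chi u *: c].
Proof.
apply: contrapT => none.
(* These functionals are the components of the Brauer map on the corner. *)
pose FF (g : OG -> O^o) := exists2 x, x \in 'C(P)%g & g = (fun w => (si * w * si) x).
pose D (w : OG) := exists w' : B, [/\ fixB w', iB * w' * iB = w', ~ isu w' & brB (cornB w - w')].
have isuD (x y : B) : fixB x -> iB * x * iB = x -> fixB y -> iB * y * iB = y ->
    isu (x + y) -> isu x \/ isu y.
  exact: (isu_D O_cdvr k_residue p_prime k_char O_fg).
have corni (x : B) : iB * x * iB = x -> cornB (valB x) = x.
  move=> xi; apply: valB_inj; rewrite val_cornB -[in RHS]xi !valB_M !val_iB //.
have DD x y : D x -> D y -> D (x + y).
  move=> [x' [fx ix nx bx]] [y' [fy iy ny bY]]; exists (x' + y'); split.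
  - exact: fixB_D.
  - by rewrite mulrDr mulrDl ix iy.
  - by move=> /(isuD _ _ fx ix fy iy) [].
  - by rewrite cornB_D opprD addrACA; apply: brB_D.
have DN x : (forall g, FF g -> cg lam (g x) 0) -> D x.
  move=> h; exists 0; split; [by move=> u _; rewrite mulr0 mul0r|by rewrite mulr0 mul0r|exact: isu0|].
  rewrite subr0 /brB val_cornB => y yC.
  have [z] := h _ (ex_intro2 _ _ y yC erefl); rewrite subr0 => ->.
  have [t tE] := lam_in_pi O_cdvr k_residue p_prime k_char zeta_prim.
  by apply/(red0P k_residue); exists (t * z); rewrite tE -[_ *: z]/(_ * (z : O)) mulrA.
have to1 (x : gT) : (x ^ (1%g)^-1)%g = x by rewrite invg1 conjg1.
have toM (u w x : gT) : u \in P -> w \in P -> (x ^ (u * w)^-1 = (x ^ w^-1) ^ u^-1)%g.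
  by move=> _ _; rewrite invMg conjgM.
(* The start of the induction: K is trivial, S is all of OG, and the group basis with its
   coordinates gives the presentation. *)
have rd : rdata zeta P (fun u x => x ^ u^-1)%g FF 1%G tactL (fun=> True) (fun x => 'd x) coefL.
  split=> //.
  - exact: normal1.
  - by move=> u w m uP wP; apply: tactM.
  - exact: tact1.
  - move=> g [x xC ->]; split.
      by move=> r y z; rewrite mulrDr mulrDl -scalerAr -scalerAl galgD galgZ.
    move=> u m uP; rewrite [tactL u m]/(tact u m) corn_tact //.
    have uV := groupVr uP.
    have [z zE] : cgB (gam u * cornB m * al (gam u^-1%g * iB)) (gam u * cornB m * (gam u^-1%g * iB)).
      by apply: cg_mull; apply: al_cgB.
    have -> : (si * m * si) x = valB (gam u * cornB m * (gam u^-1%g * iB)) x.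
      rewrite (fixB_i i uV) (mulrA _ iB) -(mulrA (gam u)) cornBr val_gamr gdelta_mulr val_gaml gdelta_mull.
      by rewrite invgK val_cornB (centP xC u uP) mulKg.
    by apply: cg_coef; exists (valB z); rewrite -[_ *: valB z]/(valB (lam *: z)) -zE.
  - by move=> u m /set1P -> _; apply: tact1.
  - move=> u x uP; apply: cg_trans (tact_cg _ uP) _.
    by rewrite !gdeltaM conjgE invgK mulgA; apply: cg_refl.
  - move=> u x m uP _; apply: cg_trans (cg_coef _ (tact_cg m uP)) _.
    rewrite -[coefL x m]/(m x) gdelta_mulr gdelta_mull invgK conjgE invgK.
    by rewrite -!mulgA mulVg mulg1 mulKg; apply: cg_refl.
  - move=> m _; rewrite {1}(galg_sum m).
    rewrite [X in cg _ _ X](eq_bigl xpredT); first exact: cg_refl.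
    move=> x /=; apply/eqP; have := @orep_mem gT gT (fun u x => x ^ u^-1)%g to1 1%G x.
    by case/imsetP=> u /set1P -> ->; rewrite to1.
have Dsi : D si.
  apply: (rigidity_rec p_prime zeta_prim (@gal_tf O gT) pP to1 toM DD DN (leqnn _) rd) => //; last first.
    move=> u uP; apply: cg_trans (tact_cg _ uP) _; rewrite -(si_d uP) -mulrA gdelta_KV mulr1.
    exact: cg_refl.
  move=> chi m chiP _ mE.
  pose c := cornB m.
  have ic : iB * c * iB = c by rewrite cornBl cornBr.
  have cE u : u \in P -> gam u * c * al (gam u^-1%g * iB) = chi u *: c.
    move=> uP; rewrite -cornB_tact // -[tact u m]/(tactL u m) mE //.
    by rewrite cornB_Z.
  have cm : mfix c.
    move=> u uP; apply: cg_sym.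
    have uV := groupVr uP.
    have E : gam u * c = chi u *: (c * al (gam u * iB)).
      by rewrite scalerAl -cE // -(mulrA (gam u * c)) al_gam // mulVg gam1 mul1r al_i -(mulrA (gam u)) cornBr.
    rewrite E; apply: cg_trans (cg_sym (pchar_cgZ _ chiP uP)).
    have cr : c * iB = c := cornBr m.
    rewrite -{1}cr -mulrA -(fixB_i i uP); apply: cg_mull; apply: cg_sym; exact: al_cgB.
  have [h hf hc] := lift_fixed cm.
  have wc : cgB (iB * h * iB) c by rewrite -ic; apply: cg_mulr; apply: cg_mull.
  exists (iB * h * iB); split.
  - by apply: fixB_M; [apply: fixB_M => //|]; exact: fixB_i.
  - by rewrite -!mulrA iBiB !mulrA iBiB.
  - move=> hu; apply: none; exists chi, c; split=> //.
    apply: (isu_cong O_cdvr k_residue p_prime k_char zeta_prim ic hu) (cg_sym wc).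
    by rewrite -!mulrA iBiB !mulrA iBiB.
  - apply: (brB_lam O_cdvr k_residue p_prime k_char zeta_prim).
    by apply: cg_sub0; apply: cg_sym.
case: Dsi => w' [fw iw nw bw].
have cs : cornB si = iB by rewrite /cornB si_si si_si.
rewrite cs in bw.
have fi : fixB (iB - w') by apply: fixB_D; [exact: fixB_i|exact: fixB_N].
have ii : iB * (iB - w') * iB = iB - w' by rewrite mulrBr mulrBl iw !iBiB.
have := isu_i i; rewrite -[iB](subrK w') addrC => /(isuD _ _ fw iw fi ii) [//|hu].
have hI : inI b P si (valB (iB - w')).
  split; first by apply/fixB_inP.
  by move: ii => /(congr1 valB); rewrite !valB_M !val_iB.
apply: (unitI_Br k_char P_defect _ hI ((isu_unitI fi ii).1 hu) bw).
by move=> /brzP h; have := source_Br i; rewrite h eqxx.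
Qed.

(** The eigenvector is itself the witness; moving [al (gam u^-1 * iB)] to the other side of its
    equation inverts the character. *)
Lemma normalised_witness : exists eta c y, pcharP eta /\ rel_wit al eta c y.
Proof.
have [chi [c [chiP [y [yi cy yc]] ic cE]]] := unit_eigenvector.
have cr : c * iB = c by rewrite -ic -!mulrA iBiB.
have yr : y * iB = y by rewrite -yi -!mulrA iBiB.
exists (fun u => chi u^-1%g), c, y; split; first exact: pchar_inv.
split; rewrite ?al_i //.
- by rewrite -ic !mulrA iBiB.
- by rewrite -yi !mulrA iBiB.
move=> u uP; have uV := groupVr uP.
have -> : gam u * c = chi u *: (c * al (gam u * iB)).
  by rewrite scalerAl -cE // -(mulrA (gam u * c)) al_gam // mulVg gam1 mul1r al_i -(mulrA (gam u)) cr.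
by rewrite scalerA mulrC (pchar_V chiP uP) scale1r.
Qed.

End Normalised.

Lemma unit_cg1 (w : B) : exists2 v, (1 + lam *: w) * v = 1 /\ v * (1 + lam *: w) = 1 & cgB v 1.
Proof.
have [v [v1 v2]] := unit_cong1 O_cdvr k_residue p_prime k_char zeta_prim w.
have E : v + lam *: (w * v) = 1 by rewrite -[RHS]v1 mulrDl mul1r scalerAl.
by exists v => //; exists (- (w * v)); rewrite -{1}E opprD addrA subrr add0r scalerN.
Qed.

Lemma normalise al : aut_lam lam al -> exists al' w w',
  [/\ aut_lam lam al', al' iB = iB, w * w' = 1, w' * w = 1 &
     (forall x, al' x = w * al x * w') /\ iB * w = w * al iB].
Proof.
move=> alP; pose j := al iB.
have jj : j * j = j by rewrite /j -(al_M alP) iBiB.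
have [z zE] := al_cgB iB alP.
have jE : j = iB + lam *: z by rewrite /j -zE addrC subrK.
(* The usual element intertwining two neighbouring idempotents, congruent to 1 because j is
   congruent to iB. *)
have wE : iB * j + (1 - iB) * (1 - j) = 1 + lam *: (iB * z - (1 - iB) * z).
  have ff : (1 - iB) * (1 - iB) = 1 - iB by rewrite mulrBl mul1r mulrBr mulr1 iBiB subrr subr0.
  rewrite jE opprD addrA mulrDr iBiB [X in _ + X]mulrBr ff addrACA (addrC iB) subrK.
  by rewrite scalerBr !scalerAr.
have [v [v1 v2] vc] := unit_cg1 (iB * z - (1 - iB) * z).
rewrite -wE in v1 v2; set w := iB * j + _ in v1 v2.
have iw : iB * w = w * j.
  have gen (e f : B) : e * e = e -> f * f = f ->
      e * (e * f + (1 - e) * (1 - f)) = (e * f + (1 - e) * (1 - f)) * f.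
    move=> ee ff.
    have -> : e * (e * f + (1 - e) * (1 - f)) = e * f.
      have e1 : e * (1 - e) = 0 by rewrite mulrBr mulr1 ee subrr.
      by rewrite mulrDr (mulrA e e) ee (mulrA e (1 - e)) e1 mul0r addr0.
    have f1 : (1 - f) * f = 0 by rewrite mulrBl mul1r ff subrr.
    by rewrite mulrDl -(mulrA e f) ff -(mulrA (1 - e)) f1 mulr0 addr0.
  exact: gen (iBiB i) jj.
have wc : cgB w 1 by rewrite /w wE; exists (iB * z - (1 - iB) * z); rewrite addrC addKr.
exists (fun x => w * al x * v), w, v; split=> //.
- split=> [x y|x y||r x|x].
  + by rewrite (al_D alP) mulrDr mulrDl.
  + by rewrite (al_M alP) -!mulrA (mulrA v) v2 mul1r.
  + by rewrite (al_1 alP) mulr1.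
  + by rewrite (al_Z alP) -scalerAr -scalerAl.
  + have : cgB (w * al x * v) (1 * x * 1) by apply: cg_mul => //; apply: cg_mul => //; apply: al_cgB.
    by rewrite mul1r mulr1 => -[u E]; exists u; rewrite -E addrC subrK.
- by rewrite -/j -iw -mulrA v1 mulr1.
Qed.

(** The normalised automorphism is returned as well: invariance of eta under fusion is proved for an
    automorphism fixing iB, while the transport deals with [al] itself. *)
Lemma twists_of_aut al : aut_lam lam al -> exists2 eta, pcharP eta &
  twists al eta /\ exists al' c y, [/\ aut_lam lam al', al' iB = iB & rel_wit al' eta c y].
Proof.
move=> alP; have [al' [w [w' [al'P al'i ww' w'w [al'E iw]]]]] := normalise alP.
have [eta [c [y [etaP r]]]] := normalised_witness al'P al'i.
exists eta => //; split; last by exists al', c, y.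
have iw' : al iB * w' = w' * iB.
  by rewrite -[LHS]mul1r -w'w -mulrA (mulrA w) -iw -!mulrA ww' mulr1.
exists (c * w), (w' * y); split.
- by rewrite mulrA (rw_l r).
- by rewrite -mulrA -iw mulrA -{2}(rw_r r) al'i.
- by rewrite mulrA iw' -mulrA -{2}(rw_l' r) al'i.
- by rewrite -mulrA (rw_r' r).
- by rewrite -mulrA (mulrA w) ww' mul1r (rw_aa' r).
- by rewrite -mulrA (mulrA y) (rw_a'a r) al'i mulrA -iw' -mulrA w'w mulr1.
- move=> u uP; have E := rw_eta r uP; rewrite al'E in E.
  have -> : c * w * al (gam u * iB) = c * (w * al (gam u * iB) * w') * w.
    by rewrite -!mulrA w'w mulr1.
  by rewrite E -scalerAl -mulrA.
Qed.

End Correspondence.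

(** * Invariance under the fusion system *)

Section BimodFacts.
Variables (O : comNzRingType) (A C : algType O).
Implicit Types M N X : bimodType A C.

Lemma bimod_hom_inv M N (f : M -> N) g : bimod_hom f -> cancel f g -> cancel g f -> bimod_hom g.
Proof.
move=> [fD fZ fR] fK gK; split=> [x y|a x|x c]; apply: (can_inj fK).
- by rewrite fD !gK.
- by rewrite fZ !gK.
- by rewrite fR !gK.
Qed.
Lemma bimod_hom_comp M N X (g : N -> X) (f : M -> N) :
  bimod_hom g -> bimod_hom f -> bimod_hom (fun x => g (f x)).
Proof.
move=> [gD gZ gR] [fD fZ fR].
by split=> [x y|a x|x c]; rewrite ?fD ?fZ ?fR ?gD ?gZ ?gR.
Qed.

Lemma summand_split X M N : bimod_summand X M -> bimod_iso X N ->
  exists (s : N -> M) (r : M -> N), [/\ bimod_hom s, bimod_hom r & forall x, r (s x) = x].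
Proof.
move=> [Y [f fh [f' fK f'K]]] [g gh [g' gK g'K]].
have f'h := bimod_hom_inv fh fK f'K; have g'h := bimod_hom_inv gh gK g'K.
have fsth : @bimod_hom O A C (X * Y)%type X fst by [].
have inh : @bimod_hom O A C X (X * Y)%type (fun x => (x, 0)).
  split=> [x y|a x|x c]; first by congr (_, _); rewrite addr0.
    by congr (_, _); rewrite scaler0.
  by congr (_, _); rewrite ract0.
exists (fun x => f' (g' x, 0)), (fun m => g (f m).1); split.
- by apply: (bimod_hom_comp f'h); apply: (bimod_hom_comp inh).
- by apply: (bimod_hom_comp gh); apply: (bimod_hom_comp fsth).
- by move=> x; rewrite f'K g'K.
Qed.
End BimodFacts.

(** * Coefficients in a twisted bimodule *)

Section TwistedFunctional.
Variables (O : comNzRingType) (gT : finGroupType) (P Q : {group gT}).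
Variables (sQP : Q \subset P) (phi : sub_hom Q P).
Hypothesis phi_inj : injective phi.
Local Notation OP := (galg O (subg_of P)).
Local Notation inc := (sub_incl sQP).
Local Notation M1 := (bimod_res (OP^o : bimodType OP OP) idfun (galg_map phi)).
Local Notation N1 := (bimod_res (OP^o : bimodType OP OP) (galg_map inc) idfun).
Local Notation tw := (tensor M1 N1).

Lemma galg_map_delta (hT kT : finGroupType) (f : {multiplicative hT -> kT}) (q : hT) :
  galg_map f (gdelta O q) = gdelta O (f q).
Proof.
apply/ffunP => x; rewrite !ffunE.
under eq_bigr => y _ do rewrite ffunE.
rewrite big_mkcond (bigD1 q) //= eqxx big1 ?addr0 => [|y /negbTE yq]; last by rewrite yq; case: ifP.
by rewrite eq_sym; case: ifP.
Qed.

Lemma galg_map_sum (hT kT : finGroupType) (f : {multiplicative hT -> kT}) (a : galg O hT) :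
  galg_map f a = \sum_w a w *: gdelta O (f w).
Proof.
rewrite {1}(galg_sum a) raddf_sum; apply: eq_bigr => w _.
by rewrite [LHS](galg_map_is_scalable f) galg_map_delta.
Qed.

Definition tw1 : tw := @tens _ _ _ _ M1 N1 1 1.

Lemma tw1_comm (q : subg_of Q) :
  tw1 *| gdelta O (inc q) = gdelta O (phi q) *: tw1.
Proof.
rewrite /tw1 tensR tensZ.
have -> : (1 : N1) *| gdelta O (inc q) = gdelta O q *: (1 : N1).
  by rewrite -[LHS]/((1 : OP) * gdelta O (inc q)) -[RHS]/(galg_map inc (gdelta O q) * (1 : OP)) galg_map_delta mul1r mulr1.
rewrite -tens_bal; congr (tens _ _).
by rewrite -[LHS]/((1 : OP) * galg_map phi (gdelta O q)) -[RHS]/(gdelta O (phi q) * (1 : OP)) galg_map_delta mul1r mulr1.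
Qed.

(** The coefficient of [tw1 *| q0], equal to [phi q0 *: tw1], in the group basis of the tensor
    product. A basis tensor phi(q) (x) q' equals 1 (x) q q', and the sum over q collects all the
    pairs with product q0. *)
Definition twf (q0 : subg_of Q) (s : M1) (t : N1) : O :=
  \sum_q (s : OP) (phi q) * (t : OP) ((inc q)^-1 * inc q0)%g.

Lemma twf_bal q0 : balanced (twf q0).
Proof.
split=> [t s s'|s t t'|s c t].
- by rewrite /twf -big_split; apply: eq_bigr => q _; rewrite ffunE mulrDl.
- by rewrite /twf -big_split; apply: eq_bigr => q _; rewrite ffunE mulrDr.
rewrite /twf.
have -> : s *| c = \sum_w c w *: ((s : OP) * gdelta O (phi w)) :> OP.
  rewrite -[LHS]/((s : OP) * galg_map phi c) galg_map_sum mulr_sumr.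
  by apply: eq_bigr => w _; rewrite -scalerAr.
have -> : c *: t = \sum_w c w *: (gdelta O (inc w) * (t : OP)) :> OP.
  rewrite -[LHS]/(galg_map inc c * (t : OP)) galg_map_sum mulr_suml.
  by apply: eq_bigr => w _; rewrite -scalerAl.
under eq_bigr => q _ do rewrite sum_ffunE mulr_suml.
under [RHS]eq_bigr => q _ do rewrite sum_ffunE mulr_sumr.
rewrite exchange_big [RHS]exchange_big /=; apply: eq_bigr => w _.
rewrite (reindex_inj (mulIg w)) /=; apply: eq_bigr => q _.
have sc (r : O) (a : OP) z : (r *: a) z = r * a z by rewrite ffunE.
transitivity ((c w * (s : OP) (phi q)) * (t : OP) ((inc (q * w))^-1 * inc q0)%g).
  congr (_ * _); apply: (etrans (sc _ _ _)); congr (_ * _).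
  by rewrite gdelta_mulr gmulfM mulgK.
rewrite mulrAC mulrC; congr (_ * _); apply/esym/(etrans (sc _ _ _)); congr (_ * _).
by rewrite gdelta_mull gmulfM invMg mulgA.
Qed.

Definition twL q0 : tw -> O := tmap (twf q0).

Lemma twL_D q0 : {morph twL q0 : x y / x + y}.
Proof. by move=> x y; apply: tmapDE; apply: twf_bal. Qed.

Lemma inc1 : inc 1%g = 1%g. Proof. exact: val_inj. Qed.
Lemma phi1 : phi 1%g = 1%g.
Proof. by apply: (mulgI (phi 1%g)); rewrite -gmulfM !mulg1. Qed.

Lemma twL_l q0 x : twL q0 (gdelta O (phi q0) *: x) = twL 1%g x.
Proof.
rewrite /twL tmapZE; last exact: twf_bal.
apply: eq_tmap => s t; rewrite /twf (reindex_inj (mulgI q0)) /=; apply: eq_bigr => q _.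
rewrite -[gdelta O _ *: s]/(gdelta O (phi q0) * (s : OP)) gdelta_mull !gmulfM mulKg invMg.
by rewrite -mulgA mulVg inc1.
Qed.

Lemma twL_r q0 x : twL q0 (x *| gdelta O (inc q0)) = twL 1%g x.
Proof.
rewrite /twL tmapRE; last exact: twf_bal.
apply: eq_tmap => s t; rewrite /twf; apply: eq_bigr => q _.
by rewrite -[t *| _]/((t : OP) * gdelta O (inc q0)) gdelta_mulr mulgK inc1 mulg1.
Qed.

Lemma twL_Z q0 (a : O) x : twL q0 ((a%:A : OP) *: x) = a * twL q0 x.
Proof.
rewrite /twL tmapZE; last exact: twf_bal.
rewrite (@tmap_comp _ _ _ _ _ _ _ _ (fun v => a * v)) => [|u v]; last exact: mulrDr.
apply: eq_tmap => t t'; rewrite /twf mulr_sumr; apply: eq_bigr => q' _.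
have -> : (a%:A : OP) *: t = a *: (t : OP) :> OP by rewrite -[LHS]/((a%:A : OP) * (t : OP)) mulr_algl.
by rewrite ffunE mulrA.
Qed.

Lemma twL_1 : twL 1%g tw1 = 1.
Proof.
rewrite /twL tmap_tens; last exact: twf_bal.
rewrite /twf (bigD1 1%g) //= phi1 inc1 invg1 mulg1 !ffunE eqxx mulr1 big1 ?addr0 // => q q1.
rewrite ffunE; case: eqP => [E|_]; last by rewrite mul0r.
by case/eqP: q1; apply: phi_inj; rewrite phi1 E.
Qed.

Local Notation twb := (twisted_bimod O sQP phi).
Definition twF q0 : twb -> O := twL q0.
Lemma twF_D q0 : {morph twF q0 : x y / x + y}. Proof. exact: twL_D. Qed.
Lemma twF_Z q0 (a : O) (x : twb) : twF q0 ((a%:A : OP) *: x) = a * twF q0 x.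
Proof. exact: twL_Z. Qed.
Lemma twF_l q0 (x : twb) : twF q0 (gdelta O (phi q0) *: x) = twF 1%g x.
Proof. exact: twL_l. Qed.
Lemma twF_r q0 (x : twb) : twF q0 (x *| gdelta O (inc q0)) = twF 1%g x.
Proof. exact: twL_r. Qed.
Definition twb1 : twb := tw1.
Lemma twF_1 : twF 1%g twb1 = 1. Proof. exact: twL_1. Qed.
Lemma twb1_comm (q : subg_of Q) : twb1 *| gdelta O (inc q) = gdelta O (phi q) *: twb1.
Proof. exact: tw1_comm. Qed.
End TwistedFunctional.

Section ArisesInvariance.
Variables (O : idomainType) (pi : O) (k : fieldType) (red : {rmorphism O -> k}).
Hypotheses (O_cdvr : complete_dvr pi) (k_residue : residue_map pi red).
Variable p : nat.
Hypotheses (p_prime : prime p) (k_char : p \in [pchar k]) (O_fg : fg_over_padic p O).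
Hypothesis K_char : [pchar {fraction O}] =i pred0.
Variable zeta : O.
Hypothesis zeta_prim : p.-primitive_root zeta.
Variables (gT : finGroupType) (b : block O gT) (P : {group gT}).
Hypothesis P_defect : defect_group b red p P.
Variable i : source_idempotent b red P.
Local Notation lam := (1 - zeta).
Local Notation OG := (galg O gT).
Local Notation "''d' g" := (gdelta O (g : gT)) (at level 8, g at level 2, format "''d' g").
Local Notation eb := (block_unit b).
Local Notation B := (block_alg b).
Local Notation valB := (@corner_val O (galg O gT) (block_idempotent b)).
Local Notation si := (source_val i).
Local Notation iB := (iB i).
Local Notation gam := (gam b).
Local Notation toB := (toB b).
Local Notation fixB := (fixB P).
Local Notation mfix := (@mfix O zeta gT b P).
Local Notation isu := (isu i).
Local Notation brB := (brB red P).
Local Notation cgB := (@cg O lam B).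
Let pP : (p.-group P)%g := defect_pgroup P_defect.

Section Invariance.
Variables (al : B -> B) (eta : gT -> O) (c y : B).
Hypotheses (alP : aut_lam lam al) (al_i : al iB = iB) (etaP : pchar_on p P eta).
Hypothesis cy : rel_wit i al eta c y.
Local Notation S := (source_alg i).
Local Notation valS := (@corner_val O (galg O gT) (source_idem_of i)).
Local Notation OP := (galg O (subg_of P)).

Lemma toS_subproof (w : OG) : si * w * si \in corner_pred (source_idem_of i).
Proof. by apply/eqP; rewrite /= -!mulrA source_idem !mulrA source_idem. Qed.
Lemma valS_inj : injective valS. Proof. exact: val_inj. Qed.
Definition toS (w : OG) : S := Corner (toS_subproof w).
Lemma S_l (m : S) : si * valS m = valS m.
Proof. exact: (@corner_mul1l _ _ (source_idem_of i) m). Qed.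
Lemma S_r (m : S) : valS m * si = valS m.
Proof. exact: (@corner_mul1r _ _ (source_idem_of i) m). Qed.
Lemma toS_val m : toS (valS m) = m.
Proof. by apply: val_inj; rewrite /= S_l S_r. Qed.
Lemma toS_D : {morph toS : x z / x + z}.
Proof. by move=> x z; apply: val_inj; rewrite /= mulrDr mulrDl. Qed.
Lemma toS_Z r x : toS (r *: x) = r *: toS x.
Proof. by apply: val_inj; rewrite /= -scalerAr -scalerAl. Qed.
Lemma S_B (m : S) : valB (toB (valS m)) = valS m.
Proof. by rewrite /= in_block_l // -S_l; apply: in_blockM; exact: (si_block i). Qed.
Lemma S_Bi (m : S) : iB * toB (valS m) * iB = toB (valS m).
Proof. by apply: valB_inj; rewrite !valB_M val_iB S_B S_l S_r. Qed.

Lemma source_delta (v : subg_of P) (m : S) :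
  valS (source_map i (gdelta O v) * m) = 'd (sgval v) * valS m.
Proof. by rewrite /= galg_map_delta -mulrA S_l. Qed.
Lemma source_deltar (v : subg_of P) (m : S) :
  valS (m * source_map i (gdelta O v)) = valS m * 'd (sgval v).
Proof. by rewrite /= galg_map_delta -(si_d i (subgP v)) mulrA S_r. Qed.

(* Comparing the two sides of the twisted bimodule relation of [phi] under such a map
   forces eta to be invariant under [phi]. *)
Lemma twist_of_witness : exists psi : S -> S, [/\ {morph psi : x z / x + z},
  forall v m, psi (source_map i (gdelta O v) * m) = eta (sgval v) *: (source_map i (gdelta O v) * psi m),
  forall v m, psi (m * source_map i (gdelta O v)) = eta (sgval v) *: (psi m * source_map i (gdelta O v)) &
  forall m, exists z, psi m = m + lam *: z].
Proof.
have cm := rel_mfix zeta_prim alP etaP cy.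
have [h hf hc] := lift_fixed cm.
have cr : c * iB = c by rewrite -{2}(rw_r cy) al_i.
have cl := rw_l cy.
have ici : iB * c * iB = c by rewrite cl cr.
have yl : iB * y = y by rewrite -{2}(rw_l' cy) al_i.
have yr := rw_r' cy.
have c_aa := rw_aa' cy; have c_a'a : y * c = iB by rewrite (rw_a'a cy).
have [h0 [h0f h0i h0c]] : exists h0, [/\ fixB h0, iB * h0 * iB = h0 & cgB h0 c].
  exists (iB * h * iB); split.
  - by apply: fixB_M; [apply: fixB_M => //|]; exact: fixB_i.
  - by rewrite -!mulrA iBiB !mulrA iBiB.
  - by rewrite -[X in cg _ _ X]ici; apply: cg_mulr; apply: cg_mull.
have cu : isu c by exists y; rewrite yl yr.
have [h1 [h1i h01 h10]] := isu_cong O_cdvr k_residue p_prime k_char zeta_prim h0i cu ici h0c.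
have h1l : iB * h1 = h1 by rewrite -h1i !mulrA iBiB.
have h1r : h1 * iB = h1 by rewrite -h1i -!mulrA iBiB.
have h0l : iB * h0 = h0 by rewrite -h0i !mulrA iBiB.
have h0r : h0 * iB = h0 by rewrite -h0i -!mulrA iBiB.
have h1f : fixB h1.
  move=> u uP; have E : h1 * (gam u * h0) * h1 = h1 * (h0 * gam u) * h1 by rewrite h0f.
  move: E; rewrite (mulrA h1 h0) h10 -(mulrA h1) -(mulrA (gam u)) h01 (fixB_i i uP) (mulrA h1) h1r.
  by rewrite -(fixB_i i uP) -mulrA h1l => ->.
(* Conjugating [al] by c multiplies the action of P by eta, but gives a map congruent only to
   conjugation by c. Conjugating back by the P-fixed lift h0 of c makes it congruent to the identity
   and leaves the relations with P intact. *)
pose f (x : B) : B := h1 * (c * al x * y) * h0.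
have fD : {morph f : x z / x + z}.
  by move=> x z; rewrite /f (al_D alP) mulrDr mulrDl mulrDr mulrDl.
have fl u x : u \in P -> iB * x = x -> f (gam u * x) = eta u *: (gam u * f x).
  move=> uP xl; rewrite /f -{1}xl (mulrA (gam u)) (al_M alP) (mulrA c) (rw_eta cy uP).
  by rewrite -!scalerAl -scalerAr -scalerAl !mulrA h1f.
have fr u x : u \in P -> x * iB = x -> f (x * gam u) = eta u *: (f x * gam u).
  move=> uP xr; rewrite /f -{1}xr -(mulrA x) -(fixB_i i uP) (al_M alP) -!mulrA.
  rewrite (mulrA (al (gam u * iB))) (rel_wit' alP cy uP) -scalerAl -!scalerAr.
  by rewrite -(mulrA y) h0f.
have f1 x : iB * x * iB = x -> cgB (f x) x.
  move=> xi; have E : h1 * (h0 * x * y) * c = x.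
    by rewrite !mulrA h10 -!mulrA c_a'a mulrA xi.
  rewrite -[X in cg _ _ X]E; apply: cg_mul => //; apply: cg_mull; apply: cg_mulr.
  by apply: cg_mul; [exact: cg_sym|exact: al_cgB].
pose x_ (m : S) := toB (valS m).
have xl m : iB * x_ m = x_ m by rewrite /x_; have E := S_Bi m; rewrite -E !mulrA iBiB.
have xr m : x_ m * iB = x_ m by rewrite /x_; have E := S_Bi m; rewrite -E -!mulrA iBiB.
have x_D : {morph x_ : x z / x + z} by move=> x z; rewrite /x_ -toB_D.
have x_l v m : x_ (source_map i (gdelta O v) * m) = gam (sgval v) * x_ m.
  by apply: valB_inj; rewrite val_gaml /x_ !S_B source_delta.
have x_r v m : x_ (m * source_map i (gdelta O v)) = x_ m * gam (sgval v).
  by apply: valB_inj; rewrite val_gamr /x_ !S_B source_deltar.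
exists (fun m => toS (valB (f (x_ m)))); split=> [m m'|v m|v m|m].
- by rewrite x_D fD -toS_D.
- rewrite x_l fl ?subgP // -[valB (_ *: _)]/(_ *: valB (gam _ * _)) toS_Z; congr (_ *: _).
  by apply: valS_inj; rewrite source_delta val_gaml /= mulrA (si_d i (subgP v)) -!mulrA.
- rewrite x_r fr ?subgP // -[valB (_ *: _)]/(_ *: valB (_ * gam _)) toS_Z; congr (_ *: _).
  apply: valS_inj; rewrite source_deltar val_gamr /= -!mulrA; congr (_ * (_ * _)).
  by rewrite (si_d i (subgP v)).
- have [w wE] := f1 _ (S_Bi m); exists (toS (valB w)).
  rewrite -{2}[m]toS_val -toS_Z -toS_D; congr toS.
  rewrite -(S_B m) -/(x_ m) -[_ + _]/(valB (x_ m + lam *: w)) -wE addrC subrK //.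
Qed.

(** In the twisted bimodule, q on the right of the generator equals [phi q] on the left. The
    compression of psi to the summand scales one side by [eta q] and the other by [eta (phi q)], and
    the coefficient of its value at the generator can be cancelled, being a unit congruent to 1. *)
Lemma arises_invariant Q (phi : sub_hom Q P) : arises i phi ->
  forall q : subg_of Q, eta (sgval (phi q)) = eta (sgval q).
Proof.
move=> [phi_inj [sQP [X [XM _ Xtw]]]] q.
have [psi [psiD psil psir psi1]] := twist_of_witness.
have [s [r [[sD sZ sR] [rD rZ rR] rs]]] := summand_split XM Xtw.
pose x0 := twb1 O sQP phi.
pose th x := r (psi (s x)).
have rO (a : O) m : r (a *: m) = (a%:A : OP) *: r m.
  have aE : a *: (m : S) = source_map i (a%:A : OP) * (m : S).
    by rewrite linearZ_LR rmorph1 mulr_algl.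
  by rewrite aE; apply: rZ.
have thl v x : th (gdelta O v *: x) = ((eta (sgval v))%:A : OP) *: (gdelta O v *: th x).
  have e : s (gdelta O v *: x) = source_map i (gdelta O v) * (s x : S) := sZ _ _.
  by rewrite /th e psil rO; congr (_ *: _); apply: rZ.
have thr v x : th (x *| gdelta O v) = ((eta (sgval v))%:A : OP) *: (th x *| gdelta O v).
  have e : s (x *| gdelta O v) = (s x : S) * source_map i (gdelta O v) := sR _ _.
  by rewrite /th e psir rO; congr (_ *: _); apply: rR.
have th1 x : exists z, th x = x + ((lam%:A : OP) *: z).
  have [z zE] := psi1 (s x); exists (r z).
  by rewrite /th zE rD rs rO.
have E : twF q (th (gdelta O (phi q) *: x0)) = eta (sgval (phi q)) * twF 1%g (th x0).
  by rewrite thl twF_Z twF_l.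
have E' : twF q (th (gdelta O (phi q) *: x0)) = eta (sgval q) * twF 1%g (th x0).
  by rewrite -(twb1_comm O sQP) thr twF_Z twF_r.
have [z zE] := th1 x0.
have thE : twF 1%g (th x0) = 1 + lam * twF 1%g z by rewrite zE twF_D twF_Z twF_1.
have uU := lam_jac O_cdvr k_residue p_prime k_char zeta_prim (twF 1%g z).
by apply: (mulIr uU); rewrite -thE -E -E'.
Qed.

End Invariance.
End ArisesInvariance.

(** * Double cosets and summands of the source algebra *)

Section KernelBimodule.
Variables (O : comNzRingType) (A C : algType O) (M N : bimodType A C).

Record bimod_morphism := BimodMorphism { bmor :> M -> N; bmorP : bimod_hom bmor }.
Variable f : bimod_morphism.

Definition ker_pred : {pred M} := fun m => f m == 0.
Record bimod_ker := BimodKer { ker_val :> M; ker_valP : ker_val \in ker_pred }.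
HB.instance Definition _ := [isSub for ker_val].
HB.instance Definition _ := [Choice of bimod_ker by <:].

Lemma bmor0 : f 0 = 0. Proof. by case: (bmorP f) => /morphD0. Qed.
Lemma bmorB x y : f (x - y) = f x - f y.
Proof. by case: (bmorP f) => fD _ _; apply: (addIr (f y)); rewrite subrK -fD subrK. Qed.
Fact ker_zmod_closed : zmod_closed ker_pred.
Proof.
split=> [|x y]; rewrite !unfold_in ?bmor0 // => /eqP fx /eqP fy.
by rewrite bmorB fx fy subrr.
Qed.
HB.instance Definition _ := GRing.SubChoice_isSubZmodule.Build _ _ bimod_ker ker_zmod_closed.

Fact ker_scale_in (a : A) (x : bimod_ker) : a *: (x : M) \in ker_pred.
Proof. by case: (bmorP f) => _ fZ _; rewrite unfold_in fZ (eqP (ker_valP x)) scaler0. Qed.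
Fact ker_ract_in (x : bimod_ker) (c : C) : (x : M) *| c \in ker_pred.
Proof. by case: (bmorP f) => _ _ fR; rewrite unfold_in fR (eqP (ker_valP x)) ract0. Qed.
Definition ker_scale (a : A) (x : bimod_ker) : bimod_ker := BimodKer (ker_scale_in a x).
Definition ker_ract (x : bimod_ker) (c : C) : bimod_ker := BimodKer (ker_ract_in x c).

Fact ker_scaleA a c x : ker_scale a (ker_scale c x) = ker_scale (a * c) x.
Proof. by apply: val_inj; apply: scalerA. Qed.
Fact ker_scale1 : left_id 1 ker_scale.
Proof. by move=> x; apply: val_inj; apply: scale1r. Qed.
Fact ker_scaleDr : right_distributive ker_scale +%R.
Proof. by move=> a x y; apply: val_inj; apply: scalerDr. Qed.
Fact ker_scaleDl x : {morph ker_scale^~ x : a c / a + c}.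
Proof. by move=> a c; apply: val_inj; apply: scalerDl. Qed.
HB.instance Definition _ := GRing.Zmodule_isLmodule.Build A bimod_ker
  ker_scaleA ker_scale1 ker_scaleDr ker_scaleDl.

Fact ker_ractDl c : {morph ker_ract^~ c : x y / x + y}.
Proof. by move=> x y; apply: val_inj; apply: ractDl. Qed.
Fact ker_ractDr x : {morph ker_ract x : c d / c + d}.
Proof. by move=> c d; apply: val_inj; apply: ractDr. Qed.
Fact ker_ract1 x : ker_ract x 1 = x.
Proof. by apply: val_inj; apply: ract1. Qed.
Fact ker_ractM x c d : ker_ract x (c * d) = ker_ract (ker_ract x c) d.
Proof. by apply: val_inj; apply: ractM. Qed.
Fact ker_lractA (a : A) x c : a *: ker_ract x c = ker_ract (a *: x) c.
Proof. by apply: val_inj; apply: lractA. Qed.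
Fact ker_central (r : O) x : (r%:A : A) *: x = ker_ract x r%:A.
Proof. by apply: val_inj; apply: bimod_central. Qed.
HB.instance Definition _ := Lmodule_isBimodule.Build O A C bimod_ker
  ker_ractDl ker_ractDr ker_ract1 ker_ractM ker_lractA ker_central.

Lemma split_summand (s : N -> M) : bimod_hom s -> (forall x, f (s x) = x) -> bimod_summand N M.
Proof.
move=> [sD sZ sR] fs; have [fD fZ fR] := bmorP f.
have inK m : m - s (f m) \in ker_pred.
  by rewrite unfold_in bmorB fs subrr.
exists (bimod_ker : bimodType A C); exists (fun m => (f m, BimodKer (inK m))).
  split=> [x y|a x|x c]; congr (_, _); rewrite ?fD ?fZ ?fR //; apply: val_inj => /=.
  - by rewrite fD sD opprD addrACA.
  - by rewrite fZ sZ -scalerN -scalerDr.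
  - have rB u v : u *| c - v *| c = (u - v) *| c :> M.
      by apply: (addIr (v *| c)); rewrite subrK -ractDl subrK.
    by rewrite fR sR rB.
exists (fun z : N * bimod_ker => s z.1 + (z.2 : M)) => [m|[x z]] /=; first by rewrite addrC subrK.
have E : f (s x + ker_val z) = x by rewrite fD fs (eqP (ker_valP z)) addr0.
by congr (_, _) => //; apply: val_inj; rewrite /= E addrC addKr.
Qed.
End KernelBimodule.

Section DeltaHom.
Variables (O : comNzRingType) (hT kT : finGroupType).
Local Notation OH := (galg O hT).
Local Notation OK := (galg O kT).
Variables (M N : bimodType OH OK) (f : M -> N).
Hypothesis fD : {morph f : x y / x + y}.
Hypothesis fO : forall (r : O) x, f ((r%:A : OH) *: x) = (r%:A : OH) *: f x.
Hypothesis fl : forall g x, f (gdelta O g *: x) = gdelta O g *: f x.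
Hypothesis fr : forall x g, f (x *| gdelta O g) = f x *| gdelta O g.

Lemma bimod_hom_delta : bimod_hom f.
Proof.
split=> // [a x|x a].
  rewrite (galg_sum a) !scaler_suml (big_morph f fD (morphD0 fD)); apply: eq_bigr => g _.
  by rewrite -(algZA _ _ x) fO fl algZA.
rewrite (galg_sum a) (big_morph _ (ractDr x) (morphD0 (ractDr x))) (big_morph f fD (morphD0 fD)).
rewrite (big_morph _ (ractDr (f x)) (morphD0 (ractDr (f x)))); apply: eq_bigr => g _.
rewrite -[a g *: _]mulr_algl !ractM -!bimod_central.
have -> : (a g)%:A *: x *| gdelta O g = (a g)%:A *: (x *| gdelta O g) by rewrite lractA.
by rewrite fO fr lractA.
Qed.
End DeltaHom.

Section OrbitSum.
Variables (O : comNzRingType) (gT : finGroupType) (P : {group gT}).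
Local Notation OG := (galg O gT).
Local Notation OP := (galg O (subg_of P)).
Local Notation "''d' g" := (gdelta O (g : gT)) (at level 8, g at level 2, format "''d' g").
Variables (V : bimodType OP OP) (D : {set gT}) (t : gT -> V).
Hypothesis Dl : forall (w : subg_of P) x, (sgval w * x \in D)%g = (x \in D).
Hypothesis Dr : forall (w : subg_of P) x, (x * sgval w \in D)%g = (x \in D).
Hypothesis tl : forall (w : subg_of P) x, x \in D -> t (sgval w * x)%g = gdelta O w *: t x.
Hypothesis tr : forall (w : subg_of P) x, x \in D -> t (x * sgval w)%g = t x *| gdelta O w.

Definition osum (a : OG) : V := \sum_(x in D) (((a x)%:A : OP) *: t x).
Lemma osumD : {morph osum : a c / a + c}.
Proof.
by move=> a c; rewrite /osum -big_split; apply: eq_bigr => x _; rewrite ffunE !scalerDl.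
Qed.
Lemma osumZ (r : O) a : osum (r *: a) = (r%:A : OP) *: osum a.
Proof. by rewrite /osum scaler_sumr; apply: eq_bigr => x _; rewrite ffunE algAct. Qed.
Lemma osum_l (w : subg_of P) a : osum ('d (sgval w) * a) = gdelta O w *: osum a.
Proof.
rewrite /osum (reindex_inj (mulgI (sgval w))) /= scaler_sumr.
apply: eq_big => x; first exact: Dl.
by rewrite Dl => xy; rewrite gdelta_mull mulKg -algZC tl.
Qed.
Lemma osum_r (w : subg_of P) a : osum (a * 'd (sgval w)) = osum a *| gdelta O w.
Proof.
rewrite /osum (reindex_inj (mulIg (sgval w))) /= (big_morph _ (ractDl _) (morphD0 (ractDl _))).
apply: eq_big => x; first exact: Dr.
by rewrite Dr => xy; rewrite gdelta_mulr mulgK -lractA tr.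
Qed.
Lemma osum_delta x : x \in D -> osum ('d x) = t x.
Proof.
move=> xy; rewrite /osum (bigD1 x) //= ffunE eqxx big1 ?addr0 => [|z /andP[_ zx]].
  by rewrite !scale1r.
by rewrite ffunE (negbTE zx) !scale0r.
Qed.
End OrbitSum.

(** * Bimodules isomorphic to the span of a double coset *)

Section DoubleCosetModel.
Variables (O : idomainType) (gT : finGroupType) (P : {group gT}).
Local Notation OG := (galg O gT).
Local Notation OP := (galg O (subg_of P)).
Local Notation "''d' g" := (gdelta O (g : gT)) (at level 8, g at level 2, format "''d' g").
Local Notation sg := (galg_map (@sgval gT P)).

Definition dcs (x : gT) := [set z | [exists u in P, exists v in P, z == u * x * v]]%g.
Lemma dcsP x z : reflect (exists u v, [/\ u \in P, v \in P & z = u * x * v]%g) (z \in dcs x).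
Proof.
rewrite inE; apply: (iffP exists_inP) => [[u uP /exists_inP[v vP /eqP ->]]|[u [v [uP vP ->]]]].
  by exists u, v.
by exists u => //; apply/exists_inP; exists v.
Qed.

Lemma dcs_repr y : exists f : gT -> subg_of P * subg_of P, forall x, x \in dcs y ->
  x = (sgval (f x).1 * y * sgval (f x).2)%g.
Proof.
suff /choice[f fE] : forall x, exists f : subg_of P * subg_of P,
    x \in dcs y -> x = (sgval f.1 * y * sgval f.2)%g by exists f.
move=> x; have [xy|xy] := boolP (x \in dcs y); last by exists (1%g, 1%g).
by have /dcsP[u [v [uP vP E]]] := xy; exists (Subg uP, Subg vP).
Qed.

Lemma dcs_mull (y : gT) (w : subg_of P) x : (sgval w * x \in dcs y)%g = (x \in dcs y).
Proof.
apply/dcsP/dcsP => -[u [v [uP vP E]]].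
    exists ((sgval w)^-1 * u)%g, v; rewrite groupM ?groupV ?subgP //; split=> //.
    by rewrite -!mulgA (mulgA u) -E mulKg.
  by exists (sgval w * u)%g, v; rewrite groupM ?subgP // E !mulgA.
Qed.
Lemma dcs_mulr (y : gT) (w : subg_of P) x : (x * sgval w \in dcs y)%g = (x \in dcs y).
Proof.
apply/dcsP/dcsP => -[u [v [uP vP E]]].
    exists u, (v * (sgval w)^-1)%g; rewrite groupM ?groupV ?subgP //; split=> //.
    by rewrite mulgA -E mulgK.
  by exists u, (v * sgval w)%g; rewrite groupM ?subgP // E !mulgA.
Qed.

Variables (y : gT) (V : bimodType OP OP) (dm : V -> OG) (dt : subg_of P -> subg_of P -> V).
(** What is needed to identify V with O[PyP] through [dm]. The clause [V_id] says that V is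
    generated by [dt 1 1], in the form in which it is used: an endomorphism fixing the generator is
    the identity. *)
Record coset_model : Prop := CosetModel {
  dm_D : {morph dm : x z / x + z};
  dm_Z : forall (a : OP) x, dm (a *: x) = sg a * dm x;
  dm_R : forall (a : OP) x, dm (x *| a) = dm x * sg a;
  dm_t : forall u v, dm (dt u v) = 'd (sgval u * y * sgval v)%g;
  dt_l : forall w u v, gdelta O w *: dt u v = dt (w * u)%g v;
  dt_r : forall w u v, dt u v *| gdelta O w = dt u (v * w)%g;
  dt_eq : forall u v u' v', (sgval u * y * sgval v = sgval u' * y * sgval v')%g ->
    dt u v = dt u' v';
  V_id : forall h : V -> V, bimod_hom h -> h (dt 1 1)%g = dt 1%g 1%g -> forall x, h x = x }.
Hypothesis VP : coset_model.
Let dm_D' := dm_D VP. Let dm_Z' := dm_Z VP. Let dm_R' := dm_R VP. Let dm_t' := dm_t VP.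
Let dt_l' := dt_l VP. Let dt_r' := dt_r VP. Let dt_eq' := dt_eq VP. Let V_id' := V_id VP.

Definition cut (a : OG) : OG := [ffun x => if x \in dcs y then a x else 0].
Definition orbsum : OG := [ffun x => (x \in dcs y)%:R].

Lemma dmul_inv : exists n : OG -> V, [/\ {morph n : a c / a + c},
  forall (r : O) a, n (r *: a) = (r%:A : OP) *: n a,
  forall (w : subg_of P) a, n ('d (sgval w) * a) = gdelta O w *: n a &
  forall (w : subg_of P) a, n (a * 'd (sgval w)) = n a *| gdelta O w] /\
  (forall x, n (dm x) = x) /\ (forall a, dm (n a) = cut a).
Proof.
have [f fE] := dcs_repr y.
pose t x := dt (f x).1 (f x).2.
have tE u v : t (sgval u * y * sgval v)%g = dt u v.
  apply/esym/dt_eq'; apply: fE; apply/dcsP.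
  by exists (sgval u), (sgval v); rewrite !subgP.
have dW := dcs_mull y; have dWr := dcs_mulr y.
pose n := osum (dcs y) t.
have tl (w : subg_of P) x : x \in dcs y -> t (sgval w * x)%g = gdelta O w *: t x.
  move=> xy; rewrite {1}(fE x xy) !mulgA -[(sgval w * _)%g]/(sgval (w * (f x).1)%g) tE.
  exact/esym/dt_l'.
have tr (w : subg_of P) x : x \in dcs y -> t (x * sgval w)%g = t x *| gdelta O w.
  move=> xy; rewrite {1}(fE x xy) -mulgA -[(sgval (f x).2 * _)%g]/(sgval ((f x).2 * w)%g) tE.
  exact/esym/dt_r'.
have nD : {morph n : a c / a + c} by exact: osumD.
have nZ (r : O) a : n (r *: a) = (r%:A : OP) *: n a by exact: osumZ.
have nl (w : subg_of P) a : n ('d (sgval w) * a) = gdelta O w *: n a by exact: osum_l.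
have nr (w : subg_of P) a : n (a * 'd (sgval w)) = n a *| gdelta O w by exact: osum_r.
have nd x : x \in dcs y -> n ('d x) = t x.
exact: osum_delta.
have hm : bimod_hom (fun x => n (dm x)).
  apply: bimod_hom_delta => [x z|r x|w x|x w].
  - by rewrite dm_D' nD.
  - by rewrite dm_Z' linearZ_LR /= rmorph1 mulr_algl nZ.
  - by rewrite dm_Z' galg_map_delta nl.
  - by rewrite dm_R' galg_map_delta nr.
have yy : y \in dcs y by apply/dcsP; exists 1%g, 1%g; rewrite !group1 mul1g mulg1.
exists n; split=> //; split.
- apply: (V_id' hm); rewrite dm_t' nd; last by rewrite !mul1g mulg1.
  by rewrite -tE mulg1 mul1g.
- move=> a; rewrite /n /osum (big_morph dm dm_D' (morphD0 dm_D')).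
  have -> : cut a = \sum_(x in dcs y) a x *: 'd x.
    rewrite {1}[cut a]galg_sum [RHS]big_mkcond; apply: eq_bigr => x _; rewrite ffunE.
    by case: ifP => // _; rewrite scale0r.
  apply: eq_bigr => x xy; rewrite dm_Z' linearZ_LR /= rmorph1 mulr_algl dm_t'.
  by rewrite -fE.
Qed.

End DoubleCosetModel.

(** * The twisted bimodule of one double coset *)

Section DoubleCosets.
Variables (O : idomainType) (pi : O) (k : fieldType) (red : {rmorphism O -> k}).
Hypotheses (O_cdvr : complete_dvr pi) (k_residue : residue_map pi red).
Variable p : nat.
Hypotheses (p_prime : prime p) (k_char : p \in [pchar k]) (O_fg : fg_over_padic p O).
Hypothesis K_char : [pchar {fraction O}] =i pred0.
Variable zeta : O.
Hypothesis zeta_prim : p.-primitive_root zeta.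
Variables (gT : finGroupType) (b : block O gT) (P : {group gT}).
Hypothesis P_defect : defect_group b red p P.
Variable i : source_idempotent b red P.
Local Notation lam := (1 - zeta).
Local Notation OG := (galg O gT).
Local Notation "''d' g" := (gdelta O (g : gT)) (at level 8, g at level 2, format "''d' g").
Local Notation eb := (block_unit b).
Local Notation B := (block_alg b).
Local Notation valB := (@corner_val O (galg O gT) (block_idempotent b)).
Local Notation si := (source_val i).
Local Notation iB := (iB i).
Local Notation gam := (gam b).
Local Notation toB := (toB b).
Local Notation fixB := (fixB P).
Local Notation mfix := (@mfix O zeta gT b P).
Local Notation isu := (isu i).
Local Notation brB := (brB red P).
Local Notation cgB := (@cg O lam B).
Let pP : (p.-group P)%g := defect_pgroup P_defect.

Local Notation OP := (galg O (subg_of P)).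

Section OneCoset.
Variable y : gT.
(** For q in this group, y q = q^(y^-1) y with both q and its conjugate in P. This is the ambiguity
    in writing an element of PyP as u y v, so O[PyP] is the twisted bimodule of [cphi]. *)
Definition cosetQ : {group gT} := (P :&: P :^ y)%G.
Lemma cosetQ_sub : cosetQ \subset P. Proof. exact: subsetIl. Qed.
Lemma cosetQ_conj (q : subg_of cosetQ) : (sgval q ^ y^-1)%g \in P.
Proof. by have /setIP[_] := subgP q; rewrite mem_conjg. Qed.
Definition coset_phi (q : subg_of cosetQ) : subg_of P := Subg (cosetQ_conj q).
Fact coset_phi_mul : {morph coset_phi : x z / (x * z)%g}.
Proof. by move=> x z; apply: val_inj; rewrite /= conjMg. Qed.
HB.instance Definition _ := isMultiplicative.Build (subg_of cosetQ) (subg_of P)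
  coset_phi coset_phi_mul.
Definition cphi : sub_hom cosetQ P := coset_phi.
Lemma cphi_inj : injective cphi.
Proof. by move=> x z /(congr1 val) /= /conjg_inj /val_inj. Qed.

Local Notation inc := (sub_incl cosetQ_sub).
Local Notation M1 := (bimod_res (OP^o : bimodType OP OP) idfun (galg_map cphi)).
Local Notation N1 := (bimod_res (OP^o : bimodType OP OP) (galg_map inc) idfun).
Local Notation tw := (tensor M1 N1).
Local Notation sg := (galg_map (@sgval gT P)).

Definition dmulf (s : M1) (t : N1) : OG := sg (s : OP) * 'd y * sg (t : OP).
Lemma dmul_bal : balanced dmulf.
Proof.
split=> [t s s'|s t t'|s c t]; rewrite /dmulf.
- by rewrite raddfD !mulrDl.
- by rewrite raddfD mulrDr.
have -> : sg (s *| c : M1) = sg (s : OP) * sg (galg_map cphi c) by rewrite -rmorphM.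
have -> : sg (c *: t : N1) = sg (galg_map inc c) * sg (t : OP) by rewrite -rmorphM.
rewrite !mulrA; congr (_ * _); rewrite -!mulrA; congr (_ * _).
have sgS (f : {multiplicative subg_of cosetQ -> subg_of P}) :
    sg (galg_map f c) = \sum_w c w *: 'd (sgval (f w)).
  rewrite (galg_map_sum f) raddf_sum; apply: eq_bigr => w _.
  by rewrite [LHS](galg_map_is_scalable (@sgval gT P)) galg_map_delta.
rewrite !sgS mulr_suml mulr_sumr; apply: eq_bigr => w _.
rewrite -scalerAl -scalerAr !gdeltaM; congr (_ *: 'd _).
by rewrite /= conjgE invgK -!mulgA mulVg mulg1.
Qed.
Definition dmul : tw -> OG := tmap dmulf.

Lemma dmul_D : {morph dmul : x z / x + z}.
Proof. by move=> x z; apply: tmapDE; apply: dmul_bal. Qed.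
Lemma dmul_Z (a : OP) x : dmul (a *: x) = sg a * dmul x.
Proof.
rewrite /dmul tmapZE; last exact: dmul_bal.
rewrite (@tmap_comp _ _ _ _ _ _ _ _ (fun v => sg a * v)) => [|u v]; last exact: mulrDr.
apply: eq_tmap => s t; rewrite /dmulf.
have -> : sg (a *: s : M1) = sg a * sg (s : OP) by rewrite -rmorphM.
by rewrite !mulrA.
Qed.
Lemma dmul_R (a : OP) x : dmul (x *| a) = dmul x * sg a.
Proof.
rewrite /dmul tmapRE; last exact: dmul_bal.
rewrite (@tmap_comp _ _ _ _ _ _ _ _ (fun v => v * sg a)) => [|u v]; last exact: mulrDl.
apply: eq_tmap => s t; rewrite /dmulf.
have -> : sg (t *| a : N1) = sg (t : OP) * sg a by rewrite -rmorphM.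
by rewrite !mulrA.
Qed.

Definition dtens (u v : subg_of P) : tw := @tens _ _ _ _ M1 N1 (gdelta O u) (gdelta O v).
Lemma dmul_dtens u v : dmul (dtens u v) = 'd (sgval u * y * sgval v)%g.
Proof. by rewrite /dmul tmap_tens; [rewrite /dmulf !galg_map_delta !gdeltaM|exact: dmul_bal]. Qed.
Lemma dtens_l w u v : gdelta O w *: dtens u v = dtens (w * u)%g v.
Proof. by rewrite /dtens tensZ; congr tens; apply: gdeltaM. Qed.
Lemma dtens_r w u v : dtens u v *| gdelta O w = dtens u (v * w)%g.
Proof. by rewrite /dtens tensR; congr tens; apply: gdeltaM. Qed.

Lemma dtens_eq u v u' v' : (sgval u * y * sgval v = sgval u' * y * sgval v')%g ->
  dtens u v = dtens u' v'.
Proof.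
move=> E; pose w := (v' * v^-1)%g.
have Eq : ((sgval v' * (sgval v)^-1) ^ y^-1 = (sgval u')^-1 * sgval u)%g.
  rewrite conjgE invgK; apply: (mulIg (y * sgval v)%g).
  by rewrite !mulgA mulgKV mulgKV; apply: (mulgI (sgval u')); rewrite !mulgA mulgV mul1g -E.
have wP : sgval w \in cosetQ.
  rewrite inE subgP mem_conjg /=.
  by rewrite Eq groupM ?groupV ?subgP.
pose q : subg_of cosetQ := Subg wP.
have qi : inc q = w by apply: val_inj.
have qf : cphi q = (u'^-1 * u)%g.
  exact: val_inj.
have -> : u = (u' * cphi q)%g by rewrite qf mulKVg.
have -> : v' = (inc q * v)%g by rewrite qi mulgKV.
rewrite /dtens.
have -> : gdelta O (u' * cphi q)%g = (gdelta O u' : M1) *| gdelta O q :> M1.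
  by rewrite -[RHS]/((gdelta O u' : OP) * galg_map cphi (gdelta O q)) galg_map_delta gdeltaM.
rewrite tens_bal; congr tens.
by rewrite -[LHS]/(galg_map inc (gdelta O q) * (gdelta O v : OP)) galg_map_delta gdeltaM.
Qed.

Lemma dmul_id (h : tw -> tw) : bimod_hom h -> h (dtens 1 1)%g = dtens 1 1 -> forall x, h x = x.
Proof.
move=> [hD hZ hR] h1; apply: tens_ext => // s s'.
have -> : tens s s' = (s : OP) *: dtens 1 1 *| (s' : OP) :> tw.
  rewrite tensZ tensR; congr tens; first exact/esym/mulr1.
  exact/esym/mul1r.
by rewrite hR hZ h1.
Qed.

Lemma dmul_model : coset_model y dmul dtens.
Proof.
exact: (CosetModel dmul_D dmul_Z dmul_R dmul_dtens dtens_l dtens_r dtens_eq dmul_id).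
Qed.
End OneCoset.
End DoubleCosets.

Section DoubleCosets.
Variables (O : idomainType) (pi : O) (k : fieldType) (red : {rmorphism O -> k}).
Hypotheses (O_cdvr : complete_dvr pi) (k_residue : residue_map pi red).
Variable p : nat.
Hypotheses (p_prime : prime p) (k_char : p \in [pchar k]) (O_fg : fg_over_padic p O).
Hypothesis K_char : [pchar {fraction O}] =i pred0.
Variable zeta : O.
Hypothesis zeta_prim : p.-primitive_root zeta.
Variables (gT : finGroupType) (b : block O gT) (P : {group gT}).
Hypothesis P_defect : defect_group b red p P.
Variable i : source_idempotent b red P.
Local Notation lam := (1 - zeta).
Local Notation OG := (galg O gT).
Local Notation "''d' g" := (gdelta O (g : gT)) (at level 8, g at level 2, format "''d' g").
Local Notation eb := (block_unit b).
Local Notation B := (block_alg b).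
Local Notation valB := (@corner_val O (galg O gT) (block_idempotent b)).
Local Notation si := (source_val i).
Local Notation iB := (iB i).
Local Notation gam := (gam b).
Local Notation toB := (toB b).
Local Notation fixB := (fixB P).
Local Notation mfix := (@mfix O zeta gT b P).
Local Notation isu := (isu i).
Local Notation brB := (brB red P).
Local Notation cgB := (@cg O lam B).
Let pP : (p.-group P)%g := defect_pgroup P_defect.

Local Notation OP := (galg O (subg_of P)).

Local Notation S := (source_alg i).
Local Notation valS := (@corner_val O (galg O gT) (source_idem_of i)).
Local Notation toS := (toS i).
Local Notation bi_equi := (@bi_equi O gT P).
Local Notation bi_fixed := (@bi_fixed O pi gT P).
Local Notation pdv := (@pdv O pi OG).
Local Notation sg := (galg_map (@sgval gT P)).

Section Cut.
Variable y : gT.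
Local Notation cut := (@cut O gT P y).
Local Notation orbsum := (orbsum O P y).
Local Notation dcs := (dcs P y).

Lemma cutE (a : OG) x : cut a x = if x \in dcs then a x else 0. Proof. by rewrite ffunE. Qed.
Lemma orbsumE x : orbsum x = (x \in dcs)%:R. Proof. by rewrite ffunE. Qed.
Lemma dcs_y : y \in dcs.
Proof. by apply/dcsP; exists 1%g, 1%g; rewrite !group1 mul1g mulg1. Qed.
Lemma dcs_uv u v x : u \in P -> v \in P -> (u * x * v \in dcs)%g = (x \in dcs).
Proof. by move=> uP vP; rewrite (dcs_mulr y (Subg vP)) (dcs_mull y (Subg uP)). Qed.
Lemma gdelta_uv u v (a : OG) x : ('d u * a * 'd v) x = a (u^-1 * x * v^-1)%g.
Proof. by rewrite gdelta_mulr gdelta_mull mulgA. Qed.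

Lemma cut_equi : bi_equi cut.
Proof.
split; first split=> [a c|r a]; first 1 last.
- by apply/ffunP => x; rewrite galgZ !cutE galgZ; case: ifP; rewrite ?mulr0.
- move=> u v a uP vP; apply/ffunP => x; rewrite gdelta_uv !cutE gdelta_uv dcs_uv ?groupV //.
- by apply/ffunP => x; rewrite galgD !cutE galgD; case: ifP; rewrite ?addr0.
Qed.
Lemma cut_cut a : cut (cut a) = cut a.
Proof. by apply/ffunP => x; rewrite !cutE; case: (x \in _). Qed.
Lemma cut_orbsum : cut orbsum = orbsum.
Proof. by apply/ffunP => x; rewrite cutE orbsumE; case: (x \in _). Qed.
Lemma orbsum_fixed u v : u \in P -> v \in P -> 'd u * orbsum * 'd v = orbsum.
Proof. by move=> uP vP; apply/ffunP => x; rewrite gdelta_uv !orbsumE dcs_uv ?groupV. Qed.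

Lemma cut_fixed (a : OG) : (forall u v, u \in P -> v \in P -> 'd u * a * 'd v = a) ->
  cut a = a y *: orbsum.
Proof.
move=> af; apply/ffunP => x; rewrite cutE galgZ orbsumE; case: ifP => [/dcsP[u [v [uP vP ->]]]|_].
  by rewrite -[in LHS](af u v uP vP) gdelta_uv mulr1 -!mulgA mulgV mulg1 mulKg.
by rewrite mulr0.
Qed.
Lemma cut_fixed_orbsum H : bi_equi H -> cut (H orbsum) = H orbsum y *: orbsum.
Proof.
by move=> [_ HP]; apply: cut_fixed => u v uP vP; rewrite -HP // orbsum_fixed.
Qed.
Lemma cut_bi_fixed (a : OG) : bi_fixed a -> pdv 1 (cut a - a y *: orbsum).
Proof.
move=> af; apply/pdv_coef => x; rewrite expr1 galgB cutE galgZ orbsumE.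
case: ifP => [/dcsP[u [v [uP vP ->]]]|_]; last by rewrite mulr0 subr0; exists 0; rewrite mulr0.
have /pdv_coef /(_ (u * y * v)%g) := af u v uP vP.
rewrite expr1 galgB gdelta_uv -!mulgA mulgV mulg1 mulKg => -[z zE].
by exists (- z); rewrite mulr1 mulrN -zE opprB.
Qed.

(** Modulo [pi], the vectors of O[PyP] fixed by P on both sides are multiples of [orbsum], and the
    hypothesis says that H does not kill it. Completing by the identity off the double coset allows
    [bi_equi_bij] to be applied. *)
Lemma cut_bij H : bi_equi H -> red (H orbsum y) != 0 ->
  exists2 W, bi_equi W & forall a, W (cut (H (cut a))) = cut a.
Proof.
move=> HE Hy; have cE := cut_equi.
pose T a := cut (H (cut a)) + (a - cut a).
have TE : bi_equi T.
  apply: bi_equiD; last by apply: bi_equiB => //; apply: bi_equi_id.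
  by apply: bi_equi_comp => //; apply: bi_equi_comp.
have Tcut a : T (cut a) = cut (H (cut a)) by rewrite /T cut_cut subrr addr0.
have [|W [WE TW _]] := bi_equi_bij O_cdvr k_residue p_prime k_char O_fg pP TE; last first.
  by exists W => // a; rewrite -Tcut TW.
move=> a af /pdv_coef; rewrite expr1 => Ta.
have ay : dvd_in pi (a y).
  have : pdv 1 (cut (H (cut a)) - a y *: (H orbsum y *: orbsum)).
    rewrite -(cut_fixed_orbsum HE); have [[_ HZ] _] := HE; have [[_ cZ] _] := cE.
    rewrite -cZ -HZ -(lin_mapB _ _ (proj1 cE)) -(lin_mapB _ _ (proj1 HE)).
    by apply/(lin_map_pdv (proj1 cE))/(lin_map_pdv (proj1 HE))/cut_bi_fixed.
  move=> /pdv_coef /(_ y); rewrite expr1 galgB !galgZ orbsumE dcs_y mulr1 => E.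
  have := Ta y; rewrite /T galgD galgB [cut a y]cutE dcs_y subrr addr0 => E'.
  apply/(red0P k_residue); apply/eqP.
  move/(red0P k_residue): E; move/(red0P k_residue): E' => E'; rewrite rmorphB E' sub0r rmorphM.
  by move/eqP; rewrite oppr_eq0 mulf_eq0 (negbTE Hy) orbF.
apply/pdv_coef => x; rewrite expr1; have [xy|xy] := boolP (x \in dcs).
  have /pdv_coef/(_ x) := cut_bi_fixed af; rewrite expr1 galgB cutE xy galgZ => -[z zE].
  have [w wE] := ay; exists (z + w * orbsum x).
  by rewrite mulrDr -zE mulrA -wE subrK.
by have := Ta x; rewrite /T galgD galgB !cutE (negbTE xy) subr0 add0r.
Qed.

Section Summand.
Variables (V : bimodType OP OP) (dm : V -> OG) (dt : subg_of P -> subg_of P -> V).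
Hypothesis VP : coset_model y dm dt.

Lemma model_cut x : cut (dm x) = dm x.
Proof.
have [n [_ [nK Kn]]] := dmul_inv VP.
by rewrite -Kn nK.
Qed.

(** The projections to two complementary summands have coefficients at y, on [orbsum], that add up
    to 1. One of them is nonzero in k, so the corresponding projection is injective by [cut_bij] and
    the other summand vanishes. *)
Lemma model_indecomposable : bimod_indecomposable V.
Proof.
have [n [[nD nZ nl nr] [nK Kn]]] := dmul_inv VP.
split.
  exists (dt 1 1)%g; apply/eqP => E; have := dm_t VP 1%g 1%g; rewrite E (morphD0 (dm_D VP)).
  move/ffunP/(_ y); rewrite mulg1 mul1g ffunE /= ffunE eqxx => /esym/eqP.
  by rewrite oner_eq0.
move=> X Y [f fh [f' fK f'K]].
have [f'D f'Z f'R] := bimod_hom_inv fh fK f'K; have [fD fZ fR] := fh.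
pose H (t : V -> V) a := dm (t (n a)).
have HE t : bimod_hom t -> bi_equi (H t).
  move=> [tD tZ tR]; split; first split=> [a c|r a].
  - by rewrite /H nD tD (dm_D VP).
  - by rewrite /H nZ tZ (dm_Z VP) linearZ_LR /= rmorph1 mulr_algl.
  - move=> u v a uP vP.
    rewrite /H (nr (Subg vP)) (nl (Subg uP)) tR tZ (dm_R VP) (dm_Z VP) !galg_map_delta.
    by [].
have Hinj t v : bimod_hom t -> red (H t orbsum y) != 0 -> t v = 0 -> v = 0.
  move=> th Ht tv; have [W WE WH] := cut_bij (HE t th) Ht.
  have := WH (dm v); rewrite /H (model_cut v) nK tv (morphD0 (dm_D VP)).
  rewrite (lin_map0 (proj1 cut_equi)) (lin_map0 (proj1 WE)) => E.
  by rewrite -[v]nK -E (morphD0 nD).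
pose t1 v := f' ((f v).1, 0); pose t2 v := f' (0, (f v).2).
have h1 : bimod_hom t1.
  split=> [a c|a x|x c]; rewrite /t1.
  - by rewrite fD -f'D; congr f'; congr (_, _); rewrite addr0.
  - by rewrite fZ -f'Z; congr f'; congr (_, _); rewrite scaler0.
  - by rewrite fR -f'R; congr f'; congr (_, _); rewrite ract0.
have h2 : bimod_hom t2.
  split=> [a c|a x|x c]; rewrite /t2.
  - by rewrite fD -f'D; congr f'; congr (_, _); rewrite addr0.
  - by rewrite fZ -f'Z; congr f'; congr (_, _); rewrite scaler0.
  - by rewrite fR -f'R; congr f'; congr (_, _); rewrite ract0.
have t12 v : t1 v + t2 v = v.
  rewrite /t1 /t2 -f'D -{3}[v]fK; congr f'; rewrite [f v]surjective_pairing.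
  by congr (_, _); rewrite /= ?addr0 ?add0r.
have H12 : H t1 orbsum y + H t2 orbsum y = 1.
  by rewrite -galgD /H -(dm_D VP) t12 Kn cut_orbsum orbsumE dcs_y.
have f'0 : f' 0 = 0 by exact: morphD0.
have [E|/eqP E] := eqVneq (red (H t1 orbsum y)) 0.
  left=> x; have t0 : t2 (f' (x, 0)) = 0 by rewrite /t2 f'K.
  have E2 : red (H t2 orbsum y) != 0.
    apply/eqP => E'; have := congr1 red H12; rewrite rmorphD E E' addr0 rmorph1 => /esym/eqP.
    by rewrite oner_eq0.
  have /(congr1 f) := Hinj _ _ h2 E2 t0; rewrite f'K (morphD0 fD).
  by move/(congr1 fst).
right=> x; have t0 : t1 (f' (0, x)) = 0 by rewrite /t1 f'K.
have /(congr1 f) := Hinj _ _ h1 (introN eqP E) t0; rewrite f'K (morphD0 fD).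
by move/(congr1 snd).
Qed.

Definition source_cut (a : OG) := si * a * si.
Lemma source_cut_equi : bi_equi source_cut.
Proof.
split; first split=> [a c|r a]; rewrite /source_cut.
- by rewrite mulrDr mulrDl.
- by rewrite -scalerAr -scalerAl.
- move=> u v a uP vP; rewrite !mulrA (si_d i uP) -!mulrA; congr (_ * _).
  by rewrite (si_d i vP).
Qed.

(** Going from O[PyP] through g into the corner and cutting back to PyP is invertible by [cut_bij],
    which splits the map into the source algebra. *)
Lemma model_summand g : bi_equi g -> red (source_cut (g orbsum) y) != 0 ->
  bimod_summand V (source_bimod i).
Proof.
move=> gE gy; have [n [[nD nZ nl nr] [nK Kn]]] := dmul_inv VP.
have HE : bi_equi (fun a => source_cut (g a)) := bi_equi_comp source_cut_equi gE.
have [W WE WH] := cut_bij HE gy.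
have [[gD gZ] gP] := gE.
have [[WD WZ] WP] := WE; have [[cD cZ] cP] := cut_equi.
pose s (x : V) : source_bimod i := toS (g (dm x)).
pose r (m : source_bimod i) : V := n (W (cut (valS m))).
have SO (a : O) (m : S) : (a%:A : OP) *: (m : source_bimod i) = a *: m :> S.
  by rewrite -[LHS]/(source_map i (a%:A : OP) * m) linearZ_LR rmorph1 mulr_algl.
have Sl v (m : source_bimod i) : valS (gdelta O v *: m) = 'd (sgval v) * valS m.
  exact: source_delta.
have Sr v (m : source_bimod i) : valS (m *| gdelta O v) = valS m * 'd (sgval v).
  exact: source_deltar.
have g_l u a : u \in P -> g ('d u * a) = 'd u * g a.
  by move=> uP; have := gP u 1%g a uP (group1 P); rewrite !mulr1.
have g_r u a : u \in P -> g (a * 'd u) = g a * 'd u.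
  by move=> uP; have := gP 1%g u a (group1 P) uP; rewrite !mul1r.
have WC_l u a : u \in P -> W (cut ('d u * a)) = 'd u * W (cut a).
  move=> uP; have := cP u 1%g a uP (group1 P); have := WP u 1%g (cut a) uP (group1 P).
  by rewrite !mulr1 => <- ->.
have WC_r u a : u \in P -> W (cut (a * 'd u)) = W (cut a) * 'd u.
  move=> uP; have := cP 1%g u a (group1 P) uP; have := WP 1%g u (cut a) (group1 P) uP.
  by rewrite !mul1r => <- ->.
have sh : bimod_hom s.
  apply: bimod_hom_delta => [x z|a x|u x|x u].
  - by rewrite /s (dm_D VP) gD toS_D.
  - rewrite SO /s (dm_Z VP) linearZ_LR /= rmorph1 mulr_algl gZ; exact: toS_Z.
  - apply: valS_inj; rewrite Sl /s (dm_Z VP) galg_map_delta g_l ?subgP //=.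
    by rewrite !mulrA (si_d i (subgP u)).
  - apply: valS_inj; rewrite Sr /s (dm_R VP) galg_map_delta g_r ?subgP //=.
    by rewrite -!mulrA (si_d i (subgP u)).
have rh : bimod_hom r.
  apply: bimod_hom_delta => [x z|a x|u x|x u]; rewrite /r.
  - by rewrite -nD -WD -cD.
  - by rewrite -nZ -WZ -cZ SO.
  - by rewrite -nl -WC_l ?subgP // Sl.
  - by rewrite -nr -WC_r ?subgP // Sr.
apply: (@split_summand _ _ _ _ _ (BimodMorphism rh) s sh) => x /=.
rewrite /r /s /= -/(source_cut _) -{1}[dm x]model_cut WH.
by rewrite model_cut nK.
Qed.
End Summand.
End Cut.

Lemma arises_of_coef y g : bi_equi g -> red (source_cut (g (orbsum O P y)) y) != 0 ->
  arises i (cphi P y).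
Proof.
move=> gE gy; split; first exact: cphi_inj.
have VP := @dmul_model O gT P y.
exists (cosetQ_sub P y), (twisted_bimod O (cosetQ_sub P y) (cphi P y)); split.
- exact: (model_summand VP gE gy).
- exact: (model_indecomposable VP).
- by exists id => //; exists id.
Qed.
End DoubleCosets.

(** * Rescaling the double cosets on which eta is invariant *)

Section DoubleCosets.
Variables (O : idomainType) (pi : O) (k : fieldType) (red : {rmorphism O -> k}).
Hypotheses (O_cdvr : complete_dvr pi) (k_residue : residue_map pi red).
Variable p : nat.
Hypotheses (p_prime : prime p) (k_char : p \in [pchar k]) (O_fg : fg_over_padic p O).
Hypothesis K_char : [pchar {fraction O}] =i pred0.
Variable zeta : O.
Hypothesis zeta_prim : p.-primitive_root zeta.
Variables (gT : finGroupType) (b : block O gT) (P : {group gT}).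
Hypothesis P_defect : defect_group b red p P.
Variable i : source_idempotent b red P.
Local Notation lam := (1 - zeta).
Local Notation OG := (galg O gT).
Local Notation "''d' g" := (gdelta O (g : gT)) (at level 8, g at level 2, format "''d' g").
Local Notation eb := (block_unit b).
Local Notation B := (block_alg b).
Local Notation valB := (@corner_val O (galg O gT) (block_idempotent b)).
Local Notation si := (source_val i).
Local Notation iB := (iB i).
Local Notation gam := (gam b).
Local Notation toB := (toB b).
Local Notation fixB := (fixB P).
Local Notation mfix := (@mfix O zeta gT b P).
Local Notation isu := (isu i).
Local Notation brB := (brB red P).
Local Notation cgB := (@cg O lam B).
Let pP : (p.-group P)%g := defect_pgroup P_defect.

Local Notation OP := (galg O (subg_of P)).

Local Notation S := (source_alg i).
Local Notation valS := (@corner_val O (galg O gT) (source_idem_of i)).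
Local Notation toS := (toS i).
Local Notation cut := (@cut O gT P).
Local Notation orbsum := (orbsum O P).
Local Notation dcs := (dcs P).
Local Notation source_cut := (source_cut i).
Local Notation bi_equi := (@bi_equi O gT P).
Local Notation bi_fixed := (@bi_fixed O pi gT P).
Local Notation pdv := (@pdv O pi OG).
Local Notation sg := (galg_map (@sgval gT P)).

Section Coefficients.
(* Cutting down to double cosets makes this relation transitive, and a cycle
   through x exhibits O[PxP] as a summand of the source algebra. *)
Definition coef_rel x z := exists2 g, bi_equi g & red (source_cut (g (orbsum z)) x) != 0.

Lemma coef_rel_trans x z t : coef_rel x z -> coef_rel z t -> coef_rel x t.
Proof.
move=> [g gE gx] [h hE hz]; exists (fun a => g (cut z (source_cut (h a)))).
  apply: bi_equi_comp => //; apply: bi_equi_comp; first exact: cut_equi.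
  by apply: bi_equi_comp => //; apply: source_cut_equi.
have HE : bi_equi (fun a => source_cut (h a)) := bi_equi_comp (source_cut_equi i) hE.
rewrite cut_fixed => [|u v uP vP]; last by rewrite -(proj2 HE) // orbsum_fixed.
have [[_ gZ] _] := gE; have [[_ eZ] _] := source_cut_equi i.
by rewrite gZ eZ galgZ rmorphM mulf_neq0.
Qed.

(** By transitivity the successors of x0 in Z again have successors among themselves, and they form
    a smaller set unless x0 is related to itself. *)
Lemma trans_cycle (r : gT -> gT -> Prop) (Z : {set gT}) x0 : (forall x z t, r x z -> r z t -> r x t) ->
  x0 \in Z -> (forall x, x \in Z -> exists2 z, z \in Z & r x z) -> exists2 x, x \in Z & r x x.
Proof.
move=> rT; elim: {Z}#|Z| {-2}Z (leqnn #|Z|) x0 => [|n IHn] Z Zn x0 x0Z Zr.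
  by move: Zn x0Z; rewrite leqn0 cards_eq0 => /eqP ->; rewrite inE.
have [r0|r0] := pselect (r x0 x0); first by exists x0.
pose Z' := [set x in Z | `[< r x0 x >]].
have Z'P x : x \in Z' -> x \in Z /\ r x0 x by rewrite inE => /andP[? /asboolP].
have [x1 x1Z r1] := Zr _ x0Z.
have x1Z' : x1 \in Z' by rewrite inE x1Z; apply/asboolP.
have Z'n : (#|Z'| <= n)%N.
  rewrite -ltnS; apply: leq_trans Zn; apply: proper_card; apply/properP; split.
    by apply/subsetP => x /Z'P[].
  by exists x0 => //; apply/negP => /Z'P[].
have Z's x : x \in Z' -> exists2 z, z \in Z' & r x z.
  move=> /Z'P[xZ rx]; have [z zZ rz] := Zr _ xZ; exists z => //; rewrite inE zZ; apply/asboolP.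
  exact: rT rx rz.
by have [x /Z'P[xZ _] rx] := IHn Z' Z'n x1 x1Z' Z's; exists x.
Qed.

Lemma bi_fixed_equi T a : bi_equi T -> bi_fixed a -> bi_fixed (T a).
Proof.
move=> [Tl TP] af u v uP vP; rewrite -TP // -(lin_mapB _ _ Tl); apply: lin_map_pdv Tl _.
exact: af.
Qed.

(** Modulo [pi] a bi-fixed vector is a combination of double coset sums from its support; they are
    peeled off one at a time until one is found on which L does not vanish. *)
Lemma bi_fixed_expand (L : OG -> O) (a : OG) : {morph L : x z / x + z} ->
  (forall r x, L (r *: x) = r * L x) -> bi_fixed a ->
  red (L a) != 0 -> exists2 z, red (a z) != 0 & red (L (orbsum z)) != 0.
Proof.
move=> LD LZ; pose Z a := [set z | red (a z) != 0] : {set gT}.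
have LB x z : L (x - z) = L x - L z.
  by rewrite LD -scaleN1r LZ mulN1r.
have Lpi x : pdv 1 x -> red (L x) = 0.
  by move=> [w ->]; apply/(red0P k_residue); rewrite LZ expr1; exists (L w).
elim: {a}#|Z a| {-2}a (leqnn #|Z a|) => [|n IHn] a Zn af La.
  case/eqP: La; apply: Lpi; apply/pdv_coef => x; rewrite expr1; apply/(red0P k_residue).
  apply: contrapT => /eqP ax; move: Zn; rewrite leqn0 cards_eq0 => /eqP/setP/(_ x).
  by rewrite !inE ax.
have [/existsP[z /andP[az Lz]]|/existsPn nz] := boolP [exists z, (red (a z) != 0) && (red (L (orbsum z)) != 0)].
  by exists z.
have [z az] : exists z, red (a z) != 0.
  apply: contrapT => h; case/eqP: La; apply: Lpi; apply/pdv_coef => x; rewrite expr1.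
  by apply/(red0P k_residue); apply: contrapT => /eqP ax; apply: h; exists x.
have Lz : red (L (orbsum z)) = 0 by have := nz z; rewrite az /= => /negPn/eqP.
have cE := cut_equi O P z; have [_ cP] := cE.
have L0 : red (L (cut z a)) = 0.
  have := Lpi _ (cut_bi_fixed z af); rewrite LB LZ rmorphB rmorphM Lz mulr0 subr0.
  by [].
have caf : bi_fixed (a - cut z a).
  exact: (bi_fixed_equi (bi_equiB (bi_equi_id O P) cE) af).
have Zn' : (#|Z (a - cut z a)%R| <= n)%N.
  rewrite -ltnS; apply: leq_trans Zn; apply: proper_card; apply/properP; split.
    apply/subsetP => x; rewrite !inE galgB cutE; case: ifP => _; last by rewrite subr0.
    by rewrite subrr rmorph0 eqxx.
  by exists z; rewrite !inE // galgB cutE dcs_y subrr rmorph0 eqxx.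
have Lc : red (L (a - cut z a)) != 0 by rewrite LB rmorphB L0 subr0.
have [x xa xL] := IHn (a - cut z a) Zn' caf Lc.
exists x => //; move: xa; rewrite galgB cutE; case: ifP => _; last by rewrite subr0.
by rewrite subrr rmorph0 eqxx.
Qed.
End Coefficients.

Section Twist.
Variable eta : gT -> O.
Hypothesis etaP : pchar_on p P eta.
Hypothesis eta_arises : forall (Q : {group gT}) (phi : sub_hom Q P), arises i phi ->
  forall q : subg_of Q, eta (sgval (phi q)) = eta (sgval q).

(** The condition under which [eta u * eta v] depends only on the element u x v. *)
Definition good (x : gT) := `[< forall u, u \in P -> (u ^ x)%g \in P -> eta (u ^ x)%g = eta u >].
Lemma goodP x : reflect (forall u, u \in P -> (u ^ x)%g \in P -> eta (u ^ x)%g = eta u) (good x).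
Proof. exact: asboolP. Qed.

Lemma good_uv u v x : u \in P -> v \in P -> good (u * x * v)%g = good x.
Proof.
have [eM _] := etaP.
have eJ w v' : w \in P -> v' \in P -> eta (w ^ v')%g = eta w.
  move=> wP vP; rewrite conjgE !eM ?groupM ?groupV //.
  by rewrite mulrC -mulrA [eta v' * _](pchar_V p_prime etaP) ?mulr1.
have h u' v' z : u' \in P -> v' \in P -> good z -> good (u' * z * v')%g.
  move=> uP vP /goodP zg; apply/goodP => w wP wxP.
  have wuP : (w ^ u')%g \in P by rewrite groupJ.
  have wuzP : ((w ^ u') ^ z)%g \in P.
    by move: wxP; rewrite !conjgM groupJr.
  by rewrite !conjgM eJ // zg // eJ.
move=> uP vP; apply/idP/idP; last exact: h.
by move/(h u^-1%g v^-1%g); rewrite !mulgA mulVg mul1g mulgK; apply; rewrite groupV.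
Qed.

Lemma good_of_coef x : coef_rel x x -> good x.
Proof.
move=> [g gE gx]; have ar := arises_of_coef O_cdvr k_residue p_prime k_char O_fg P_defect gE gx.
apply/goodP => u uP uxP.
have qP : (u ^ x)%g \in cosetQ P x by rewrite inE uxP memJ_conjg.
by have := eta_arises ar (Subg qP); rewrite /= conjgK => ->.
Qed.

Definition bad_part (a : OG) : OG := [ffun x => if good x then 0 else a x].
Lemma bad_partE a x : bad_part a x = if good x then 0 else a x. Proof. by rewrite ffunE. Qed.
Lemma bad_part_equi : bi_equi bad_part.
Proof.
split; first split=> [a c|r a].
- by apply/ffunP => x; rewrite galgD !bad_partE galgD; case: ifP; rewrite ?addr0.
- by apply/ffunP => x; rewrite galgZ !bad_partE galgZ; case: ifP; rewrite ?mulr0.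
- move=> u v a uP vP; apply/ffunP => x.
  by rewrite gdelta_uv !bad_partE gdelta_uv good_uv ?groupV.
Qed.

(** On the corner this is the compression of the projection that discards the bad double cosets.
    Once it is invertible, every element of the corner is the compression of a combination of good
    double cosets. *)
Definition bad_free (a : OG) := a - source_cut (bad_part (source_cut a)).
Lemma bad_free_equi : bi_equi bad_free.
Proof.
apply: bi_equiB; first exact: bi_equi_id.
apply: bi_equi_comp; first exact: source_cut_equi.
by apply: bi_equi_comp; [exact: bad_part_equi|exact: source_cut_equi].
Qed.

Lemma source_cutK a : source_cut (source_cut a) = source_cut a.
Proof.
rewrite /source_cut -!mulrA (mulrA si si) source_idem; congr (_ * (_ * _)).
Qed.

(* A fixed vector in the kernel modulo pi, followed along the double cosets in its
   support, gives a cycle of [coef_rel] through a bad element. *)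
Lemma bad_free_bij : exists W, [/\ bi_equi W, cancel bad_free W & cancel W bad_free].
Proof.
apply: (bi_equi_bij O_cdvr k_residue p_prime k_char O_fg pP bad_free_equi) => a af Va.
have eE := source_cut_equi i; have bE := bad_part_equi.
pose a1 := bad_part (source_cut a).
have a1f : bi_fixed a1 by apply: bi_fixed_equi (bi_equi_comp bE eE) af.
suff a10 : pdv 1 a1.
  have -> : a = bad_free a + source_cut a1 by rewrite /bad_free subrK.
  by apply: pdvD => //; apply: lin_map_pdv (proj1 eE) a10.
have a1E : pdv 1 (a1 - bad_part (source_cut a1)).
  rewrite -[source_cut a1]source_cutK {1}/a1 -(lin_mapB _ _ (proj1 bE)) -(lin_mapB _ _ (proj1 eE)).
  by apply: lin_map_pdv (proj1 bE) _; apply: lin_map_pdv (proj1 eE) Va.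
apply: contrapT => Na1; pose Z := [set z | red (a1 z) != 0].
have [x0 x0Z] : exists x0, x0 \in Z.
  apply: contrapT => h; apply: Na1; apply/pdv_coef => x; rewrite expr1; apply/(red0P k_residue).
  by apply: contrapT => /eqP ax; apply: h; exists x; rewrite inE.
have Zbad x : x \in Z -> ~~ good x.
  by rewrite inE /a1 bad_partE; case: ifP => //; rewrite rmorph0 eqxx.
have Zr x : x \in Z -> exists2 z, z \in Z & coef_rel x z.
  move=> xZ; have xb := Zbad _ xZ.
  have Lx : red (source_cut a1 x) != 0.
    have /pdv_coef/(_ x) := a1E; rewrite expr1 galgB bad_partE (negbTE xb).
    move/(red0P k_residue); rewrite rmorphB => /eqP; rewrite subr_eq0 => /eqP <-.
    by move: xZ; rewrite inE.
  have [[eD eZ] _] := eE.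
  have [||z az Lz] := @bi_fixed_expand (fun a => source_cut a x) a1 _ _ a1f Lx.
  - by move=> c d; rewrite eD galgD.
  - by move=> r c; rewrite eZ galgZ.
  by exists z; [rewrite inE|exists id => //; exact: bi_equi_id].
have [x /Zbad xb xx] := trans_cycle coef_rel_trans x0Z Zr.
by rewrite good_of_coef in xb.
Qed.

(** A representative r is fixed in each double coset, and x = u r v receives the value
    [eta u * eta v]; the congruence to 1 is inherited from eta. *)
Lemma twist_function : exists c : gT -> O,
  (forall u v x, u \in P -> v \in P -> good x -> c (u * x * v)%g = eta u * eta v * c x) /\
  forall x, exists y, good x -> c x = 1 + lam * y.
Proof.
have [eM _] := etaP.
have dU u v x : u \in P -> v \in P -> dcs (u * x * v)%g = dcs x.
  move=> uP vP; apply/setP => z; apply/dcsP/dcsP => -[u' [v' [u'P v'P ->]]].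
    by exists (u' * u)%g, (v * v')%g; rewrite !groupM // !mulgA.
  exists (u' * u^-1)%g, (v^-1 * v')%g; rewrite !groupM ?groupV // !mulgA.
  by split=> //; rewrite mulgKV mulgK.
pose r x := odflt x [pick z in dcs x].
have rU u v x : u \in P -> v \in P -> r (u * x * v)%g = r x.
  move=> uP vP; rewrite /r dU //; case: pickP => // /(_ x); by rewrite dcs_y.
have rP x : exists u v, [/\ u \in P, v \in P & x = (u * r x * v)%g].
  have : r x \in dcs x by rewrite /r; case: pickP => // /(_ x); rewrite dcs_y.
  move=> /dcsP[u [v [uP vP ->]]]; exists u^-1%g, v^-1%g; rewrite !groupV uP vP; split=> //.
  by rewrite !mulgA mulVg mul1g mulgK.
have /choice[f fP] : forall x, exists f : gT * gT, [/\ f.1 \in P, f.2 \in P & x = (f.1 * r x * f.2)%g].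
  by move=> x; have [u [v h]] := rP x; exists (u, v).
pose c x := eta (f x).1 * eta (f x).2.
have cE u v z : u \in P -> v \in P -> good z -> r (u * z * v)%g = z -> c (u * z * v)%g = eta u * eta v.
  move=> uP vP /goodP zg rz; have [f1 f2] := fP (u * z * v)%g; rewrite rz => E.
  set u' := (f _).1 in f1 E *; set v' := (f _).2 in f2 E *.
  (* Two ways of writing the same element of PzP differ by an element of P whose conjugate under z
     is again in P, and goodness of z equates the values of eta on the two. *)
  have E2 : ((u'^-1 * u) ^ z = v' * v^-1)%g.
    rewrite conjgE; apply: (mulgI (u' * z)%g); apply: (mulIg v).
    by rewrite !mulgA mulgKV -E -!mulgA mulKVg mulKVg.
  have := zg (u'^-1 * u)%g; rewrite E2 !groupM ?groupV // => /(_ isT isT).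
  rewrite !eM ?groupV // => E3.
  have uV := pchar_V p_prime etaP f1; have vV := pchar_V p_prime etaP vP.
  rewrite /c -/u' -/v'.
  have -> : eta v' = eta v' * eta v^-1%g * eta v by rewrite -mulrA [_ * eta v]mulrC vV mulr1.
  by rewrite E3 !mulrA uV mul1r.
exists c; split=> [u v x uP vP xg|x].
  have [f1 f2 xE] := fP x; have rg : good (r x) by rewrite {1}xE good_uv in xg.
  have rr : r (r x) = r x by rewrite {2}xE rU.
  have uf : (u * (f x).1)%g \in P by rewrite groupM.
  have fv : ((f x).2 * v)%g \in P by rewrite groupM.
  have -> : (u * x * v = u * (f x).1 * r x * ((f x).2 * v))%g by rewrite {1}xE !mulgA.
  by rewrite cE ?rU // !eM // /c; ring.
have [f1 f2 _] := fP x; have [z1 E1] := pchar_cong zeta_prim etaP f1.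
have [z2 E2] := pchar_cong zeta_prim etaP f2.
by exists (z1 + z2 + lam * z1 * z2) => _; rewrite /c E1 E2; ring.
Qed.

(* On the good double cosets the twist by eta is a well-defined rescaling of the
   group basis; [bad_free] lets us discard the others. *)
Lemma twisted_map : exists phi : OG -> OG, [/\ lin_map phi,
  forall a, phi a = source_cut (phi a),
  forall u v a, u \in P -> v \in P -> source_cut a = a ->
    phi ('d u * a * 'd v) = (eta u * eta v) *: ('d u * phi a * 'd v) &
  forall a, source_cut a = a -> exists w, phi a = a + lam *: w].
Proof.
have [W [WE VW WV]] := bad_free_bij; have [c [cE c1]] := twist_function.
pose cm (a : OG) : OG := [ffun x => if good x then c x * a x else 0].
have cmE a x : cm a x = if good x then c x * a x else 0 by rewrite ffunE.
have cml : lin_map cm.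
  split=> [a d|r a]; apply/ffunP => x.
    by rewrite galgD !cmE galgD mulrDr; case: ifP; rewrite ?addr0.
  by rewrite galgZ !cmE galgZ; case: ifP; rewrite ?mulr0 // mulrCA.
have [eM _] := etaP; have eE := source_cut_equi i; have [el eP] := eE; have [Wl WP] := WE.
have cmP u v a : u \in P -> v \in P -> cm ('d u * a * 'd v) = (eta u * eta v) *: ('d u * cm a * 'd v).
  move=> uP vP; apply/ffunP => x; rewrite galgZ cmE !gdelta_uv cmE good_uv ?groupV //.
  case: ifP => xg; last by rewrite mulr0.
  rewrite mulrA cE ?groupV // ?good_uv ?groupV //.
  have U := pchar_V p_prime etaP uP; have V := pchar_V p_prime etaP vP.
  rewrite mulrA; congr (_ * _).
  by rewrite mulrACA U V !mul1r.
have Wcut a : source_cut a = a -> source_cut (W a) = W a.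
  move=> ea; apply: (can_inj VW); rewrite WV.
  have Ve x : bad_free (source_cut x) = source_cut (bad_free x).
    by rewrite /bad_free (lin_mapB _ _ el) !source_cutK.
  by rewrite Ve WV.
exists (fun a => source_cut (cm (W a))); split.
- split=> [a d|r a].
    by rewrite (proj1 Wl) (proj1 cml) (proj1 el).
  by rewrite (proj2 Wl) (proj2 cml) (proj2 el).
- by move=> a; rewrite source_cutK.
- by move=> u v a uP vP ea; rewrite WP // cmP // (proj2 el) eP.
move=> a ea; set b' := W a.
have eb' : source_cut b' = b' by exact: Wcut.
have aE : a = source_cut (b' - bad_part b').
  rewrite -[LHS]WV -/b' /bad_free eb' (lin_mapB _ _ el) eb'.
  by [].
have /choice[w wE] := c1.
exists (source_cut [ffun x => if good x then w x * b' x else 0]).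
rewrite aE -(proj2 el) -(proj1 el); congr source_cut; apply/ffunP => x.
rewrite galgD galgZ galgB bad_partE cmE ffunE; case: ifP => xg.
  by rewrite (wE _ xg) subr0 mulrDl mul1r mulrA.
by rewrite subrr mulr0 addr0.
Qed.
End Twist.
End DoubleCosets.

(** * From a twisted linear map to an automorphism *)

Section DoubleCosets.
Variables (O : idomainType) (pi : O) (k : fieldType) (red : {rmorphism O -> k}).
Hypotheses (O_cdvr : complete_dvr pi) (k_residue : residue_map pi red).
Variable p : nat.
Hypotheses (p_prime : prime p) (k_char : p \in [pchar k]) (O_fg : fg_over_padic p O).
Hypothesis K_char : [pchar {fraction O}] =i pred0.
Variable zeta : O.
Hypothesis zeta_prim : p.-primitive_root zeta.
Variables (gT : finGroupType) (b : block O gT) (P : {group gT}).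
Hypothesis P_defect : defect_group b red p P.
Variable i : source_idempotent b red P.
Local Notation lam := (1 - zeta).
Local Notation OG := (galg O gT).
Local Notation "''d' g" := (gdelta O (g : gT)) (at level 8, g at level 2, format "''d' g").
Local Notation eb := (block_unit b).
Local Notation B := (block_alg b).
Local Notation valB := (@corner_val O (galg O gT) (block_idempotent b)).
Local Notation si := (source_val i).
Local Notation iB := (iB i).
Local Notation gam := (gam b).
Local Notation toB := (toB b).
Local Notation fixB := (fixB P).
Local Notation mfix := (@mfix O zeta gT b P).
Local Notation isu := (isu i).
Local Notation brB := (brB red P).
Local Notation cgB := (@cg O lam B).
Let pP : (p.-group P)%g := defect_pgroup P_defect.

Local Notation OP := (galg O (subg_of P)).

Local Notation S := (source_alg i).
Local Notation valS := (@corner_val O (galg O gT) (source_idem_of i)).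
Local Notation toS := (toS i).
Local Notation cut := (@cut O gT P).
Local Notation orbsum := (orbsum O P).
Local Notation dcs := (dcs P).
Local Notation source_cut := (source_cut i).
Local Notation bi_equi := (@bi_equi O gT P).
Local Notation bi_fixed := (@bi_fixed O pi gT P).
Local Notation dvdB := (@pdv O pi B).
Local Notation pdv := (@pdv O pi OG).
Local Notation sg := (galg_map (@sgval gT P)).

Section TwistingAutomorphism.
Variable eta : gT -> O.
Hypothesis etaP : pchar_on p P eta.
Local Notation ui u := (gam u * iB).

(** Approximations to the automorphism: compatible with P and eta exactly, but multiplicative only
    modulo [lam], because f is congruent to the identity. *)
Record twist_map (f : B -> B) : Prop := TwistMap {
  tm_D : {morph f : x y / x + y};
  tm_Z : forall r x, f (r *: x) = r *: f x;
  tm_1 : f 1 = 1;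
  tm_l : forall u x, u \in P -> f (ui u * x) = eta u *: (ui u * f x);
  tm_r : forall u x, u \in P -> f (x * ui u) = eta u *: (f x * ui u);
  tm_cg : forall x, cgB (f x) x }.

Lemma iB_ui u : u \in P -> iB * ui u = ui u.
Proof. by move=> uP; rewrite (fixB_i i uP) mulrA iBiB. Qed.

Section Step.
Variables X Y : {set gT} -> B.
Local Notation Rc := (rcosets P [set: gT]).
Hypothesis XY : \sum_(C in Rc) X C * Y C = 1.
Hypothesis bal : forall f h, linB f -> linB h ->
  (forall u x y, u \in P -> x * iB = x -> iB * y = y ->
     f (x * ui u) * h y = f x * h (ui u * y)) ->
  forall a, \sum_(C in Rc) f (a * X C) * h (Y C) = \sum_(C in Rc) f (X C) * h (Y C * a).

Section OneStep.
Variable f : B -> B.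
Hypothesis fP : twist_map f.
Local Notation D := (fun x y => f (x * y) - f x * f y).
(** The 1-cochain obtained by contracting the defect D with the Casimir element; adding it to f
    cancels D to first order. *)
Definition corr (a : B) := \sum_(C in Rc) f (X C) * D (Y C) a.
Definition improve (a : B) := f a + corr a.

Lemma tm_0 : f 0 = 0. Proof. exact: morphD0 (tm_D fP). Qed.
Lemma tm_sum (F : {set gT} -> B) : f (\sum_(C in Rc) F C) = \sum_(C in Rc) f (F C).
Proof. exact: (big_morph f (tm_D fP) tm_0). Qed.
Lemma tm_lin : linB f. Proof. by split; [exact: tm_D|exact: tm_Z]. Qed.
Lemma tm_ui u : u \in P -> f (ui u) = eta u *: ui u.
Proof. by move=> uP; rewrite -[X in f X]mulr1 (tm_l fP) // (tm_1 fP) mulr1. Qed.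

Lemma D_linr x : linB (D x).
Proof.
split=> [y z|r y]; first by rewrite mulrDr !(tm_D fP) mulrDr opprD addrACA.
by rewrite -scalerAr !(tm_Z fP) -scalerAr scalerBr.
Qed.
Lemma D_linl y : linB (fun x => D x y).
Proof.
split=> [x z|r x]; first by rewrite mulrDl !(tm_D fP) mulrDl opprD addrACA.
by rewrite -scalerAl !(tm_Z fP) -scalerAl scalerBr.
Qed.
Lemma D_l u x y : u \in P -> D (ui u * x) y = eta u *: (ui u * D x y).
Proof.
move=> uP /=; rewrite -(mulrA (ui u) x y) !(tm_l fP) // -scalerAl -scalerBr; congr (_ *: _).
by rewrite mulrBr (mulrA (ui u) (f x)).
Qed.
Lemma bal_f a h : linB h -> (forall u y, u \in P -> iB * y = y -> h (ui u * y) = eta u *: (ui u * h y)) ->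
  \sum_(C in Rc) f (a * X C) * h (Y C) = \sum_(C in Rc) f (X C) * h (Y C * a).
Proof.
move=> hl hu; apply: bal => // [|u x y uP xi yi]; first exact: tm_lin.
by rewrite (tm_r fP) // hu // -scalerAl -scalerAr (mulrA (f x) (ui u)).
Qed.
Lemma bal_fl u h : u \in P -> linB h -> (forall u y, u \in P -> iB * y = y -> h (ui u * y) = eta u *: (ui u * h y)) ->
  \sum_(C in Rc) f (X C) * h (Y C * ui u) = eta u *: (ui u * \sum_(C in Rc) f (X C) * h (Y C)).
Proof.
move=> uP hl hu; rewrite -bal_f // mulr_sumr scaler_sumr; apply: eq_bigr => C _.
by rewrite (tm_l fP) // -scalerAl (mulrA (ui u) (f _)).
Qed.

Lemma improve_twist : twist_map improve.
Proof.
have corrD : {morph corr : x y / x + y}.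
  move=> x y; rewrite /corr -big_split; apply: eq_bigr => C _.
  by rewrite (proj1 (D_linr (Y C))) mulrDr.
have corrZ r x : corr (r *: x) = r *: corr x.
  rewrite /corr scaler_sumr; apply: eq_bigr => C _.
  by rewrite (proj2 (D_linr (Y C))) -scalerAr.
split=> [x y|r x||u x uP|u x uP|x].
- by rewrite /improve corrD (tm_D fP) addrACA.
- by rewrite /improve corrZ (tm_Z fP) scalerDr.
- rewrite /improve /corr big1 ?addr0 ?(tm_1 fP) // => C _.
  by rewrite !mulr1 subrr mulr0.
- rewrite /improve (tm_l fP) // mulrDr scalerDr; congr (_ + _).
  rewrite /corr; under eq_bigr => C _ do rewrite mulrBr.
  under [X in _ = _ *: (_ * X)]eq_bigr => C _ do rewrite mulrBr.
  rewrite !sumrB mulrBr scalerBr; congr (_ - _).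
    under eq_bigr => C _ do rewrite mulrA.
    apply: (@bal_fl u (fun y => f (y * x)) uP).
      split=> [y z|r y]; first by rewrite mulrDl (tm_D fP).
      by rewrite -scalerAl (tm_Z fP).
    by move=> v y vP _; rewrite -mulrA (tm_l fP).
  under eq_bigr => C _ do rewrite (tm_l fP) // mulrA -scalerAr.
  under [X in _ = _ *: (_ * X)]eq_bigr => C _ do rewrite mulrA.
  have h1 : linB f := tm_lin.
  have := bal_fl uP h1 (fun v y vP _ => tm_l fP y vP).
  rewrite (eq_bigr (fun C => eta u *: (f (X C) * (f (Y C) * ui u)))) => [|C _]; last first.
    by rewrite (tm_r fP) // -scalerAr.
  move/(congr1 (fun z => z * f x)); rewrite mulr_suml -scalerAl.
  rewrite -(mulrA (ui u)) mulr_suml => <-; apply: eq_bigr => C _.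
  by rewrite -scalerAl !mulrA.
- rewrite /improve (tm_r fP) // mulrDl scalerDr; congr (_ + _).
  rewrite /corr mulr_suml scaler_sumr; apply: eq_bigr => C _.
  rewrite (mulrA (Y C)) !(tm_r fP) // -scalerAr -scalerBr -scalerAr; congr (_ *: _).
  by rewrite (mulrA (f (Y C))) -mulrBl (mulrA (f (X C))).
- rewrite -[X in cg _ _ X]addr0; apply: cgD; first exact: tm_cg.
  have -> : (0 : B) = \sum_(C in Rc) 0 by rewrite big1.
  apply: cg_sum => C _; rewrite -(mulr0 (f (X C))); apply: cg_mull; apply: cg_sub0.
  apply: cg_trans (tm_cg fP _) _; apply: cg_sym; apply: cg_mul; exact: tm_cg.
Qed.

Lemma dvdB_sum (I : finType) (Q : pred I) n (F : I -> B) : (forall j, Q j -> dvdB n (F j)) ->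
  dvdB n (\sum_(j | Q j) F j).
Proof.
move=> h; rewrite big_mkcond; apply: pdv_sum => j; case: ifP => [/h|_] //; exact: pdv0.
Qed.

(* D satisfies f(a) D(b,c) - D(ab,c) + D(a,bc) - D(a,b) f(c) = 0. Contracting this
   with the Casimir element sum X (x) Y, as in the proof that separable algebras have
   no second Hochschild cohomology, makes the new defect quadratic in D. *)
Lemma improve_defect n : (forall x y, dvdB n (D x y)) ->
  (forall a, dvdB n (improve a - f a)) /\
  forall x y, dvdB (n + n) (improve (x * y) - improve x * improve y).
Proof.
move=> Dn; have cn a : dvdB n (corr a) by apply: dvdB_sum => C _; apply: pdvMl.
split=> [a|x y]; first by rewrite /improve addrC addKr.
pose s := \sum_(C in Rc) D (X C) (Y C).
pose t := \sum_(C in Rc) D x (X C) * D (Y C) y.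
have XYf : \sum_(C in Rc) f (X C) * f (Y C) = 1 - s.
  rewrite /s sumrB -tm_sum XY (tm_1 fP) opprB addrC subrK //.
have key : f x * corr y = (1 - s) * D x y + corr (x * y) - corr x * f y - t.
  have E1 : f x * corr y = \sum_(C in Rc) f (x * X C) * D (Y C) y - t.
    rewrite /corr mulr_sumr /t -sumrB; apply: eq_bigr => C _.
    by rewrite -mulrBl opprB [f (x * _) + _]addrC subrK mulrA.
  rewrite E1; congr (_ - _).
  rewrite (@bal_f x (fun z => D z y)); first last.
  - by move=> u z uP _; apply: D_l.
  - exact: D_linl.
  rewrite -XYf mulr_suml /corr mulr_suml -big_split -sumrB; apply: eq_bigr => C _ /=.
  rewrite -(mulrA (f (X C)) (f (Y C))) -mulrDr -(mulrA (f (X C))) -mulrBr; congr (_ * _).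
  rewrite mulrBr mulrBl (mulrA (Y C) x y) (mulrA (f (Y C)) (f x)).
  move: (f (Y C * x * y)) (f (Y C) * f (x * y)) (f (Y C) * f x * f y) (f (Y C * x) * f y) => A1 A2 A3 A4.
  by rewrite [A2 - A3 + _]addrC addrA subrK opprB addrA subrK.
have -> : improve (x * y) - improve x * improve y = s * D x y + t - corr x * corr y.
  rewrite /improve (mulrDl (f x)) (mulrDr (f x)) (mulrDr (corr x)) key; clear key.
  move: (corr (x * y)) (corr x * f y) (corr x * corr y) => A1 A2 A3.
  rewrite mulrBl mul1r; move: (s * (f (x * y) - f x * f y)) => A4; move: (f (x * y)) (f x * f y) => A5 A6; move: t => A7.
  rewrite (_ : A6 + (A5 - A6 - A4 + A1 - A2 - A7) = A5 - A4 + A1 - A2 - A7); last first.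
    by rewrite !addrA [A6 + A5]addrC addrK.
  rewrite (addrACA _ (- A7)) subrK (addrAC A5 (- A4)) opprD opprB (addrA (A5 + A1)).
  by rewrite [A5 + A1 + _]addrC subrK opprD opprK addrA.
apply: pdvB; first apply: pdvD.
- by apply: pdvMM => //; apply: dvdB_sum => C _.
- by apply: dvdB_sum => C _; apply: pdvMM.
- exact: pdvMM.
Qed.
End OneStep.

Lemma dvdB_sep (x : B) : (forall n, dvdB n x) -> x = 0.
Proof.
move=> h; apply: valB_inj; apply: (pdv_sep O_cdvr k_residue) => n.
by have [w ->] := h n; exists (valB w).
Qed.

Lemma limB (s : nat -> B) : (forall n, dvdB n (s n.+1 - s n)) -> exists l, forall n, dvdB n (l - s n).
Proof.
move=> h; have [l lE] : exists l, forall n, pdv n (l - valB (s n)).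
  apply: (gal_lim O_cdvr) => n; have [w wE] := h n; exists (valB w).
  by rewrite -[_ - _]/(valB (s n.+1 - s n)) wE.
exists (toB l) => n; have [w wE] := lE n; exists (toB w).
rewrite -toB_Z -wE -{1}[s n]toB_val.
have tB x y : toB (x - y) = toB x - toB y by apply: (addIr (toB y)); rewrite subrK -toB_D subrK.
by rewrite tB.
Qed.

Lemma twist_map_aut f : twist_map f -> exists al, aut_lam lam al /\ forall u, u \in P -> al (ui u) = eta u *: ui u.
Proof.
move=> fP; pose F n := iter n improve f.
have FP n : twist_map (F n) by elim: n => [|n IHn] //; apply: improve_twist.
have lpi x y : cgB x y -> dvdB 1 (x - y).
  have [z zE] := lam_in_pi O_cdvr k_residue p_prime k_char zeta_prim.
  by move=> [w ->]; exists (z *: w); rewrite scalerA expr1 zE.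
have FD n : forall x y, dvdB n.+1 (F n (x * y) - F n x * F n y).
  elim: n => [|n IHn] x y.
    apply: lpi; apply: cg_trans (tm_cg fP _) _; apply: cg_sym; apply: cg_mul; exact: tm_cg.
  have [_ h] := improve_defect (FP n) IHn; apply: pdv_le (h x y).
  by rewrite addSn ltnS addnS leq_addr.
have /choice[al alE] : forall a, exists l, forall n, dvdB n (l - F n a).
  move=> a; apply: limB => n; have [h _] := improve_defect (FP n) (FD n).
  exact: pdv_le (leqnSn n) (h a).
have uniq x y : (forall n, dvdB n (x - y)) -> x = y.
  by move=> h; apply/eqP; rewrite -subr_eq0; apply/eqP/dvdB_sep.
have lim a l : (forall n, dvdB n (l - F n a)) -> al a = l.
  by move=> h; apply: uniq => n; apply: pdv_trans (alE a n) (pdvC (h n)).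
exists al; split; last first.
  by move=> u uP; apply: lim => n; rewrite (tm_ui (FP n)) // subrr; apply: pdv0.
split=> [x y|x y||r x|x].
- by apply: lim => n; rewrite (tm_D (FP n)) opprD addrACA; apply: pdvD; apply: alE.
- apply: lim => n; apply: (@pdv_trans _ _ _ _ (F n x * F n y)).
    by apply: pdvM2; apply: alE.
  by apply/pdvC; apply: pdv_le (leqnSn n) (FD n x y).
- by apply: lim => n; rewrite (tm_1 (FP n)) subrr; apply: pdv0.
- by apply: lim => n; rewrite (tm_Z (FP n)) -scalerBr; apply: pdvZ; apply: alE.
(* The limit is taken with respect to [pi]; its congruence modulo [lam] is read off at a stage n for
   which [lam] divides [pi ^+ n]. *)
have [n [d dE]] := dvd_pi_pow O_cdvr k_residue (lam_neq0 p_prime zeta_prim).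
have [w wE] := alE x n; have [w' w'E] := tm_cg (FP n) x.
exists (d *: w + w'); by rewrite scalerDr scalerA -dE -wE -w'E subrKA addrC subrK.
Qed.
End Step.

Variable phi : OG -> OG.
Hypotheses (phi_l : lin_map phi) (phi_c : forall a, phi a = source_cut (phi a)).
Hypothesis phi_uv : forall u v a, u \in P -> v \in P -> source_cut a = a ->
    phi ('d u * a * 'd v) = (eta u * eta v) *: ('d u * phi a * 'd v).
Hypothesis phi_cg : forall a, source_cut a = a -> exists w, phi a = a + lam *: w.

(** The image j of iB is congruent to iB, hence invertible in the corner, and commutes with P
    because both sides are scaled by the same character. Multiplication by its inverse makes the map
    unital and keeps the relations with P. *)
Lemma normalised_twist : exists psi : B -> B, [/\ linB psi, psi iB = iB,
  forall x, iB * psi x * iB = psi x,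
  forall u v x, u \in P -> v \in P -> iB * x * iB = x ->
    psi (gam u * x * gam v) = (eta u * eta v) *: (gam u * psi x * gam v) &
  forall x, iB * x * iB = x -> cgB (psi x) x].
Proof.
pose ps x := toB (phi (valB x)).
have valA x : iB * x * iB = x -> source_cut (valB x) = valB x.
  by move=> {2}<-; rewrite !valB_M val_iB.
have psD : {morph ps : x y / x + y} by move=> x y; rewrite -toB_D -(proj1 phi_l).
have psZ r x : ps (r *: x) = r *: ps x by rewrite -toB_Z -(proj2 phi_l).
have psi x : iB * ps x * iB = ps x by rewrite {2}/ps phi_c /source_cut !toBM.
have psuv u v x : u \in P -> v \in P -> iB * x * iB = x ->
    ps (gam u * x * gam v) = (eta u * eta v) *: (gam u * ps x * gam v).
  move=> uP vP xi; rewrite /ps val_gamr val_gaml phi_uv ?valA // toB_Z.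
  by rewrite !toBM.
have pscg x : iB * x * iB = x -> cgB (ps x) x.
  move=> xi; have [w wE] := phi_cg (valA x xi); exists (toB w).
  by rewrite /ps wE toB_D toB_val toB_Z addrC addKr.
have ii : iB * iB * iB = iB by rewrite !iBiB.
have eta1 := pchar_1 p_prime etaP.
pose j := ps iB; have ji : iB * j * iB = j := psi iB.
have jf : fixB j.
  move=> u uP; have h1 := psuv u 1%g iB uP (group1 P) ii; have h2 := psuv 1%g u iB (group1 P) uP ii.
  have E : eta u *: (gam u * j) = eta u *: (j * gam u).
    move: h1 h2; rewrite gam1 !mulr1 !mul1r eta1 mulr1 mul1r => <- <-.
    by rewrite (fixB_i i uP).
  have U := pchar_V p_prime etaP uP.
  by rewrite -[LHS]scale1r -[RHS]scale1r -U mulrC -!scalerA E.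
have [j' [j'i jj' j'j]] := isu_cong O_cdvr k_residue p_prime k_char zeta_prim ji (isu_i i) ii (pscg _ ii).
have jl : iB * j = j by rewrite -ji !mulrA iBiB.
have jr : j * iB = j by rewrite -ji -!mulrA iBiB.
have j'l : iB * j' = j' by rewrite -j'i !mulrA iBiB.
have j'r : j' * iB = j' by rewrite -j'i -!mulrA iBiB.
have j'f : fixB j'.
  move=> u uP; have E : j' * (gam u * j) * j' = j' * (j * gam u) * j' by rewrite jf.
  move: E; rewrite (mulrA j' j) j'j -(mulrA j') -(mulrA (gam u)) jj' (fixB_i i uP) (mulrA j') j'r.
  by rewrite -(fixB_i i uP) -mulrA j'l => ->.
have j'c : cgB j' iB.
  rewrite -[X in cg _ X _]j'r -[X in cg _ _ X]j'j; apply: cg_mull; apply: cg_sym; exact: pscg.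
exists (fun x => ps x * j'); split=> [||x|u v x uP vP xi|x xi].
- by split=> [x y|r x]; rewrite ?psD ?mulrDl // psZ scalerAl.
- exact: jj'.
- by rewrite mulrA -[X in _ = X * _]psi -!mulrA j'r j'l.
- rewrite psuv // -scalerAl; congr (_ *: _).
  by rewrite -!mulrA j'f.
- rewrite -[X in cg _ _ X](_ : x * iB = x); first by apply: cg_mul => //; exact: pscg.
  by rewrite -xi -!mulrA iBiB.
Qed.

Lemma twisting_aut_of_map : exists al, aut_lam lam al /\ twists i al eta.
Proof.
have [psi [[psD psZ] ps1 psi_i psuv pscg]] := normalised_twist.
have [X [Y [Xi Yi XY bal]]] := casimir O_cdvr k_residue p_prime k_char O_fg K_char P_defect i.
pose e := iB; pose e' : B := 1 - e.
have ee : e * e = e by exact: iBiB.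
have ee' : e * e' = 0 by rewrite /e' mulrBr mulr1 ee subrr.
have e'e : e' * e = 0 by rewrite /e' mulrBl mul1r ee subrr.
have e'e' : e' * e' = e' by rewrite {2}/e' mulrBr mulr1 e'e subr0.
have e1 : e + e' = 1 by rewrite /e' addrC subrK.
clearbody e'.
have pl x : e * psi x = psi x by rewrite -psi_i !mulrA ee.
have pr x : psi x * e = psi x by rewrite -psi_i -!mulrA ee.
have eta1 := pchar_1 p_prime etaP.
have psl u x : u \in P -> e * x * e = x -> psi (ui u * x) = eta u *: (ui u * psi x).
  move=> uP xi; have := psuv u 1%g x uP (group1 P) xi; rewrite gam1 !mulr1 eta1 mulr1.
  have {1}-> : x = e * x by rewrite -xi !mulrA ee.
  by rewrite -(mulrA (gam u) iB (psi x)) pl -(mulrA (gam u)) => ->.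
have psr u x : u \in P -> e * x * e = x -> psi (x * ui u) = eta u *: (psi x * ui u).
  move=> uP xi; have := psuv 1%g u x (group1 P) uP xi; rewrite gam1 !mul1r eta1 mul1r.
  have {1}-> : x = x * e by rewrite -xi -!mulrA ee.
  by rewrite (fixB_i i uP) (mulrA (psi x)) pr (mulrA x) => ->.
(* Extension along the Peirce decomposition. An element a of eBe' is the sum of the a [X C] [Y C],
   where a [X C] lies in the corner and psi applies to it; e'Be is treated symmetrically through
   [Y C] a, and e'Be' is left unchanged. *)
pose f1 a := psi (e * a * e).
pose f2 a := \sum_(C in rcosets P [set: gT]) psi (e * a * e' * X C) * Y C * e'.
pose f3 a := \sum_(C in rcosets P [set: gT]) e' * X C * psi (Y C * e' * a * e).
pose f4 a := e' * a * e'.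
pose f a := f1 a + f2 a + (f3 a + f4 a).
have f1D : {morph f1 : x y / x + y} by move=> x y; rewrite /f1 mulrDr mulrDl psD.
have f2D : {morph f2 : x y / x + y}.
  move=> x y; rewrite /f2 -big_split; apply: eq_bigr => C _ /=.
  by rewrite mulrDr mulrDl mulrDl psD !mulrDl.
have f3D : {morph f3 : x y / x + y}.
  move=> x y; rewrite /f3 -big_split; apply: eq_bigr => C _ /=.
  by rewrite mulrDr mulrDl psD mulrDr.
have f4D : {morph f4 : x y / x + y} by move=> x y; rewrite /f4 mulrDr mulrDl.
have [u0 u0P] : exists u0, u0 \in P by exists 1%g.
have eXi C : e * X C * e = e * X C by rewrite -mulrA Xi.
have ui_l u : u \in P -> e * ui u = ui u := @iB_ui u.
have ui_r u : ui u * e = ui u by rewrite -mulrA iBiB.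
have e'ui u : u \in P -> e' * ui u = 0 by move=> uP; rewrite -ui_l // mulrA e'e mul0r.
have uie' u : ui u * e' = 0 by rewrite -mulrA ee' mulr0.
have Xe' C : X C * e' = 0 by rewrite -Xi -mulrA ee' mulr0.
have fP : twist_map f.
  split=> [x y|r x||u x uP|u x uP|x].
  - rewrite /f f1D f2D f3D f4D.
    by rewrite (addrACA (f1 x)) (addrACA (f3 x)) (addrACA (f1 x + f2 x)).
  - rewrite /f !scalerDr; congr (_ + _ + (_ + _)).
    + by rewrite /f1 -scalerAr -scalerAl psZ.
    + rewrite /f2 scaler_sumr; apply: eq_bigr => C _.
      by rewrite -scalerAr -!scalerAl psZ -!scalerAl.
    + rewrite /f3 scaler_sumr; apply: eq_bigr => C _.
      by rewrite -scalerAr -!scalerAl psZ -!scalerAr.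
    + by rewrite /f4 -scalerAr -scalerAl.
  - rewrite /f /f1 /f2 /f3 /f4 mulr1 ee ps1 mulr1 e'e' big1 => [|C _]; last first.
      by rewrite ee' mul0r (morphD0 psD) !mul0r.
    rewrite big1 => [|C _]; last by rewrite mulr1 -(mulrA (Y C)) e'e mulr0 (morphD0 psD) mulr0.
    by rewrite addr0 add0r e1.
  - have E3 : f3 (ui u * x) = 0.
      rewrite /f3 big1 // => C _; rewrite -(mulrA _ e') (mulrA e') e'ui // mul0r mulr0 mul0r.
      by rewrite (morphD0 psD) mulr0.
    have E3' : ui u * f3 x = 0.
      by rewrite /f3 mulr_sumr big1 // => C _; rewrite !mulrA uie' !mul0r.
    have E4 : f4 (ui u * x) = 0 by rewrite /f4 mulrA e'ui // !mul0r.
    have E4' : ui u * f4 x = 0 by rewrite /f4 !mulrA uie' !mul0r.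
    rewrite /f E3 E4 !addr0 !mulrDr E3' E4' !addr0 scalerDr; congr (_ + _).
      rewrite /f1; have -> : e * (ui u * x) * e = ui u * (e * x * e).
        by rewrite (mulrA e) ui_l // !mulrA ui_r.
      by apply: psl => //; rewrite !mulrA ee -mulrA ee.
    rewrite /f2 mulr_sumr scaler_sumr; apply: eq_bigr => C _.
    have -> : e * (ui u * x) * e' * X C = ui u * (e * x * e' * X C).
      by rewrite (mulrA e) ui_l // !mulrA ui_r.
    rewrite psl //; last by rewrite !mulrA ee -(mulrA _ (X C)) Xi.
    by rewrite -!scalerAl !mulrA.
  - have E2 : f2 (x * ui u) = 0.
      rewrite /f2 big1 // => C _; rewrite (mulrA e) -(mulrA (e * x) (ui u) e') uie' mulr0 mul0r.
      by rewrite (morphD0 psD) !mul0r.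
    have E2' : f2 x * ui u = 0.
      by rewrite /f2 mulr_suml big1 // => C _; rewrite -!mulrA e'ui // !mulr0.
    have E4 : f4 (x * ui u) = 0 by rewrite /f4 -!mulrA ee' !mulr0.
    have E4' : f4 x * ui u = 0 by rewrite /f4 -!mulrA e'ui // !mulr0.
    rewrite /f E2 E4 !addr0 !mulrDl E2' E4' !addr0 scalerDr; congr (_ + _).
      rewrite /f1; have -> : e * (x * ui u) * e = e * x * e * ui u.
        by rewrite -!mulrA ui_l // iBiB.
      by apply: psr => //; rewrite !mulrA ee -mulrA ee.
    rewrite /f3 mulr_suml scaler_sumr; apply: eq_bigr => C _.
    have -> : Y C * e' * (x * ui u) * e = Y C * e' * x * e * ui u.
      by rewrite -!mulrA ui_l // iBiB.
    rewrite psr //; last by rewrite !mulrA Yi -mulrA ee.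
    by rewrite -!scalerAr !mulrA.
  - have c1 : cgB (f1 x) (e * x * e) by apply: pscg; rewrite !mulrA ee -mulrA ee.
    have c2 : cgB (f2 x) (e * x * e').
      rewrite -[X in cg _ _ X](_ : \sum_(C in rcosets P [set: gT]) e * x * e' * X C * Y C * e' = _); last first.
        transitivity (e * x * e' * (\sum_(C in rcosets P [set: gT]) X C * Y C) * e').
          by rewrite mulr_sumr mulr_suml; apply: eq_bigr => C _; rewrite !mulrA.
        by rewrite XY mulr1 -mulrA e'e'.
      apply: cg_sum => C _; apply: cg_mulr; apply: cg_mulr; apply: pscg.
      by rewrite !mulrA ee -(mulrA _ (X C)) Xi.
    have c3 : cgB (f3 x) (e' * x * e).
      rewrite -[X in cg _ _ X](_ : \sum_(C in rcosets P [set: gT]) e' * X C * (Y C * e' * x * e) = _); last first.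
        transitivity (e' * (\sum_(C in rcosets P [set: gT]) X C * Y C) * e' * x * e).
          by rewrite mulr_sumr !mulr_suml; apply: eq_bigr => C _; rewrite !mulrA.
        by rewrite XY mulr1 e'e'.
      apply: cg_sum => C _; apply: cg_mull; apply: pscg.
      by rewrite !mulrA Yi -mulrA ee.
    have {2}-> : x = e * x * e + e * x * e' + (e' * x * e + e' * x * e').
      by rewrite -!mulrDr -mulrDl e1 mulr1 -mulrDl e1 mul1r.
    by apply: cgD; apply: cgD => //; exact: cg_refl.
have [al [alP alu]] := twist_map_aut XY bal fP.
exists al; split=> //.
have ali : al iB = iB by have := alu 1%g (group1 P); rewrite gam1 mul1r eta1 scale1r.
exists iB, iB; split; rewrite ?ali ?iBiB // => u uP.
by rewrite alu // -scalerAr iB_ui.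
Qed.
End TwistingAutomorphism.

Lemma twisting_aut eta : pchar_on p P eta ->
  (forall (Q : {group gT}) (phi : sub_hom Q P), arises i phi ->
     forall q : subg_of Q, eta (sgval (phi q)) = eta (sgval q)) ->
  exists al, aut_lam lam al /\ twists i al eta.
Proof.
move=> etaP ea.
have [phi [phi_l phi_c phi_uv phi_cg]] := twisted_map O_cdvr k_residue p_prime k_char O_fg zeta_prim P_defect etaP ea.
exact: twisting_aut_of_map phi_l phi_c phi_uv phi_cg.
Qed.
End DoubleCosets.

(** * Units congruent to 1 minus a trace *)

Section LocalCentre.
Variables (O : idomainType) (pi : O) (k : fieldType) (red : {rmorphism O -> k}).
Hypotheses (O_cdvr : complete_dvr pi) (k_residue : residue_map pi red).
Variable p : nat.
Hypotheses (p_prime : prime p) (k_char : p \in [pchar k]) (O_fg : fg_over_padic p O).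
Hypothesis K_char : [pchar {fraction O}] =i pred0.
Variable zeta : O.
Hypothesis zeta_prim : p.-primitive_root zeta.
Variables (gT : finGroupType) (b : block O gT) (P : {group gT}).
Hypothesis P_defect : defect_group b red p P.
Variable i : source_idempotent b red P.
Local Notation lam := (1 - zeta).
Local Notation OG := (galg O gT).
Local Notation "''d' g" := (gdelta O (g : gT)) (at level 8, g at level 2, format "''d' g").
Local Notation eb := (block_unit b).
Local Notation B := (block_alg b).
Local Notation valB := (@corner_val O (galg O gT) (block_idempotent b)).
Local Notation si := (source_val i).
Local Notation iB := (iB i).
Local Notation gam := (gam b).
Local Notation toB := (toB b).
Local Notation fixB := (fixB P).
Local Notation mfix := (@mfix O zeta gT b P).
Local Notation isu := (isu i).
Local Notation brB := (brB red P).
Local Notation cgB := (@cg O lam B).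
Let pP : (p.-group P)%g := defect_pgroup P_defect.

(* The trace of d from the trivial group vanishes under the Brauer homomorphism
   because P is nontrivial, so it is not a unit of the local centre. *)
Lemma unit_of_conj_sum (c d c' : B) : (P :!=: 1)%g -> c = 1 - conj_sum gam d + lam *: c' ->
  exists c'', c * c'' = 1 /\ c'' * c = 1.
Proof.
move=> P1 cE; pose z := valB (conj_sum gam d).
have zE : z = \sum_g conjd (valB d) g.
  rewrite /z /conj_sum (big_morph valB (id1 := 0) (op1 := +%R)) //.
  rewrite [RHS](reindex_inj invg_inj) /=; apply: eq_bigr => g _.
  by rewrite -[LHS]/(valB (gam g * d * gam g^-1%g)) val_gamr val_gaml /conjd invgK.
have zC : in_center z.
  apply/center_conj => g; rewrite zE /conjd mulr_sumr mulr_suml.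
  rewrite [RHS](reindex_inj (mulIg g)) /=; apply: eq_bigr => h _.
  by rewrite -[RHS]/(conjd (valB d) (h * g)%g) conjdM.
have eC : in_center eb by case: (block_primitive b).
have zb : eb * z = z by exact: ebl.
have ee : eb * eb = eb by exact: block_idem.
have zin : in_e (@in_center O OG) eb z.
  by split=> //; rewrite zb; exact: ebr.
have pc a : in_center a -> pfix red P a by move=> aC; apply: fixed_pfix; apply: fixed_center.
have [y [yC yE] zy] : unit_e (@in_center O OG) eb (eb - z).
  have [[y [yC yE] zy]|//] := unit_e_or O_cdvr k_residue p_prime k_char O_fg
    (@centerB O gT) (@centerM O gT) (@center_lim _ _ _ _ O_cdvr k_residue gT) (block_primitive b) zin.
  have eBr : ~ brz red P eb.
    by move/brzP => h; have /maxgroupP[/andP[_]] := P_defect; rewrite h eqxx.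
  case: eBr; rewrite -zy; apply: (brzMl k_char pP) (pc _ zC) (pc _ yC) _.
  by rewrite zE; exact: (full_trace_brz red k_char pP (valB d) P1).
pose Y := toB y; have yb : eb * y = y by rewrite -yE !mulrA ee.
have vY : valB Y = y by exact: yb.
have YC x : Y * x = x * Y by apply: valB_inj; rewrite !valB_M vY yC.
have zY : (1 - conj_sum gam d) * Y = 1.
  by apply: valB_inj; rewrite valB_M vY -[RHS]zy.
have [v [cv vc]] := unit_cong1 O_cdvr k_residue p_prime k_char zeta_prim (c' * Y).
have cY : c * Y = 1 + lam *: (c' * Y) by rewrite cE mulrDl zY -scalerAl.
exists (Y * v); rewrite mulrA cY; split=> //.
have cw : c * (Y * v) = 1 by rewrite mulrA cY.
have vcY : v * Y * c = 1 by rewrite -mulrA YC cY.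
rewrite -[X in X * c]mul1r -vcY -(mulrA (v * Y)) cw mulr1 //.
Qed.
End LocalCentre.

(** * Comparison of the two blocks *)

Section Injection.
Variables (O : idomainType) (pi : O) (k : fieldType) (red : {rmorphism O -> k}).
Hypotheses (O_cdvr : complete_dvr pi) (k_residue : residue_map pi red).
Variable p : nat.
Hypotheses (p_prime : prime p) (k_char : p \in [pchar k]) (O_fg : fg_over_padic p O).
Hypothesis K_char : [pchar {fraction O}] =i pred0.
Variable zeta : O.
Hypothesis zeta_prim : p.-primitive_root zeta.
Local Notation lam := (1 - zeta).

Definition expo (gT : finGroupType) (f : {ffun gT -> 'F_p}) (u : gT) : O := zeta ^+ (f u).

Definition stable_char (gT : finGroupType) (b : block O gT) (P : {group gT})
    (i : source_idempotent b red P) (eta : gT -> O) :=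
  pchar_on p P eta /\
  forall (Q : {group gT}) (phi : sub_hom Q P), arises i phi ->
    forall q : subg_of Q, eta (sgval (phi q)) = eta (sgval q).

(** Exponents in F_p replace values in O so that there are finitely many candidates, and vanishing
    off P makes the function determined by the character. *)
Definition char_set (gT : finGroupType) (b : block O gT) (P : {group gT})
    (i : source_idempotent b red P) : {set {ffun gT -> 'F_p}} :=
  [set f | `[< stable_char i (expo f) /\ forall u, u \notin P -> f u = 0 >]].

Lemma twists_ext (gT : finGroupType) (b : block O gT) (P : {group gT})
    (i : source_idempotent b red P) al (eta eta' : gT -> O) :
  (forall u, u \in P -> eta u = eta' u) -> twists i al eta -> twists i al eta'.
Proof.
move=> E [a [a' r]]; exists a, a'; case: r => r1 r2 r3 r4 r5 r6 r7; split=> // u uP.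
by rewrite r7 // E.
Qed.

Lemma expo_of_pchar (gT : finGroupType) (P : {group gT}) (eta : gT -> O) : pchar_on p P eta ->
  exists f : {ffun gT -> 'F_p}, (forall u, u \in P -> expo f u = eta u) /\
    forall u, u \notin P -> f u = 0.
Proof.
move=> [_ ep]; have /choice[l lE] : forall u, exists l : nat, u \in P -> eta u = zeta ^+ l.
  move=> u; have [uP|uP] := boolP (u \in P); last by exists 0%N.
  by have [l lE] := zeta_exp_eq1 zeta_prim (ep _ uP); exists l.
exists [ffun u => if u \in P then (l u)%:R else 0]; split=> u uP; rewrite ?/expo ffunE.
  by rewrite uP val_Fp_nat // (prim_expr_mod zeta_prim) lE.
by rewrite (negbTE uP).
Qed.

Lemma expo_inj (gT : finGroupType) (f g : {ffun gT -> 'F_p}) u : expo f u = expo g u -> f u = g u.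
Proof.
move/eqP; rewrite /expo (eq_prim_root_expr zeta_prim) => E; apply: val_inj => /=.
have h (x : 'F_p) : (x < p)%N by have := ltn_ord x; rewrite {2}Fp_cast.
by move: E; rewrite /= !modn_small => [/eqP||].
Qed.

Variables (gT gT' : finGroupType) (b : block O gT) (b' : block O gT').
Variables (P : {group gT}) (P' : {group gT'}).
Hypotheses (P_defect : defect_group b red p P) (P'_defect : defect_group b' red p P').
Hypothesis P_nontrivial : (P :!=: 1)%g.
Variables (i : source_idempotent b red P) (i' : source_idempotent b' red P').
Local Notation B := (block_alg b).
Local Notation B' := (block_alg b').
Variables (M : bimodType B B') (N : bimodType B' B) (X : bimodType B B) (Y : bimodType B' B').
Hypotheses (M_fg : finitely_generated M) (M_proj : projective M).
Hypothesis N_fg : finitely_generated N.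
Hypothesis MN_iso : bimod_iso (tensor M N) (B^o * X)%type.
Hypothesis NM_iso : bimod_iso (tensor N M) (B'^o * Y)%type.
Hypothesis Y_proj : bimod_projective Y.

(** f is realised by some [al], transported to [be], whose character is f'. None of these choices is
    canonical, so the whole chain is kept in the relation R. Two chains ending in the same f' have
    conjugate [be]; the resulting intertwiner of the two [al] is a unit, and [twists_unique]
    identifies the two starting characters. *)
Lemma card_char_set_le : (#|char_set i| <= #|char_set i'|)%N.
Proof.
have [F Fh [F' FK F'K]] := MN_iso; have [G Gh [G' GK G'K]] := NM_iso.
have [F'D F'Z F'R] := bimod_hom_inv Fh FK F'K; have [FD FZ FR] := Fh.
have [G'D G'Z G'R] := bimod_hom_inv Gh GK G'K; have [GD GZ GR] := Gh.
pose eps x : B := (F x).1; pose kap := F' (1, 0).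
pose eps' x : B' := (G x).1; pose kap' := G' (1, 0).
pose pY x := (G x).2; pose jY y := G' (0, y).
have epsD : {morph eps : x y / x + y} by move=> x y; rewrite /eps FD.
have epsZ c x : eps (c *: x) = c * eps x by rewrite /eps FZ.
have epsR x c : eps (x *| c) = eps x * c by rewrite /eps FR.
have kapC (c : B) : c *: kap = kap *| c.
  rewrite -F'Z -F'R; congr F'; congr (_, _); last by rewrite scaler0 ract0.
  by rewrite -[LHS]/(c * 1) -[RHS]/(1 * c) mulr1 mul1r.
have eps_kap : eps kap = 1 by rewrite /eps F'K.
have eps'D : {morph eps' : x y / x + y} by move=> x y; rewrite /eps' GD.
have eps'Z c x : eps' (c *: x) = c * eps' x by rewrite /eps' GZ.
have eps'R x c : eps' (x *| c) = eps' x * c by rewrite /eps' GR.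
have eps'_kap : eps' kap' = 1 by rewrite /eps' G'K.
have pYhom : bimod_hom pY by split=> [x y|c x|x c]; rewrite /pY ?GD ?GZ ?GR.
have jYhom : bimod_hom jY.
  split=> [x y|c x|x c]; rewrite /jY -?G'D -?G'Z -?G'R; congr G'; congr (_, _).
  - by rewrite addr0.
  - by rewrite scaler0.
  - by rewrite ract0.
have pYjY y : pY (jY y) = y by rewrite /pY G'K.
have pYkap : pY kap' = 0 by rewrite /pY G'K.
have eps'jY y : eps' (jY y) = 0 by rewrite /eps' G'K.
have L_split x : x = eps' x *: kap' + jY (pY x).
  rewrite -G'Z -G'D -{1}[x]GK; congr G'; rewrite [G x]surjective_pairing; congr (_, _).
    by rewrite -[RHS]/(eps' x * 1 + 0) mulr1 addr0.
  by rewrite -[RHS]/(eps' x *: 0 + pY x) scaler0 add0r.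
have jac := lam_jac O_cdvr k_residue p_prime k_char zeta_prim.
have gs := B_group_spanned b; have gs' := B_group_spanned b'.
pose R (f : {ffun gT -> 'F_p}) (f' : {ffun gT' -> 'F_p}) :=
  exists (al : B -> B) (be : B' -> B') (S T : M -> M),
  [/\ aut_lam lam al, twists i al (expo f), aut_lam lam be & twists i' be (expo f')] /\
  [/\ olin S, forall c m, S (c *: m) = al c *: S m, forall m y, S (m *| be y) = S m *| y
    & forall m, cb lam (S m) (s0 eps kap' m)] /\
  [/\ olin T, forall c m, T (al c *: m) = c *: T m, forall m y, T (m *| y) = T m *| be y
    & forall m, cb lam (T m) (T0 kap eps' m)].
have Rex f : exists f', f \in char_set i -> f' \in char_set i' /\ R f f'.
  have [|fn] := boolP (f \in char_set i); last by exists 0.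
  rewrite inE => /asboolP[[fP fa] f0].
  have [al [alP alt]] := twisting_aut O_cdvr k_residue p_prime k_char O_fg K_char zeta_prim P_defect fP fa.
  have [be [S [T [beP SP TP]]]] := transfer jac gs gs' M_fg M_proj N_fg epsD epsZ epsR kapC
    eps'D eps'Z eps'R eps'_kap Y_proj pYhom jYhom pYjY pYkap eps'jY L_split alP.
  have [eta' eP [bet [be' [c [y [be'P be'i r]]]]]] :=
    twists_of_aut O_cdvr k_residue p_prime k_char O_fg zeta_prim P'_defect i' beP.
  have ea := arises_invariant O_cdvr k_residue p_prime k_char zeta_prim be'P be'i eP r.
  have [f' [f'E f'0]] := expo_of_pchar eP.
  exists f' => _; split; last first.
    exists al, be, S, T; split=> //; split=> //.
    by apply: twists_ext bet => u uP; rewrite f'E.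
  rewrite inE; apply/asboolP; split=> //; split.
    case: eP => eM ep; split=> [u w uP wP|u uP]; last by rewrite f'E ?ep.
    by rewrite !f'E ?groupM // eM.
  move=> Q phi ar q; rewrite !f'E ?subgP //; first exact: ea ar q.
  by have [_ [sQP _]] := ar; apply: (subsetP sQP); apply: subgP.
have Rinj f1 f2 f' : f1 \in char_set i -> f2 \in char_set i -> f' \in char_set i' ->
    R f1 f' -> R f2 f' -> f1 = f2.
  rewrite !inE => /asboolP[[f1P _] f10] /asboolP[[f2P _] f20] /asboolP[[f'P _] _].
  move=> [al1 [be1 [S1 [T1 [[al1P al1t be1P be1t] [S1P T1P]]]]]].
  move=> [al2 [be2 [S2 [T2 [[al2P al2t be2P be2t] [S2P T2P]]]]]].
  have [w w1 wE] := twists_conj O_cdvr k_residue p_prime k_char O_fg K_char zeta_prim P'_defect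
    be1P be2P f'P be1t be2t.
  have [c [d [cE [c' c'E]]]] := conjugator gs gs' M_fg M_proj epsD epsZ epsR kapC eps_kap
    Y_proj pYhom jYhom L_split al1P al2P S1P T2P wE w1.
  have [v [cv vc]] := unit_of_conj_sum O_cdvr k_residue p_prime k_char O_fg zeta_prim P_defect
    P_nontrivial c'E.
  apply/ffunP => u; have [uP|uP] := boolP (u \in P); last by rewrite f10 // f20.
  apply: expo_inj; apply/esym.
  exact: (twists_unique O_cdvr k_residue p_prime k_char zeta_prim P_defect al2P al1P f2P f1P
    al2t al1t cv vc (fun x => esym (cE x)) uP).
have [g gP] := choice Rex.
have g_inj : {in char_set i &, injective g}.
  move=> f1 f2 h1 h2 E; have [g1 R1] := gP _ h1; have [g2 R2] := gP _ h2.
  by apply: (Rinj _ _ (g f1)) => //; rewrite E.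
rewrite -(card_in_imset g_inj); apply: subset_leq_card; apply/subsetP => _ /imsetP[f fI ->].
by have [] := gP _ fI.
Qed.
End Injection.

(** * Counting characters of the focal quotient *)

Section Homs.
Variables (p : nat) (gT : finGroupType) (P K : {group gT}).
Hypotheses (p_prime : prime p) (pP : (p.-group P)%g) (KP : (K <| P)%g) (abA : abelian (P / K)).

Definition hom_set : {set {ffun gT -> 'F_p}} :=
  [set f : {ffun gT -> 'F_p} | `[< [/\ forall u w, u \in P -> w \in P -> f (u * w)%g = f u + f w,
                   forall u, u \in K -> f u = 0 & forall u, u \notin P -> f u = 0] >]].

Local Notation A := (P / K)%G.
Local Notation E := (A / 'Phi(A))%G.
Let h (u : gT) := coset 'Phi(A)%g (coset K u).
Let pA : (p.-group A)%g. Proof. exact: quotient_pgroup. Qed.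
Let nKP : (P \subset 'N(K))%g. Proof. exact: normal_norm. Qed.
Let nPhi : (A \subset 'N('Phi(A)))%g. Proof. by rewrite normal_norm ?Phi_normal. Qed.

Lemma expFp (x : 'F_p) : x *+ p = 0.
Proof. by rewrite -mulr_natr pchar_Fp_0 ?mulr0. Qed.

(** The Frattini subgroup of the abelian p-group P / K consists of p-th powers, on which a
    homomorphism to F_p vanishes. *)
Lemma hom_ker f u : f \in hom_set -> u \in P -> h u = 1%g -> f u = 0.
Proof.
rewrite inE => /asboolP[fM fK _] uP hu.
have cA x : x \in P -> coset K x \in A by move=> xP; rewrite mem_quotient.
have f1 : f 1%g = 0 by apply: (addrI (f 1%g)); rewrite -fM // mulg1 addr0.
have fX y n : y \in P -> f (y ^+ n)%g = f y *+ n.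
  by move=> yP; elim: n => [|n IHn]; rewrite ?expg0 // expgS fM ?groupX // IHn mulrS.
have uPhi : coset K u \in 'Phi(A)%g.
  by apply: coset_idr hu; apply: (subsetP nPhi); apply: cA.
move: uPhi; rewrite (Phi_Mho pA abA) (MhoEabelian 1 pA abA) expn1.
case/imsetP => _ /morphimP[y yN yP ->] E1.
have uN := subsetP nKP _ uP.
have kK : (u * (y ^+ p)^-1)%g \in K.
  rewrite -mem_rcoset; apply/rcoset_kercosetP; rewrite ?groupX // E1; exact/esym/morphX.
have ypP : (y ^+ p)%g \in P by rewrite groupX.
have -> : u = (u * (y ^+ p)^-1 * (y ^+ p))%g by rewrite mulgKV.
rewrite fM //; last by rewrite groupM ?groupV.
by rewrite fK // fX // expFp addr0.
Qed.

Lemma hM u w : u \in P -> w \in P -> h (u * w)%g = (h u * h w)%g.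
Proof.
move=> uP wP; rewrite /h morphM ?(subsetP nKP) // morphM //.
- by rewrite (subsetP nPhi) ?mem_quotient.
- by rewrite (subsetP nPhi) ?mem_quotient.
Qed.
Lemma hE u : u \in P -> h u \in E.
Proof. by move=> uP; rewrite !mem_quotient. Qed.
Lemma h_surj x : x \in E -> exists2 u, u \in P & h u = x.
Proof. by case/morphimP => _ _ /morphimP[u _ uP ->] ->; exists u. Qed.

Lemma card_E : #|E| = (p ^ 'm(P / K)%g)%N.
Proof.
rewrite grank_abelian // (rank_abelian_pgroup pA abA).
have pO : (p.-group 'Ohm_1(A))%g by apply: pgroupS pA; exact: Ohm_sub.
rewrite -[RHS]/(p ^ logn p #|_|)%N -p_part part_pnat_id //.
have E1 : (#|E| * #|'Phi(A)%g|)%N = #|A| by rewrite card_quotient // mulnC Lagrange ?Phi_sub.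
have := mul_card_Ohm_Mho_abelian 1 abA; rewrite -(Phi_Mho pA abA) -[in RHS]E1 => /eqP.
by rewrite eqn_pmul2r ?cardG_gt0 // => /eqP ->.
Qed.

(** Homomorphisms to F_p factor through the Frattini quotient of P / K. Seen as a vector space of
    row vectors, it has as many linear forms, given here by column vectors, as elements. *)
Lemma card_hom_set : #|hom_set| = (p ^ 'm(P / K)%g)%N.
Proof.
rewrite -card_E.
have abE : (p.-abelem E)%g by exact: Phi_quotient_abelem.
have [E1|ntE] := eqVneq (E : {set _}) 1%g.
  rewrite E1 cards1; apply/eqP/cards1P; exists [ffun=> 0].
  apply/setP => f; rewrite in_set1; apply/idP/eqP => [fH|->].
    apply/ffunP => u; rewrite ffunE; have [uP|uP] := boolP (u \in P).
      by apply: hom_ker => //; apply/set1gP; rewrite -E1 hE.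
    by move: fH; rewrite inE => /asboolP[_ _ ->].
  by rewrite inE; apply/asboolP; split=> *; rewrite !ffunE ?addr0.
pose r u := abelem_rV abE ntE (h u).
have rM u w : u \in P -> w \in P -> r (u * w)%g = r u + r w.
  by move=> uP wP; rewrite /r hM // abelem_rV_M ?hE.
pose Th (w : 'cV['F_p]_('dim E)) : {ffun gT -> 'F_p} :=
  [ffun u => if u \in P then (r u *m w) 0 0 else 0].
have Th_inj : injective Th.
  move=> w w' /ffunP Ew; apply/matrixP => j j0; rewrite (ord1 j0).
  have [u uP hu] := h_surj (mem_rVabelem abE ntE (delta_mx 0 j)).
  have := Ew u; rewrite !ffunE uP /r hu rVabelemK -!rowE !mxE.
  by [].
have -> : #|E| = #|[set: 'cV['F_p]_('dim E)]|.
  by rewrite cardsT -(card_abelem_rV abE ntE) !card_mx mul1n muln1.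
rewrite -(card_imset _ Th_inj); apply: eq_card => f; apply/idP/imsetP => [fH|[w _ ->]]; last first.
  rewrite inE; apply/asboolP; split=> [u v uP vP|u uK|u uP]; rewrite !ffunE.
  - by rewrite groupM // uP vP rM // mulmxDl mxE.
  - rewrite (subsetP (normal_sub KP) _ uK).
    have -> : r u = 0.
      have h1 : h u = 1%g by rewrite /h (coset_id uK) morph1.
      rewrite /r h1.
      by apply: (addrI (abelem_rV abE ntE 1%g)); rewrite -abelem_rV_M ?group1 // mulg1 addr0.
    by rewrite mul0mx mxE.
  - by rewrite (negbTE uP).
have fK u : u \in P -> h u = 1%g -> f u = 0 by move=> uP; apply: hom_ker.
move: fH; rewrite inE => /asboolP[fM _ f0].
have f1 : f 1%g = 0 by apply: (addrI (f 1%g)); rewrite -fM // mulg1 addr0.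
have fh u u' : u \in P -> u' \in P -> h u = h u' -> f u = f u'.
  move=> uP u'P E1; have := fK (u * u'^-1)%g.
  have hV : h u'^-1%g = (h u')^-1%g.
    by apply: (mulgI (h u')); rewrite mulgV -hM ?groupV // mulgV /h !morph1.
  rewrite hM ?groupV // hV E1 mulgV groupM ?groupV // => /(_ isT erefl).
  have fV : f u' + f u'^-1%g = 0 by rewrite -fM ?groupV // mulgV.
  by rewrite fM ?groupV // => E2; apply: (addIr (f u'^-1%g)); rewrite E2 fV.
have /choice[s sP] : forall v : 'rV['F_p]_('dim E), exists u, u \in P /\ h u = rVabelem abE ntE v.
  by move=> v; have [u uP hu] := h_surj (mem_rVabelem abE ntE v); exists u.
pose g v := f (s v).
have gD : {morph g : v w / v + w}.
  move=> v w; have [sv hv] := sP v; have [sw hw] := sP w; have [sx hx] := sP (v + w).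
  rewrite /g -fM //; apply: fh; rewrite ?groupM // hM // hx hv hw.
  exact: rVabelemD.
have g0 : g 0 = 0 by apply: (addrI (g 0)); rewrite -gD !addr0.
have gZ (a : 'F_p) v : g (a *: v) = a * g v.
  rewrite -[a]natr_Zp scaler_nat mulr_natl.
  by elim: (nat_of_ord a) => [|n IHn]; rewrite ?mulr0n // !mulrS gD IHn.
exists (\col_j g (delta_mx 0 j)) => //; apply/ffunP => u; rewrite ffunE.
case: ifP => [uP|/negbT/f0 //].
have -> : f u = g (r u).
  have [su hu] := sP (r u); apply: fh => //; rewrite hu.
  by rewrite /r abelem_rV_K ?hE.
rewrite mxE {1}(row_sum_delta (r u)) (big_morph g gD g0); apply: eq_bigr => j _.
by rewrite gZ mxE.
Qed.
End Homs.

Section Focal.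
Variables (O : idomainType) (k : fieldType) (red : {rmorphism O -> k}).
Variables (gT : finGroupType) (b : block O gT) (P : {group gT}).
Variable i : source_idempotent b red P.
Variable F : hom_family gT.
Arguments F : clear implicits.
Hypothesis FE : forall Q R (f : sub_hom Q R), F Q R f <-> generated_fusion (arises i) f.

Lemma focal_gen (u : gT) (phi : sub_hom <[u]>%G P) : u \in P -> F <[u]>%G P phi ->
  (sgval (phi (Subg (cycle_id u))) * u^-1)%g \in focal P F.
Proof.
by move=> uP Fphi; apply: mem_gen; rewrite inE; apply/asboolP; exists u, phi.
Qed.

Lemma focal_sub : focal P F \subset P.
Proof.
rewrite gen_subG; apply/subsetP => x; rewrite inE => /asboolP[u [phi [uP _ ->]]].
by rewrite groupM ?groupV ?subgP.
Qed.

Section ConjHom.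
Variables (Q R : {group gT}) (t : gT).
Hypothesis QR : forall x, x \in Q -> (x ^ t)%g \in R.
Definition conj_sub (x : subg_of Q) : subg_of R := Subg (QR (subgP x)).
Fact conj_sub_mul : {morph conj_sub : x y / (x * y)%g}.
Proof. by move=> x y; apply: val_inj; rewrite /= conjMg. Qed.
HB.instance Definition _ := isMultiplicative.Build (subg_of Q) (subg_of R) conj_sub conj_sub_mul.
Definition conj_hom : sub_hom Q R := conj_sub.
End ConjHom.

(** Conjugations by elements of P belong to F. Taking u to be the inverse of x makes the generator
    of the focal subgroup the inverse of the commutator. *)
Lemma focal_comm x t : x \in P -> t \in P -> [~ x, t]%g \in focal P F.
Proof.
move=> xP tP; have xV : x^-1%g \in P by rewrite groupV.
have QR y : y \in <[x^-1]>%G -> (y ^ t)%g \in P.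
  by move=> yx; rewrite groupJ // (subsetP _ _ yx) // cycle_subG.
have Fc : F <[x^-1]>%G P (conj_hom QR).
  by apply/FE => F0 F0f _; apply: (fus_conj F0f) tP _ => //; rewrite cycle_subG.
have := focal_gen xV Fc; rewrite /= invgK -groupV invMg -conjVg invgK.
by rewrite commgEl.
Qed.

Lemma focal_normal : (focal P F <| P)%g.
Proof.
rewrite /normal focal_sub -commg_subl gen_subG.
apply/subsetP => _ /imset2P[x t xF tP ->]; apply: focal_comm => //.
exact: (subsetP focal_sub).
Qed.

Lemma focal_abelian : abelian (P / focal P F).
Proof.
rewrite /abelian quotient_cents2 ?normal_norm ?focal_normal // gen_subG.
by apply/subsetP => _ /imset2P[x t xP tP ->]; apply: focal_comm.
Qed.

Variables (p : nat) (eta : gT -> O).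
Hypotheses (p_prime : prime p) (etaP : pchar_on p P eta).

(** The injective maps between subgroups of P that preserve eta form a fusion system; if it contains
    the arising morphisms, it contains F. Conversely, restricting an arising morphism to the cyclic
    group of q gives a morphism of F, whose focal element carries the required equality. *)
Lemma stable_charP : stable_char p i eta <-> forall x, x \in focal P F -> eta x = 1.
Proof.
have eM := proj1 etaP; have e1 := pchar_1 p_prime etaP.
split=> [[_ ea]|ef].
  pose F0 : hom_family gT := fun Q R f =>
    [/\ Q \subset P, R \subset P, injective f & forall q, eta (sgval (f q)) = eta (sgval q)].
  have F0f : fusion_system P F0.
    split.
    - by move=> Q R f [].
    - by move=> Q R f [].
    - move=> Q R f g fg [QP RP fi fe]; split=> // [x y|q]; last by rewrite -fg.
      by rewrite -!fg; apply: fi.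
    - move=> Q R f u QP RP uP fu; split=> // [x y|q].
        by move/(congr1 val); rewrite /= !fu => /conjg_inj /val_inj.
      have qP := subsetP QP _ (subgP q).
      rewrite fu conjgE !eM ?groupM ?groupV // mulrC -mulrA.
      by rewrite [eta u * _](pchar_V p_prime etaP uP) mulr1.
    - move=> Q R S f g [QP RP fi fe] [_ SP gi ge]; split=> // [x y /gi/fi //|q].
      by rewrite ge fe.
    - move=> Q R S f f' g [QP RP fi fe] f'f fK gK.
      have SP : S \subset P.
        apply/subsetP => s sS; rewrite -[s]/(sgval (Subg sS)) -(gK (Subg sS)) f'f.
        exact: (subsetP RP) (subgP _).
      split; split=> //.
      + exact: can_inj fK.
      + by move=> q; rewrite f'f fe.
      + exact: can_inj gK.
      + by move=> q; rewrite -{2}(gK q) f'f fe.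
  have F0a Q (phi : sub_hom Q P) : arises i phi -> F0 Q P phi.
    by move=> ar; split=> //; [case: ar => _ [sQP _]|case: ar|exact: ea].
  have subI : group_set [set x in P | eta x == 1].
    apply/group_setP; split=> [|x y]; first by rewrite inE group1 e1 eqxx.
    by rewrite !inE => /andP[xP /eqP ex] /andP[yP /eqP ey]; rewrite groupM // eM // ex ey mulr1 eqxx.
  move=> x xF; suff : x \in Group subI by rewrite inE => /andP[_ /eqP].
  move: x xF; apply/subsetP; rewrite gen_subG; apply/subsetP => x.
  rewrite inE => /asboolP[u [phi [uP /FE Fphi ->]]]; rewrite inE groupM ?groupV ?subgP //=.
  have [_ _ _ E] := Fphi F0 F0f F0a.
  by rewrite eM ?groupV ?subgP // E /= (pchar_V p_prime etaP).
split=> // Q phi ar q; have [_ [sQP _]] := ar.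
have uP : sgval q \in P := subsetP sQP _ (subgP q).
have sub : <[sgval q]>%G \subset Q by rewrite cycle_subG subgP.
pose psi : sub_hom <[sgval q]>%G P := phi \o sub_incl sub.
have Fpsi : F <[sgval q]>%G P psi.
  apply/FE => F0 F0f F0a; apply: (fus_comp F0f) (F0a _ _ ar).
  apply: (fus_conj F0f) (group1 P) _ => //; first exact: subset_trans sQP.
  by move=> x; rewrite conjg1.
have := ef _ (focal_gen uP Fpsi).
have -> : psi (Subg (cycle_id (sgval q))) = phi q.
  by rewrite /psi /=; congr (phi _); apply: val_inj.
rewrite eM ?groupV ?subgP // => E.
by rewrite -[LHS]mulr1 -(pchar_V p_prime etaP uP) mulrCA E mulr1.
Qed.
End Focal.

Section Count.
Variables (O : idomainType) (k : fieldType) (red : {rmorphism O -> k}).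
Variables (p : nat) (zeta : O).
Hypotheses (p_prime : prime p) (zeta_prim : p.-primitive_root zeta).
Variables (gT : finGroupType) (b : block O gT) (P : {group gT}).
Hypothesis pP : (p.-group P)%g.
Variable i : source_idempotent b red P.
Variable F : hom_family gT.
Arguments F : clear implicits.
Hypothesis FE : forall Q R (f : sub_hom Q R), F Q R f <-> generated_fusion (arises i) f.

Lemma card_char_set : #|char_set p zeta i| = (p ^ 'm(P / focal P F)%g)%N.
Proof.
rewrite -(card_hom_set p_prime pP (focal_normal FE) (focal_abelian FE)); apply: eq_card => f.
have eD u w : zeta ^+ (f u) * zeta ^+ (f w) = zeta ^+ ((f u + f w)%R : 'F_p).
  rewrite -exprD -(prim_expr_mod zeta_prim); congr (zeta ^+ (_ %% _)%N).
  exact/esym/Fp_cast.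
have e0 u : expo zeta f u = 1 -> f u = 0.
  move=> E; have := @expo_inj _ _ p_prime _ zeta_prim _ f [ffun=> 0] u.
  by rewrite /expo !ffunE; apply; exact: E.
rewrite !inE; apply/asboolP/asboolP => [[fs f0]|[fM fK f0]].
  have [fP _] := fs; split=> // [u w uP wP|u uK].
    have [eM _] := fP; have := eM u w uP wP; rewrite /expo eD => E.
    by have := @expo_inj _ _ p_prime _ zeta_prim _ f [ffun=> f u + f w] (u * w)%g; rewrite /expo !ffunE; apply.
  by apply: e0; move/(stable_charP FE p_prime fP): fs; apply.
have fP : pchar_on p P (expo zeta f).
  split=> [u w uP wP|u uP]; first by rewrite /expo eD fM.
  by rewrite /expo exprAC (prim_expr_order zeta_prim) expr1n.
split=> //; apply/(stable_charP FE p_prime fP) => x xK.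
by rewrite /expo fK // expr0.
Qed.
End Count.

Theorem corollary1p5 (p : nat) (O : idomainType) (pi : O)
    (k : fieldType) (red : {rmorphism O -> k})
    (p_prime : prime p)
    (O_cdvr : complete_dvr pi)
    (k_residue : residue_map pi red)
    (k_char : p \in [pchar k])
    (K_char : [pchar {fraction O}] =i pred0)
    (O_fg : fg_over_padic p O)
    (gT gT' : finGroupType)
    (O_root : exists z : O, #|[set: gT]|.-primitive_root z)
    (O_root' : exists z : O, #|[set: gT']|.-primitive_root z)
    (b : block O gT) (b' : block O gT')
    (P : {group gT}) (P' : {group gT'})
    (P_defect : defect_group b red p P)
    (P'_defect : defect_group b' red p P')
    (P_nontrivial : P :!=: 1%g)
    (P'_nontrivial : P' :!=: 1%g)
    (F : hom_family gT) (F' : hom_family gT')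
    (F_fusion : block_fusion_system red b P F)
    (F'_fusion : block_fusion_system red b' P' F')
    (stable_eq :
       stably_equivalent_of_Morita_type (block_alg b) (block_alg b')) :
  ('m(P / focal P F) = 'm(P' / focal P' F'))%g.
Proof.
have [z z_prim] := O_root.
have pP := defect_pgroup P_defect; have pP' := defect_pgroup P'_defect.
(* Since P is a nontrivial p-group, p divides the order of the group and a power of z is a primitive
   p-th root of unity. *)
have pG : (p %| #|[set: gT]|)%N.
  have [_ pdP _] := pgroup_pdiv pP P_nontrivial.
  by apply: dvdn_trans pdP _; apply: cardSg; apply: subsetT.
have zeta_prim := dvdn_prim_root z_prim pG.
have [i FE] := F_fusion; have [i' FE'] := F'_fusion.
have [M [N [X [Y [[[Mfg Mp] _ [Nfg Np] _] [MN Xp NM Yp]]]]]] := stable_eq.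
have le1 := card_char_set_le O_cdvr k_residue p_prime k_char O_fg K_char zeta_prim
  P_defect P'_defect P_nontrivial i i' Mfg Mp Nfg MN NM Yp.
have le2 := card_char_set_le O_cdvr k_residue p_prime k_char O_fg K_char zeta_prim
  P'_defect P_defect P'_nontrivial i' i Nfg Np Mfg NM MN Xp.
have /eqP : (#|char_set p (z ^+ (#|[set: gT]| %/ p)) i| == #|char_set p (z ^+ (#|[set: gT]| %/ p)) i'|)%N.
  by rewrite eqn_leq le1 le2.
rewrite (card_char_set p_prime zeta_prim pP FE) (card_char_set p_prime zeta_prim pP' FE').
by move/eqP; rewrite eqn_exp2l ?prime_gt1 // => /eqP.
Qed.
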